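(* Let $K_\nu$ be a completion (archimedean or not) of a number field. The commutator operator $K=i\,[B,A]=i(BA-AB)$ with initial domain $\mathcal{S}_0$ is essentially self-adjoint on $L^2(K_\nu,dx)$. It is bounded. It commutes with the unitary dilations $U(t)$ ($t\in K_\nu^\times$) and anti-commutes with the Fourier transform $\mathcal{F}$ and with the Inversion $I$.
   Context: $\lambda$ is the additive character of $K_\nu$ given by $\lambda(x)=\exp(2\pi i\{\mathrm{Tr}(x)\})$ for $\nu$ finite ($\mathrm{Tr}$ the trace to $\mathbb{Q}_p$, $\{a\}$ the polar part of $a\in\mathbb{Q}_p$) and $\lambda(x)=\exp(-2\pi i\,\mathrm{Tr}(x))$ for $\nu$ archimedean ($\mathrm{Tr}$ the trace to $\mathbb{R}$). $dx$ is the self-dual Haar measure for $\lambda$, and $\mathcal{F}(\varphi)(y)=\int_{K_\nu}\varphi(x)\lambda(-xy)\,dx$ (a unitary operator of $L^2(K_\nu,dx)$). $|t|$ is the module: $d(tx)=|t|\,dx$ (so $|z|=z\bar z$ on $\mathbb{C}$). $\mathcal{S}_0$ is the space of Schwartz-Bruhat functions on $K_\nu$ having compact support and vanishing identically in a neighborhood of the origin. $A$ is the operator of multiplication by $\log(|x|)$ and $B=\mathcal{F}A\mathcal{F}^{-1}=\mathcal{F}^{-1}A\mathcal{F}$, i.e. $B(\varphi)=\mathcal{F}(\log(|y|)\,\mathcal{F}^{-1}(\varphi)(y))$. The unitary dilations are $U(t):\varphi(x)\mapsto|t|^{-1/2}\varphi(x/t)$; the Inversion is the unitary $I:\varphi(x)\mapsto\frac1{|x|}\varphi(\frac1x)$.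 A unitary $V$ commutes (resp. anti-commutes) with $K$ if $V\overline K=\overline K V$ (resp. $V\overline K=-\overline K V$), where $\overline K$ is the closure of $(K,\mathcal{S}_0)$ on $L^2(K_\nu,dx)$. *)

(* Defs.v *)
From HB Require Import structures.
From mathcomp Require Import all_boot all_order all_algebra all_field.
From mathcomp Require Import all_classical all_reals all_analysis.
From mathcomp Require Import complex.

Set Implicit Arguments.
Unset Strict Implicit.
Unset Printing Implicit Defensive.

Import Order.TTheory GRing.Theory Num.Theory numFieldNormedType.Exports.
Local Open Scope classical_set_scope.
Local Open Scope ring_scope.

(** Fields with a real absolute value [absv], with the topology it defines. *)
HB.mixin Record isValuedField (R : realType) K
    & GRing.Field K & Topological K := {
  absv : K -> R ;
  absv_ge0 : forall x, 0 <= absv x ;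
  absv_eq0 : forall x, (absv x == 0) = (x == 0) ;
  absvM : forall x y, absv (x * y) = absv x * absv y ;
  absvD : forall x y, absv (x + y) <= absv x + absv y ;
  nbhs_absv : forall x : K,
    nbhs x = filter_from [set e : R | 0 < e]
                         (fun e => [set y | absv (x - y) < e])
}.

#[short(type="valuedFieldType")]
HB.structure Definition ValuedField (R : realType) :=
  {K of GRing.Field K & Topological K & isValuedField R K}.

#[non_forgetful_inheritance]
HB.instance Definition _ (R : realType) (K : valuedFieldType R) :=
  isPointed.Build K 0.

(** [K] is the completion of the number field [F] for the nontrivial absolute
    value that [iota] induces on [F]. *)
Record is_completion (R : realType) (F : fieldExtType rat)
    (K : valuedFieldType R) (iota : {rmorphism F -> K}) : Prop := {
  completion_nontrivial : exists x : F, x != 0 /\ absv (iota x) != 1 ;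
  completion_complete : forall u : nat -> K,
    (forall e : R, 0 < e -> exists N : nat, forall m n : nat,
      (N <= m)%N -> (N <= n)%N -> absv (u m - u n) < e) ->
    cvg (u n @[n --> \oo]) ;
  completion_dense : dense (range iota)
}.

Notation borel K := (g_sigma_algebraType (@open K)).

Section LocalField.
Context {R : realType} (K : valuedFieldType R).

Definition finite_place : Prop :=
  forall x y : K, absv (x + y) <= Num.max (absv x) (absv y).

(** The closure of [Q] in [K], that is, [Q_p] or the real numbers. *)
Definition prime_completion : set K := closure (range (ratr : rat -> K)).

Definition is_prime_basis (n : nat) (e : 'I_n -> K) : Prop :=
  forall z : K, exists! c : 'rV[K]_n,
    (forall i, prime_completion (c ord0 i)) /\ z = \sum_i c ord0 i * e i.

(** The trace from [K] to [prime_completion]: the trace of multiplication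
    by [x], in any basis. *)
Definition is_trace (x a : K) : Prop :=
  exists (n : nat) (e : 'I_n -> K) (M : 'M[K]_n),
    [/\ is_prime_basis e,
        (forall i j, prime_completion (M i j)),
        (forall j, x * e j = \sum_i M i j * e i)
      & a = \tr M].

Definition Tr (x : K) : K := xget 0 [set a | is_trace x a].

Definition residue_char : nat :=
  xget 0%N [set p : nat | prime p /\ absv (p%:R : K) < 1].

(** The polar part of [a] in [Q_p]: the element of [Z[1/p]] lying in [[0, 1)]
    that differs from [a] by an element of [Z_p], the unit ball of [Q_p]. *)
Definition polar_part (a : K) : rat :=
  xget 0 [set q : rat |
    [/\ 0 <= q < 1,
        exists n : nat, q * (residue_char ^ n)%:R \is a Num.int
      & absv (a - ratr q) <= 1]].

(** At an archimedean place, [r : R] and [a : K] are the same element of the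
    completion of [Q]. *)
Definition same_real (r : R) (a : K) : Prop :=
  exists u : nat -> rat,
    ((ratr (u n) : R) @[n --> \oo] --> r) /\
    ((ratr (u n) : K) @[n --> \oo] --> a).

Definition real_of (a : K) : R := xget 0 [set r | same_real r a].
Definition of_real (r : R) : K := xget 0 [set a | same_real r a].

Definition expi (theta : R) : R[i] := (cos theta +i* sin theta)%C.

Definition lambda (x : K) : R[i] :=
  if `[< finite_place >] then expi (2 * pi * ratr (polar_part (Tr x)))
  else expi (- (2 * pi * real_of (Tr x))).

Definition line (g : K -> R) (x h : K) : R -> R := fun t => g (x + of_real t * h).

Definition dir_derive (h : K) (g : K -> R) : K -> R :=
  fun x => derive1 (line g x h) 0.

(** Schwartz functions on [K] seen as a real vector space: every iterated
    directional derivative exists, is continuous and decreases rapidly. *)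
Definition schwartz (g : K -> R) : Prop :=
  forall hs : seq K,
    let Dg := foldr dir_derive g hs in
    [/\ continuous Dg,
        (forall x h : K, derivable (line Dg x h) 0 1)
      & forall m : nat, exists C : R, forall x : K, absv x ^+ m * `|Dg x| <= C].

Definition compactly_supported (f : K -> R[i]) : Prop :=
  compact (closure [set x | f x != 0]).

Definition schwartz_bruhat (f : K -> R[i]) : Prop :=
  if `[< finite_place >] then
    (forall x : K, \forall y \near x, f y = f x) /\ compactly_supported f
  else schwartz (fun x => complex.Re (f x)) /\
       schwartz (fun x => complex.Im (f x)).

Definition S0 (f : K -> R[i]) : Prop :=
  [/\ schwartz_bruhat f, compactly_supported f
    & \forall x \near (0 : K), f x = 0].

End LocalField.

Section Measure.
Context {R : realType} {K : valuedFieldType R}.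
Variable mu : {measure set (borel K) -> \bar R}.

Record is_haar : Prop := {
  haar_translation : forall (a : K) (E : set (borel K)), measurable E ->
    mu ((fun x => a + x) @` E) = mu E ;
  haar_compact : forall E : set K, compact E -> (mu E < +oo)%E ;
  haar_open : forall E : set K, open E -> E !=set0 -> (0 < mu E)%E
}.

(** The module of [t]: [d(tx) = |t| dx]. It is [absv t] up to an exponent, e.g.
    the square of the usual absolute value for the complex field. *)
Definition module (t : K) : R :=
  xget 0 [set r : R | 0 <= r /\ forall E : set (borel K), measurable E ->
    mu ((fun x => t * x) @` E) = (r%:E * mu E)%E].

Definition Cintegral (f : K -> R[i]) : R[i] :=
  ((\int[mu]_x complex.Re (f x)) +i* (\int[mu]_x complex.Im (f x)))%C.

Definition fourier (f : K -> R[i]) : K -> R[i] :=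
  fun y => Cintegral (fun x => f x * lambda (- (x * y))).

(** The Haar measure is self-dual for [lambda]: Fourier inversion holds. *)
Definition self_dual : Prop :=
  forall f : K -> R[i], schwartz_bruhat f ->
    forall x, fourier (fourier f) x = f (- x).

Definition L2norm (f : K -> R[i]) : \bar R :=
  'N[mu]_2%:E [(fun x : borel K => (complex.Re `|f x|)%:E)].

Definition L2 (f : K -> R[i]) : Prop :=
  [/\ measurable_fun setT (fun x : borel K => complex.Re (f x)),
      measurable_fun setT (fun x : borel K => complex.Im (f x))
    & (L2norm f < +oo)%E].

Definition aeq (f g : K -> R[i]) : Prop := {ae mu, forall x, f x = g x}.

Definition inner (f g : K -> R[i]) : R[i] :=
  Cintegral (fun x => f x * (g x)^*%C).

Definition L2cvg (u : nat -> K -> R[i]) (f : K -> R[i]) : Prop :=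
  L2norm (fun x => u n x - f x) @[n --> \oo] --> 0%E.

(** The elements of the Hilbert space are functions in [L2] up to [aeq], and
    an (unbounded) operator is given by its graph. All the graphs below only
    contain functions in [L2] and are invariant under [aeq]. *)
Definition operator := (K -> R[i]) -> (K -> R[i]) -> Prop.

Implicit Types S T V : operator.

Definition op_eq S T : Prop := forall f g, S f g <-> T f g.

Definition op_comp S T : operator := fun f h => exists2 g, T f g & S g h.

Definition op_inv T : operator := fun f g => T g f.

Definition op_opp T : operator := fun f g => T f (fun x => - g x).

Definition op_closure T : operator := fun f g =>
  [/\ L2 f, L2 g & exists u v : nat -> K -> R[i],
    [/\ forall n, T (u n) (v n), L2cvg u f & L2cvg v g]].

Definition op_adjoint T : operator := fun g h =>
  [/\ L2 g, L2 h & forall f k, T f k -> inner k g = inner f h].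

Definition densely_defined T : Prop :=
  forall f, L2 f -> exists u : nat -> K -> R[i],
    (forall n, exists g, T (u n) g) /\ L2cvg u f.

Definition self_adjoint T : Prop :=
  densely_defined T /\ op_eq T (op_adjoint T).

Definition essentially_self_adjoint T : Prop := self_adjoint (op_closure T).

Definition bounded_op T : Prop :=
  (forall f, L2 f -> exists g, T f g) /\
  exists C : R, forall f g, T f g -> (L2norm g <= C%:E * L2norm f)%E.

Definition commutes V T : Prop :=
  op_eq (op_comp V (op_closure T)) (op_comp (op_closure T) V).

Definition anti_commutes V T : Prop :=
  op_eq (op_comp V (op_closure T)) (op_opp (op_comp (op_closure T) V)).

(** The operator [f |-> Phi f] with initial domain [D]. *)
Definition op_of (D : (K -> R[i]) -> Prop)
    (Phi : (K -> R[i]) -> (K -> R[i])) : operator := fun f g =>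
  [/\ L2 f, L2 g & exists f0, [/\ D f0, aeq f f0 & aeq g (Phi f0)]].

(** The Fourier transform on [L2], as the closure of its restriction to the
    Schwartz-Bruhat functions, where the integral converges. *)
Definition opF : operator := op_closure (op_of (@schwartz_bruhat R K) fourier).

Definition opA : operator :=
  op_of setT (fun f x => (ln (module x))%:C%C * f x).

Definition opB : operator := op_comp opF (op_comp opA (op_inv opF)).

Definition opK : operator := fun f g =>
  [/\ L2 f, L2 g & exists f0 u v,
    [/\ S0 f0 /\ aeq f f0,
        op_comp opB opA f0 u,
        op_comp opA opB f0 v
      & aeq g (fun x => 'i%C * (u x - v x))]].

Definition opU (t : K) : operator :=
  op_of setT (fun f x => ((Num.sqrt (module t))^-1)%:C%C * f (x / t)).

Definition opI : operator :=
  op_of setT (fun f x => ((module x)^-1)%:C%C * f (x^-1)).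

End Measure.

(* Main.v *)
Require Import Defs.
From HB Require Import structures.
From mathcomp Require Import all_boot all_order all_algebra all_field.
From mathcomp Require Import all_classical all_reals all_analysis.
From mathcomp Require Import complex measurable_realfun ring lra.

Set Implicit Arguments.
Unset Strict Implicit.
Unset Printing Implicit Defensive.

Import Order.TTheory GRing.Theory Num.Theory numFieldNormedType.Exports.
Local Open Scope classical_set_scope.
Local Open Scope ring_scope.

(** Write [ell x = ln |x|], [A] for multiplication by [ell] and
    [B = F A F^-1]. The commutator is an explicit integral operator,
    [K f (x) = -(i / kappa) int (ell y - ell x) / |y - x| f y dy].
    To see this, let [g] be a bump function of integral 1 and [G] its Fourier
    transform. Frullani's formula [int (G t - G (t y)) dt / |t| = kappa ell y]
    turns the matrix coefficients of [B] into averages of translations, and in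
    those of [BA - AB] the averages collapse by the change of variables
    [h = s t]. For [f] in [S0], [ell F f] and [ell F (A f)] are square
    integrable because [f] and [A f] are Hoelder continuous.
    The kernel is skew-symmetric and homogeneous of degree -1, so Schur's test
    with the weight [|x|^(1/2)] bounds it. Hence the closure of [K] is an
    everywhere defined bounded hermitian operator. Homogeneity gives the
    invariance under dilations, the substitution [x -> 1/x] changes the sign of
    the kernel, and Fourier transform exchanges [A] and [B]. *)

(** Three obstacles shape the proof. The place is only known as a complete valued field in which a
    number field is dense; the analysis therefore rests on properties shared by all places: the
    module is a power of [absv], [lambda] is Hoelder continuous, inversion holds on Schwartz-Bruhat
    functions, and test functions are dense. For the same reason the bump is a Lipschitz tent, given
    by one formula at every place. The constant kappa is not computed: it is the ratio of two
    monotone homomorphisms of the multiplicative group. Frullani's formula produces, for each of BA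
    and AB, a translation average that is singular at t = 0 and is regularised by the term G t <u,
    v>. This term is the same in both coefficients because A is symmetric, so that it disappears
    from the commutator and an absolutely convergent kernel is left. Finally S0 is not stable under
    Fourier transform. The anti-commutation with F is therefore an identity between matrix
    coefficients on S0, carried to L2 by using density in each argument separately. *)

Local Notation mfun := (measurable_fun setT).
Local Notation mfun_comp := measurableT_comp.
Local Notation mfun_prod := measurable_funM.
Local Notation Re := complex.Re.
Local Notation Im := complex.Im.

(** * Complex-valued integration *)

Section ComplexModulus.
Context {R : realType}.
Implicit Types z w : R[i].

Definition cabs z : R := Re `|z|.

Lemma cabsE z : `|z| = (cabs z)%:C%C.
Proof. by rewrite /cabs normc_def. Qed.

Lemma cabs_sqrt z : cabs z = Num.sqrt (Re z ^+ 2 + Im z ^+ 2).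
Proof. by rewrite /cabs normc_def. Qed.

Lemma cabs_sqr z : cabs z ^+ 2 = Re z ^+ 2 + Im z ^+ 2.
Proof. by rewrite cabs_sqrt sqr_sqrtr// addr_ge0// sqr_ge0. Qed.

Lemma cabs_ge0 z : 0 <= cabs z.
Proof. by rewrite cabs_sqrt sqrtr_ge0. Qed.

Lemma cabs0 : cabs 0 = 0. Proof. by rewrite /cabs normr0. Qed.
Lemma cabs1 : cabs 1 = 1. Proof. by rewrite /cabs normr1. Qed.

Lemma cabsM z w : cabs (z * w) = cabs z * cabs w.
Proof. by apply: complexI; rewrite -cabsE normrM !cabsE -rmorphM. Qed.

Lemma cabsN z : cabs (- z) = cabs z. Proof. by rewrite /cabs normrN. Qed.

Lemma cabsB z w : cabs (z - w) = cabs (w - z).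
Proof. by rewrite /cabs distrC. Qed.

Lemma cabsD z w : cabs (z + w) <= cabs z + cabs w.
Proof. by rewrite -lecR rmorphD /= -!cabsE ler_normD. Qed.

Lemma cabsX z n : cabs (z ^+ n) = cabs z ^+ n.
Proof. by elim: n => [|n IH]; rewrite ?expr0 ?cabs1// !exprS cabsM IH. Qed.

Lemma cabsJ z : cabs (z^*)%C = cabs z.
Proof. by case: z => a b; rewrite !cabs_sqrt /= sqrrN. Qed.

Lemma cabs_eq0 z : (cabs z == 0) = (z == 0).
Proof. by rewrite -[RHS]normr_eq0 cabsE -(inj_eq (@complexI R)). Qed.

Lemma cabsR (x : R) : cabs x%:C%C = `|x|.
Proof. by rewrite cabs_sqrt /= expr0n addr0 sqrtr_sqr. Qed.

Lemma cabs_real (x : R) : 0 <= x -> cabs x%:C%C = x.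
Proof. by move=> x0; rewrite cabsR ger0_norm. Qed.

Lemma cabsi : cabs 'i%C = 1.
Proof. by rewrite cabs_sqrt /= expr0n add0r expr1n sqrtr1. Qed.

Lemma Re_le_cabs z : `|Re z| <= cabs z.
Proof. by rewrite -sqrtr_sqr cabs_sqrt ler_sqrt ?lerDl ?addr_ge0 ?sqr_ge0. Qed.

Lemma Im_le_cabs z : `|Im z| <= cabs z.
Proof. by rewrite -sqrtr_sqr cabs_sqrt ler_sqrt ?lerDr ?addr_ge0 ?sqr_ge0. Qed.

Lemma cabs_le_ReIm z : cabs z <= `|Re z| + `|Im z|.
Proof.
case: z => a b /=; have -> : (a +i* b)%C = a%:C%C + 'i%C * b%:C%C.
  by simpc.
by rewrite (le_trans (cabsD _ _))// cabsM cabsi mul1r !cabsR.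
Qed.

Lemma ReD z w : Re (z + w) = Re z + Re w.
Proof. by case: z; case: w. Qed.
Lemma ImD z w : Im (z + w) = Im z + Im w.
Proof. by case: z; case: w. Qed.
Lemma ReN z : Re (- z) = - Re z. Proof. by case: z. Qed.
Lemma ImN z : Im (- z) = - Im z. Proof. by case: z. Qed.
Lemma ReM z w : Re (z * w) =
  Re z * Re w - Im z * Im w.
Proof. by case: z; case: w. Qed.
Lemma ImM z w : Im (z * w) =
  Re z * Im w + Im z * Re w.
Proof. by case: z; case: w. Qed.
Lemma ReJ z : Re (z^*)%C = Re z. Proof. by case: z. Qed.
Lemma ImJ z : Im (z^*)%C = - Im z. Proof. by case: z. Qed.

Lemma ReIm_eq z w : Re z = Re w ->
  Im z = Im w -> z = w.
Proof. by case: z => a b; case: w => c d /= -> ->. Qed.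

Lemma mulcJ z : z * (z^*)%C = (cabs z ^+ 2)%:C%C.
Proof.
by apply: ReIm_eq; rewrite ?ReM ?ImM ReJ ImJ /= ?cabs_sqr; ring.
Qed.

Lemma cconjK z : ((z^*)^*)%C = z.
Proof. by case: z => a b; rewrite /= opprK. Qed.
Lemma conjcD z w : ((z + w)^*)%C = (z^*)%C + (w^*)%C.
Proof. exact: rmorphD. Qed.
Lemma conjcM z w : ((z * w)^*)%C = (z^*)%C * (w^*)%C.
Proof. exact: rmorphM. Qed.
Lemma conjcN z : ((- z)^*)%C = - (z^*)%C.
Proof. exact: rmorphN. Qed.

Lemma cabs_sub_sqr z w : cabs (z + w) ^+ 2 <= 2 * cabs z ^+ 2 + 2 * cabs w ^+ 2.
Proof.
rewrite !cabs_sqr ReD ImD; set a := Re z; set b := Im z.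
set c := Re w; set d := Im w.
have := sqr_ge0 (a - c); have := sqr_ge0 (b - d); rewrite !sqrrB !sqrrD; lra.
Qed.

End ComplexModulus.

Section ComplexMeasurable.
Context d (T : measurableType d) {R : realType}.
Implicit Types (f g : T -> R[i]).

Definition cmeas f := mfun (fun x => Re (f x)) /\
  mfun (fun x => Im (f x)).

Lemma cmeas_cst c : cmeas (fun=> c).
Proof. by split; exact: measurable_cst. Qed.

Lemma cmeasD f g : cmeas f -> cmeas g -> cmeas (fun x => f x + g x).
Proof.
move=> [f1 f2] [g1 g2]; split.
  by apply: eq_measurable_fun (measurable_funD f1 g1) => x _; rewrite ReD.
by apply: eq_measurable_fun (measurable_funD f2 g2) => x _; rewrite ImD.
Qed.

Lemma cmeasN f : cmeas f -> cmeas (fun x => - f x).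
Proof.
move=> [f1 f2]; split.
  by apply: eq_measurable_fun (measurable_funN f1) => x _; rewrite ReN.
by apply: eq_measurable_fun (measurable_funN f2) => x _; rewrite ImN.
Qed.

Lemma cmeasB f g : cmeas f -> cmeas g -> cmeas (fun x => f x - g x).
Proof. by move=> mf mg; apply: cmeasD => //; exact: cmeasN. Qed.

Lemma cmeasM f g : cmeas f -> cmeas g -> cmeas (fun x => f x * g x).
Proof.
move=> [f1 f2] [g1 g2]; split.
  apply: eq_measurable_fun (measurable_funB (mfun_prod f1 g1)
    (mfun_prod f2 g2)) => x _; by rewrite ReM.
apply: eq_measurable_fun (measurable_funD (mfun_prod f1 g2)
  (mfun_prod f2 g1)) => x _; by rewrite ImM.
Qed.

Lemma cmeasJ f : cmeas f -> cmeas (fun x => (f x)^*%C).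
Proof.
move=> [f1 f2]; split.
  by apply: eq_measurable_fun f1 => x _; rewrite ReJ.
by apply: eq_measurable_fun (measurable_funN f2) => x _; rewrite ImJ.
Qed.

Lemma cmeasR (h : T -> R) : mfun h ->
  cmeas (fun x => (h x)%:C%C).
Proof. by move=> mh; split => //=; exact: measurable_cst. Qed.

Lemma cmeas_cabs f : cmeas f -> mfun (fun x => cabs (f x)).
Proof.
move=> [f1 f2]; apply: (eq_measurable_fun (Num.sqrt \o
  ((fun x => Re (f x) ^+ 2) \+ (fun x => Im (f x) ^+ 2)))).
  by move=> x _; rewrite cabs_sqrt.
apply: mfun_comp.
  exact: continuous_measurable_fun (@sqrt_continuous R).
by apply: measurable_funD; exact: measurable_funX.
Qed.

End ComplexMeasurable.

Lemma cmeas_comp d (T : measurableType d) d' (T' : measurableType d')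
    (R : realType) (h : T' -> T) (f : T -> R[i]) :
  mfun h -> cmeas f -> cmeas (fun x => f (h x)).
Proof. by move=> mh [f1 f2]; split; [exact: (mfun_comp f1 mh)|exact: (mfun_comp f2 mh)]. Qed.

Section ComplexIntegral.
Context d (T : measurableType d) {R : realType}.
Variable mu : {measure set T -> \bar R}.
Implicit Types (f g : T -> R[i]).

Definition cinteg f := cmeas f /\ (\int[mu]_x (cabs (f x))%:E < +oo)%E.

Definition cint f : R[i] :=
  ((\int[mu]_x Re (f x)) +i* (\int[mu]_x Im (f x)))%C.

Lemma cint_ext f g : f =1 g -> cint f = cint g.
Proof. by move=> /funext ->. Qed.

Lemma ge0_int_le (u v : T -> R) :
  mfun u -> mfun v ->
  (forall x, 0 <= u x) -> (forall x, u x <= v x) ->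
  (\int[mu]_x (u x)%:E <= \int[mu]_x (v x)%:E)%E.
Proof.
move=> mu1 mv u0 uv; apply: ge0_le_integral => //.
- by move=> x _; rewrite lee_fin.
- exact/measurable_EFinP.
- exact/measurable_EFinP.
- by move=> x _; rewrite lee_fin.
Qed.

Lemma cinteg_Re f : cinteg f ->
  mu.-integrable setT (EFin \o (fun x => Re (f x))).
Proof.
move=> [[m1 m2] ff]; apply/integrableP; split; first exact/measurable_EFinP.
apply: le_lt_trans ff.
apply: (@ge0_int_le (fun x => `|Re (f x)|)) => //.
- exact: mfun_comp.
- exact: cmeas_cabs.
- by move=> x; exact: Re_le_cabs.
Qed.

Lemma cinteg_Im f : cinteg f ->
  mu.-integrable setT (EFin \o (fun x => Im (f x))).
Proof.
move=> [[m1 m2] ff]; apply/integrableP; split; first exact/measurable_EFinP.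
apply: le_lt_trans ff.
apply: (@ge0_int_le (fun x => `|Im (f x)|)) => //.
- exact: mfun_comp.
- exact: cmeas_cabs.
- by move=> x; exact: Im_le_cabs.
Qed.

Lemma cinteg_cabs f : cinteg f ->
  mu.-integrable setT (EFin \o (fun x => cabs (f x))).
Proof.
move=> [mf ff]; apply/integrableP; split.
  by apply/measurable_EFinP; exact: cmeas_cabs.
apply: le_lt_trans ff; under eq_integral do
  rewrite /= ger0_norm ?cabs_ge0//.
by [].
Qed.

Lemma cinteg_le f (v : T -> R) : cmeas f -> mfun v ->
  (forall x, cabs (f x) <= v x) -> (\int[mu]_x (v x)%:E < +oo)%E -> cinteg f.
Proof.
move=> mf mv fv vv; split=> //; apply: le_lt_trans vv; apply: ge0_int_le => //.
  exact: cmeas_cabs.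
by move=> x; exact: cabs_ge0.
Qed.

Lemma ge0_intD_lty (u v : T -> R) :
  mfun u -> mfun v ->
  (forall x, 0 <= u x) -> (forall x, 0 <= v x) ->
  (\int[mu]_x (u x)%:E < +oo)%E -> (\int[mu]_x (v x)%:E < +oo)%E ->
  (\int[mu]_x (u x + v x)%:E < +oo)%E.
Proof.
move=> mu1 mv u0 v0 uoo voo.
rewrite (_ : (fun x => _) = (fun x => (u x)%:E + (v x)%:E)%E) //.
rewrite ge0_integralD//; first exact: lte_add_pinfty.
- by move=> x _; rewrite lee_fin.
- exact/measurable_EFinP.
- by move=> x _; rewrite lee_fin.
- exact/measurable_EFinP.
Qed.

Lemma ge0_intZ (u : T -> R) c : mfun u -> (forall x, 0 <= u x) ->
  0 <= c -> (\int[mu]_x (c * u x)%:E = c%:E * \int[mu]_x (u x)%:E)%E.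
Proof.
move=> mu1 u0 c0; rewrite -ge0_integralZl//.
- exact/measurable_EFinP.
- by move=> x _; rewrite lee_fin.
Qed.

Lemma ge0_intZ_lty (u : T -> R) c : mfun u ->
  (forall x, 0 <= u x) -> 0 <= c -> (\int[mu]_x (u x)%:E < +oo)%E ->
  (\int[mu]_x (c * u x)%:E < +oo)%E.
Proof.
move=> mu1 u0 c0 uoo; rewrite ge0_intZ//; apply: lte_mul_pinfty => //.
Qed.

Lemma cintegD f g : cinteg f -> cinteg g -> cinteg (fun x => f x + g x).
Proof.
move=> [mf ff] [mg gg].
apply: (@cinteg_le _ (fun x => cabs (f x) + cabs (g x))).
- exact: cmeasD.
- by apply: measurable_funD; exact: cmeas_cabs.
- by move=> x; exact: cabsD.
- by apply: ge0_intD_lty => //; [exact: cmeas_cabs | exact: cmeas_cabs|..];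
    move=> x; exact: cabs_ge0.
Qed.

Lemma cintegMl f g (C : R) : cinteg f -> cmeas g ->
  (forall x, cabs (g x) <= C) -> cinteg (fun x => g x * f x).
Proof.
move=> [mf ff] mg gC.
have [C0|C0] := lerP 0 C; last first.
  split; first exact: cmeasM.
  rewrite (_ : (fun x => _) = cst 0%E) ?integral0//; apply/funext => x.
  by have := le_trans (cabs_ge0 _) (gC x); rewrite leNgt C0.
apply: (@cinteg_le _ (fun x => C * cabs (f x))).
- exact: cmeasM.
- by apply: mfun_prod => //; exact: cmeas_cabs.
- by move=> x; rewrite cabsM ler_wpM2r ?cabs_ge0.
- by apply: ge0_intZ_lty => //; [exact: cmeas_cabs|move=> x; exact: cabs_ge0].
Qed.

Lemma cintegZ f c : cinteg f -> cinteg (fun x => c * f x).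
Proof.
by move=> ff; apply: (@cintegMl _ (fun=> c) (cabs c)) => //; exact: cmeas_cst.
Qed.

Lemma cintegN f : cinteg f -> cinteg (fun x => - f x).
Proof.
move=> /(@cintegZ _ (-1)); rewrite (_ : (fun x => -1 * f x) = (fun x => - f x))//.
by apply/funext => x; rewrite mulN1r.
Qed.

Lemma cintegB f g : cinteg f -> cinteg g -> cinteg (fun x => f x - g x).
Proof. by move=> ff gg; apply: cintegD => //; exact: cintegN. Qed.

Lemma cintegJ f : cinteg f -> cinteg (fun x => (f x)^*%C).
Proof.
move=> [mf ff]; split; first exact: cmeasJ.
by under eq_integral do rewrite cabsJ.
Qed.

Lemma cintD f g : cinteg f -> cinteg g ->
  cint (fun x => f x + g x) = cint f + cint g.
Proof.
move=> ff gg; apply: ReIm_eq; rewrite /cint /=.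
  by under eq_Rintegral do rewrite ReD; rewrite RintegralD//; exact: cinteg_Re.
by under eq_Rintegral do rewrite ImD; rewrite RintegralD//; exact: cinteg_Im.
Qed.

Lemma integrableZl_EFin (h : T -> R) r : mu.-integrable setT (EFin \o h) ->
  mu.-integrable setT (EFin \o (fun x => r * h x)).
Proof. by move=> ih; exact: (integrableZl measurableT r ih). Qed.

Lemma cintZ f c : cinteg f -> cint (fun x => c * f x) = c * cint f.
Proof.
move=> ff; have := cinteg_Re ff; have := cinteg_Im ff => fi fr.
apply: ReIm_eq; rewrite /cint ?ReM ?ImM /=.
  under eq_Rintegral do rewrite ReM.
  rewrite (RintegralB measurableT (integrableZl_EFin _ fr)
    (integrableZl_EFin _ fi)) !RintegralZl//.
under eq_Rintegral do rewrite ImM.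
rewrite (RintegralD measurableT (integrableZl_EFin _ fi)
  (integrableZl_EFin _ fr)) !RintegralZl//.
Qed.

Lemma cintN f : cinteg f -> cint (fun x => - f x) = - cint f.
Proof.
move=> ff; rewrite -[RHS]mulN1r -cintZ//; apply: cint_ext => x.
by rewrite mulN1r.
Qed.

Lemma cintB f g : cinteg f -> cinteg g ->
  cint (fun x => f x - g x) = cint f - cint g.
Proof.
by move=> ff gg; rewrite -cintN// -cintD//; exact: cintegN.
Qed.

Lemma cintJ f : cinteg f -> cint (fun x => (f x)^*%C) = (cint f)^*%C.
Proof.
move=> ff; have := cinteg_Im ff => fi.
apply: ReIm_eq; rewrite /cint ?ReJ ?ImJ /=.
  by under eq_Rintegral do rewrite ReJ.
under eq_Rintegral do rewrite ImJ -mulN1r.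
by rewrite RintegralZl// mulN1r.
Qed.

Lemma cint0 : cint (fun=> 0) = 0.
Proof. by rewrite /cint /= Rintegral_cst// !mul0r. Qed.

(** Rotating by the unimodular constant [u] that makes [u * cint f] real and nonnegative leaves only
    real parts to compare. *)
Lemma cabs_cint_le f : cinteg f ->
  ((cabs (cint f))%:E <= \int[mu]_x (cabs (f x))%:E)%E.
Proof.
move=> ff; have [f0|f0] := eqVneq (cint f) 0.
  by rewrite f0 cabs0 integral_ge0// => x _; rewrite lee_fin cabs_ge0.
pose u := (cint f)^*%C / (cabs (cint f))%:C%C.
have cf0 : cabs (cint f) != 0 by rewrite cabs_eq0.
have cC0 : (cabs (cint f))%:C%C != 0 :> R[i].
  by rewrite (inj_eq (@complexI R) _ 0).
have u1 : cabs u = 1.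
  apply: (mulIf cf0); rewrite mul1r -[X in _ * X]cabs_real ?cabs_ge0//.
  by rewrite -cabsM /u divfK// cabsJ.
have uc : u * cint f = (cabs (cint f))%:C%C.
  by rewrite /u mulrAC [_ * cint f]mulrC mulcJ expr2 rmorphM /= mulfK.
have -> : cabs (cint f) = \int[mu]_x Re (u * f x).
  have := congr1 (@Re R) uc; rewrite [RHS]/= => <-.
  by rewrite -cintZ.
have uf : cinteg (fun x => u * f x) by exact: cintegZ.
have iuf := cinteg_Re uf.
rewrite /Rintegral fineK ?integrable_fin_num//.
apply: le_trans (_ : (\int[mu]_x (cabs (u * f x))%:E <= _)%E); last first.
  by under eq_integral do rewrite cabsM u1 mul1r.
apply: le_integral => //; first exact: (cinteg_cabs uf).
by move=> x _; rewrite lee_fin (le_trans (ler_norm _))// Re_le_cabs.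
Qed.

Lemma cint_ae f g : cmeas f -> cmeas g -> {ae mu, forall x, f x = g x} ->
  cint f = cint g.
Proof.
move=> [f1 f2] [g1 g2] fg; apply: ReIm_eq; rewrite /cint /= /Rintegral.
  congr fine; apply: ae_eq_integral => //; try exact/measurable_EFinP.
  by apply: filterS fg => x /= ->.
congr fine; apply: ae_eq_integral => //; try exact/measurable_EFinP.
by apply: filterS fg => x /= ->.
Qed.

Lemma cint_real (h : T -> R) : cint (fun x => (h x)%:C%C) =
  (\int[mu]_x h x)%:C%C.
Proof. by rewrite /cint /= Rintegral_cst// mul0r. Qed.

End ComplexIntegral.

Lemma le_abse_fine {R : realType} (z : \bar R) : (`|(fine z)%:E| <= `|z|)%E.
Proof. by case: z => [r| |] //=; rewrite normr0 leey. Qed.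

Section ComplexFubini.
Context d1 d2 (T1 : measurableType d1) (T2 : measurableType d2) {R : realType}.
Variable m1 : {sigma_finite_measure set T1 -> \bar R}.
Variable m2 : {sigma_finite_measure set T2 -> \bar R}.

(** [Rintegral] applies [fine] to the inner integral, which turns an infinite value into 0. This
    happens only on a null set, so the iterated real integral still agrees with the extended one. *)
Lemma Rintegral_fubini_F (g : T1 * T2 -> R) :
  (m1 \x m2)%E.-integrable setT (EFin \o g) ->
  m1.-integrable setT (EFin \o (fun x => \int[m2]_y g (x, y))) /\
  \int[m1]_x (\int[m2]_y g (x, y)) = fine (\int[m1]_x \int[m2]_y (g (x, y))%:E)%E.
Proof.
move=> ig; have iF := integrable_fubini_F ig.
have mF := measurable_int _ iF.
have mf : mfun (EFin \o (fun x => \int[m2]_y g (x, y))).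
  apply/measurable_EFinP; rewrite /Rintegral.
  by apply: (@mfun_comp _ _ _ _ _ _ fine) => //; exact: mF.
split.
  apply: le_integrable iF => // x _.
  exact: le_abse_fine.
rewrite {1}/Rintegral; congr fine; apply: ae_eq_integral => //.
have := integrable_ae measurableT iF; apply: filterS => x /= H _.
by rewrite /Rintegral fineK//; exact: H.
Qed.

Lemma Rintegral_fubini_G (g : T1 * T2 -> R) :
  (m1 \x m2)%E.-integrable setT (EFin \o g) ->
  m2.-integrable setT (EFin \o (fun y => \int[m1]_x g (x, y))) /\
  \int[m2]_y (\int[m1]_x g (x, y)) = fine (\int[m2]_y \int[m1]_x (g (x, y))%:E)%E.
Proof.
move=> ig; have mgE := measurable_int _ ig.
have iG : m2.-integrable setT (fubini_G m1 (EFin \o g)).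
  apply/integrableP; split; first exact: (measurable_fubini_G ig).
  have fin21 := (@integrable21ltyP _ _ _ _ _ m1 m2 _ mgE).1 ig.
  apply: le_lt_trans fin21.
  have mn : mfun (fun z => `|(EFin \o g) z|%E) by exact: mfun_comp.
  apply: ge0_le_integral => //.
  - by apply: mfun_comp => //; exact: (measurable_fubini_G ig).
  - exact: (measurable_fun_fubini_tonelli_G _ mn).
  - move=> y _; apply: le_abse_integral => //.
    exact: (mfun_comp mgE).
have mG := measurable_int _ iG.
have mg : mfun (EFin \o (fun y => \int[m1]_x g (x, y))).
  apply/measurable_EFinP; rewrite /Rintegral.
  by apply: (@mfun_comp _ _ _ _ _ _ fine) => //; exact: mG.
split.
  apply: le_integrable iG => // x _.
  exact: le_abse_fine.
rewrite {1}/Rintegral; congr fine; apply: ae_eq_integral => //.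
have := integrable_ae measurableT iG; apply: filterS => x /= H _.
by rewrite /Rintegral fineK//; exact: H.
Qed.

Variable f : T1 * T2 -> R[i].
Hypothesis mf : cmeas f.
Hypothesis foo : (\int[m1]_x \int[m2]_y (cabs (f (x, y)))%:E < +oo)%E.

Let iprod (g : T1 * T2 -> R) : mfun g ->
  (forall z, `|g z| <= cabs (f z)) -> (m1 \x m2)%E.-integrable setT (EFin \o g).
Proof.
move=> mg gf; have mgE : mfun (EFin \o g).
  exact/measurable_EFinP.
apply/(@integrable12ltyP _ _ _ _ _ m1 m2 _ mgE); apply: le_lt_trans foo.
rewrite -(fubini_tonelli1 (fun z => (cabs (f z))%:E))/=; last 2 first.
- by apply/measurable_EFinP; exact: cmeas_cabs.
- by move=> z; rewrite lee_fin cabs_ge0.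
rewrite -(fubini_tonelli1 (fun z => `|g z|%:E))/=.
- apply: ge0_int_le => //; [|exact: cmeas_cabs].
  exact: mfun_comp.
- by apply/measurable_EFinP; exact: mfun_comp.
- by move=> z; rewrite lee_fin.
Qed.

Let iRe : (m1 \x m2)%E.-integrable setT (EFin \o (fun z => Re (f z))).
Proof. by apply: iprod => [|z]; [exact: mf.1|exact: Re_le_cabs]. Qed.

Let iIm : (m1 \x m2)%E.-integrable setT (EFin \o (fun z => Im (f z))).
Proof. by apply: iprod => [|z]; [exact: mf.2|exact: Im_le_cabs]. Qed.

Lemma cinteg_ReIm d (T : measurableType d) (m : {measure set T -> \bar R})
    (h : T -> R[i]) :
  m.-integrable setT (EFin \o (fun z => Re (h z))) ->
  m.-integrable setT (EFin \o (fun z => Im (h z))) -> cinteg m h.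
Proof.
move=> /integrableP[m1r r] /integrableP[m2i i].
have mh : cmeas h by split; exact/measurable_EFinP.
apply: (@cinteg_le _ _ _ _ _ (fun z => `|Re (h z)| + `|Im (h z)|)) => //.
- by apply: measurable_funD; apply: mfun_comp => //; [exact: mh.1|exact: mh.2].
- by move=> z; exact: cabs_le_ReIm.
- apply: ge0_intD_lty => //.
  + by apply: mfun_comp => //; exact: mh.1.
  + by apply: mfun_comp => //; exact: mh.2.
Qed.

Lemma cinteg_fubini1 : cinteg m1 (fun x => cint m2 (fun y => f (x, y))).
Proof.
apply: cinteg_ReIm => /=; [exact: (Rintegral_fubini_F iRe).1|].
exact: (Rintegral_fubini_F iIm).1.
Qed.

Lemma cinteg_fubini2 : cinteg m2 (fun y => cint m1 (fun x => f (x, y))).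
Proof.
apply: cinteg_ReIm => /=; [exact: (Rintegral_fubini_G iRe).1|].
exact: (Rintegral_fubini_G iIm).1.
Qed.

Lemma cint_fubini : cint m1 (fun x => cint m2 (fun y => f (x, y))) =
  cint m2 (fun y => cint m1 (fun x => f (x, y))).
Proof.
apply: ReIm_eq; rewrite /cint /=.
  rewrite (Rintegral_fubini_F iRe).2 (Rintegral_fubini_G iRe).2.
  by congr fine; exact: (Fubini iRe).
rewrite (Rintegral_fubini_F iIm).2 (Rintegral_fubini_G iIm).2.
by congr fine; exact: (Fubini iIm).
Qed.

End ComplexFubini.

Section RealConvergence.
Context d (T : measurableType d) {R : realType}.
Variable mu : {measure set T -> \bar R}.

Lemma dominated_to0 (g : nat -> T -> R) (G : T -> R) :
  (forall n, mfun (g n)) -> mfun G ->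
  (forall n x, 0 <= g n x) -> (forall n x, g n x <= G x) ->
  (\int[mu]_x (G x)%:E < +oo)%E ->
  (forall x, g n x @[n --> \oo] --> 0) ->
  forall e : R, 0 < e -> exists N, forall n, (N <= n)%N ->
    (\int[mu]_x (g n x)%:E <= e%:E)%E.
Proof.
move=> mg mG g0 gG Goo gc e e0.
have [|||||_ _] := @dominated_convergence _ _ _ mu setT measurableT
  (fun n x => (g n x)%:E) (cst 0%E) (EFin \o G).
- by move=> n; exact/measurable_EFinP.
- exact: measurable_cst.
- apply/nearW => x _; rewrite /= -[0%E]/(0%:E).
  by apply/cvg_EFin; [exact: nearW|exact: gc].
- apply/integrableP; split; first exact/measurable_EFinP.
  by under eq_integral do rewrite /= ger0_norm ?(le_trans (g0 0%N _) (gG 0%N _))//.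
- by apply/nearW => x n _ /=; rewrite lee_fin ger0_norm.
rewrite integral_cst//= mul0e => /fine_cvgP[fn].
move=> /cvgrPdist_le /(_ e e0); case: fn => N1 _ fN1 [N2 _ N2P].
exists (maxn N1 N2) => n; rewrite geq_max => /andP[n1 n2].
have := N2P n n2; rewrite /= sub0r normrN => H.
rewrite -(@fineK _ (\int[mu]_x _)%E) ?lee_fin; last exact: (fN1 n n1).
exact: le_trans (ler_norm _) H.
Qed.

End RealConvergence.

(** * Square integrable functions: inner product, convergence, completeness *)

Section SquareIntegrable.
Context d (T : measurableType d) {R : realType}.
Variable mu : {measure set T -> \bar R}.
Implicit Types (f g h : T -> R[i]) (u v : nat -> T -> R[i]).

Definition sqn f := (\int[mu]_x (cabs (f x) ^+ 2)%:E)%E.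
Definition sqL f := cmeas f /\ (sqn f < +oo)%E.
(** The square of the L2 norm. Working with squares avoids roots; the triangle inequality becomes
    [nrD], with its factor 2. *)
Definition nr f : R := fine (sqn f).
Definition ip f g : R[i] := cint mu (fun x => f x * (g x)^*%C).
Definition cvg2 u f := forall e : R, 0 < e -> exists N, forall n,
  (N <= n)%N -> nr (fun x => u n x - f x) <= e.

Lemma sqn_ge0 f : (0 <= sqn f)%E.
Proof. by apply: integral_ge0 => x _; rewrite lee_fin sqr_ge0. Qed.

Lemma nr_ge0 f : 0 <= nr f. Proof. by rewrite fine_ge0// sqn_ge0. Qed.

Lemma sqnE f : sqL f -> sqn f = (nr f)%:E.
Proof. by move=> [_ ff]; rewrite fineK// ge0_fin_numE// sqn_ge0. Qed.

Lemma meas_sq f : cmeas f -> mfun (fun x => cabs (f x) ^+ 2).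
Proof. by move=> mf; apply: measurable_funX; exact: cmeas_cabs. Qed.

Lemma sqL_le f (v : T -> R) : cmeas f -> mfun v ->
  (forall x, cabs (f x) ^+ 2 <= v x) -> (\int[mu]_x (v x)%:E < +oo)%E -> sqL f.
Proof.
move=> mf mv fv vv; split=> //; apply: le_lt_trans vv; apply: ge0_int_le => //.
  exact: meas_sq.
by move=> x; exact: sqr_ge0.
Qed.

Lemma sqn_le f (C : R) : (sqn f <= C%:E)%E -> nr f <= C.
Proof.
rewrite /nr; have := sqn_ge0 f; case: (sqn f) => [r| |] //=.
Qed.

Lemma sqLD f g : sqL f -> sqL g -> sqL (fun x => f x + g x).
Proof.
move=> [mf ff] [mg gg].
apply: (@sqL_le _ (fun x => 2 * cabs (f x) ^+ 2 + 2 * cabs (g x) ^+ 2)).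
- exact: cmeasD.
- by apply: measurable_funD; apply: mfun_prod => //; exact: meas_sq.
- by move=> x; exact: cabs_sub_sqr.
- apply: ge0_intD_lty.
  + by apply: mfun_prod => //; exact: meas_sq.
  + by apply: mfun_prod => //; exact: meas_sq.
  + by move=> x; rewrite mulr_ge0// sqr_ge0.
  + by move=> x; rewrite mulr_ge0// sqr_ge0.
  + by apply: ge0_intZ_lty => //; [exact: meas_sq|move=> x; exact: sqr_ge0].
  + by apply: ge0_intZ_lty => //; [exact: meas_sq|move=> x; exact: sqr_ge0].
Qed.

Lemma nrD f g : sqL f -> sqL g ->
  nr (fun x => f x + g x) <= 2 * nr f + 2 * nr g.
Proof.
move=> Lf Lg; apply: sqn_le; rewrite EFinD !EFinM -!sqnE//.
have mf := meas_sq Lf.1; have mg := meas_sq Lg.1.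
rewrite -!ge0_intZ//; try by move=> x; exact: sqr_ge0.
rewrite -ge0_integralD//; first last.
- by apply/measurable_EFinP; apply: mfun_prod.
- by move=> x _; rewrite lee_fin mulr_ge0 ?sqr_ge0.
- by apply/measurable_EFinP; apply: mfun_prod.
- by move=> x _; rewrite lee_fin mulr_ge0 ?sqr_ge0.
apply: (@ge0_int_le _ _ _ _ _ (fun x => 2 * cabs (f x) ^+ 2 + 2 * cabs (g x) ^+ 2)).
- by apply: meas_sq; exact: cmeasD Lf.1 Lg.1.
- by apply: measurable_funD; apply: mfun_prod.
- by move=> x; exact: sqr_ge0.
- by move=> x; exact: cabs_sub_sqr.
Qed.

Lemma sqLMl f g (C : R) : sqL f -> cmeas g -> (forall x, cabs (g x) <= C) ->
  sqL (fun x => g x * f x).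
Proof.
move=> [mf ff] mg gC.
apply: (@sqL_le _ (fun x => C ^+ 2 * cabs (f x) ^+ 2)).
- exact: cmeasM.
- by apply: mfun_prod => //; exact: meas_sq.
- move=> x; rewrite cabsM exprMn ler_wpM2r ?sqr_ge0//.
  by rewrite lerXn2r ?nnegrE ?cabs_ge0// (le_trans _ (gC x))// cabs_ge0.
- apply: ge0_intZ_lty => //; [exact: meas_sq|by move=> x; exact: sqr_ge0|].
  exact: sqr_ge0.
Qed.

Lemma sqLZ f c : sqL f -> sqL (fun x => c * f x).
Proof.
by move=> ff; apply: (@sqLMl _ (fun=> c) (cabs c)) => //; exact: cmeas_cst.
Qed.

Lemma nrZ f c : cmeas f -> nr (fun x => c * f x) = cabs c ^+ 2 * nr f.
Proof.
move=> mf; rewrite /nr /sqn; under eq_integral do rewrite cabsM exprMn.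
rewrite ge0_intZ ?sqr_ge0//; last 2 first.
- exact: meas_sq.
- by move=> x; exact: sqr_ge0.
rewrite -/(sqn f); have := sqn_ge0 f; case: (sqn f) => [r| |] //= _.
(* Only [sqn f = +oo] is left; both sides are then 0, because [fine] sends the infinite value to
   0. *)
by rewrite mulr0 mulry; have := sqr_ge0 (cabs c); rewrite le_eqVlt =>
  /orP[/eqP <-|c0]; [rewrite sgr0 mul0e|rewrite gtr0_sg// mul1e].
Qed.

Lemma sqLN f : sqL f -> sqL (fun x => - f x).
Proof.
move=> [mf ff]; split; first exact: cmeasN.
by rewrite /sqn; under eq_integral do rewrite cabsN.
Qed.

Lemma nr_distC f g : nr (fun x => f x - g x) = nr (fun x => g x - f x).
Proof. by rewrite /nr /sqn; under eq_integral do rewrite cabsB. Qed.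

Lemma sqLB f g : sqL f -> sqL g -> sqL (fun x => f x - g x).
Proof. by move=> ff gg; apply: sqLD => //; exact: sqLN. Qed.

Lemma nr_split f g h : sqL f -> sqL g -> sqL h -> nr (fun x => f x - h x) <=
  2 * nr (fun x => f x - g x) + 2 * nr (fun x => g x - h x).
Proof.
move=> Lf Lg Lh; rewrite (_ : (fun x => f x - h x) =
  (fun x => (f x - g x) + (g x - h x))); first by apply: nrD; exact: sqLB.
by apply/funext => x; rewrite addrA subrK.
Qed.

Lemma sqn_ae f g : cmeas f -> cmeas g -> {ae mu, forall x, f x = g x} ->
  sqn f = sqn g.
Proof.
move=> mf mg fg; apply: ge0_ae_eq_integral => //.
- by apply/measurable_EFinP; exact: meas_sq.
- by apply/measurable_EFinP; exact: meas_sq.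
- by move=> x _; rewrite lee_fin sqr_ge0.
- by move=> x _; rewrite lee_fin sqr_ge0.
- by apply: filterS fg => x /= ->.
Qed.

Lemma sqL_ae f g : sqL f -> cmeas g -> {ae mu, forall x, f x = g x} -> sqL g.
Proof. by move=> [mf ff] mg fg; split=> //; rewrite -(sqn_ae mf mg fg). Qed.

Lemma nr_eq0_ae f : sqL f -> nr f = 0 -> {ae mu, forall x, f x = 0}.
Proof.
move=> Lf f0; have sf : sqn f = 0%E by rewrite sqnE// f0.
have mf : mfun (fun x => (cabs (f x) ^+ 2)%:E).
  by apply/measurable_EFinP; exact: meas_sq Lf.1.
have := (ae_eq_integral_abs mu measurableT mf).1.
have -> : (\int[mu]_x `|(cabs (f x) ^+ 2)%:E|)%E = sqn f.
  by apply: eq_integral => x _; rewrite gee0_abs// lee_fin sqr_ge0.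
move=> /(_ sf); apply: filterS => x /(_ I) [] /eqP.
by rewrite sqrf_eq0 cabs_eq0 => /eqP.
Qed.

Lemma nr_ae f g : sqL f -> sqL g -> {ae mu, forall x, f x = g x} ->
  nr (fun x => f x - g x) = 0.
Proof.
move=> Lf Lg fg; rewrite /nr (@sqn_ae _ (fun=> 0)).
- by rewrite /sqn (_ : (fun x => _) = cst 0%E) ?integral0//; apply/funext => x;
    rewrite cabs0 expr0n.
- exact: cmeasB Lf.1 Lg.1.
- exact: cmeas_cst.
- by apply: filterS fg => x ->; rewrite subrr.
Qed.

Lemma cinteg_ip f g : sqL f -> sqL g -> cinteg mu (fun x => f x * (g x)^*%C).
Proof.
move=> [mf ff] [mg gg].
apply: (@cinteg_le _ _ _ _ _ (fun x => cabs (f x) ^+ 2 + cabs (g x) ^+ 2)).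
- by apply: cmeasM => //; exact: cmeasJ.
- by apply: measurable_funD; exact: meas_sq.
- move=> x; rewrite cabsM cabsJ; set a := cabs _; set b := cabs _.
  have := sqr_ge0 (a - b); have := sqr_ge0 a; have := sqr_ge0 b.
  by rewrite sqrrB; nra.
- by apply: ge0_intD_lty => //; try (by apply: meas_sq); move=> x; exact: sqr_ge0.
Qed.

Lemma ipDl f g h : sqL f -> sqL g -> sqL h ->
  ip (fun x => f x + g x) h = ip f h + ip g h.
Proof.
move=> Lf Lg Lh; rewrite /ip -cintD; [|exact: cinteg_ip..].
by apply: cint_ext => x; rewrite mulrDl.
Qed.

Lemma ipZl f h c : sqL f -> sqL h -> ip (fun x => c * f x) h = c * ip f h.
Proof.
move=> Lf Lh; rewrite /ip -cintZ; last exact: cinteg_ip.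
by apply: cint_ext => x; rewrite mulrA.
Qed.

Lemma ipNl f h : sqL f -> sqL h -> ip (fun x => - f x) h = - ip f h.
Proof.
move=> Lf Lh; rewrite /ip -cintN; last exact: cinteg_ip.
by apply: cint_ext => x; rewrite mulNr.
Qed.

Lemma ipBl f g h : sqL f -> sqL g -> sqL h ->
  ip (fun x => f x - g x) h = ip f h - ip g h.
Proof. by move=> Lf Lg Lh; rewrite -ipNl// -ipDl//; exact: sqLN. Qed.

Lemma ipJ f g : sqL f -> sqL g -> ip g f = (ip f g)^*%C.
Proof.
move=> Lf Lg; rewrite /ip -cintJ; last exact: cinteg_ip.
by apply: cint_ext => x; rewrite conjcM cconjK mulrC.
Qed.

Lemma ipDr f g h : sqL f -> sqL g -> sqL h ->
  ip h (fun x => f x + g x) = ip h f + ip h g.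
Proof.
move=> Lf Lg Lh; rewrite (ipJ (sqLD Lf Lg) Lh) ipDl// conjcD.
by rewrite -(ipJ Lf Lh) -(ipJ Lg Lh).
Qed.

Lemma ipZr f h c : sqL f -> sqL h -> ip h (fun x => c * f x) = c^*%C * ip h f.
Proof.
by move=> Lf Lh; rewrite (ipJ (sqLZ c Lf) Lh) ipZl// conjcM -ipJ.
Qed.

Lemma ipNr f h : sqL f -> sqL h -> ip h (fun x => - f x) = - ip h f.
Proof.
by move=> Lf Lh; rewrite (ipJ (sqLN Lf) Lh) ipNl// conjcN -ipJ.
Qed.

Lemma ipBr f g h : sqL f -> sqL g -> sqL h ->
  ip h (fun x => f x - g x) = ip h f - ip h g.
Proof. by move=> Lf Lg Lh; rewrite -ipNr// -ipDr//; exact: sqLN. Qed.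

Lemma ip_ae f f' g g' : cmeas f -> cmeas f' -> cmeas g -> cmeas g' ->
  {ae mu, forall x, f x = f' x} -> {ae mu, forall x, g x = g' x} ->
  ip f g = ip f' g'.
Proof.
move=> mf mf' mg mg' ff gg; apply: cint_ae.
- by apply: cmeasM => //; exact: cmeasJ.
- by apply: cmeasM => //; exact: cmeasJ.
- by apply: filterS2 ff gg => x -> ->.
Qed.

Lemma ip_self f : sqL f -> ip f f = (nr f)%:C%C.
Proof.
move=> Lf; rewrite /ip (@cint_ext _ _ _ _ _ (fun x => (cabs (f x) ^+ 2)%:C%C)).
  by rewrite cint_real.
by move=> x; rewrite mulcJ.
Qed.

(** The choice [s = c / (2 * a)] makes the first summand [c / 2], and the second one must supply the
    other half. For [a = 0] a large [s] contradicts [c > 0]. *)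
Lemma optimize_scale (c a b : R) : 0 <= c -> 0 <= a -> 0 <= b ->
  (forall s, 0 < s -> c <= s * a + s^-1 * b) -> c ^+ 2 <= 4 * (a * b).
Proof.
move=> c0 a0 b0 H.
have [->|cn0] := eqVneq c 0; first by rewrite expr0n mulr_ge0// mulr_ge0.
have cp : 0 < c by rewrite lt0r cn0.
have [az|an0] := eqVneq a 0.
  have s0 : 0 < 2 * (b + 1) / c by rewrite divr_gt0// mulr_gt0//; lra.
  have := H _ s0; rewrite az mulr0 add0r invf_div => h.
  have : c * (2 * (b + 1)) <= c * b.
    have b1 : 0 < 2 * (b + 1) by lra.
    by rewrite -ler_pdivlMr// mulrAC.
  rewrite ler_pM2l//; lra.
have ap : 0 < a by rewrite lt0r an0.
have s0 : 0 < c / (2 * a) by rewrite divr_gt0// mulr_gt0.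
have := H _ s0; rewrite invf_div => h.
have e1 : c / (2 * a) * a = c / 2 by field.
rewrite e1 in h; have h2 : c / 2 <= 2 * a / c * b by lra.
have : c / 2 * (2 * c) <= 2 * a / c * b * (2 * c) by rewrite ler_wpM2r//; lra.
have -> : 2 * a / c * b * (2 * c) = 4 * (a * b) by field.
by have -> : c / 2 * (2 * c) = c ^+ 2 by field.
Qed.

Lemma cabs_ip_AMGM f g : sqL f -> sqL g -> cabs (ip f g) <= nr f + nr g.
Proof.
move=> Lf Lg; rewrite -lee_fin; apply: le_trans (cabs_cint_le (cinteg_ip Lf Lg)) _.
rewrite EFinD -!sqnE// -ge0_integralD//; first last.
- by apply/measurable_EFinP; apply: meas_sq; exact: Lg.1.
- by move=> x _; rewrite lee_fin sqr_ge0.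
- by apply/measurable_EFinP; apply: meas_sq; exact: Lf.1.
- by move=> x _; rewrite lee_fin sqr_ge0.
apply: (@ge0_int_le _ _ _ _ _ (fun x => cabs (f x) ^+ 2 + cabs (g x) ^+ 2)).
- by apply: cmeas_cabs; apply: cmeasM; [exact: Lf.1|apply: cmeasJ; exact: Lg.1].
- by apply: measurable_funD; apply: meas_sq; [exact: Lf.1|exact: Lg.1].
- by move=> x; exact: cabs_ge0.
- move=> x; rewrite cabsM cabsJ; set a := cabs _; set b := cabs _.
  have := sqr_ge0 (a - b); have := sqr_ge0 a; have := sqr_ge0 b.
  by rewrite sqrrB; nra.
Qed.

(* A sesquilinear form bounded by the sum of the squared norms is bounded by
   their geometric mean: rescale both arguments by reciprocal factors. *)
Lemma form_scale (Q : (T -> R[i]) -> (T -> R[i]) -> R[i]) (C : R) f g :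
  0 <= C -> sqL f -> sqL g ->
  (forall s : R, 0 < s -> Q (fun x => s%:C%C * f x) (fun x => (s^-1)%:C%C * g x)
     = Q f g) ->
  (forall f g, sqL f -> sqL g -> cabs (Q f g) <= C * (nr f + nr g)) ->
  cabs (Q f g) ^+ 2 <= 4 * (C ^+ 2 * (nr f * nr g)).
Proof.
move=> C0 Lf Lg Qs QC.
have -> : C ^+ 2 * (nr f * nr g) = (C * nr f) * (C * nr g) by ring.
apply: optimize_scale; rewrite ?cabs_ge0 ?mulr_ge0 ?nr_ge0// => s s0.
pose t := Num.sqrt s; have t0 : 0 < t by rewrite sqrtr_gt0.
have ts : t ^+ 2 = s by rewrite sqr_sqrtr// ltW.
rewrite -(Qs t t0); apply: le_trans (QC _ _ (sqLZ _ Lf) (sqLZ _ Lg)) _.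
rewrite !nrZ; [|exact: Lg.1|exact: Lf.1].
have -> : cabs t%:C%C = t by rewrite cabs_real// ltW.
have -> : cabs (t^-1)%:C%C = t^-1 by rewrite cabs_real// invr_ge0 ltW.
by rewrite exprVn ts mulrDr mulrCA [C * (s^-1 * _)]mulrCA.
Qed.

(** The constant 4 comes from the bound of [cabs_ip_AMGM], which lacks the factor 1/2 of the sharp
    arithmetic-geometric inequality. *)
Lemma cauchy_schwarz f g : sqL f -> sqL g ->
  cabs (ip f g) ^+ 2 <= 4 * (nr f * nr g).
Proof.
move=> Lf Lg; have := @form_scale ip 1 f g ler01 Lf Lg; rewrite expr1n mul1r; apply.
  move=> s s0; rewrite ipZl ?ipZr//; [|exact: sqLZ].
  rewrite conjc_real mulrA -rmorphM /= divff ?mul1r//; exact: lt0r_neq0.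
by move=> f' g' Lf' Lg'; rewrite mul1r; exact: cabs_ip_AMGM.
Qed.

Lemma cvg2_ip u f g : (forall n, sqL (u n)) -> sqL f -> sqL g -> cvg2 u f ->
  forall e : R, 0 < e -> exists N, forall n, (N <= n)%N ->
    cabs (ip (u n) g - ip f g) <= e.
Proof.
move=> Lu Lf Lg uf e e0.
have C0 : 0 < 4 * (nr g + 1) by have := nr_ge0 g; lra.
have [N NP] := uf (e ^+ 2 / (4 * (nr g + 1))) (divr_gt0 (exprn_gt0 2 e0) C0).
exists N => n nN; rewrite -ipBl//.
rewrite -(@ler_pXn2r _ 2)// ?nnegrE ?cabs_ge0 ?(ltW e0)//.
apply: le_trans (cauchy_schwarz (sqLB (Lu n) Lf) Lg) _.
have := NP n nN; set z := nr (fun x => _) => zle.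
rewrite ler_pdivlMr// in zle; apply: le_trans zle.
have z0 : 0 <= z by exact: nr_ge0.
have := nr_ge0 g; nra.
Qed.

Lemma cvg2_ip_lim u f g c : (forall n, sqL (u n)) -> sqL f -> sqL g ->
  cvg2 u f -> (forall e : R, 0 < e -> exists N, forall n, (N <= n)%N ->
    cabs (ip (u n) g - c) <= e) -> ip f g = c.
Proof.
move=> Lu Lf Lg uf uc; apply/eqP; rewrite -subr_eq0 -cabs_eq0 eq_le cabs_ge0 andbT.
apply/ler_addgt0Pl => e e0; rewrite addr0.
have e2 : 0 < e / 2 by lra.
have [N NP] := cvg2_ip Lu Lf Lg uf e2; have [M MP] := uc _ e2.
have := NP (maxn N M) (leq_maxl _ _); have := MP (maxn N M) (leq_maxr _ _).
set w := ip (u _) g => h1 h2.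
rewrite (_ : ip f g - c = - (w - ip f g) + (w - c)); last by ring.
by rewrite (le_trans (cabsD _ _))// cabsN; lra.
Qed.

Lemma cvg2_unique u f g : (forall n, sqL (u n)) -> sqL f -> sqL g ->
  cvg2 u f -> cvg2 u g -> {ae mu, forall x, f x = g x}.
Proof.
move=> Lu Lf Lg uf ug.
have : nr (fun x => f x - g x) = 0.
  apply/eqP; rewrite eq_le nr_ge0 andbT; apply/ler_addgt0Pl => e e0; rewrite addr0.
  have e2 : 0 < e / 4 by lra.
  have [N NP] := uf _ e2; have [M MP] := ug _ e2.
  have := NP (maxn N M) (leq_maxl _ _); have := MP (maxn N M) (leq_maxr _ _).
  move=> h1 h2; apply: le_trans (nr_split Lf (Lu (maxn N M)) Lg) _.
  by rewrite nr_distC; lra.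
move=> /(nr_eq0_ae (sqLB Lf Lg)); apply: filterS => x /eqP.
by rewrite subr_eq0 => /eqP.
Qed.

End SquareIntegrable.

Section Completeness.
Context d (T : measurableType d) {R : realType}.
Variable mu : {measure set T -> \bar R}.
Implicit Types (f g h : T -> R[i]) (u v : nat -> T -> R[i]).

Lemma nneseries_lty_geometric (a : nat -> \bar R) (C r : R) :
  0 <= r -> r < 1 -> (forall n, 0 <= a n)%E ->
  (forall n, a n <= (C * r ^+ n)%:E)%E -> (\sum_(0 <= n <oo) a n < +oo)%E.
Proof.
move=> r0 r1 a0 aC.
apply: le_lt_trans (lee_nneseries (fun n _ _ => a0 n) (fun n _ => aC n)) _.
have cg : cvgn (series (geometric C r)).
  by apply: is_cvg_geometric_series; rewrite ger0_norm.
rewrite (_ : (fun n => _) = EFin \o series (geometric C r)); last first.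
  by apply/funext => n; rewrite /= /series /= sumEFin.
by rewrite EFin_lim// ltry.
Qed.

Lemma cvg_telescope (w : nat -> R) (C r : R) : 0 <= r -> r < 1 ->
  (forall n, `|w n.+1 - w n| <= C * r ^+ n) -> cvgn w.
Proof.
move=> r0 r1 wC.
have cs : cvgn (series (telescope w)).
  apply: normed_cvg; apply: (@series_le_cvg _ _ (geometric C r)).
  - by move=> n; exact: normr_ge0.
  - by move=> n; rewrite /= (le_trans _ (wC n)).
  - by move=> n; rewrite /telescope /=; exact: wC.
  - by apply: is_cvg_geometric_series; rewrite ger0_norm.
rewrite (_ : w = cst (w 0%N) + series (telescope w)).
  exact: is_cvgD (is_cvg_cst _) cs.
by apply/funext => n; rewrite /= [LHS]eq_sum_telescope.
Qed.

(* Along a subsequence with summable weighted squared differences, the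
   sequence converges almost everywhere. *)
Lemma sqL_fast_cvg_ae u : (forall n, sqL mu (u n)) ->
  (forall n, nr mu (fun x => u n.+1 x - u n x) <= 4^-1 ^+ n) ->
  exists N : set T, [/\ measurable N, mu N = 0 & forall x, ~ N x ->
    cvgn (fun n => Re (u n x)) /\ cvgn (fun n => Im (u n x))].
Proof.
move=> Lu uf.
pose t n x : \bar R := (2 ^+ n * cabs (u n.+1 x - u n x) ^+ 2)%:E.
have Ld n := sqLB (Lu n.+1) (Lu n).
have t0 n x : (0 <= t n x)%E by rewrite /t lee_fin; apply: mulr_ge0; [exact: exprn_ge0|exact: sqr_ge0].
have mt n : mfun (t n).
  apply/measurable_EFinP; apply: mfun_prod => //.
  exact: meas_sq (Ld n).1.
pose H x : \bar R := (\sum_(0 <= n <oo) t n x)%E.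
have mH : mfun H by apply: ge0_emeasurable_sum.
have H0 x : (0 <= H x)%E by apply: nneseries_ge0 => n _ _; exact: t0.
have Hoo : (\int[mu]_x H x < +oo)%E.
  rewrite /H integral_nneseries//.
  apply: (@nneseries_lty_geometric _ 1 2^-1); [lra|lra| |].
    by move=> n; apply: integral_ge0 => x _; exact: t0.
  move=> n; rewrite /t ge0_intZ ?exprn_ge0//; last 2 first.
    exact: meas_sq (Ld n).1.
    by move=> x; exact: sqr_ge0.
  rewrite -/(sqn mu (fun x => u n.+1 x - u n x)) sqnE// -EFinM lee_fin mul1r.
  apply: le_trans (ler_wpM2l _ (uf n)) _; first by rewrite exprn_ge0.
  rewrite -exprMn; apply: lerXn2r; rewrite ?nnegrE; lra.
have iH : mu.-integrable setT H.
  apply/integrableP; split => //.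
  by under eq_integral do rewrite gee0_abs//.
have [N [mN N0 NP]] := integrable_ae measurableT iH.
exists N; split=> // x Nx.
have Hf : H x \is a fin_num by apply: contra_notP Nx => Hx; apply: NP => /= /(_ I).
have tH n : (t n x <= H x)%E.
  rewrite /H (nneseriesD1 (n := n)) ?leeDl//.
  by apply: nneseries_ge0 => k _ _; exact: t0.
pose C := Num.sqrt (fine (H x)); pose r : R := Num.sqrt 2^-1.
have r0 : 0 <= r by exact: sqrtr_ge0.
have r1 : r < 1 by rewrite -[ltRHS]sqrtr1 ltr_sqrt; lra.
have b n : cabs (u n.+1 x - u n x) <= C * r ^+ n.
  rewrite -(@ler_pXn2r _ 2)// ?nnegrE ?cabs_ge0 ?mulr_ge0 ?exprn_ge0 ?sqrtr_ge0//.
  rewrite exprMn sqr_sqrtr ?fine_ge0// exprAC sqr_sqrtr ?invr_ge0//.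
  have := tH n; rewrite -(fineK Hf) lee_fin exprVn mulrC ler_pdivlMr ?exprn_gt0//.
split; apply: (@cvg_telescope _ C r) => // n; apply: le_trans _ (b n).
  by rewrite -ReN -ReD; exact: Re_le_cabs.
by rewrite -ImN -ImD; exact: Im_le_cabs.
Qed.

Lemma cvg_cabs_sub (w : nat -> R[i]) (c : R[i]) :
  Re (w n) @[n --> \oo] --> Re c ->
  Im (w n) @[n --> \oo] --> Im c ->
  forall z, cabs (z - w n) ^+ 2 @[n --> \oo] --> cabs (z - c) ^+ 2.
Proof.
move=> wr wi z; rewrite cabs_sqr.
rewrite (_ : (fun n => cabs (z - w n) ^+ 2) = (fun n =>
  (Re z - Re (w n)) ^+ 2 + (Im z - Im (w n)) ^+ 2)).
  rewrite !ReD !ImD !ReN !ImN !expr2; apply: cvgD.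
    by apply: cvgM; apply: cvgB => //; exact: cvg_cst.
  by apply: cvgM; apply: cvgB => //; exact: cvg_cst.
by apply/funext => n; rewrite cabs_sqr !ReD !ImD !ReN !ImN.
Qed.

Lemma limn_einf_ge (u : nat -> \bar R) l : (forall n, l <= u n)%E ->
  (l <= limn_einf u)%E.
Proof.
move=> ul; rewrite limn_einf_lim; apply: lime_ge; first exact: is_cvg_einfs.
by apply: nearW => n; apply: le_ereal_inf_tmp => _ [m _ <-]; exact: ul.
Qed.

Lemma limn_einf_le (u : nat -> \bar R) l : (forall n, u n <= l)%E ->
  (limn_einf u <= l)%E.
Proof.
move=> ul; rewrite limn_einf_lim; apply: lime_le; first exact: is_cvg_einfs.
apply: nearW => n; apply: le_trans (ul n); apply: ge_ereal_inf.
by exists (u n) => //; exists n => /=.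
Qed.

(** Fatou's lemma for squared norms. It turns almost everywhere convergence under a uniform bound
    into a norm estimate for the limit. *)
Lemma fatou_nr (w : nat -> T -> R[i]) h (C : R) : (forall n, cmeas (w n)) ->
  cmeas h -> (forall n, (sqn mu (w n) <= C%:E)%E) ->
  {ae mu, forall x, (cabs (w n x) ^+ 2) @[n --> \oo] --> cabs (h x) ^+ 2} ->
  (sqn mu h <= C%:E)%E.
Proof.
move=> mw mh wC wh.
have mw2 n : mfun (fun x => (cabs (w n x) ^+ 2)%:E).
  by apply/measurable_EFinP; exact: meas_sq.
have -> : sqn mu h = (\int[mu]_x limn_einf (fun n => (cabs (w n x) ^+ 2)%:E))%E.
  apply: ge0_ae_eq_integral => //.
  - by apply/measurable_EFinP; exact: meas_sq.
  - rewrite (_ : (fun x => _) = (fun x =>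
        - limn_esup (fun n => - (cabs (w n x) ^+ 2)%:E))%E).
      apply: mfun_comp => //; apply: measurable_fun_limn_esup => n.
      exact: mfun_comp.
    by apply/funext => x; rewrite (limn_esupN (fun n => (cabs (w n x) ^+ 2)%:E)) oppeK.
  - by move=> x _; rewrite lee_fin sqr_ge0.
  - by move=> x _; apply: limn_einf_ge => n; rewrite lee_fin sqr_ge0.
  - apply: filterS wh => x wx _; apply/esym.
    have: (cabs (w n x) ^+ 2)%:E @[n --> \oo] --> (cabs (h x) ^+ 2)%:E.
      by apply/cvg_EFin; [exact: nearW|].
    by move=> /cvg_limn_einf_sup[].
apply: le_trans (@fatou _ _ _ mu setT measurableT _ mw2 _) _.
  by move=> n x _; rewrite lee_fin sqr_ge0.
exact: limn_einf_le.
Qed.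

(** Riesz-Fischer: a subsequence with geometric increments converges almost everywhere, and Fatou's
    lemma upgrades this to norm convergence of the whole sequence. *)
Lemma sqL_complete u : (forall n, sqL mu (u n)) ->
  (forall e : R, 0 < e -> exists N, forall m n, (N <= m)%N -> (N <= n)%N ->
    nr mu (fun x => u m x - u n x) <= e) ->
  exists2 f, sqL mu f & cvg2 mu u f.
Proof.
move=> Lu uC.
have [p pP] : exists p : nat -> nat, forall n, forall k l, (p n <= k)%N ->
    (p n <= l)%N -> nr mu (fun x => u k x - u l x) <= 4^-1 ^+ n.
  suff /boolp.choice[p pP] : forall n, exists p, forall k l, (p <= k)%N ->
      (p <= l)%N -> nr mu (fun x => u k x - u l x) <= 4^-1 ^+ n by exists p.
  move=> n; have e0 : 0 < (4^-1 : R) ^+ n by rewrite exprn_gt0// invr_gt0.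
  by have [N NP] := uC _ e0; exists N.
(* [q] is increasing and dominates both [p] and the identity, so [u \o q] is a subsequence whose
   increments obey the bound attached to [p]. *)
pose q := fix q n := if n is m.+1 then maxn (p n) (q m).+1 else p 0%N.
have pq n : (p n <= q n)%N by case: n => [|n] //=; exact: leq_maxl.
have qS n : (q n <= q n.+1)%N by rewrite /= ltnW// leq_maxr.
have nq n : (n <= q n)%N.
  by elim: n => [|n IH] //=; rewrite (leq_trans _ (leq_maxr _ _)).
have qm : {homo q : m n / (m <= n)%N}.
  by apply: homo_leq => //; exact: leq_trans.
have [N [mN N0 NP]] : exists N : set T, [/\ measurable N, mu N = 0 &
    forall x, ~ N x -> cvgn (fun n => Re (u (q n) x)) /\
      cvgn (fun n => Im (u (q n) x))].
  apply: (@sqL_fast_cvg_ae (fun n => u (q n))) => // n.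
  by apply: pP; rewrite ?pq// (leq_trans (pq n) (qS n)).
(* Multiplication by this indicator makes the limits exist at every point, from which measurability
   of the limit function follows. *)
pose h (x : T) : R := \1_(~` N) x.
have mh : mfun h by apply: measurable_indic; exact: measurableC.
have cR x : cvgn (fun n => h x * Re (u (q n) x)).
  have [Nx|Nx] := pselect (N x).
    rewrite (_ : (fun n => _) = cst 0); first exact: is_cvg_cst.
    by apply/funext => n; rewrite /h indicE memNset ?mul0r//= => /(_ Nx).
  by apply: is_cvgMr; exact: (NP _ Nx).1.
have cI x : cvgn (fun n => h x * Im (u (q n) x)).
  have [Nx|Nx] := pselect (N x).
    rewrite (_ : (fun n => _) = cst 0); first exact: is_cvg_cst.
    by apply/funext => n; rewrite /h indicE memNset ?mul0r//= => /(_ Nx).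
  by apply: is_cvgMr; exact: (NP _ Nx).2.
pose f x : R[i] := (limn (fun n => h x * Re (u (q n) x)) +i*
  limn (fun n => h x * Im (u (q n) x)))%C.
have mf : cmeas f.
  split; rewrite /f /=.
    apply: (@measurable_fun_cvg _ _ _ _ (fun n x => h x * Re (u (q n) x))).
      by move=> n; apply: mfun_prod => //; exact: (Lu (q n)).1.1.
    by move=> x _; exact: cR.
  apply: (@measurable_fun_cvg _ _ _ _ (fun n x => h x * Im (u (q n) x))).
    by move=> n; apply: mfun_prod => //; exact: (Lu (q n)).1.2.
  by move=> x _; exact: cI.
have uqf : {ae mu, forall x, forall z, cabs (z - u (q n) x) ^+ 2 @[n --> \oo] -->
    cabs (z - f x) ^+ 2}.
  exists N; split=> // x /= H; apply: contrapT => Nx; apply: H.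
  have h1 : h x = 1 by rewrite /h indicE mem_set.
  have hE (w : nat -> R) : (fun n => h x * w n) = w.
    by apply/funext => n; rewrite h1 mul1r.
  by apply: cvg_cabs_sub; rewrite /f /= hE; [have := cR x|have := cI x]; rewrite hE.
have key (e : R) : 0 < e -> exists N, forall n, (N <= n)%N ->
    (sqn mu (fun x => (u n x - f x)%R) <= e%:E)%E.
  move=> e0; have [M MP] := uC _ e0; exists M => n Mn.
  (* The shift by [M] puts every term of the sequence in the range of the Cauchy bound. *)
  apply: (@fatou_nr (fun k x => u n x - u (q (k + M)%N) x)).
  - by move=> k; exact: cmeasB (Lu _).1 (Lu _).1.
  - exact: cmeasB (Lu _).1 mf.
  - move=> k; rewrite sqnE ?lee_fin; last exact: sqLB.
    by apply: MP => //; apply: leq_trans (leq_addl k M) (nq _).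
  - apply: filterS uqf => x /(_ (u n x)) H.
    by rewrite (cvg_shiftn M (fun k => cabs (u n x - u (q k) x) ^+ 2)).
have [M MP] := key 1 ltr01.
have Lf : sqL mu f.
  have LB : sqL mu (fun x => u M x - f x).
    split; first exact: cmeasB (Lu M).1 mf.
    by apply: le_lt_trans (MP M (leqnn M)) _; rewrite ltry.
  rewrite (_ : f = fun x => u M x - (u M x - f x)); first exact: sqLB.
  by apply/funext => x; rewrite opprB addrC subrK.
exists f => // e e0; have [N' NP'] := key e e0; exists N' => n nN.
by apply: sqn_le; exact: NP'.
Qed.

End Completeness.

(** * Absolute values and Borel measurability of the field operations *)

Section ValuedFieldBasics.
Context {R : realType} {K : valuedFieldType R}.
Implicit Types x y z : K.
Notation a := (@absv R K).

Lemma absv0 : a 0 = 0. Proof. by apply/eqP; rewrite absv_eq0. Qed.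

Lemma absv_gt0 x : (0 < a x) = (x != 0).
Proof. by rewrite lt0r absv_eq0 absv_ge0 andbT. Qed.

Lemma absv1 : a 1 = 1.
Proof.
have a1 : a 1 != 0 by rewrite absv_eq0 oner_eq0.
by apply: (mulfI a1); rewrite -absvM !mulr1.
Qed.

Lemma absvX x n : a (x ^+ n) = a x ^+ n.
Proof. by elim: n => [|n IH]; rewrite ?expr0 ?absv1// !exprS absvM IH. Qed.

Lemma absvN1 : a (- 1) = 1.
Proof.
have : a (-1) ^+ 2 == 1 by rewrite -absvX sqrrN expr1n absv1.
rewrite sqrf_eq1 => /orP[/eqP //|/eqP h].
by have := absv_ge0 (-1 : K); rewrite h ler0N1.
Qed.

Lemma absvN x : a (- x) = a x.
Proof. by rewrite -mulN1r absvM absvN1 mul1r. Qed.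

Lemma absv_distC x y : a (x - y) = a (y - x).
Proof. by rewrite -absvN opprB. Qed.

Lemma absvV x : a x^-1 = (a x)^-1.
Proof.
have [->|x0] := eqVneq x 0; first by rewrite invr0 absv0 invr0.
have ax : a x != 0 by rewrite absv_eq0.
by apply: (mulfI ax); rewrite -absvM !divff// absv1.
Qed.

Lemma absv_div x y : a (x / y) = a x / a y.
Proof. by rewrite absvM absvV. Qed.

Lemma absvB x y : a (x - y) <= a x + a y.
Proof. by rewrite -(absvN y) absvD. Qed.

Lemma absv_dist_trans y x z : a (x - z) <= a (x - y) + a (y - z).
Proof. by rewrite (le_trans _ (absvD _ _))// addrA subrK. Qed.

Lemma absv_dist_ge x y : `|a x - a y| <= a (x - y).
Proof.
rewrite ler_norml; have := absvD (x - y) y; have := absvD (y - x) x.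
by rewrite !subrK (absv_distC y x) => *; lra.
Qed.

Lemma absv_sum (I : Type) (r : seq I) (P : pred I) (F : I -> K) :
  a (\sum_(i <- r | P i) F i) <= \sum_(i <- r | P i) a (F i).
Proof.
elim/big_ind2: _ => [|x1 x2 y1 y2 h1 h2|//]; first by rewrite absv0.
by rewrite (le_trans (absvD _ _))// lerD.
Qed.

Lemma nbhsE x (A : set K) :
  nbhs x A <-> exists2 e : R, 0 < e & forall y, a (x - y) < e -> A y.
Proof. by rewrite nbhs_absv; split=> -[e e0 H]; exists e. Qed.

Lemma openE' (A : set K) :
  open A <-> forall x, A x -> exists2 e : R, 0 < e & forall y, a (x - y) < e -> A y.
Proof.
by rewrite openE; split=> H x /H; [move=> /nbhsE|move=> ?; apply/nbhsE].
Qed.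

Lemma nbhs_ball_absv x (e : R) : 0 < e -> nbhs x [set y | a (x - y) < e].
Proof. by move=> e0; apply/nbhsE; exists e. Qed.

Lemma open_ball_absv x (e : R) : open [set y | a (x - y) < e].
Proof.
apply/openE' => y /= xy; exists (e - a (x - y)); first by rewrite subr_gt0.
move=> z yz; apply: le_lt_trans (absv_dist_trans y _ _) _; lra.
Qed.

Lemma cvgn_absvP (u : nat -> K) (l : K) : u n @[n --> \oo] --> l <->
  forall e : R, 0 < e -> exists N, forall n, (N <= n)%N -> a (l - u n) < e.
Proof.
split=> [ul e e0|H A /nbhsE[e e0 eA]].
  by have [N _ NP] := ul _ (nbhs_ball_absv l e0); exists N => n; exact: NP.
by have [N NP] := H e e0; exists N => // n /= /NP /eA.
Qed.

Lemma continuous_absvP (V : topologicalType) (g : K -> V) :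
  continuous g <-> forall x (A : set V), nbhs (g x) A ->
    exists2 e : R, 0 < e & forall y, a (x - y) < e -> A (g y).
Proof.
split=> gc x A.
  by move=> /(gc x) /nbhsE.
by move=> /gc[e e0 eP]; apply/nbhsE; exists e.
Qed.

Lemma continuous_realP (g : K -> R) : continuous g <-> forall x (e : R), 0 < e ->
    exists2 r : R, 0 < r & forall y, a (x - y) < r -> `|g x - g y| < e.
Proof.
rewrite continuous_absvP; split=> gc x.
  move=> e e0; apply: (gc x [set t | `|g x - t| < e]).
  by apply/nbhs_ballP; exists e.
move=> A /nbhs_ballP[e /= e0 eA]; have [r r0 rP] := gc x e e0.
by exists r => // y xy; apply: eA; exact: rP.
Qed.

Lemma continuous_absv : continuous a.
Proof.
apply/continuous_realP => x e e0; exists e => // y xy.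
exact: le_lt_trans (absv_dist_ge x y) xy.
Qed.

Lemma closure_absvP (A : set K) x :
  closure A x <-> forall e : R, 0 < e -> exists2 y, A y & a (x - y) < e.
Proof.
split=> [cA e e0|H B /nbhsE[e e0 eB]].
  by have [y [Ay xy]] := cA _ (nbhs_ball_absv x e0); exists y.
by have [y Ay xy] := H e e0; exists y; split=> //; exact: eB.
Qed.

End ValuedFieldBasics.

Section BorelMeasurability.
Context {R : realType} {K : valuedFieldType R}.
Implicit Types x y z : K.
Notation a := (@absv R K).

Lemma borel_open (A : set (borel K)) : @open K A -> measurable A.
Proof. by move=> oA; exact: sub_sigma_algebra. Qed.

Lemma borel_measurable_fun d (T : measurableType d) (f : T -> borel K) :
  (forall U : set K, open U -> measurable (f @^-1` U)) -> mfun f.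
Proof.
move=> fU; apply: (@measurability _ _ _ (borel K) _ _ (@open K : set (set (borel K)))) => //.
by move=> _ [U oU <-]; rewrite setTI; exact: fU.
Qed.

Lemma mfun_set1_borel (x : borel K) : measurable [set x].
Proof.
rewrite -(setCK [set x]); apply: measurableC; apply: borel_open.
apply/openE' => y /= /eqP xy; exists (a (y - x)).
  by rewrite absv_gt0 subr_eq0.
by move=> z /[swap] ->; rewrite ltxx.
Qed.

Lemma continuous_borel_real (g : K -> R) : continuous g ->
  measurable_fun [set: borel K] (g : borel K -> R).
Proof.
move=> gc; apply: (measurability (@RGenOInfty.G R)).
  exact: RGenOInfty.measurableE.
move=> _ [_ [x ->] <-]; rewrite setTI; apply: borel_open.
apply: open_comp => [y _|]; first exact: gc.
by have := @interval_open R (BRight x) (BInfty _ false) isT isT.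
Qed.

Variable q : nat -> K.
Hypothesis q_dense : forall x (e : R), 0 < e -> exists n, a (x - q n) < e.

(** The product sigma-algebra is generated by rectangles. The dense sequence [q] writes an open set
    of pairs as a countable union of products of balls; this is what makes addition and
    multiplication jointly measurable. *)
Lemma borel_prod_open (S : set (borel K * borel K)) :
  (forall x y, S (x, y) -> exists2 e : R, 0 < e & forall x' y',
    a (x - x') < e -> a (y - y') < e -> S (x', y')) -> measurable S.
Proof.
move=> So.
pose B (t : nat * nat * nat) : set (borel K * borel K) :=
  [set x | a (q t.1.1 - x) < t.2.+1%:R^-1] `*`
  [set y | a (q t.1.2 - y) < t.2.+1%:R^-1].
have mB t : measurable (B t).
  by apply: measurableX; apply: borel_open; exact: open_ball_absv.
pose D := [set t : nat * nat * nat | B t `<=` S].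
suff -> : S = \bigcup_(t in D) B t.
  rewrite bigcup_mkcond; apply: countable_bigcupT_measurable => [|t].
    exact: countableP.
  by case: ifP => _; [exact: mB|exact: measurable0].
apply/seteqP; split=> [[x y] Sxy|xy [t Dt Bt]]; last exact: Dt.
have [e e0 eP] := So _ _ Sxy.
have e2 : 0 < e / 2 by lra.
have [N _ Ne] := near_infty_natSinv_lt (PosNum e2).
have /= NN := Ne N (leqnn N).
have N0 : 0 < (N.+1%:R^-1 : R) by rewrite invr_gt0.
have [i iP] := q_dense x N0; have [j jP] := q_dense y N0.
exists (i, j, N) => /=; last by split; rewrite /= absv_distC.
move=> [x' y'] [/= h1 h2]; apply: eP.
  apply: le_lt_trans (absv_dist_trans (q i) x x') _; rewrite [ltRHS]splitr.
  by apply: ltrD; [exact: lt_trans iP NN|exact: lt_trans h1 NN].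
apply: le_lt_trans (absv_dist_trans (q j) y y') _; rewrite [ltRHS]splitr.
by apply: ltrD; [exact: lt_trans jP NN|exact: lt_trans h2 NN].
Qed.

Lemma mfun_add_borel :
  mfun (fun z : borel K * borel K => (z.1 + z.2 : K) : borel K).
Proof.
apply: borel_measurable_fun => U /openE' oU; apply: borel_prod_open => x y /= /oU.
move=> [e e0 eP]; exists (e / 2); first lra.
move=> x' y' h1 h2; apply: eP; rewrite opprD addrACA.
by apply: le_lt_trans (absvD _ _) _; lra.
Qed.

Lemma mfun_mul_borel :
  mfun (fun z : borel K * borel K => (z.1 * z.2 : K) : borel K).
Proof.
apply: borel_measurable_fun => U /openE' oU; apply: borel_prod_open => x y /= /oU.
move=> [e e0 eP].
pose M := a x + a y + 1; have M0 : 0 < M.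
  by have := absv_ge0 x; have := absv_ge0 y; rewrite /M; lra.
pose r := Num.min 1 (e / (2 * M)); have r0 : 0 < r.
  by rewrite lt_min ltr01 divr_gt0// mulr_gt0.
exists r => // x' y' h1 h2; apply: eP.
have -> : x * y - x' * y' = x * (y - y') + (x - x') * y' by ring.
apply: le_lt_trans (absvD _ _) _; rewrite !absvM.
have [r1 r2] : r <= 1 /\ r <= e / (2 * M) by rewrite !ge_min !lexx orbT.
have y'b : a y' <= a y + 1.
  by rewrite -[y'](subrK y); apply: le_trans (absvD _ _) _; rewrite absv_distC; lra.
move: r2; rewrite ler_pdivlMr ?mulr_gt0// => r2.
have := absv_ge0 x; have := absv_ge0 y; have := absv_ge0 y'.
have := absv_ge0 (x - x'); have := absv_ge0 (y - y').
rewrite /M in r2 *; nra.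
Qed.

Lemma mfun_inv_borel :
  mfun (fun z : borel K => (z^-1 : K) : borel K).
Proof.
apply: borel_measurable_fun => U /openE' oU.
pose V := [set z : K | z != 0 /\ U z^-1].
have oV : open V.
  apply/openE' => x [x0 Ux]; have [e e0 eP] := oU _ Ux.
  have ax : 0 < a x by rewrite absv_gt0.
  pose r := Num.min (a x / 2) (e * a x ^+ 2 / 2); have r0 : 0 < r.
    by rewrite lt_min !divr_gt0// mulr_gt0// exprn_gt0.
  exists r => // y xy.
  have [r1 r2] : r <= a x / 2 /\ r <= e * a x ^+ 2 / 2 by rewrite !ge_min !lexx orbT.
  have ay : a x / 2 < a y.
    by have := absvD (x - y) y; rewrite subrK; lra.
  have y0 : y != 0 by rewrite -absv_gt0; lra.
  split=> //; apply: eP.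
  have -> : x^-1 - y^-1 = - ((x - y) / (x * y)) by field; rewrite ?x0 ?y0.
  rewrite absvN absv_div absvM ltr_pdivrMr ?mulr_gt0//; last by rewrite absv_gt0.
  have : e * (a x * (a x / 2)) < e * (a x * a y) by rewrite !ltr_pM2l.
  by rewrite expr2 in r2; lra.
(* Since [0^-1 = 0], the preimage of [U] is the open set [V], together with the point 0 exactly when
   [U 0]. *)
have [U0|U0] := pselect (U 0).
  rewrite (_ : _ @^-1` _ = V `|` [set 0]).
    apply: measurableU; [exact: borel_open|exact: mfun_set1_borel].
  apply/seteqP; split=> z /=.
    by have [->|z0 Uz] := eqVneq z 0; [right|left].
  by move=> [[]//|->]; rewrite invr0.
rewrite (_ : _ @^-1` _ = V); first exact: borel_open.
apply/seteqP; split=> z /=; last by case.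
by have [->|z0 Uz] := eqVneq z 0; [rewrite invr0|split].
Qed.

End BorelMeasurability.

(** * Finite-dimensional spans over the closure of the rationals *)

Section PrimeSpan.
Context {R : realType} {K : valuedFieldType R}.
Implicit Types (x y z : K) (c e : nat -> K).
Notation a := (@absv R K).
Notation P := (@prime_completion R K).

Hypothesis complete : forall u : nat -> K,
    (forall e : R, 0 < e -> exists N : nat, forall m n : nat,
      (N <= m)%N -> (N <= n)%N -> a (u m - u n) < e) ->
    exists l, forall e : R, 0 < e -> exists N, forall n, (N <= n)%N ->
      a (l - u n) < e.
(** Over an arbitrary field [ratr] need not be a morphism, as positive characteristic shows; for a
    completion these laws come from the embedding of the number field. *)
Hypothesis ratrD : {morph (ratr : rat -> K) : x y / x + y}.
Hypothesis ratrM : {morph (ratr : rat -> K) : x y / x * y}.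
Hypothesis ratrV : {morph (ratr : rat -> K) : x / x^-1}.

Lemma primeP x : P x <-> forall e : R, 0 < e -> exists q : rat, a (x - ratr q) < e.
Proof.
rewrite /prime_completion closure_absvP; split=> H e e0.
  by have [_ [q _ <-] h] := H e e0; exists q.
by have [q h] := H e e0; exists (ratr q) => //; exists q.
Qed.

Lemma prime_ratr q : P (ratr q).
Proof.
apply/primeP => e e0; exists q.
by rewrite subrr absv0.
Qed.

Lemma prime_closed x : (forall e : R, 0 < e -> exists2 y, P y & a (x - y) < e) -> P x.
Proof.
move=> H; apply/primeP => e e0; have e2 : 0 < e / 2 by lra.
have [y /primeP/(_ _ e2)[q yq] xy] := H _ e2; exists q.
by apply: le_lt_trans (absv_dist_trans y _ _) _; lra.
Qed.

Lemma primeD x y : P x -> P y -> P (x + y).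
Proof.
move=> /primeP Px /primeP Py; apply/primeP => e e0; have e2 : 0 < e / 2 by lra.
have [q xq] := Px _ e2; have [r yr] := Py _ e2; exists (q + r).
by rewrite ratrD opprD addrACA; apply: le_lt_trans (absvD _ _) _; lra.
Qed.

Lemma prime_scale q y : P y -> P (ratr q * y).
Proof.
move=> /primeP Py; apply/primeP => e e0.
have d0 : 0 < e / (a (ratr q : K) + 1) by rewrite divr_gt0// ltr_wpDl ?absv_ge0.
have [r yr] := Py _ d0; exists (q * r); rewrite ratrM -mulrBr absvM.
rewrite ltr_pdivlMr ?ltr_wpDl ?absv_ge0// in yr.
apply: le_lt_trans yr; rewrite mulrC ler_wpM2l ?absv_ge0//; lra.
Qed.

Lemma primeM x y : P x -> P y -> P (x * y).
Proof.
move=> /primeP Px Py; apply: prime_closed => e e0.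
have d0 : 0 < e / (a y + 1) by rewrite divr_gt0// ltr_wpDl ?absv_ge0.
have [r xr] := Px _ d0; exists (ratr r * y); first exact: prime_scale.
rewrite -mulrBl absvM; rewrite ltr_pdivlMr ?ltr_wpDl ?absv_ge0// in xr.
by apply: le_lt_trans xr; rewrite ler_wpM2l ?absv_ge0//; lra.
Qed.

Lemma prime0 : P 0.
Proof.
by have := @prime_ratr 0; rewrite /ratr mul0r.
Qed.

Lemma primeN x : P x -> P (- x).
Proof.
have rN : ratr (-1) = -1 :> K by rewrite /ratr rmorphN1 divr1.
by move=> Px; have := @prime_scale (-1) x Px; rewrite rN mulN1r.
Qed.

Lemma prime1 : P 1.
Proof. by have := @prime_ratr 1; rewrite /ratr divr1. Qed.

Lemma primeB x y : P x -> P y -> P (x - y).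
Proof. by move=> Px Py; apply: primeD => //; exact: primeN. Qed.

Lemma primeV x : P x -> P x^-1.
Proof.
have [->|x0] := eqVneq x 0; first by rewrite invr0.
have ax : 0 < a x by rewrite absv_gt0.
move=> /primeP Px; apply: prime_closed => e e0.
pose r := Num.min (a x / 2) (e * a x ^+ 2 / 2); have r0 : 0 < r.
  by rewrite lt_min !divr_gt0// mulr_gt0// exprn_gt0.
have [q xq] := Px _ r0; exists (ratr q)^-1; first by rewrite -ratrV; exact: prime_ratr.
set y : K := ratr q in xq *.
have [r1 r2] : r <= a x / 2 /\ r <= e * a x ^+ 2 / 2 by rewrite !ge_min !lexx orbT.
have ay : a x / 2 < a y by have := absvD (x - y) y; rewrite subrK; lra.
have y0 : y != 0 by rewrite -absv_gt0; lra.
have -> : x^-1 - y^-1 = - ((x - y) / (x * y)) by field; rewrite ?x0 ?y0.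
rewrite absvN absv_div absvM ltr_pdivrMr ?mulr_gt0//; last by rewrite absv_gt0.
have : e * (a x * (a x / 2)) < e * (a x * a y) by rewrite !ltr_pM2l.
by rewrite expr2 in r2; lra.
Qed.

Definition pspan n e x := exists2 c : nat -> K, forall i, P (c i) &
  x = \sum_(i < n) c i * e i.
Definition pfree n e := forall c, (forall i, P (c i)) ->
  \sum_(i < n) c i * e i = 0 -> forall i, (i < n)%N -> c i = 0.
(** Equivalence of norms on the span: coordinates depend continuously on the vector. *)
Definition pbounded n e (C : R) := 0 < C /\ forall c, (forall i, P (c i)) ->
  forall i, (i < n)%N -> a (c i) <= C * a (\sum_(i < n) c i * e i).

(** The bound turns a convergent sequence of vectors of the span into Cauchy sequences of
    coordinates; the limits of the latter are coordinates of [x]. *)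
Lemma pspan_closed n e C : pbounded n e C -> forall x,
  (forall r : R, 0 < r -> exists2 y, pspan n e y & a (x - y) < r) -> pspan n e x.
Proof.
move=> [C0 CP] x H.
have /boolp.choice[c cP] : forall k : nat, exists c, (forall i, P (c i)) /\
    a (x - \sum_(i < n) c i * e i) < k.+1%:R^-1.
  move=> k; have [|y [c Pc ->] h] := H k.+1%:R^-1; first by rewrite invr_gt0.
  by exists c.
have small (r : R) : 0 < r -> exists N : nat, forall k, (N <= k)%N ->
    k.+1%:R^-1 < r.
  move=> r0; have [N _ NP] := near_infty_natSinv_lt (PosNum r0).
  by exists N => k /NP.
have cauchy i : (i < n)%N -> exists l, P l /\ forall r : R, 0 < r ->
    exists N, forall k, (N <= k)%N -> a (l - c k i) < r.
  move=> ni; have [|l lP] := complete (u := fun k => c k i).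
    move=> r r0; have d0 : 0 < r / (2 * C) by rewrite divr_gt0// mulr_gt0.
    have [N NP] := small _ d0; exists N => k l Nk Nl.
    apply: le_lt_trans (CP (fun j => c k j - c l j) _ i ni) _.
      by move=> j; apply: primeB; [exact: (cP k).1|exact: (cP l).1].
    have -> : \sum_(i < n) (c k i - c l i) * e i =
        (x - \sum_(i < n) c l i * e i) - (x - \sum_(i < n) c k i * e i).
      under eq_bigr do rewrite mulrBl.
      by rewrite sumrB; ring.
    have h1 := (cP k).2; have h2 := (cP l).2.
    have := NP k Nk; have := NP l Nl; rewrite !ltr_pdivlMr ?mulr_gt0// => g1 g2.
    have := absvB (x - \sum_(i < n) c l i * e i) (x - \sum_(i < n) c k i * e i).
    set A := a (_ - _); set u := (k.+1%:R^-1) in h1 g2 *.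
    by set v := (l.+1%:R^-1) in h2 g1 *; nra.
  exists l; split=> //; apply: prime_closed => r r0.
  by have [N NP] := lP r r0; exists (c N i); [exact: (cP N).1|exact: NP].
have /boolp.choice[l lP] : forall i, exists l, P l /\ ((i < n)%N ->
    forall r : R, 0 < r -> exists N, forall k, (N <= k)%N -> a (l - c k i) < r).
  move=> i; have [/cauchy[l [Pl h]]|ni] := boolP (i < n)%N; first by exists l.
  by exists 0; split=> //; exact: prime0.
exists l; first by move=> i; exact: (lP i).1.
apply/eqP; rewrite -subr_eq0 -absv_eq0 eq_le absv_ge0 andbT.
apply/ler_addgt0Pl => r r0; rewrite addr0.
pose E := \sum_(i < n) a (e i) + 1; have E0 : 0 < E.
  by rewrite ltr_wpDl// sumr_ge0// => i _; exact: absv_ge0.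
have d0 : 0 < r / (2 * E) by rewrite divr_gt0// mulr_gt0.
have [M MP] : exists M, forall k, (M <= k)%N -> forall i, (i < n)%N ->
    a (l i - c k i) < r / (2 * E).
  suff: forall m, (m <= n)%N -> exists M, forall k, (M <= k)%N ->
      forall i, (i < m)%N -> a (l i - c k i) < r / (2 * E) by apply.
  elim=> [|m IH] mn; first by exists 0%N.
  have [M MP] := IH (ltnW mn); have [N NP] := (lP m).2 mn _ d0.
  exists (maxn M N) => k; rewrite geq_max => /andP[Mk Nk] i.
  by rewrite ltnS leq_eqVlt => /orP[/eqP ->|im]; [exact: NP|exact: MP].
have [N NP] := small (r / 2) (divr_gt0 r0 (ltr0n _ 2)).
pose k := maxn M N; have h1 := (cP k).2; have h2 := NP k (leq_maxr _ _).
apply: le_trans (absv_dist_trans (\sum_(i < n) c k i * e i) _ _) _.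
rewrite -sumrB.
have h3 : a (\sum_(i < n) (c k i * e i - l i * e i)) <= r / (2 * E) * (E - 1).
  apply: le_trans (absv_sum _ _ _) _; rewrite addrK mulr_sumr ler_sum// => i _.
  rewrite -mulrBl absvM ler_wpM2r ?absv_ge0// absv_distC ltW//.
  by apply: MP => //; exact: leq_maxl.
have : r / (2 * E) * (E - 1) <= r / 2.
  have -> : r / 2 = r / (2 * E) * E by field; exact: lt0r_neq0.
  by rewrite ler_pM2l//; lra.
move=> h4; rewrite [leRHS]splitr; apply: lerD; first exact: ltW (lt_trans h1 h2).
exact: le_trans h3 h4.
Qed.

(** By induction the span of the first [n] vectors is closed, so the next vector stays at some
    distance [d > 0] from it, and this controls the last coefficient. *)
Lemma pbounded_of_pfree n e : pfree n e -> exists C, pbounded n e C.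
Proof.
elim: n => [|n IH] fe; first by exists 1; split.
have fn : pfree n e.
  move=> c Pc s0 i ni.
  have := fe (fun j => if (j < n)%N then c j else 0).
  have Pc' j : P (if (j < n)%N then c j else 0) by case: ifP => _ //; exact: prime0.
  rewrite big_ord_recr /= ltnn mul0r addr0.
  under eq_bigr do rewrite ltn_ord.
  by move=> /(_ Pc' s0 i (leqW ni)); rewrite ni.
have [C Cb] := IH fn; have [C0 CP] := Cb.
have [d d0 dP] : exists2 d : R, 0 < d & forall y, pspan n e y -> d <= a (y + e n).
  apply: contrapT => H; have : pspan n e (- e n).
    apply: (pspan_closed Cb) => r r0; apply: contrapT => H2; apply: H.
    exists r => // y sy; rewrite leNgt; apply/negP => yr; apply: H2.
    by exists y => //; rewrite -opprD absvN addrC.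
  move=> [c Pc ce].
  have := fe (fun j => if (j < n)%N then c j else 1).
  have Pc' j : P (if (j < n)%N then c j else 1) by case: ifP => _ //; exact: prime1.
  rewrite big_ord_recr /= ltnn mul1r.
  under eq_bigr do rewrite ltn_ord.
  rewrite -ce addNr => /(_ Pc' erefl n (ltnSn n)); rewrite ltnn => /eqP.
  by rewrite oner_eq0.
(* [d^-1] bounds the last coefficient. Removing the last term changes the vector by at most
   [a (e n) / d] times its size, and [C] bounds the coefficients of what remains. *)
exists (d^-1 + C * (1 + a (e n) / d)).
have dV : 0 < d^-1 by rewrite invr_gt0.
have en0 := absv_ge0 (e n).
have B0 : 0 < C * (1 + a (e n) / d).
  by rewrite mulr_gt0// ltr_pwDl// divr_ge0// ltW.
split; first by rewrite addr_gt0.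
move=> c Pc; rewrite big_ord_recr /=; set S := \sum_(i < n) _.
have cn : a (c n) <= d^-1 * a (S + c n * e n).
  have [->|cn0] := eqVneq (c n) 0.
    rewrite absv0; apply: mulr_ge0; [exact: ltW|exact: absv_ge0].
  have -> : S + c n * e n = c n * (S / c n + e n) by field.
  rewrite absvM mulrCA ler_peMr ?absv_ge0// mulrC ler_pdivlMr// mul1r; apply: dP.
  exists (fun i => c i / c n); first by move=> i; apply: primeM => //; exact: primeV.
  by rewrite /S mulr_suml; apply: eq_bigr => i _; rewrite mulrAC.
have x0 := absv_ge0 (S + c n * e n); set x := a (_ + _) in cn x0 *.
move=> i; rewrite ltnS leq_eqVlt => /orP[/eqP ->|ni].
  by apply: le_trans cn _; rewrite ler_wpM2r// lerDl ltW.
apply: le_trans (CP c Pc i ni) _; rewrite -/S.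
have Sx : a S <= x + a (c n) * a (e n).
  by rewrite -absvM -{1}[S](addrK (c n * e n)); exact: absvB.
apply: le_trans (_ : C * (x + d^-1 * x * a (e n)) <= _).
  apply: ler_wpM2l; first exact: ltW.
  by apply: le_trans Sx _; rewrite lerD2l ler_wpM2r.
rewrite mulrDl; apply: (@le_trans _ _ (C * (1 + a (e n) / d) * x)).
  by rewrite le_eqVlt; apply/orP; left; apply/eqP; field; exact: lt0r_neq0.
by rewrite lerDr mulr_ge0// ltW.
Qed.

(** A basis of the number field over the rationals may become dependent over their closure in the
    completion, so a free family has to be extracted from it. *)
Lemma pfree_subfamily n e : exists m, exists e', pfree m e' /\
  forall x, pspan n e x -> pspan m e' x.
Proof.
elim: n => [|n [m [e' [fm sm]]]].
  exists 0%N, e; split=> [c _ _ i|x //].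
  by rewrite ltn0.
have spanD x y : pspan m e' x -> pspan m e' y -> pspan m e' (x + y).
  move=> [c Pc ->] [c' Pc' ->]; exists (fun i => c i + c' i).
    by move=> i; exact: primeD.
  by rewrite -big_split; apply: eq_bigr => i _; rewrite mulrDl.
have spanZ k x : P k -> pspan m e' x -> pspan m e' (k * x).
  move=> Pk [c Pc ->]; exists (fun i => k * c i).
    by move=> i; exact: primeM.
  by rewrite mulr_sumr; apply: eq_bigr => i _; rewrite mulrA.
have [sn|sn] := pselect (pspan m e' (e n)).
  exists m, e'; split=> // x [c Pc ->]; rewrite big_ord_recr /=; apply: spanD.
    by apply: sm; exists c.
  exact: spanZ.
exists m.+1, (fun i => if (i < m)%N then e' i else e n).
have sumE c : \sum_(i < m.+1) c i * (if (i < m)%N then e' i else e n) =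
    \sum_(i < m) c i * e' i + c m * e n.
  rewrite big_ord_recr /= ltnn; congr (_ + _).
  by apply: eq_bigr => i _; rewrite ltn_ord.
split.
  move=> c Pc; rewrite sumE => s0.
  have cm : c m = 0.
    apply/eqP; apply: contrapT => /negP cm; apply: sn.
    have -> : e n = (- (c m)^-1) * \sum_(i < m) c i * e' i.
      move/eqP: s0; rewrite addr_eq0 => /eqP ->.
      by rewrite mulrNN mulrA mulVf ?mul1r.
    by apply: spanZ; [apply/primeN/primeV|exists c].
  move: s0; rewrite cm mul0r addr0 => s0 i.
  by rewrite ltnS leq_eqVlt => /orP[/eqP ->//|]; exact: fm.
move=> x [c Pc ->]; rewrite big_ord_recr /=.
have [c' Pc' c'E] : pspan m e' (\sum_(i < n) c i * e i) by apply: sm; exists c.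
exists (fun i => if (i < m)%N then c' i else c n).
  by move=> i; case: ifP.
rewrite (sumE (fun i => if (i < m)%N then c' i else c n)) ltnn c'E.
congr (_ + _).
by apply: eq_bigr => i _; rewrite ltn_ord.
Qed.

End PrimeSpan.

(** * Total boundedness and compactness *)

Section Compactness.
Context {R : realType} {K : valuedFieldType R}.
Implicit Types (x y z : K).
Notation a := (@absv R K).

Definition tbounded (A : set K) := forall r : R, 0 < r ->
  exists s : seq K, forall x, A x -> exists2 y, y \in s & a (x - y) < r.

Lemma tboundedS (A B : set K) : A `<=` B -> tbounded B -> tbounded A.
Proof. by move=> AB tB r r0; have [s sP] := tB r r0; exists s => x /AB/sP. Qed.

Lemma tboundedD (A B : set K) : tbounded A -> tbounded B ->
  tbounded [set z | exists x y, [/\ A x, B y & z = x + y]].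
Proof.
move=> tA tB r r0; have r2 : 0 < r / 2 by lra.
have [s sP] := tA _ r2; have [t tP] := tB _ r2.
exists [seq x + y | x <- s, y <- t] => _ [x [y [/sP[x' sx xx] /tP[y' ty yy] ->]]].
exists (x' + y'); first exact: allpairs_f.
by rewrite opprD addrACA; apply: le_lt_trans (absvD _ _) _; lra.
Qed.

Lemma tboundedZ (A : set K) z : tbounded A -> tbounded [set x * z | x in A].
Proof.
move=> tA r r0.
have d0 : 0 < r / (a z + 1) by rewrite divr_gt0// ltr_wpDl ?absv_ge0.
have [s sP] := tA _ d0; exists [seq x * z | x <- s] => _ [x /sP[y sy xy] <-].
exists (y * z); first exact: map_f.
rewrite -mulrBl absvM; rewrite ltr_pdivlMr ?ltr_wpDl ?absv_ge0// in xy.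
by apply: le_lt_trans xy; rewrite ler_wpM2l ?absv_ge0//; lra.
Qed.

Lemma tbounded_sum n (A : set K) (e : nat -> K) : tbounded A ->
  tbounded [set x | exists2 c : nat -> K, forall i, (i < n)%N -> A (c i) &
    x = \sum_(i < n) c i * e i].
Proof.
move=> tA; elim: n => [|n IH].
  move=> r r0; exists [:: 0] => x [c _ ->]; exists 0; first exact: mem_head.
  by rewrite big_ord0 subrr absv0.
apply: tboundedS (tboundedD IH (tboundedZ (e n) tA)) => x [c Ac ->].
rewrite big_ord_recr /=; exists (\sum_(i < n) c i * e i), (c n * e n); split=> //.
  by exists c => // i ni; apply: Ac; exact: leqW.
by exists (c n) => //; exact: Ac.
Qed.

Hypothesis complete : forall u : nat -> K,
    (forall e : R, 0 < e -> exists N : nat, forall m n : nat,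
      (N <= m)%N -> (N <= n)%N -> a (u m - u n) < e) ->
    exists l, forall e : R, 0 < e -> exists N, forall n, (N <= n)%N ->
      a (l - u n) < e.

Lemma ultra_seq (U : set_system K) (s : seq K) (p : K -> set K) :
  UltraFilter U -> U [set x | exists2 y, y \in s & p y x] ->
  exists2 y, y \in s & U (p y).
Proof.
move=> UU; elim: s => [|y s IH] Us.
  have : U set0 by apply: filterS Us => x [].
  by move=> /filter_not_empty.
have [Uy|UCy] := in_ultra_setVsetC (p y) UU; first by exists y; rewrite ?mem_head.
have [|z zs Uz] := IH; last by exists z; rewrite // inE zs orbT.
apply: filterS2 Us UCy => x [z]; rewrite inE => /orP[/eqP -> //|zs pz _].
by exists z.
Qed.

(** An ultrafilter on a totally bounded set contains a ball of every radius [n.+1%:R^-1]. Two such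
    balls meet, so their centres form a Cauchy sequence, to whose limit the ultrafilter
    converges. *)
Lemma tbounded_compact (A : set K) : closed A -> tbounded A -> compact A.
Proof.
move=> cA tA; rewrite compact_ultra => U UU UA.
have /boolp.choice[c cP] : forall n : nat, exists y, U [set x | a (x - y) < n.+1%:R^-1].
  move=> n; have [|s sP] := tA n.+1%:R^-1; first by rewrite invr_gt0.
  have [|y ys Uy] := @ultra_seq U s (fun y => [set x | a (x - y) < n.+1%:R^-1]) UU.
    by apply: filterS UA => x /sP.
  by exists y.
have small (r : R) : 0 < r -> exists N : nat, forall k, (N <= k)%N ->
    k.+1%:R^-1 < r.
  move=> r0; have [N _ NP] := near_infty_natSinv_lt (PosNum r0).
  by exists N => k /NP.
have [l lP] : exists l, forall e : R, 0 < e -> exists N, forall n, (N <= n)%N ->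
      a (l - c n) < e.
  apply: complete => e e0; have e2 : 0 < e / 2 by lra.
  have [N NP] := small _ e2; exists N => m n Nm Nn.
  have [x [h1 h2]] := filter_ex (filterI (cP m) (cP n)).
  apply: le_lt_trans (absv_dist_trans x _ _) _; rewrite [ltRHS]splitr.
  apply: ltrD; last exact: lt_trans h2 (NP n Nn).
  by rewrite absv_distC; exact: lt_trans h1 (NP m Nm).
have Ul : U --> l.
  move=> B /nbhsE[e e0 eB]; have e2 : 0 < e / 2 by lra.
  have [N NP] := small _ e2; have [M MP] := lP _ e2.
  have h1 := MP _ (leq_maxl M N); have h2 := NP _ (leq_maxr M N).
  apply: filterS (cP (maxn M N)) => x /= h3; apply: eB.
  apply: le_lt_trans (absv_dist_trans (c (maxn M N)) _ _) _.
  rewrite [ltRHS]splitr; apply: ltrD => //.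
  by rewrite absv_distC; exact: lt_trans h3 h2.
exists l; split=> //; apply: cA => B /Ul UB.
by have [x [h1 h2]] := filter_ex (filterI UA UB); exists x.
Qed.

End Compactness.

(** * Finite places: residue characteristic, digits and polar parts *)

Section FinitePlace.
Context {R : realType} {K : valuedFieldType R}.
Implicit Types (x y z : K).
Notation a := (@absv R K).
Notation P := (@prime_completion R K).

Hypothesis ultra : forall x y, a (x + y) <= Num.max (a x) (a y).
Hypothesis ratrD : {morph (ratr : rat -> K) : x y / x + y}.
Hypothesis ratrM : {morph (ratr : rat -> K) : x y / x * y}.
Hypothesis ratrN : {morph (ratr : rat -> K) : x / - x}.
Hypothesis char0 : forall n : nat, (n.+1%:R : K) != 0.

Lemma ultra_le x y (r : R) : a x <= r -> a y <= r -> a (x + y) <= r.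
Proof. by move=> xr yr; rewrite (le_trans (ultra _ _))// ge_max xr yr. Qed.

Lemma ultra_lt x y (r : R) : a x < r -> a y < r -> a (x + y) < r.
Proof. by move=> xr yr; rewrite (le_lt_trans (ultra _ _))// gt_max xr yr. Qed.

Lemma ultra_sub_le x y (r : R) : a x <= r -> a y <= r -> a (x - y) <= r.
Proof. by move=> xr yr; apply: ultra_le; rewrite ?absvN. Qed.

Lemma ultra_nat n : a n%:R <= 1.
Proof.
elim: n => [|n IH]; first by rewrite absv0.
by rewrite -addn1 natrD; apply: ultra_le; rewrite ?absv1.
Qed.

Lemma ultra_int (n : int) : a n%:~R <= 1.
Proof. by case: n => n; rewrite ?NegzE ?mulrNz ?absvN; exact: ultra_nat. Qed.

(** Induction by splitting off the least prime factor: either this factor is small or the cofactor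
    is. *)
Lemma small_prime n : (0 < n)%N -> a n%:R < 1 ->
  exists2 p, prime p & a (p%:R : K) < 1.
Proof.
elim: n {-2}n (leqnn n) => [|m IH] n; first by case: n.
move=> nm n0 an.
have n1 : (1 < n)%N.
  by case: n n0 an {nm} => [|[|n]]//; rewrite absv1 ltxx.
have [ap|ap] := ltrP (a (pdiv n)%:R) 1; first by exists (pdiv n); rewrite ?pdiv_prime.
have ndE : n = (n %/ pdiv n * pdiv n)%N by rewrite divnK// pdiv_dvd.
apply: (IH (n %/ pdiv n)%N).
- by rewrite -ltnS; apply: leq_trans nm; rewrite ltn_Pdiv// prime_gt1// pdiv_prime.
- by rewrite divn_gt0 ?pdiv_gt0// pdiv_leq.
- move: an; rewrite {1}ndE natrM absvM; apply: le_lt_trans.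
  by rewrite ler_peMr// absv_ge0.
Qed.

Variable p : nat.
Hypothesis p_prime : prime p.
Hypothesis ap : a (p%:R : K) < 1.

Let p0 : 0 < a (p%:R : K).
Proof.
rewrite absv_gt0; have := prime_gt0 p_prime.
by case: (p) => // n _; exact: char0.
Qed.

(** Bezout writes 1 as [u * m - v * p]; if [m] were small like [p], the ultrametric inequality would
    make 1 small. *)
Lemma coprime_absv1 m : coprime m p -> a m%:R = 1.
Proof.
have [->|m0] := posnP m.
  by rewrite /coprime gcd0n => /eqP p1; move: p_prime; rewrite p1.
move=> mp; apply/eqP; rewrite eq_le ultra_nat /= leNgt; apply/negP => am.
case: (egcdnP p m0) => u v uv _; move: mp; rewrite /coprime => /eqP g1.
have h : a (1 : K) < 1.
  have -> : 1 = u%:R * m%:R - v%:R * p%:R :> K.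
    by rewrite -!natrM uv g1 natrD addrAC subrr add0r.
  apply: ultra_lt; rewrite ?absvN absvM; [apply: le_lt_trans am|apply: le_lt_trans ap].
    by rewrite ler_piMl ?absv_ge0// ultra_nat.
  by rewrite ler_piMl ?absv_ge0// ultra_nat.
by rewrite absv1 ltxx in h.
Qed.

Lemma residue_charE : residue_char K = p.
Proof.
rewrite /residue_char; case: xgetP => [q _ [q_prime aq]|/(_ p)]; last first.
  by case; split.
have [//|qp] := eqVneq q p.
have : coprime q p by rewrite prime_coprime// dvdn_prime2.
by move=> /coprime_absv1 h; rewrite h ltxx in aq.
Qed.

Lemma ratr_den (q : rat) : a (ratr q) <= 1 -> coprime `|denq q|%N p.
Proof.
move=> aq; rewrite coprime_sym prime_coprime//; apply/negP => pd.
have nq : a (numq q)%:~R = 1.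
  have : a `|numq q|%:R = 1.
    apply: coprime_absv1; rewrite coprime_sym prime_coprime//; apply/negP => pn.
    have := coprime_num_den q; rewrite /coprime => /eqP g1.
    have : (p %| gcdn `|numq q| `|denq q|)%N by rewrite dvdn_gcd pn pd.
    by rewrite g1 dvdn1 => /eqP p1; move: p_prime; rewrite p1.
  by case: (numq q) => n //=; rewrite NegzE mulrNz absvN.
have dq : a (denq q)%:~R < 1.
  have -> : a (denq q)%:~R = a `|denq q|%:R.
    by rewrite -{1}(gtz0_abs (denq_gt0 q)).
  move/dvdnP: pd => [k ->]; rewrite natrM absvM; apply: le_lt_trans ap.
  by rewrite ler_piMl ?absv_ge0// ultra_nat.
move: aq; rewrite /ratr absv_div nq div1r leNgt invf_gt1 ?dq//.
rewrite absv_gt0; have := denq_gt0 q; case: (denq q) => [[|n]|n] // _.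
exact: char0.
Qed.

(** The denominator of [q] is prime to [p], hence has an inverse [u] modulo [p ^ M]; the digit [j]
    is the residue of the numerator times [u]. *)
Lemma ratr_digit (q : rat) M : a (ratr q) <= 1 ->
  exists2 j : nat, (j < p ^ M)%N & a (ratr q - j%:R) <= a (p%:R : K) ^+ M.
Proof.
move=> aq; have cd := ratr_den aq.
pose d := `|denq q|%N; have dE : denq q = d :> int by rewrite -(gtz0_abs (denq_gt0 q)).
have d0 : (0 < d)%N by rewrite absz_gt0 denq_eq0.
have ad : a (d%:R : K) = 1 by exact: coprime_absv1.
have cdM : coprime d (p ^ M) by rewrite coprimeXr.
case: (egcdnP (p ^ M) d0) => u v uv _; move: cdM; rewrite /coprime => /eqP g1.
rewrite g1 in uv; have pM : (0 < p ^ M)%N by rewrite expn_gt0 prime_gt0.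
have pM0 : (p ^ M)%N%:Z != 0 by rewrite -lt0n in pM *.
pose n := numq q; pose j := `|((n * u%:Z) %% (p ^ M)%N%:Z)%Z|%N.
have jE : (n * u%:Z)%R = ((n * u%:Z) %/ (p ^ M)%N%:Z)%Z * (p ^ M)%N%:Z + j%:Z.
  by rewrite {1}(divz_eq (n * u%:Z) (p ^ M)%N%:Z) /j gez0_abs// modz_ge0.
exists j.
  by rewrite -ltz_nat /j gez0_abs ?modz_ge0// ltz_pmod.
set k := ((n * u%:Z) %/ (p ^ M)%N%:Z)%Z in jE.
have dK : (d%:R : K) != 0 by rewrite -absv_eq0 ad oner_eq0.
have nE : (n - j%:Z * d%:Z)%R = (k * d%:Z - n * v%:Z) * (p ^ M)%N%:Z.
  have uvZ : u%:Z * d%:Z = v%:Z * (p ^ M)%N%:Z + 1 by rewrite -!PoszM uv PoszD.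
  have -> : j%:Z = n * u%:Z - k * (p ^ M)%N%:Z by rewrite jE addrAC subrr add0r.
  rewrite mulrBl -mulrA uvZ; ring.
have -> : ratr q - j%:R = (n - j%:Z * d%:Z)%:~R / d%:R :> K.
  by rewrite /ratr dE rmorphB rmorphM /= mulrBl mulfK.
rewrite absv_div ad divr1 nE rmorphM absvM /=.
rewrite -[X in _ <= X]mul1r ler_pM ?absv_ge0 ?ultra_int//.
by rewrite -absvX -natrX.
Qed.

Lemma prime_digit x M : P x -> a x <= 1 ->
  exists2 j : nat, (j < p ^ M)%N & a (x - j%:R) <= a (p%:R : K) ^+ M.
Proof.
move=> /primeP Px ax.
have pM0 : 0 < a (p%:R : K) ^+ M by rewrite exprn_gt0.
have [q xq] := Px _ pM0.
have pM1 : a (p%:R : K) ^+ M <= 1 by rewrite exprn_ile1// ltW.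
have aq : a (ratr q : K) <= 1.
  rewrite (_ : ratr q = x - (x - ratr q)); last by rewrite opprB addrC subrK.
  by apply: ultra_sub_le => //; apply: ltW (lt_le_trans xq pM1).
have [j jM jq] := ratr_digit M aq; exists j => //.
rewrite -(subrK (ratr q) x) -addrA; apply: ultra_le => //; exact: ltW.
Qed.

Lemma absv_p_lt (r : R) : 0 < r -> exists N, a (p%:R : K) ^+ N < r.
Proof.
move=> r0; have := @cvg_expr R (a (p%:R : K)).
rewrite ger0_norm ?absv_ge0// => /(_ ap) /cvgrPdist_lt /(_ r r0) [N _ NP].
exists N; have := NP N (leqnn N); rewrite /= sub0r normrN ger0_norm//.
by rewrite exprn_ge0// absv_ge0.
Qed.

Lemma prime_scale_unit x : P x -> exists N, a (p%:R ^+ N * x) <= 1.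
Proof.
move=> Px; have c0 : 0 < (a x + 1)^-1 by rewrite invr_gt0 ltr_wpDl ?absv_ge0.
have [N] := absv_p_lt c0; exists N; rewrite absvM absvX.
have x1 : 0 < a x + 1 by rewrite ltr_wpDl ?absv_ge0.
move: p1; rewrite -[X in _ < X]div1r ltr_pdivlMr// => /ltW; apply: le_trans.
by rewrite ler_wpM2l ?exprn_ge0 ?absv_ge0// lerDl.
Qed.

(** Multiplication by [p ^+ N] moves the ball into the unit ball, where the integers below [p ^ M]
    form a finite net. *)
Lemma tbounded_prime_finite (r : R) : tbounded [set x | P x /\ a x <= r].
Proof.
move=> e e0; have c0 : 0 < (`|r| + 1)^-1 by rewrite invr_gt0 ltr_wpDl.
have [N Nr] := absv_p_lt c0.
have d0 : 0 < e * a (p%:R : K) ^+ N by rewrite mulr_gt0// exprn_gt0.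
have [M Me] := absv_p_lt d0.
exists [seq (j%:R : K) / p%:R ^+ N | j <- iota 0 (p ^ M)] => x [Px xr].
have pN0 : (p%:R : K) ^+ N != 0 by rewrite -absv_gt0 absvX exprn_gt0.
have [||j jM jx] := @prime_digit (p%:R ^+ N * x) M.
- by rewrite -natrX -[X in P (X * _)](ratr_nat K); exact: prime_scale.
- have r1 : 0 < `|r| + 1 by rewrite ltr_wpDl.
  rewrite absvM absvX; move: Nr; rewrite -[X in _ < X]div1r ltr_pdivlMr// => /ltW.
  apply: le_trans; rewrite ler_wpM2l ?exprn_ge0 ?absv_ge0//.
  by rewrite (le_trans xr)// (le_trans (ler_norm _))// lerDl.
exists (j%:R / p%:R ^+ N); first by apply/mapP; exists j; rewrite // mem_iota.
have -> : x - j%:R / p%:R ^+ N = (p%:R ^+ N * x - j%:R) / p%:R ^+ N by field.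
rewrite absv_div absvX ltr_pdivrMr ?exprn_gt0//; exact: le_lt_trans jx Me.
Qed.

Definition is_polar x (q : rat) := [/\ 0 <= q < 1,
  exists n : nat, q * (p ^ n)%:R \is a Num.int & a (x - ratr q) <= 1].

Lemma polar_exists x : P x -> exists q, is_polar x q.
Proof.
move=> Px; have [N xN] := prime_scale_unit Px.
have [|//|j jM jx] := @prime_digit (p%:R ^+ N * x) N.
  by rewrite -natrX -[X in P (X * _)](ratr_nat K); exact: prime_scale.
have pN : (0 < p ^ N)%N by rewrite expn_gt0 prime_gt0.
have pN0 : (p%:R : K) ^+ N != 0 by rewrite -absv_gt0 absvX exprn_gt0.
have pNq : (p ^ N)%:R != 0 :> rat by rewrite pnatr_eq0 -lt0n.
exists (j%:R / (p ^ N)%:R); split.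
- by rewrite divr_ge0//= ltr_pdivrMr ?ltr0n// mul1r ltr_nat.
- by exists N; rewrite divfK//; exact: natr_int.
have -> : ratr (j%:R / (p ^ N)%:R) = j%:R / p%:R ^+ N :> K.
  have rp : ratr (p ^ N)%:R = p%:R ^+ N :> K by rewrite ratr_nat natrX.
  by apply: (mulIf pN0); rewrite divfK// -{1}rp -ratrM divfK// ratr_nat.
have -> : x - j%:R / p%:R ^+ N = (p%:R ^+ N * x - j%:R) / p%:R ^+ N by field.
by rewrite absv_div absvX ler_pdivrMr ?exprn_gt0// mul1r.
Qed.

(** The denominator divides a power of [p] by the first hypothesis and is prime to [p] by the
    second, so it is 1. *)
Lemma polar_int (q : rat) n : q * (p ^ n)%:R \is a Num.int -> a (ratr q : K) <= 1 ->
  q \is a Num.int.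
Proof.
move=> /intrP[k qk] /ratr_den cd.
have dn : (`|denq q| %| p ^ n)%N.
  have : (denq q %| numq q * (p ^ n)%N%:Z)%Z.
    apply/dvdzP; exists k; apply/eqP; rewrite -(eqr_int rat) !rmorphM /= -qk.
    by rewrite mulrAC -numqE.
  rewrite dvdzE abszM /= Gauss_dvdr//; rewrite coprime_sym; exact: coprime_num_den.
have : coprime `|denq q| (p ^ n) by rewrite coprimeXr.
move: (gcdn_idPl dn); rewrite /coprime => -> /eqP d1.
rewrite -(divq_num_den q) -(gtz0_abs (denq_gt0 q)) d1 divr1; exact: intr_int.
Qed.

Lemma polar_partP x : P x -> is_polar x (polar_part x).
Proof.
move=> /polar_exists[q qP]; rewrite /polar_part residue_charE.
by case: xgetP => [r _ //|/(_ q)].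
Qed.

(** The combination lies in Z[1/p] and in the unit ball. With [z = x + y] it gives additivity of
    [lambda], with [x = y = 0] the triviality of [lambda] near 0. *)
Lemma polar_part_diff_int x y z : P x -> P y -> P z -> a (z - (x + y)) <= 1 ->
  polar_part z - (polar_part x + polar_part y) \is a Num.int.
Proof.
move=> Px Py Pz xyz.
have [_ [n1 i1] b1] := polar_partP Px; have [_ [n2 i2] b2] := polar_partP Py.
have [_ [n3 i3] b3] := polar_partP Pz.
have up (q : rat) n m : q * (p ^ n)%:R \is a Num.int ->
    q * (p ^ (n + m))%:R \is a Num.int.
  by move=> h; rewrite expnD natrM mulrA rpredM// natr_int.
apply: (@polar_int _ (n1 + n2 + n3)).
  rewrite mulrBl mulrDl; apply: rpredB; [|apply: rpredD].
  - by rewrite addnC; exact: up.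
  - by rewrite -addnA; exact: up.
  - by rewrite addnAC addnC; apply: up.
rewrite ratrD ratrN ratrD.
have -> : ratr (polar_part z) - (ratr (polar_part x) + ratr (polar_part y)) =
    (z - (x + y)) - (z - ratr (polar_part z)) + (x - ratr (polar_part x)) +
    (y - ratr (polar_part y)) by ring.
apply: ultra_le => //; apply: ultra_le => //; exact: ultra_sub_le.
Qed.

End FinitePlace.

(** * Ostrowski's theorem *)

Section Ostrowski.
Context {R : realType} {K : valuedFieldType R}.
Implicit Types (x y z : K).
Notation a := (@absv R K).

(** For [t > 1], Bernoulli's inequality for [t ^+ k.+1], once squared, gives quadratic growth along
    even exponents, which no linear bound allows. *)
Lemma pow_le_linear (t A : R) : 0 <= t -> 0 <= A ->
  (forall k, t ^+ k <= A * k.+1%:R) -> t <= 1.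
Proof.
move=> t0 A0 H; rewrite leNgt; apply/negP => t1.
pose h := t - 1; have h0 : 0 < h by rewrite subr_gt0.
have bern k : 1 + k%:R * h <= t ^+ k.
  elim: k => [|k IH]; first by rewrite mul0r addr0.
  rewrite exprS; apply: le_trans (_ : t * (1 + k%:R * h) <= _); last by rewrite ler_wpM2l.
  rewrite -natr1 /h; have : 0 <= k%:R * (t - 1) * (t - 1) by rewrite -mulrA mulr_ge0// mulr_ge0// ltW.
  by nra.
have [k kP] : exists k : nat, (2 * A + A) / h ^+ 2 < k%:R.
  by exists (Num.bound ((2 * A + A) / h ^+ 2)); apply: archi_boundP;
    rewrite divr_ge0 ?sqr_ge0// addr_ge0// mulr_ge0.
have k1 : 1 <= k.+1%:R :> R by rewrite ler1n.
have h2 : 0 < h ^+ 2 by rewrite exprn_gt0.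
have := H (k.+1 * 2)%N; rewrite exprM leNgt => /negP; apply.
have b := bern k.+1.
have : (1 + k.+1%:R * h) ^+ 2 <= (t ^+ k.+1) ^+ 2.
  by rewrite lerXn2r ?nnegrE ?exprn_ge0// addr_ge0// mulr_ge0// ltW.
apply: lt_le_trans.
rewrite ltr_pdivrMr// in kP.
have -> : (k.+1 * 2).+1%:R = 2 * k.+1%:R + 1 :> R by rewrite -natr1 natrM mulrC.
have kk : k%:R <= k.+1%:R :> R by rewrite ler_nat.
set z : R := k.+1%:R in k1 kk *.
have : A * (2 * z + 1) <= (2 * A + A) * z.
  by nra.
have : (2 * A + A) * z < k%:R * h ^+ 2 * z by rewrite ltr_pM2r//; lra.
have : k%:R * h ^+ 2 * z <= z * h ^+ 2 * z.
  by rewrite ler_wpM2r ?ler_wpM2r ?ltW//; lra.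
have : z * h ^+ 2 * z < (1 + z * h) ^+ 2.
  have := mulr_gt0 (lt_le_trans ltr01 k1) h0 => zh.
  have -> : (1 + z * h) ^+ 2 = z * h ^+ 2 * z + 2 * (z * h) + 1 by ring.
  by lra.
by lra.
Qed.

(** Binomial coefficients have absolute value at most 1, so the k-th power of [a (x + y) / M] is at
    most [k.+1]; [pow_le_linear] removes this factor. *)
Lemma absv_bounded_ultra : (forall n : nat, a n%:R <= 1) -> finite_place K.
Proof.
move=> an x y; set M := Num.max _ _.
have [M0|M0] := eqVneq M 0.
  have : a x <= 0 by rewrite -M0 le_max lexx.
  have : a y <= 0 by rewrite -M0 le_max lexx orbT.
  by rewrite M0; have := absvD x y; lra.
have Mp : 0 < M by rewrite lt0r M0 le_max absv_ge0.
rewrite -[leRHS]mul1r -ler_pdivrMr//.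
apply: (@pow_le_linear _ 1) => //; first by rewrite divr_ge0 ?absv_ge0// ltW.
move=> k; rewrite mul1r expr_div_n ler_pdivrMr ?exprn_gt0// -absvX exprDn.
apply: le_trans (absv_sum _ _ _) _.
rewrite -[X in X%:R]card_ord mulr_natl -sumr_const ler_sum// => i _.
rewrite -mulr_natl !absvM absvX absvX.
apply: le_trans (ler_piMl _ (an _)) _; first by rewrite mulr_ge0 ?exprn_ge0 ?absv_ge0.
have -> : M ^+ k = M ^+ (k - i) * M ^+ i by rewrite -exprD subnK// -ltnS.
by apply: ler_pM; rewrite ?exprn_ge0 ?absv_ge0// lerXn2r ?nnegrE ?absv_ge0 ?(ltW Mp)//
  le_max lexx ?orbT.
Qed.

Lemma absv_nat_le n : a n%:R <= n%:R.
Proof.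
elim: n => [|n IH]; first by rewrite absv0.
by rewrite -addn1 !natrD (le_trans (absvD _ _))// absv1 lerD2r.
Qed.

(** Expansion of [m] in base [n]: each of at most [j] digits contributes at most [n], and the powers
    of [n] are bounded by [N ^+ j]. *)
Lemma absv_digits (n : nat) (N : R) : (1 < n)%N -> 1 <= N -> a n%:R <= N ->
  forall j m, (m < n ^ j)%N -> a m%:R <= j%:R * n%:R * N ^+ j.
Proof.
move=> n1 N1 aN; elim=> [|j IH] m mj.
  by move: mj; rewrite expn0 ltnS leqn0 => /eqP ->; rewrite absv0 !mul0r.
rewrite {1}(divn_eq m n) natrD natrM (le_trans (absvD _ _))// absvM.
have h1 : a (m %/ n)%:R <= j%:R * n%:R * N ^+ j.
  by apply: IH; rewrite ltn_divLR// -?expnSr//; exact: ltn_trans n1.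
have h2 : a (m %% n)%:R <= n%:R.
  apply: le_trans (absv_nat_le _) _; rewrite ler_nat ltnW// ltn_mod.
  exact: ltn_trans n1.
have NN : 1 <= N ^+ j.+1 by rewrite exprn_ege1.
have N0 : 0 <= N by apply: le_trans N1.
have h3 : a (m %/ n)%:R * a n%:R <= j%:R * n%:R * N ^+ j * N.
  by apply: ler_pM; rewrite ?absv_ge0.
rewrite -natr1 exprSr !mulrDl mul1r -mulrA in h3 NN *.
apply: lerD; first by rewrite -!mulrA in h3 *.
apply: le_trans h2 _; rewrite ler_peMr//.
Qed.

(** In base [n] the number [m ^ k] has about [k * ln m / ln n] digits. The resulting bound on
    [a m ^+ k] exceeds the wanted power by a factor linear in [k], which disappears as [k] grows. *)
Lemma absv_nat_bound n m : (1 < n)%N -> (0 < m)%N ->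
  a m%:R <= Num.max 1 (a n%:R) `^ (ln m%:R / ln n%:R).
Proof.
move=> n1 m0; set N := Num.max _ _.
have N1 : 1 <= N by rewrite le_max lexx.
have Np : 0 < N by apply: lt_le_trans N1.
have nR : 1 < n%:R :> R by rewrite ltr1n.
have lnn : 0 < ln n%:R :> R by rewrite ln_gt0.
have mR : 1 <= m%:R :> R by rewrite ler1n.
have lnm : 0 <= ln m%:R :> R by rewrite ln_ge0.
set t : R := ln m%:R / ln n%:R; have t0 : 0 <= t by rewrite divr_ge0// ltW.
have Nt : 0 < N `^ t by rewrite powR_gt0.
rewrite -[leRHS]mul1r -ler_pdivrMr//.
apply: (@pow_le_linear _ ((t + 1) * n%:R * N)).
- by rewrite divr_ge0 ?absv_ge0// ltW.
- by rewrite !mulr_ge0// ?(ltW Np)// addr_ge0.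
move=> k; rewrite expr_div_n ler_pdivrMr ?exprn_gt0// -absvX -natrX.
have [j [j1 j2]] : exists j : nat, (m ^ k < n ^ j)%N /\ j%:R <= k%:R * t + 1.
  exists (Num.truncn (k%:R * t)).+1; split.
    rewrite -(ltr_nat R) !natrX -ltr_ln ?posrE ?exprn_gt0//; last 2 first.
      exact: lt_le_trans mR. exact: lt_trans nR.
    rewrite !lnXn; [|exact: lt_trans nR|exact: lt_le_trans mR].
    rewrite -[ltLHS]mulr_natl -[ltRHS]mulr_natl.
    rewrite -ltr_pdivrMr// -mulrA -/t.
    by have /andP[] := truncn_itv (mulr_ge0 (ler0n R k) t0).
  rewrite -natr1 lerD2r.
  by have /andP[] := truncn_itv (mulr_ge0 (ler0n R k) t0).
apply: le_trans (absv_digits n1 N1 _ j1) _; first by rewrite le_max lexx orbT.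
have h1 : N ^+ j <= N * (N `^ t) ^+ k.
  have -> : N ^+ j = N `^ j%:R by rewrite powR_mulrn// ltW.
  have -> : (N `^ t) ^+ k = N `^ (t * k%:R) by rewrite powRrM powR_mulrn// powR_ge0.
  have -> : N * N `^ (t * k%:R) = N `^ (1 + t * k%:R).
    by rewrite powRD ?(gt_eqF Np) ?implybT// powRr1// ltW.
  by apply: ler_powR => //; rewrite addrC mulrC.
have h2 : j%:R <= (t + 1) * k.+1%:R.
  by rewrite (le_trans j2)// -natr1; have : 0 <= (k%:R : R) by []; nra.
have nn : 0 <= (n%:R : R) by [].
apply: le_trans (_ : (t + 1) * k.+1%:R * n%:R * (N * (N `^ t) ^+ k) <= _).
  by apply: ler_pM => //; rewrite ?mulr_ge0 ?exprn_ge0 ?(ltW Np)// ler_wpM2r.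
by rewrite le_eqVlt; apply/orP; left; apply/eqP; ring.
Qed.

Hypothesis arch : ~ finite_place K.

(** Exchanging the roles of the two bases in [absv_nat_bound] shows that the slope [ln (a n) / ln n]
    is the same for all [n > 1]. *)
Lemma ostrowski_nat : exists2 s : R, 0 < s & forall n, a n%:R = n%:R `^ s.
Proof.
have [m am] : exists m : nat, 1 < a m%:R.
  apply: contrapT => H; apply: arch; apply: absv_bounded_ultra => n.
  by rewrite leNgt; apply/negP => h; apply: H; exists n.
have m0 : (0 < m)%N by case: (m) am => //; rewrite absv0 ltr10.
(* A base [n] with [a n <= 1] would bound every integer by 1, against the choice of [m]. *)
have big n : (1 < n)%N -> 1 < a n%:R.
  move=> n1; rewrite ltNge; apply/negP => an.
  have := absv_nat_bound n1 m0; rewrite max_l// powR1.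
  by rewrite leNgt am.
have le_slope n k : (1 < n)%N -> (1 < k)%N ->
    ln (a k%:R) / ln k%:R <= ln (a n%:R) / ln n%:R :> R.
  move=> n1 k1; have := absv_nat_bound n1 (ltnW k1); rewrite max_r ?(ltW (big n n1))//.
  have ak := big k k1; have an := big n n1.
  rewrite -ler_ln ?posrE ?powR_gt0//; last 2 first.
    exact: lt_trans ak. exact: lt_trans an.
  have lk : 0 < ln k%:R :> R by rewrite ln_gt0// ltr1n.
  rewrite ln_powR ler_pdivrMr// => /le_trans; apply.
  by rewrite le_eqVlt; apply/orP; left; apply/eqP; ring.
exists (ln (a 2%:R) / ln 2%:R).
  by rewrite divr_gt0 ?ln_gt0 ?big ?ltr1n.
move=> n; have [->|n0] := eqVneq n 0%N.
  rewrite absv0 powR0// gt_eqF// divr_gt0 ?ln_gt0 ?big ?ltr1n//.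
have [->|n1] := eqVneq n 1%N; first by rewrite absv1 powR1.
have n2 : (1 < n)%N by rewrite ltn_neqAle eq_sym n1 lt0n.
have e : ln (a n%:R) / ln n%:R = ln (a 2%:R) / ln 2%:R :> R.
  by apply/eqP; rewrite eq_le !le_slope.
rewrite -e; apply: ln_inj; rewrite ?posrE ?powR_gt0 ?ltr0n ?lt0n//.
  exact: lt_trans (big n n2).
by rewrite ln_powR divfK// gt_eqF// ln_gt0// ltr1n.
Qed.

Lemma ostrowski : exists2 s : R, 0 < s & forall q : rat,
  a (ratr q) = `|ratr q : R| `^ s.
Proof.
have [s s0 sP] := ostrowski_nat; exists s => // q.
have intE (n : int) : a n%:~R = `|n%:~R : R| `^ s.
  case: n => n; first by rewrite /= sP normr_nat.
  by rewrite NegzE !mulrNz absvN normrN /= sP normr_nat.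
have dq : 0 < `|(denq q)%:~R : R| by rewrite normr_gt0 intr_eq0 denq_eq0.
rewrite /ratr absv_div !intE normrM normfV powRM ?invr_ge0//.
have dqs : `|(denq q)%:~R : R| `^ s != 0 by rewrite gt_eqF// powR_gt0.
congr (_ * _); apply: (mulIf dqs); rewrite mulVf// -powRM ?invr_ge0//.
by rewrite mulVf ?powR1// gt_eqF.
Qed.

End Ostrowski.

(** * The real numbers inside an archimedean completion *)

Section RealEmbedding.
Context {R : realType} {K : valuedFieldType R}.
Implicit Types (x y z : K) (r : R).
Notation a := (@absv R K).
Notation P := (@prime_completion R K).

Hypothesis complete : forall u : nat -> K,
    (forall e : R, 0 < e -> exists N : nat, forall m n : nat,
      (N <= m)%N -> (N <= n)%N -> a (u m - u n) < e) ->
    exists l, forall e : R, 0 < e -> exists N, forall n, (N <= n)%N ->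
      a (l - u n) < e.
Hypothesis ratrD : {morph (ratr : rat -> K) : x y / x + y}.
Hypothesis ratrM : {morph (ratr : rat -> K) : x y / x * y}.
Hypothesis ratrN : {morph (ratr : rat -> K) : x / - x}.
Variable s : R.
Hypothesis s0 : 0 < s.
Hypothesis as_ : forall q : rat, a (ratr q : K) = `|ratr q : R| `^ s.

Lemma same_realP r x : same_real r x <-> exists u : nat -> rat,
  (forall e : R, 0 < e -> exists N, forall n, (N <= n)%N -> `|r - ratr (u n)| < e) /\
  (forall e : R, 0 < e -> exists N, forall n, (N <= n)%N -> a (x - ratr (u n)) < e).
Proof.
split=> -[u [h1 h2]]; exists u; split.
- by move=> e e0; move/cvgrPdist_lt: h1 => /(_ e e0)[N _ NP]; exists N => n /NP.
- exact/cvgn_absvP.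
- by apply/cvgrPdist_lt => e e0; have [N NP] := h1 e e0; exists N.
- exact/cvgn_absvP.
Qed.

Lemma powR_small (e : R) : 0 < e -> exists2 d : R, 0 < d &
  forall t, 0 <= t -> t < d -> t `^ s < e.
Proof.
move=> e0; exists (e `^ s^-1); first by rewrite powR_gt0.
move=> t t0 td; have -> : e = (e `^ s^-1) `^ s.
  by rewrite -powRrM mulVf ?powRr1 ?(ltW e0)// gt_eqF.
by apply: gt0_ltr_powR => //; rewrite nnegrE ?powR_ge0.
Qed.

Lemma powR_small_inv (e : R) : 0 < e -> exists2 d : R, 0 < d &
  forall t, 0 <= t -> t `^ s < d -> t < e.
Proof.
move=> e0; exists (e `^ s); first by rewrite powR_gt0.
move=> t t0; apply: contraTT; rewrite -!leNgt => et.
by apply: ge0_ler_powR; rewrite ?nnegrE ?(ltW s0) ?(ltW e0).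
Qed.

Lemma same_realD r t x y : same_real r x -> same_real t y -> same_real (r + t) (x + y).
Proof.
move=> /same_realP[u [ur ux]] /same_realP[v [vt vy]]; apply/same_realP.
exists (fun n => u n + v n); split=> e e0; have e2 : 0 < e / 2 by lra.
  have [N NP] := ur _ e2; have [M MP] := vt _ e2; exists (maxn N M) => n.
  rewrite geq_max => /andP[/NP h1 /MP h2]; rewrite rmorphD /= opprD addrACA.
  by apply: le_lt_trans (ler_normD _ _) _; lra.
have [N NP] := ux _ e2; have [M MP] := vy _ e2; exists (maxn N M) => n.
rewrite geq_max => /andP[/NP h1 /MP h2]; rewrite ratrD opprD addrACA.
by apply: le_lt_trans (absvD _ _) _; lra.
Qed.

Lemma same_realN r x : same_real r x -> same_real (- r) (- x).
Proof.
move=> /same_realP[u [ur ux]]; apply/same_realP.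
exists (fun n => - u n); split=> e e0.
  have [N NP] := ur _ e0; exists N => n /NP.
  by rewrite rmorphN /= -opprD normrN.
by have [N NP] := ux _ e0; exists N => n /NP; rewrite ratrN -opprD absvN.
Qed.

Lemma same_real_absv r x : same_real r x -> a x = `|r| `^ s.
Proof.
move=> /same_realP[u [ur ux]].
have h1 : a (ratr (u n)) @[n --> \oo] --> a x.
  apply/cvgrPdist_lt => e e0; have [N NP] := ux e e0; exists N => // n /NP.
  exact: le_lt_trans (absv_dist_ge _ _).
have h2 : a (ratr (u n)) @[n --> \oo] --> `|r| `^ s.
  (* At 0 the continuity of the power function is [powR_small]; elsewhere the power is
     [expR (s * ln t)]. *)
  have [r0|r0] := eqVneq r 0.
    rewrite r0 normr0 powR0 ?gt_eqF//; apply/cvgrPdist_lt => e e0.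
    have [d d0 dP] := powR_small e0; have [N NP] := ur d d0.
    exists N => // n /NP; rewrite r0 !sub0r normrN => h.
    by rewrite as_ normrN ger0_norm ?powR_ge0// dP.
  under eq_fun do rewrite as_.
  have rp : 0 < `|r| by rewrite normr_gt0.
  have cn : `|ratr (u n) : R| @[n --> \oo] --> `|r|.
    by apply: cvg_norm; apply/cvgrPdist_lt => e e0; have [N NP] := ur e e0; exists N.
  have c : (fun t : R => expR (s * ln t)) t @[t --> `|r|] --> expR (s * ln `|r|).
    apply: continuous_comp; last exact: continuous_expR.
    by apply: cvgM; [exact: cvg_cst|exact: continuous_ln].
  have pE (t : R) : t != 0 -> t `^ s = expR (s * ln t).
    by rewrite /powR => /negbTE ->.
  rewrite pE ?gt_eqF//; apply: cvg_trans (cvg_comp _ _ cn c).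
  apply: near_eq_cvg; move/cvgrPdist_lt: cn => /(_ _ rp)[N _ NP].
  exists N => // n /NP /= h; apply/esym/pE; apply/eqP => z.
  by rewrite z subr0 normr_id ltxx in h.
exact: (cvg_unique (@Rhausdorff R) h1 h2).
Qed.

Lemma same_real_uniqr r t x : same_real r x -> same_real t x -> r = t.
Proof.
move=> h1 /same_realN h2; have := same_real_absv (same_realD h1 h2).
rewrite subrr absv0 => /esym/eqP; rewrite powR_eq0 normr_eq0 subr_eq0.
by move=> /andP[/eqP].
Qed.

Lemma same_real_uniql r x y : same_real r x -> same_real r y -> x = y.
Proof.
move=> h1 /same_realN h2; have := same_real_absv (same_realD h1 h2).
rewrite subrr normr0 powR0 ?gt_eqF// => /eqP.
by rewrite absv_eq0 subr_eq0 => /eqP.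
Qed.

Lemma same_real_prime r x : same_real r x -> P x.
Proof.
move=> /same_realP[u [_ ux]]; apply/primeP => e e0; have [N NP] := ux e e0.
by exists (u N); exact: NP.
Qed.

Lemma same_realM r t x y : same_real r x -> same_real t y -> same_real (r * t) (x * y).
Proof.
move=> hr ht; have /same_realP[u [ur ux]] := hr; have /same_realP[v [vt vy]] := ht.
apply/same_realP.
exists (fun n => u n * v n); split=> e e0.
  have h1 : ratr (u n) * ratr (v n) @[n --> \oo] --> r * t.
    by apply: cvgM; apply/cvgrPdist_lt => d d0; [have [N NP] := ur d d0|have [N NP] := vt d d0]; exists N.
  move/cvgrPdist_lt: h1 => /(_ e e0)[N _ NP]; exists N => n /NP.
  by rewrite rmorphM.
have M0 : 0 < a x + a y + 1 by have := absv_ge0 x; have := absv_ge0 y; lra.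
pose d := Num.min 1 (e / (2 * (a x + a y + 1))).
have d0 : 0 < d by rewrite lt_min ltr01 divr_gt0// mulr_gt0.
have [d1 d2] : d <= 1 /\ d <= e / (2 * (a x + a y + 1)) by rewrite !ge_min !lexx orbT.
have [N NP] := ux _ d0; have [M MP] := vy _ d0; exists (maxn N M) => n.
rewrite geq_max => /andP[/NP h1 /MP h2]; rewrite ratrM.
set x' : K := ratr (u n) in h1 *; set y' : K := ratr (v n) in h2 *.
have -> : x * y - x' * y' = x * (y - y') + (x - x') * y' by ring.
apply: le_lt_trans (absvD _ _) _; rewrite (absvM x) (absvM (x - x')).
have y'b : a y' <= a y + 1.
  by rewrite -[y'](subrK y); apply: le_trans (absvD _ _) _; rewrite absv_distC; lra.
move: d2; rewrite ler_pdivlMr ?mulr_gt0// => d2.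
have := absv_ge0 x; have := absv_ge0 y; have := absv_ge0 y'.
have := absv_ge0 (x - x'); have := absv_ge0 (y - y').
nra.
Qed.

Lemma rat_seq_cvg r : exists u : nat -> rat, forall e : R, 0 < e ->
  exists N, forall n, (N <= n)%N -> `|r - ratr (u n)| < e.
Proof.
have /boolp.choice[u uP] : forall n : nat, exists q : rat, `|r - ratr q| < n.+1%:R^-1.
  move=> n; have n0 : 0 < (n.+1%:R^-1 : R) by rewrite invr_gt0.
  move: n0; set d : R := n.+1%:R^-1 => d0.
  have rd : r - d < r + d by lra.
  have [q] := rat_in_itvoo rd.
  rewrite in_itv /= => /andP[h1 h2]; exists q.
  by rewrite ltr_norml; apply/andP; split; lra.
exists u => e e0; have [N _ NP] := near_infty_natSinv_lt (PosNum e0).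
by exists N => n nN; apply: lt_trans (uP n) _; exact: NP.
Qed.

Lemma same_real_exists r : exists x, same_real r x.
Proof.
have [u ur] := rat_seq_cvg r.
have [|x xP] := complete (u := fun n => ratr (u n) : K).
  move=> e e0; have [d d0 dP] := powR_small e0; have d2 : 0 < d / 2 by lra.
  have [N NP] := ur _ d2; exists N => m n /NP h1 /NP h2.
  rewrite -ratrN -ratrD as_ dP// rmorphB /=.
  rewrite -[ratr (u m)](subrK r) -addrA; apply: le_lt_trans (ler_normD _ _) _.
  by rewrite distrC; lra.
by exists x; apply/same_realP; exists u.
Qed.

Lemma same_real_of_prime x : P x -> exists r, same_real r x.
Proof.
move=> /primeP Px.
have /boolp.choice[u uP] : forall n : nat, exists q : rat, a (x - ratr q) < n.+1%:R^-1.
  by move=> n; apply: Px; rewrite invr_gt0.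
have ux e : 0 < e -> exists N, forall n, (N <= n)%N -> a (x - ratr (u n)) < e.
  move=> e0; have [N _ NP] := near_infty_natSinv_lt (PosNum e0).
  by exists N => n nN; apply: lt_trans (uP n) _; exact: NP.
have cu : cvgn (fun n => ratr (u n) : R).
  apply: cauchy_cvg; apply: cauchy_exP => e e0.
  have [d d0 dP] := powR_small_inv e0; have d2 : 0 < d / 2 by lra.
  have [N NP] := ux _ d2; exists (ratr (u N)); exists N => // n /NP h.
  rewrite /= /ball /= -rmorphB /=; apply: dP => //.
  rewrite -as_ ratrD ratrN; apply: le_lt_trans (absv_dist_trans x _ _) _.
  by have := NP N (leqnn N); rewrite absv_distC; lra.
exists (limn (fun n => ratr (u n) : R)); apply/same_realP; exists u; split=> // e e0.
by move/cvgrPdist_lt: cu => /(_ e e0)[N _ NP]; exists N => n /NP.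
Qed.

Lemma real_ofP x : P x -> same_real (real_of x) x.
Proof.
move=> /same_real_of_prime[r rx]; rewrite /real_of.
by case: xgetP => [t _ //|/(_ r)].
Qed.

Lemma of_realP r : same_real r (of_real K r).
Proof.
have [x rx] := same_real_exists r; rewrite /of_real.
by case: xgetP => [t _ //|/(_ x)].
Qed.

Lemma of_realD r t : of_real K (r + t) = of_real K r + of_real K t.
Proof. by apply: (same_real_uniql (of_realP _)); apply: same_realD; exact: of_realP. Qed.

Lemma of_realM r t : of_real K (r * t) = of_real K r * of_real K t.
Proof. by apply: (same_real_uniql (of_realP _)); apply: same_realM; exact: of_realP. Qed.

Lemma of_realN r : of_real K (- r) = - of_real K r.
Proof. by apply: (same_real_uniql (of_realP _)); apply: same_realN; exact: of_realP. Qed.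

Lemma absv_of_real r : a (of_real K r) = `|r| `^ s.
Proof. exact: same_real_absv (of_realP r). Qed.

Lemma prime_of_real r : P (of_real K r).
Proof. exact: same_real_prime (of_realP r). Qed.

Lemma real_ofK x : P x -> of_real K (real_of x) = x.
Proof. by move=> /real_ofP; apply: same_real_uniql; exact: of_realP. Qed.

Lemma of_realK r : real_of (of_real K r) = r.
Proof. by have /same_real_uniqr := real_ofP (@prime_of_real r); apply; exact: of_realP. Qed.

Lemma real_ofD x y : P x -> P y -> real_of (x + y) = real_of x + real_of y.
Proof.
move=> Px Py; rewrite -{1}(real_ofK Px) -{1}(real_ofK Py) -of_realD.
exact: of_realK.
Qed.

Lemma real_of_absv x : P x -> a x = `|real_of x| `^ s.
Proof. by move=> /real_ofP/same_real_absv. Qed.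

Lemma real_of_abs x : P x -> `|real_of x| = a x `^ s^-1.
Proof. by move=> /real_of_absv ->; rewrite -powRrM mulfV ?powRr1// gt_eqF. Qed.

(** The net is the image under [of_real] of a real grid of mesh [n%:R^-1]; [absv_of_real] converts
    real distances into distances of [K]. *)
Lemma tbounded_prime_arch (c : R) : tbounded [set x | P x /\ a x <= c].
Proof.
move=> e e0; have [d d0 dP] := powR_small e0.
pose M := Num.max 0 c `^ s^-1.
have [n nd] : exists n : nat, d^-1 < n%:R.
  by exists (Num.bound d^-1); apply: archi_boundP; rewrite invr_ge0 ltW.
have n0 : 0 < n%:R :> R by rewrite (lt_trans _ nd)// invr_gt0.
pose B := Num.bound (n%:R * M).
exists [seq of_real K (sgn * j%:R / n%:R) | sgn <- [:: 1; -1], j <- iota 0 B.+1].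
move=> x [Px xc]; pose r := real_of x.
have rM : `|r| <= M.
  rewrite /r real_of_abs//; apply: ge0_ler_powR.
  - by rewrite invr_ge0 ltW.
  - by rewrite nnegrE absv_ge0.
  - by rewrite nnegrE le_max lexx.
  - by rewrite le_max xc orbT.
pose j := Num.truncn (n%:R * `|r|).
have /andP[j1 j2] : j%:R <= n%:R * `|r| < j.+1%:R.
  by apply: truncn_itv; rewrite mulr_ge0.
pose sgn : R := if 0 <= r then 1 else -1.
have sr : r = sgn * `|r|.
  by rewrite /sgn; case: lerP => h; [rewrite mul1r ger0_norm|rewrite mulN1r ltr0_norm ?opprK].
have s1 : `|sgn| = 1 by rewrite /sgn; case: ifP; rewrite ?normrN normr1.
have jB : j \in iota 0 B.+1.
  rewrite mem_iota leq0n add0n ltnS -(ler_nat R); apply: le_trans j1 _.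
  apply: le_trans (_ : n%:R * M <= _); first by rewrite ler_wpM2l// ltW.
  by apply/ltW/archi_boundP; rewrite mulr_ge0 ?(ltW n0)// powR_ge0.
have sS : sgn \in [:: 1; -1] by rewrite /sgn; case: ifP; rewrite !inE eqxx ?orbT.
exists (of_real K (sgn * j%:R / n%:R)).
  by apply/allpairsP; exists (sgn, j); split.
rewrite -(real_ofK Px) -of_realN -of_realD absv_of_real; apply: dP => //.
rewrite -/r {1}sr -mulrA -mulrBr normrM s1 mul1r.
rewrite -natr1 in j2.
have h : `|r| - j%:R / n%:R = (n%:R * `|r| - j%:R) / n%:R.
  by field; rewrite gt_eqF.
rewrite h ger0_norm; last by rewrite divr_ge0 ?(ltW n0)// subr_ge0.
rewrite ltr_pdivrMr//; apply: lt_le_trans (_ : 1 <= _); first lra.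
by move: nd; rewrite -[d^-1]mul1r ltr_pdivrMr// mulrC => /ltW.
Qed.

End RealEmbedding.

(** * Local compactness of the completion *)

Section CompletionFacts.
Context {R : realType} {F : fieldExtType rat} {K : valuedFieldType R}.
Variable iota : {rmorphism F -> K}.
Hypothesis iotaC : is_completion iota.
Implicit Types (x y z : K).
Notation a := (@absv R K).
Notation P := (@prime_completion R K).

Lemma completion_cauchy (u : nat -> K) :
    (forall e : R, 0 < e -> exists N : nat, forall m n : nat,
      (N <= m)%N -> (N <= n)%N -> a (u m - u n) < e) ->
    exists l, forall e : R, 0 < e -> exists N, forall n, (N <= n)%N ->
      a (l - u n) < e.
Proof.
by move=> /(completion_complete iotaC) /cvgP cu; exists (lim (u n @[n --> \oo]));
  apply/cvgn_absvP.
Qed.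

Lemma iota_alg (q : rat) : iota (q%:A) = ratr q.
Proof. exact: (fmorph_eq_rat (iota \o in_alg F)). Qed.

Lemma completion_ratrD : {morph (ratr : rat -> K) : x y / x + y}.
Proof. by move=> q r; rewrite -!iota_alg scalerDl rmorphD. Qed.

Lemma completion_ratrM : {morph (ratr : rat -> K) : x y / x * y}.
Proof. by move=> q r; rewrite -!iota_alg -rmorphM -scalerAl mul1r scalerA. Qed.

Lemma completion_ratrN : {morph (ratr : rat -> K) : x / - x}.
Proof. by move=> q; rewrite -!iota_alg scaleNr rmorphN. Qed.

Lemma completion_ratrV : {morph (ratr : rat -> K) : x / x^-1}.
Proof.
move=> q; rewrite -!iota_alg -fmorphV; congr (iota _).
exact: (fmorphV (in_alg F) q).
Qed.

Lemma completion_char0 (n : nat) : (n.+1%:R : K) != 0.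
Proof.
rewrite -(ratr_nat K) -iota_alg fmorph_eq0 scaler_eq0 oner_eq0 orbF.
by rewrite pnatr_eq0.
Qed.

Let D := completion_ratrD.
Let M := completion_ratrM.
Let N := completion_ratrN.
Let V := completion_ratrV.

Lemma completion_gt1 : exists t : K, 1 < a t.
Proof.
have [x [x0 x1]] := completion_nontrivial iotaC.
have ax : 0 < a (iota x) by rewrite absv_gt0 fmorph_eq0.
have [h|h] := ltP 1 (a (iota x)); first by exists (iota x).
exists (iota x)^-1; rewrite absvV invf_gt1//.
by rewrite lt_neqAle x1.
Qed.

(** Otherwise all nonzero integers, hence all nonzero rationals, have absolute value 1. An element
    of the number field of absolute value above 1 is then impossible, since the leading term of its
    minimal equation would dominate; applied to an element and its inverse, this makes the absolute
    value trivial. *)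
Lemma finite_place_prime : finite_place K ->
  exists2 p, prime p & a (p%:R : K) < 1.
Proof.
move=> ultra; apply: contrapT => H.
have an n : (0 < n)%N -> a (n%:R : K) = 1.
  move=> n0; apply/eqP; rewrite eq_le (ultra_nat ultra) /= leNgt; apply/negP => h.
  exact: (H (small_prime n0 h)).
have aint (m : int) : m != 0 -> a (m%:~R : K) = 1.
  case: m => m m0; first by rewrite an// lt0n.
  by rewrite NegzE mulrNz absvN an.
have aq (q : rat) : a (ratr q : K) <= 1.
  have [->|q0] := eqVneq q 0; first by rewrite /ratr mul0r absv0.
  by rewrite /ratr absv_div !aint ?divr1// ?numq_eq0// denq_eq0.
have le1 (x : F) : a (iota x) <= 1.
  rewrite leNgt; apply/negP => x1.
  pose p := minPoly 1%AS x.
  have px : p.[x] = 0 by apply/eqP/root_minPoly.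
  have pm : p \is monic by exact: monic_minPoly.
  have [n pn] : exists n, size p = n.+2.
    by exists (adjoin_degree 1%AS x).-1; rewrite /p size_minPoly /adjoin_degree.
  have xn : x ^+ n.+1 = - \sum_(i < n.+1) p`_i * x ^+ i.
    move: px; rewrite horner_coef pn big_ord_recr /=.
    have -> : p`_n.+1 = 1 by move/monicP: pm; rewrite lead_coefE pn.
    by rewrite mul1r addrC => /eqP; rewrite addr_eq0 => /eqP.
  have pi i : a (iota p`_i) <= 1.
    have /polyOverP/(_ i) := minPolyOver 1%AS x.
    by rewrite -/p => /vlineP[q ->]; rewrite iota_alg.
  have : a (iota x) ^+ n.+1 <= a (iota x) ^+ n.
    rewrite -absvX -rmorphXn xn rmorphN absvN rmorph_sum /=.
    elim/big_ind: _ => [|u v hu hv|i _].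
    - by rewrite absv0 exprn_ge0// absv_ge0.
    - exact: ultra_le.
    rewrite rmorphM absvM rmorphXn absvX.
    apply: le_trans (_ : 1 * a (iota x) ^+ i <= _).
      by rewrite ler_wpM2r ?exprn_ge0 ?absv_ge0.
    by rewrite mul1r ler_weXn2l ?(ltW x1)// -ltnS.
  by rewrite exprS ger_pMl ?exprn_gt0 ?(lt_trans ltr01 x1)// leNgt x1.
have [x [x0 x1]] := completion_nontrivial iotaC.
move/negP: x1; apply; rewrite eq_le le1 /=.
have := le1 x^-1; rewrite fmorphV absvV invf_le1//.
by rewrite absv_gt0 fmorph_eq0.
Qed.

Lemma tbounded_prime (r : R) : tbounded [set x | P x /\ a x <= r].
Proof.
have [fin|inf] := pselect (finite_place K).
  have [p pp ap] := finite_place_prime fin.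
  exact: (tbounded_prime_finite fin M completion_char0 pp ap).
have [s s0 sP] := ostrowski inf.
exact: (tbounded_prime_arch completion_cauchy D N s0 sP).
Qed.

Lemma completion_dense_absv x (r : R) : 0 < r ->
  exists z : F, a (x - iota z) < r.
Proof.
move=> r0; have [] := completion_dense iotaC _ (open_ball_absv x r).
  by exists x => /=; rewrite subrr absv0.
by move=> y [/= h [z _ zy]]; exists z; rewrite zy.
Qed.

(** The number field is dense and spanned by finitely many elements over the rationals. A span over
    their closure is itself closed, so it is all of [K]. *)
Lemma completion_basis : exists n (e : nat -> K) (C : R),
  [/\ pfree n e, pbounded n e C & forall x, pspan n e x].
Proof.
pose b i : K := iota (vbasis {:F})`_i.
have [n [e [fe se]]] := pfree_subfamily D M V (\dim {:F}) b.
have [C Cb] := pbounded_of_pfree completion_cauchy D M V fe.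
exists n, e, C; split=> // x; apply: (pspan_closed completion_cauchy D M Cb).
move=> r r0.
have [z h] := completion_dense_absv x r0.
exists (iota z) => //; apply: se; exists (fun i => ratr (if insub i is Some j then coord (vbasis {:F}) j z else 0)).
  by move=> i; exact: prime_ratr.
rewrite {1}(coord_vbasis (memvf z)) rmorph_sum /=; apply: eq_bigr => i _.
by rewrite valK -mulr_algl rmorphM /= iota_alg.
Qed.

(** The coordinates of a bounded element are bounded, which reduces compactness of balls to total
    boundedness in the closure of the rationals. *)
Lemma completion_compact_ball (r : R) : compact [set x : K | a x <= r].
Proof.
have [n [e [C [_ [C0 Cb] se]]]] := completion_basis.
apply: (tbounded_compact completion_cauchy).
  apply/closure_id; apply/seteqP; split; first exact: subset_closure.
  move=> x /closure_absvP H /=; apply/ler_addgt0Pl => d d0.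
  have [y yr xy] := H d d0; rewrite -(subrK y x).
  by apply: le_trans (absvD _ _) _; rewrite /= in yr; lra.
apply: tboundedS (tbounded_sum n e (tbounded_prime (C * r))) => x /= xr.
have [c Pc xE] := se x; exists c => // i ni; split=> //.
by apply: le_trans (Cb c Pc i ni) _; rewrite -xE ler_wpM2l// ltW.
Qed.

Lemma completion_separable : exists q : nat -> K,
  forall x (e : R), 0 < e -> exists n, a (x - q n) < e.
Proof.
pose g (c : 'rV[rat]_(\dim {:F})) : K :=
  iota (\sum_i c ord0 i *: (vbasis {:F})`_i).
exists (fun n => if unpickle n is Some c then g c else 0) => x r r0.
have [z h] := completion_dense_absv x r0.
exists (pickle (\row_i coord (vbasis {:F}) i z)); rewrite pickleK /g.
rewrite (_ : \sum_i _ = z) // [RHS](coord_vbasis (memvf z)).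
by apply: eq_bigr => i _; rewrite mxE.
Qed.

End CompletionFacts.

Lemma lipschitz_of_derive {R : realType} (f df : R -> R) (C : R) :
  (forall x : R, is_derive x (1 : R) f (df x)) -> (forall x, `|df x| <= C) ->
  forall x y, `|f x - f y| <= C * `|x - y|.
Proof.
move=> fd dC x y.
wlog xy : x y / y < x.
  move=> H; have [|yx|->] := ltgtP x y; last by rewrite !subrr normr0 mulr0.
    by move=> /H; rewrite distrC [`|y - x|]distrC.
  exact: H.
have [] := @MVT R f df y x xy.
- apply: continuous_subspaceT => z; apply/differentiable_continuous.
  by apply/derivable1_diffP; have [] := fd z.
move=> c _ ->; rewrite normrM ler_wpM2r//.
Qed.

(** * Trace and additive character *)

Section AdditiveCharacter.
Context {R : realType} {F : fieldExtType rat} {K : valuedFieldType R}.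
Variable iota : {rmorphism F -> K}.
Hypothesis iotaC : is_completion iota.
Implicit Types (x y z : K).
Notation a := (@absv R K).
Notation P := (@prime_completion R K).

Let D := completion_ratrD iota.
Let M := completion_ratrM iota.
Let N := completion_ratrN iota.
Let PD x y : P x -> P y -> P (x + y). Proof. exact: primeD. Qed.
Let PM x y : P x -> P y -> P (x * y). Proof. exact: primeM. Qed.
Let PN x : P x -> P (- x). Proof. exact: primeN. Qed.

Definition Pmx m n (A : 'M[K]_(m, n)) := forall i j, P (A i j).

Lemma Pmx_mul m n k (A : 'M[K]_(m, n)) (B : 'M[K]_(n, k)) :
  Pmx A -> Pmx B -> Pmx (A *m B).
Proof.
move=> PA PB i j; rewrite mxE; elim/big_ind: _ => [|u v|l _].
- exact: prime0.
- exact: PD.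
- exact: PM.
Qed.

Lemma Pmx1 n : Pmx (1%:M : 'M[K]_n).
Proof.
move=> i j; rewrite mxE; case: (i == j); [exact: prime1|exact: prime0].
Qed.

Lemma basis_mulmx_inj n k (e : 'I_n -> K) (A B : 'M[K]_(n, k)) :
  is_prime_basis e -> Pmx A -> Pmx B ->
  (\row_i e i) *m A = (\row_i e i) *m B -> A = B.
Proof.
move=> be PA PB AB; apply/matrixP => i j.
have [c [_ cu]] := be (((\row_i e i) *m A) ord0 j).
have cA : c = (col j A)^T.
  apply: cu; split=> [l|]; first by rewrite !mxE; exact: PA.
  by rewrite mxE; apply: eq_bigr => l _; rewrite !mxE mulrC.
have cB : c = (col j B)^T.
  apply: cu; split=> [l|]; first by rewrite !mxE; exact: PB.
  by rewrite AB mxE; apply: eq_bigr => l _; rewrite !mxE mulrC.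
have := congr1 (fun t : 'rV_n => t ord0 i) (etrans (esym cA) cB).
by rewrite !mxE.
Qed.

Lemma basis_coords n k (e : 'I_n -> K) (f : 'I_k -> K) : is_prime_basis e ->
  exists2 A : 'M[K]_(n, k), Pmx A & \row_j f j = (\row_i e i) *m A.
Proof.
move=> be.
have /boolp.choice[c cP] : forall j, exists c : 'rV[K]_n,
    (forall i, P (c ord0 i)) /\ f j = \sum_i c ord0 i * e i.
  by move=> j; have [c [cP _]] := be (f j); exists c.
exists (\matrix_(i, j) c j ord0 i).
  by move=> i j; rewrite mxE; exact: (cP j).1.
apply/rowP => j; rewrite !mxE (cP j).2; apply: eq_bigr => i _.
by rewrite !mxE mulrC.
Qed.

(** Two bases are related by mutually inverse matrices over [prime_completion], so the two matrices
    of multiplication by [x] are conjugate. This fixes the value that [xget] selects in [Tr]. *)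
Lemma is_trace_unique x b c : is_trace x b -> is_trace x c -> b = c.
Proof.
move=> [n [e [A [be PA xe ->]]]] [m [f [B [bf PB xf ->]]]].
have [S PS fS] := basis_coords f be; have [T PT eT] := basis_coords e bf.
have xE : x *: (\row_i e i) = (\row_i e i) *m A.
  apply/rowP => j; rewrite !mxE xe; apply: eq_bigr => i _.
  by rewrite !mxE mulrC.
have xF : x *: (\row_i f i) = (\row_i f i) *m B.
  apply/rowP => j; rewrite !mxE xf; apply: eq_bigr => i _.
  by rewrite !mxE mulrC.
have ST : S *m T = 1%:M.
  apply: (basis_mulmx_inj be); [exact: Pmx_mul|exact: Pmx1|].
  by rewrite mulmxA -fS -eT mulmx1.
have TS : T *m S = 1%:M.
  apply: (basis_mulmx_inj bf); [exact: Pmx_mul|exact: Pmx1|].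
  by rewrite mulmxA -eT -fS mulmx1.
have SB : S *m B = A *m S.
  apply: (basis_mulmx_inj be); [exact: Pmx_mul|exact: Pmx_mul|].
  by rewrite !mulmxA -fS -xF -xE -scalemxAl -fS.
rewrite -[B in RHS]mul1mx -TS -mulmxA SB mxtrace_mulC -mulmxA ST.
by rewrite mulmx1.
Qed.

Lemma completion_prime_basis : exists n (e : 'I_n -> K) (C : R),
  [/\ is_prime_basis e, 0 < C & forall (c : 'rV[K]_n), (forall i, P (c ord0 i)) ->
    forall i, a (c ord0 i) <= C * a (\sum_i c ord0 i * e i)].
Proof.
have [n [e [C [fe [C0 Cb] se]]]] := completion_basis iotaC.
pose ext (c : 'rV[K]_n) (i : nat) : K := if insub i is Some j then c ord0 j else 0.
have extP (c : 'rV[K]_n) : (forall i, P (c ord0 i)) -> forall i, P (ext c i).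
  by move=> Pc i; rewrite /ext; case: insubP => [j _ _|_]; [exact: Pc|exact: prime0].
have extE (c : 'rV[K]_n) (i : 'I_n) : ext c i = c ord0 i by rewrite /ext valK.
have sumE (c : 'rV[K]_n) : \sum_(i < n) ext c i * e i = \sum_i c ord0 i * e i.
  by apply: eq_bigr => i _; rewrite extE.
exists n, (fun i => e i), C; split=> //; last first.
  by move=> c /extP Pc i; have := Cb _ Pc i (ltn_ord i); rewrite sumE extE.
move=> z; have [c Pc zE] := se z.
exists (\row_i c i); split.
  split=> [i|]; first by rewrite mxE.
  by rewrite zE; apply: eq_bigr => i _; rewrite mxE.
move=> c' [Pc' zE']; apply/rowP => i; rewrite mxE.
apply/eqP; rewrite -subr_eq0; apply/eqP.
have := fe (fun i => c i - ext c' i); rewrite -(extE c' i); apply => //.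
  by move=> j; apply: PD => //; apply/PN/extP.
under eq_bigr do rewrite mulrBl.
by rewrite sumrB sumE -zE -zE' subrr.
Qed.

Lemma is_trace_exists n (e : 'I_n -> K) x : is_prime_basis e ->
  exists A : 'M[K]_n, [/\ Pmx A, (forall j, x * e j = \sum_i A i j * e i),
    is_trace x (\tr A) & Tr x = \tr A].
Proof.
move=> be; have [A PA xA] := basis_coords (fun j => x * e j) be.
have xe j : x * e j = \sum_i A i j * e i.
  have := congr1 (fun t : 'rV_n => t ord0 j) xA; rewrite !mxE => ->.
  by apply: eq_bigr => i _; rewrite !mxE mulrC.
have tA : is_trace x (\tr A) by exists n, e, A.
exists A; split=> //; rewrite /Tr; case: xgetP => [b _ tb|/(_ (\tr A))//].
exact: is_trace_unique tb tA.
Qed.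

Lemma TrD x y : Tr (x + y) = Tr x + Tr y.
Proof.
have [n [e [C [be _ _]]]] := completion_prime_basis.
have [A [PA xA tA ->]] := is_trace_exists x be.
have [B [PB yB tB ->]] := is_trace_exists y be.
have [S [PS xyS tS ->]] := is_trace_exists (x + y) be.
apply: (is_trace_unique tS); exists n, e, (A + B); split=> //.
- by move=> i j; rewrite mxE; exact: PD.
- move=> j; rewrite mulrDl xA yB -big_split; apply: eq_bigr => i _.
  by rewrite mxE mulrDl.
- by rewrite mxtraceD.
Qed.

Lemma prime_Tr x : P (Tr x).
Proof.
have [n [e [C [be _ _]]]] := completion_prime_basis.
have [A [PA xA tA ->]] := is_trace_exists x be.
rewrite /mxtrace; elim/big_ind: _ => [|u v|l _]; [exact: prime0|exact: PD|exact: PA].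
Qed.

Lemma Tr_bound : exists2 C : R, 0 < C & forall x, a (Tr x) <= C * a x.
Proof.
have [n [e [C [be C0 Cb]]]] := completion_prime_basis.
exists (C * \sum_i a (e i) + 1).
  by rewrite ltr_wpDl// mulr_ge0 ?(ltW C0)// sumr_ge0// => i _; exact: absv_ge0.
move=> x; have [A [PA xA tA ->]] := is_trace_exists x be.
apply: le_trans (absv_sum _ _ _) _.
apply: le_trans (_ : C * (\sum_i a (e i)) * a x <= _); last first.
  by rewrite mulrDl lerDl mul1r absv_ge0.
rewrite mulr_sumr mulr_suml ler_sum// => i _.
have := Cb (\row_l A l i) _ i; rewrite mxE => h.
apply: le_trans (h _) _; first by move=> l; rewrite mxE; exact: PA.
under eq_bigr do rewrite mxE.
by rewrite -xA absvM mulrAC mulrA.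
Qed.

Lemma expiD (s t : R) : expi (s + t) = expi s * expi t.
Proof. by apply: ReIm_eq; rewrite ?ReM ?ImM /= ?cosD ?sinD; ring. Qed.

Lemma cabs_expi (t : R) : cabs (expi t) = 1.
Proof. by rewrite cabs_sqrt /= cos2Dsin2 sqrtr1. Qed.

Lemma expi_int (n : int) : expi (2 * pi * n%:~R) = 1 :> R[i].
Proof.
have e1 : expi (2 * pi) = 1 :> R[i].
  by apply: ReIm_eq; rewrite /= mulr_natl ?cos2pi ?sin2pi.
have en (k : nat) : expi (2 * pi * k%:R) = 1 :> R[i].
  elim: k => [|k IH]; first by apply: ReIm_eq; rewrite /= mulr0 ?cos0 ?sin0.
  have -> : 2 * pi * k.+1%:R = 2 * pi * k%:R + 2 * pi :> R by rewrite -natr1; ring.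
  by rewrite expiD IH e1 mulr1.
case: n => n; first exact: en.
rewrite NegzE mulrNz mulrN -[LHS]mulr1 -{1}(en n.+1) -expiD addNr.
by apply: ReIm_eq; rewrite /= ?cos0 ?sin0.
Qed.

Lemma expi_lipschitz (t : R) : cabs (expi t - 1) <= 2 * `|t|.
Proof.
apply: le_trans (cabs_le_ReIm _) _; rewrite ReD ImD ReN ImN /=.
rewrite mulr_natl mulr2n; apply: lerD.
  have := @lipschitz_of_derive _ (@cos R) (fun u => - sin u) 1 _ _ t 0.
  rewrite cos0 !subr0 mul1r; apply => x.
  by rewrite normrN sin_max.
have := @lipschitz_of_derive _ (@sin R) (@cos R) 1 _ _ t 0.
rewrite sin0 !subr0 mul1r; apply => x.
exact: cos_max.
Qed.

Lemma real_of_facts : ~ finite_place K -> exists2 s : R, 0 < s &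
  (forall x y, P x -> P y -> real_of (x + y) = real_of x + real_of y) /\
  (forall x, P x -> `|real_of x| = a x `^ s^-1).
Proof.
move=> /ostrowski[s s0 sP]; exists s => //; split=> [x y Px Py|x Px].
  exact: (real_ofD (completion_cauchy iotaC) D N s0 sP).
exact: (real_of_abs D N s0 sP).
Qed.

Lemma lambdaD x y : lambda (x + y) = lambda x * lambda y :> R[i].
Proof.
rewrite /lambda; case: asboolP => [fin|inf].
  have [p pp ap] := finite_place_prime iotaC fin.
  have : polar_part (Tr (x + y)) - (polar_part (Tr x) + polar_part (Tr y))
      \is a Num.int.
    apply: (polar_part_diff_int fin D M N (completion_char0 iota) pp ap);
      try exact: prime_Tr.
    by rewrite TrD subrr absv0 ler01.
  move=> /intrP[k /eqP]; rewrite subr_eq => /eqP ->.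
  rewrite !rmorphD /= ratr_int mulrDr expiD expi_int mul1r mulrDr expiD //.
have [s s0 [rD _]] := real_of_facts inf.
by rewrite TrD rD ?mulrDr ?opprD ?expiD//; exact: prime_Tr.
Qed.

Lemma cabs_lambda x : cabs (lambda x : R[i]) = 1.
Proof. by rewrite /lambda; case: ifP => _; exact: cabs_expi. Qed.

Lemma lambda0 : lambda (0 : K) = 1 :> R[i].
Proof.
have l0 : lambda (0 : K) != 0 :> R[i] by rewrite -cabs_eq0 cabs_lambda oner_eq0.
by apply: (mulIf l0); rewrite -lambdaD addr0 mul1r.
Qed.

Lemma lambdaN x : lambda (- x) = (lambda x)^*%C :> R[i].
Proof.
have l0 : lambda x != 0 :> R[i] by rewrite -cabs_eq0 cabs_lambda oner_eq0.
apply: (mulIf l0); rewrite -lambdaD addNr lambda0 mulrC mulcJ cabs_lambda.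
by rewrite expr1n.
Qed.

(** At a finite place the character is trivial where [T * a z <= 1], and elsewhere its distance from
    1, at most 2, is below [2 * T * a z]. At an archimedean place the exponent [s^-1] converts
    [absv] into the real absolute value of the trace. *)
Lemma lambda_hoelder : exists C b : R, [/\ 0 < C, 0 < b &
  forall z, cabs (lambda z - 1 : R[i]) <= C * a z `^ b].
Proof.
have [T T0 TP] := Tr_bound.
have [fin|inf] := pselect (finite_place K).
  have [p pp ap] := finite_place_prime iotaC fin.
  exists (2 * T), 1; split=> //; first by rewrite mulr_gt0.
  move=> z; rewrite powRr1 ?absv_ge0//.
  have [zT|zT] := leP (T * a z) 1.
    rewrite (_ : lambda z = 1) ?subrr ?cabs0 ?mulr_ge0 ?absv_ge0 ?(ltW T0)//.
    rewrite /lambda; case: asboolP => // _.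
    have : polar_part (Tr z) - (polar_part (0 : K) + polar_part (0 : K))
        \is a Num.int.
      apply: (polar_part_diff_int fin D M N (completion_char0 iota) pp ap).
      - exact: prime0.
      - exact: prime0.
      - exact: prime_Tr.
      - by rewrite addr0 subr0 (le_trans (TP z)).
    (* The same lemma at 0 shows that [polar_part 0] is an integer, which removes it from the
       previous statement. *)
    have : polar_part (0 : K) - (polar_part (0 : K) + polar_part (0 : K))
        \is a Num.int.
      apply: (polar_part_diff_int fin D M N (completion_char0 iota) pp ap);
        try exact: prime0.
      by rewrite addr0 subrr absv0 ler01.
    rewrite opprD addrA subrr sub0r => h0 h.
    have : polar_part (Tr z) \is a Num.int.
      have := rpredB (rpredB h h0) h0; congr (_ \is a Num.int); ring.
    by move=> /intrP[k ->]; rewrite ratr_int expi_int.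
  apply: le_trans (cabsD _ _) _; rewrite cabsN cabs1 cabs_lambda.
  by rewrite -mulrA; lra.
have [s s0 [_ rA]] := real_of_facts inf.
exists (2 * (2 * pi * T `^ s^-1)), s^-1; split.
- by rewrite !mulr_gt0 ?pi_gt0 ?powR_gt0.
- by rewrite invr_gt0.
move=> z; rewrite /lambda; case: asboolP => // _.
apply: le_trans (expi_lipschitz _) _.
rewrite normrN normrM ger0_norm; last by rewrite mulr_ge0 ?pi_ge0.
rewrite -!mulrA !ler_pM2l ?pi_gt0// rA; last exact: prime_Tr.
rewrite -powRM ?(ltW T0) ?absv_ge0//.
by apply: ge0_ler_powR => //; rewrite ?nnegrE ?invr_ge0 ?absv_ge0 ?mulr_ge0 ?absv_ge0 ?ltW.
Qed.

End AdditiveCharacter.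

Lemma exp_unbounded {R : realType} (b r : R) : 1 < b -> exists n, r <= b ^+ n.
Proof.
move=> b1; have b0 : 0 < b by rewrite (lt_trans ltr01).
have r1 : 0 < `|r| + 1 by rewrite ltr_wpDl.
have c0 : 0 < (`|r| + 1)^-1 by rewrite invr_gt0.
have := @cvg_expr R b^-1; rewrite ger0_norm ?invr_ge0 ?(ltW b0)// invf_lt1//.
move=> /(_ b1) /cvgrPdist_lt /(_ _ c0) [N _ /(_ N (leqnn N))] /=.
rewrite sub0r normrN ger0_norm ?exprn_ge0 ?invr_ge0 ?(ltW b0)//.
rewrite exprVn ltf_pV2 ?posrE ?exprn_gt0// => h; exists N.
by have := ler_norm r; lra.
Qed.

(** The facts on which integration over [K] rests. Sigma-finiteness, on which Tonelli's theorem
    depends, is carried by the type of [mu]. *)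
Record local_haar {R : realType} {K : valuedFieldType R}
    (mu : {sigma_finite_measure set (borel K) -> \bar R}) : Prop := {
  lh_haar : is_haar mu ;
  lh_separable : exists q : nat -> K,
    forall x (e : R), 0 < e -> exists n, absv (x - q n) < e ;
  lh_compact : forall r : R, compact [set x : K | absv x <= r] ;
  lh_gt1 : exists p : K, 1 < absv p
}.

(** * Haar measure and the module *)

Section Haar.
Context {R : realType} {K : valuedFieldType R}.
Variable mu : {sigma_finite_measure set (borel K) -> \bar R}.
Hypothesis lh : local_haar mu.
Notation a := (@absv R K).
Notation B := (borel K).
Notation mfB f := (mfun (f : _ -> B)).

Definition lh_seq : nat -> K := projT1 (cid (lh_separable lh)).
Lemma lh_dense x (e : R) : 0 < e -> exists n, a (x - lh_seq n) < e.
Proof. exact: projT2 (cid (lh_separable lh)) x e. Qed.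

Definition lh_base : K := projT1 (cid (lh_gt1 lh)).
Lemma lh_base_gt1 : 1 < a lh_base.
Proof. exact: projT2 (cid (lh_gt1 lh)). Qed.

Notation q_dense := lh_dense.
Notation p := lh_base.
Let p1 := lh_base_gt1.
Let haar := lh_haar lh.
Let compact_ball := lh_compact lh.

Lemma mfun_add d (T : measurableType d) (f g : T -> B) :
  mfun f -> mfun g ->
  mfB (fun x : T => (f x : K) + g x).
Proof.
by move=> mf mg; exact: (mfun_comp (mfun_add_borel q_dense)
  (measurable_fun_pair mf mg)).
Qed.

Lemma mfun_mul d (T : measurableType d) (f g : T -> B) :
  mfun f -> mfun g ->
  mfB (fun x : T => (f x : K) * g x).
Proof.
by move=> mf mg; exact: (mfun_comp (mfun_mul_borel q_dense)
  (measurable_fun_pair mf mg)).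
Qed.

Lemma mfun_inv d (T : measurableType d) (f : T -> B) :
  mfun f -> mfB (fun x : T => (f x : K)^-1).
Proof. by move=> mf; exact: (mfun_comp mfun_inv_borel mf). Qed.

Lemma mfun_opp d (T : measurableType d) (f : T -> B) :
  mfun f -> mfB (fun x : T => - (f x : K)).
Proof.
move=> mf; rewrite (_ : (fun x => _) = (fun x => (-1 : K) * f x)).
  by apply: mfun_mul => //; exact: measurable_cst.
by apply/funext => x; rewrite mulN1r.
Qed.

Lemma mfun_sub d (T : measurableType d) (f g : T -> B) :
  mfun f -> mfun g ->
  mfB (fun x : T => (f x : K) - g x).
Proof. by move=> mf mg; apply: mfun_add => //; exact: mfun_opp. Qed.

Notation idB := (fun x : B => x).
Let mid : mfun idB. Proof. exact: measurable_id. Qed.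
Let mc (c : K) d (T : measurableType d) : mfB (fun _ : T => c).
Proof. exact: measurable_cst. Qed.
Let mfst : mfB (fun z : B * B => z.1).
Proof. exact: measurable_fst. Qed.
Let msnd : mfB (fun z : B * B => z.2).
Proof. exact: measurable_snd. Qed.

Lemma preimage_measurable (f : B -> B) (E : set B) : mfun f ->
  measurable E -> measurable (f @^-1` E).
Proof. by move=> mf mE; rewrite -[X in measurable X]setTI; exact: mf. Qed.

Lemma int_map (phi : B -> B) (c : R) (f : B -> \bar R) :
  mfun phi -> 0 <= c ->
  (forall E : set B, measurable E -> mu (phi @^-1` E) = c%:E * mu E)%E ->
  mfun f -> (forall x, 0 <= f x)%E ->
  (\int[mu]_x f (phi x) = c%:E * \int[mu]_x f x)%E.
Proof.
move=> mphi c0 H mf f0.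
have <- := ge0_integral_mscale mu measurableT (NngNum c0) mf (fun x _ => f0 x).
transitivity (\int[pushforward mu phi]_x f x)%E.
  by rewrite (ge0_integral_pushforward mphi).
apply: eq_measure_integral => E mE _.
by rewrite /= /mscale /=; exact: H.
Qed.

Lemma tonelli2 (g : B -> B -> R) :
  mfun (fun z : B * B => g z.1 z.2) -> (forall x y, 0 <= g x y) ->
  (\int[mu]_x \int[mu]_y (g x y)%:E = \int[mu]_y \int[mu]_x (g x y)%:E)%E.
Proof.
move=> mg g0; apply: (fubini_tonelli (fun z : B * B => (g z.1 z.2)%:E)).
  exact/measurable_EFinP.
by move=> z; rewrite lee_fin.
Qed.

Lemma haar_shift (c : K) (E : set B) : measurable E ->
  mu ((fun x : K => x + c) @^-1` E) = mu E.
Proof.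
move=> mE; rewrite -(haar_translation haar c); last first.
  by apply: (@preimage_measurable (fun x : K => x + c)) => //; apply: mfun_add.
congr (mu _); apply/seteqP; split=> [_ [x /= Ex <-]|x Ex]; first by rewrite addrC.
by exists (x - c) => /=; [rewrite subrK|rewrite addrC subrK].
Qed.

Lemma int_shift (c : K) (f : B -> \bar R) : mfun f ->
  (forall x, 0 <= f x)%E -> (\int[mu]_x f ((x : K) + c)%R = \int[mu]_x f x)%E.
Proof.
move=> mf f0; rewrite -[RHS]mul1e.
apply: (@int_map (fun x : K => x + c)) => //; first exact: mfun_add.
by move=> E mE; rewrite mul1e; exact: haar_shift.
Qed.

Lemma ball_measurable (r : R) : measurable ([set x : K | a x <= r] : set B).
Proof.
rewrite (_ : [set x | _] = a @^-1` [set t | t <= r]); last by [].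
rewrite -[X in measurable X]setTI.
apply: (continuous_borel_real (@continuous_absv R K)) => //.
rewrite (_ : [set t | t <= r] = `]-oo, r]%classic); first exact: measurable_itv.
by apply/seteqP; split=> t /=; rewrite in_itv.
Qed.

Lemma haar_ball_lty (r : R) : (mu [set x : K | (a x <= r)%R] < +oo)%E.
Proof. exact: (haar_compact haar). Qed.

Lemma haar_ball_gt0 (r : R) : 0 < r -> (0 < mu [set x : K | (a x <= r)%R])%E.
Proof.
move=> r0; apply: lt_le_trans (haar_open haar (open_ball_absv 0 r) _) _.
  by exists 0 => /=; rewrite subrr absv0.
apply: le_measure; rewrite ?inE; [apply: borel_open; exact: open_ball_absv|exact: ball_measurable|].
by move=> x /=; rewrite sub0r absvN => /ltW.
Qed.

Let B1 := [set x : K | a x <= 1] : set B.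
Let mB1 : measurable B1. Proof. exact: ball_measurable. Qed.
Let b1 := fine (mu B1).
Let b1E : mu B1 = b1%:E.
Proof. by rewrite fineK// ge0_fin_numE// haar_ball_lty. Qed.
Let b10 : 0 < b1. Proof. by rewrite -lte_fin -b1E haar_ball_gt0. Qed.

Let mind (E : set B) d (T : measurableType d) (f : T -> B) :
  measurable E -> mfun f -> mfun (fun x => \1_E (f x) : R).
Proof. by move=> mE mf; apply: (mfun_comp _ mf); exact: measurable_indic. Qed.

Let ind_int (E : set B) : measurable E -> (\int[mu]_x (\1_E x)%:E = mu E)%E.
Proof. by move=> mE; rewrite integral_indic// setIT. Qed.

Let ind_shift (E : set B) c : measurable E ->
  (\int[mu]_x (\1_E ((x : K) + c)%R)%:E = mu E)%E.
Proof.
move=> mE; rewrite (int_shift c (f := fun x => (\1_E x)%:E)) ?ind_int//.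
  by apply/measurable_EFinP; exact: mind.
Qed.

Let eind (E : set B) (f : B -> B) : (fun x => (\1_E (f x) : R)) = \1_(f @^-1` E).
Proof. by apply/funext => x; rewrite !indicE; congr (_%:R); apply/idP/idP; rewrite !inE. Qed.

Let int_indM (E : set B) (r : R) d (f : B -> B) :
  measurable E -> mfB f -> 0 <= r -> (\int[mu]_x (\1_E (f x))%:E = d)%E ->
  (\int[mu]_x (r * \1_E (f x))%:E = r%:E * d)%E.
Proof.
move=> mE mf r0 <-; apply: ge0_intZ => //.
exact: mind.
Qed.

Let int_indZr (E : set B) (k : \bar R) : measurable E -> (0 <= k)%E ->
  (\int[mu]_x ((\1_E x)%:E * k) = mu E * k)%E.
Proof.
move=> mE k0; rewrite ge0_integralZr ?ind_int//.
by apply/measurable_EFinP; exact: mind.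
Qed.

Let fin_mu_cancel (u v : \bar R) : (u * b1%:E = v * b1%:E -> u = v)%E.
Proof.
move=> h; have := congr1 (fun t => t * (b1^-1)%:E)%E h.
by rewrite -!muleA -EFinM mulfV ?gt_eqF// !mule1.
Qed.

Let indic_iff (A A' : set B) (x y : B) : (A x <-> A' y) ->
  \1_A x = \1_A' y :> R.
Proof.
move=> AA'; rewrite !indicE; have -> : (x \in A) = (y \in A') => //.
by apply/idP/idP; rewrite !inE => /AA'.
Qed.

(** The uniqueness argument for Haar measure: the double integral of [\1_E x * \1_B1 (x + y)] is
    [mu E * b1] in one order and, after a translation of [x], [b1 * mu (- E)] in the other. *)
Lemma haar_reflection (E : set B) : measurable E ->
  mu ((fun x : K => - x) @^-1` E) = mu E.
Proof.
move=> mE; set E' : set B := (fun x : K => - x) @^-1` E.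
have mE' : measurable E'.
  by apply: (@preimage_measurable (fun x : K => - x)) => //; apply: mfun_opp.
pose g (x y : B) : R := \1_E x * \1_B1 (x + y : K).
have mg : mfun (fun z : B * B => g z.1 z.2).
  by apply: mfun_prod; apply: mind => //; exact: mfun_add.
have I1 x : (\int[mu]_y (g x y)%:E = (\1_E x)%:E * b1%:E)%E.
  apply: (@int_indM B1 (\1_E x) b1%:E (fun y : K => x + y)) => //.
    exact: mfun_add.
  by under eq_integral do rewrite addrC; rewrite ind_shift// b1E.
pose g' (x y : B) : R := \1_B1 x * \1_E (x - y : K).
have mg' : mfun (fun z : B * B => g' z.1 z.2).
  by apply: mfun_prod; apply: mind => //; exact: mfun_sub.
have I2 x : (\int[mu]_y (g' x y)%:E = (\1_B1 x)%:E * mu E')%E.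
  apply: (@int_indM E (\1_B1 x) (mu E') (fun y : K => x - y)) => //.
    exact: mfun_sub.
  rewrite -(ind_shift (- x : K) mE'); apply: eq_integral => y _; congr (_%:E).
  by apply: indic_iff; rewrite /E' /= opprB.
have I3 y : (\int[mu]_x (g x y)%:E = \int[mu]_x (g' x y)%:E)%E.
  rewrite -(int_shift y (f := fun x => (g' x y)%:E)).
  - by apply: eq_integral => x _; rewrite /g /g' addrK mulrC.
  - apply/measurable_EFinP; apply: mfun_prod; apply: mind => //.
    exact: mfun_sub.
  - by move=> x; rewrite lee_fin mulr_ge0.
apply: fin_mu_cancel; rewrite -(int_indZr mE) ?lee_fin ?(ltW b10)//.
under [RHS]eq_integral do rewrite -I1.
rewrite tonelli2//; last by move=> x y; rewrite mulr_ge0.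
under [RHS]eq_integral do rewrite I3.
rewrite -(@tonelli2 g')//; last by move=> x y; rewrite mulr_ge0.
under [RHS]eq_integral do rewrite I2.
by rewrite int_indZr ?measure_ge0// b1E muleC.
Qed.

Lemma int_reflection (f : B -> \bar R) : mfun f ->
  (forall x, 0 <= f x)%E -> (\int[mu]_x f (- (x : K))%R = \int[mu]_x f x)%E.
Proof.
move=> mf f0; rewrite -[RHS]mul1e.
apply: (@int_map (fun x : K => - x)) => //; first exact: mfun_opp.
by move=> E mE; rewrite mul1e; exact: haar_reflection.
Qed.

(** The module of a nonzero [t], read off from the unit ball; by [haar_scale] every measurable set
    is scaled by the same factor. *)
Definition mscaleB (t : K) : R := fine (mu ((fun x : K => t^-1 * x) @^-1` B1)) / b1.

Lemma haar_scale_fin (t : K) : t != 0 ->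
  mu ((fun x : K => t^-1 * x) @^-1` B1) = (mscaleB t * b1)%:E /\ 0 < mscaleB t.
Proof.
move=> t0; have at0 : 0 < a t by rewrite absv_gt0.
have -> : (fun x : K => t^-1 * x) @^-1` B1 = [set x : K | a x <= a t].
  apply/seteqP; split=> x /=; rewrite /B1 /= absvM absvV mulrC ler_pdivrMr// mul1r //.
rewrite /mscaleB.
have -> : (fun x : K => t^-1 * x) @^-1` B1 = [set x : K | a x <= a t].
  apply/seteqP; split=> x /=; rewrite /B1 /= absvM absvV mulrC ler_pdivrMr// mul1r //.
split; first by rewrite divfK ?gt_eqF// fineK// ge0_fin_numE// haar_ball_lty.
by rewrite divr_gt0// fine_gt0// haar_ball_lty haar_ball_gt0.
Qed.

(** The double-integral argument of [haar_reflection], now with the kernel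
    [\1_B1 (t^-1 * y - x)]. *)
Lemma haar_scale (t : K) (E : set B) : t != 0 -> measurable E ->
  mu ((fun x : K => t^-1 * x) @^-1` E) = ((mscaleB t)%:E * mu E)%E.
Proof.
move=> t0 mE; have [tB tB0] := haar_scale_fin t0.
set tE : set B := (fun x : K => t^-1 * x) @^-1` E.
have mtE : measurable tE.
  by apply: (@preimage_measurable (fun x : K => t^-1 * x)) => //; apply: mfun_mul.
have mtB1 : measurable ((fun x : K => t^-1 * x) @^-1` B1 : set B).
  by apply: (@preimage_measurable (fun x : K => t^-1 * x)) => //; apply: mfun_mul.
have m1 : mfB (fun z : B * B => t^-1 * z.2 - z.1 : K).
  by apply: mfun_sub => //; exact: mfun_mul.
have mty : mfB (fun y : B => t^-1 * y : K) by exact: mfun_mul.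
pose g (x y : B) : R := \1_E x * \1_B1 (t^-1 * y - x : K).
have mg : mfun (fun z : B * B => g z.1 z.2).
  by apply: mfun_prod; apply: mind.
have I1 x : (\int[mu]_y (g x y)%:E = (\1_E x)%:E * (mscaleB t * b1)%:E)%E.
  apply: (@int_indM B1 (\1_E x) _ (fun y : K => t^-1 * y - x)) => //.
    exact: mfun_sub.
  rewrite -tB -(ind_shift (- (t * x) : K) mtB1); apply: eq_integral => y _.
  by congr (_%:E); apply: indic_iff; rewrite /= mulrBr mulKf.
pose g' (x y : B) : R := \1_B1 x * \1_E (t^-1 * y - x : K).
have mg' : mfun (fun z : B * B => g' z.1 z.2).
  by apply: mfun_prod; apply: mind.
have I2 x : (\int[mu]_y (g' x y)%:E = (\1_B1 x)%:E * mu tE)%E.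
  apply: (@int_indM E (\1_B1 x) _ (fun y : K => t^-1 * y - x)) => //.
    exact: mfun_sub.
  rewrite -(ind_shift (- (t * x) : K) mtE); apply: eq_integral => y _.
  by congr (_%:E); apply: indic_iff; rewrite /tE /= mulrBr mulKf.
have I3 y : (\int[mu]_x (g x y)%:E = \int[mu]_x (g' x y)%:E)%E.
  have mgy : mfun (fun x : B => (g' x y)%:E).
    apply/measurable_EFinP; apply: mfun_prod; apply: mind => //.
    exact: mfun_sub.
  have gy0 x : (0 <= (g' x y)%:E)%E by rewrite lee_fin mulr_ge0.
  rewrite -(int_reflection mgy gy0).
  have mgy' : mfun (fun x : B => (g' (- (x : K)) y)%:E).
    by apply: (mfun_comp mgy); exact: mfun_opp.
  rewrite -(int_shift (- (t^-1 * y) : K) mgy')//.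
  by apply: eq_integral => x _; rewrite /g /g' opprB subKr mulrC.
apply: fin_mu_cancel.
have -> : ((mscaleB t)%:E * mu E * b1%:E = mu E * (mscaleB t * b1)%:E)%E.
  by rewrite [(mscaleB t * b1)%:E]EFinM muleA [((mscaleB t)%:E * mu E)%E]muleC.
rewrite -[RHS](int_indZr mE); last by rewrite lee_fin mulr_ge0// ltW.
under [RHS]eq_integral do rewrite -I1.
rewrite tonelli2//; last by move=> x y; rewrite mulr_ge0.
under [RHS]eq_integral do rewrite I3.
rewrite -(@tonelli2 g')//; last by move=> x y; rewrite mulr_ge0.
under [RHS]eq_integral do rewrite I2.
by rewrite int_indZr ?measure_ge0// b1E muleC.
Qed.

Let p0 : p != 0. Proof. by rewrite -absv_gt0 (lt_trans ltr01). Qed.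

Lemma haar_ball_iter n :
  mu [set x : K | (a x <= a p ^+ n)%R] = (mscaleB p ^+ n * b1)%:E.
Proof.
elim: n => [|n IH]; first by rewrite !expr0 mul1r -b1E.
have mE := ball_measurable (a p ^+ n).
rewrite [mscaleB p ^+ _]exprS -mulrA [(mscaleB p * _)%:E]EFinM -IH -(haar_scale p0 mE); congr (mu _).
have ap : 0 < a p by rewrite absv_gt0.
by apply/seteqP; split=> x /=; rewrite absvM absvV exprS ler_pdivrMl.
Qed.

(** A small ball [U] around [p] is disjoint from the unit ball. If scaling by [p] did not enlarge
    measures, all balls of radius [a p ^+ n] would have measure at most [b1], although a large one
    contains both the unit ball and [U]. *)
Lemma mscaleB_gt1 : 1 < mscaleB p.
Proof.
rewrite ltNge; apply/negP => m1.
have [n np] := exp_unbounded (2 * a p) p1.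
pose U := [set x : K | a (p - x) < a p - 1] : set B.
have U0 : (0 < mu U)%E.
  apply: (haar_open haar); first exact: open_ball_absv.
  by exists p; rewrite /U /= subrr absv0 subr_gt0.
have UB1 : B1 `&` U = set0.
  apply/seteqP; split=> // x; rewrite /B1 /U /= => -[h1 h2].
  have := absvD (p - x) x; rewrite subrK => h3.
  by have := le_lt_trans h3 (ltr_leD h2 h1); rewrite subrK ltxx.
have mU : measurable U by apply: borel_open; exact: open_ball_absv.
have : (mu (B1 `|` U) <= mu [set x : K | (a x <= a p ^+ n)%R])%E.
  apply: le_measure; rewrite ?inE; [exact: measurableU|exact: ball_measurable|].
  move=> x []; rewrite /B1 /U /= => h.
    by apply: le_trans h _; apply: exprn_ege1; exact: ltW.
  apply: le_trans np; have := absvD (x - p) p; rewrite subrK absv_distC => h'.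
  apply: le_trans h' _; apply: le_trans (lerD (ltW h) (lexx _)) _.
  by rewrite mulr_natl mulr2n lerD2r gerBl.
have -> : mu (B1 `|` U) = (b1%:E + mu U)%E by rewrite -b1E; exact: measureU.
rewrite haar_ball_iter leNgt => /negP; apply.
apply: le_lt_trans (_ : b1%:E < _)%E; last by rewrite lteDl.
rewrite lee_fin ger_pMl// exprn_ile1//.
by apply: ltW; exact: (haar_scale_fin p0).2.
Qed.

(** All points have the same finite measure by translation, and [{0}] is fixed by the dilation by
    [p], which multiplies measures by a factor above 1. *)
Lemma haar_set1 (x : K) : mu [set x] = 0%E.
Proof.
have -> : mu [set x] = mu [set 0 : K].
  rewrite -(haar_shift x (mfun_set1_borel (x : B))); congr (mu _).
  apply/seteqP; split=> y /=; last by move=> ->; rewrite add0r.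
  by move=> h; apply: (addIr x); rewrite add0r.
have m0 := mfun_set1_borel (0 : B).
have f0 : (mu [set (0 : K)%R] < +oo)%E.
  apply: le_lt_trans (haar_ball_lty 1); apply: le_measure; rewrite ?inE//.
  by move=> y /= ->; rewrite absv0.
have := haar_scale p0 m0.
have -> : (fun x : K => p^-1 * x) @^-1` [set 0] = [set 0 : K].
  apply/seteqP; split=> y /=; last by move=> ->; rewrite mulr0.
  by move=> /eqP; rewrite mulf_eq0 invr_eq0 (negbTE p0) => /eqP.
have : (0 <= mu [set (0 : K)%R])%E by [].
move: f0; case: (mu _) => [r| |] // _; rewrite lee_fin => r0 -[] /esym/eqP.
rewrite -subr_eq0 -{2}[r]mul1r -mulrBl mulf_eq0 subr_eq0 gt_eqF ?mscaleB_gt1//=.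
by move=> /eqP ->.
Qed.

Lemma module_image (t : K) (E : set B) : measurable E ->
  mu ((fun x : K => t * x) @` E) = ((if t == 0 then 0 else mscaleB t)%:E * mu E)%E.
Proof.
move=> mE; have [->|t0] := eqVneq t 0; last first.
  rewrite -(haar_scale t0 mE); congr (mu _); apply/seteqP; split.
    by move=> _ [x Ex <-] /=; rewrite mulKf.
  by move=> x /= Ex; exists (t^-1 * x) => //; rewrite mulVKf.
(* For [t = 0] the image is empty or [{0}], a null set in either case. *)
rewrite mul0e; have [->|/set0P[x Ex]] := eqVneq E set0; first by rewrite image_set0 measure0.
rewrite -(haar_set1 0); congr (mu _); apply/seteqP; split.
  by move=> _ [y _ <-]; rewrite mul0r.
by move=> _ ->; exists x; rewrite ?mul0r.
Qed.

Lemma moduleE (t : K) : module mu t = if t == 0 then 0 else mscaleB t.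
Proof.
rewrite /module; case: xgetP => [r _ [r0 rP]|/(_ (if t == 0 then 0 else mscaleB t))].
  have : (r%:E * mu B1 = (if t == 0 then 0 else mscaleB t)%:E * mu B1)%E.
    exact: eq_trans (esym (rP B1 mB1)) (module_image t mB1).
  by rewrite b1E -!EFinM => -[]; apply: (mulIf (lt0r_neq0 b10)).
case; split; last by move=> E mE; exact: module_image.
by case: eqVneq => // t0; rewrite ltW//; exact: (haar_scale_fin t0).2.
Qed.

Notation md := (module mu).

Lemma module0 : md 0 = 0. Proof. by rewrite moduleE eqxx. Qed.

Lemma module_gt0 (t : K) : t != 0 -> 0 < md t.
Proof. by move=> t0; rewrite moduleE (negbTE t0); exact: (haar_scale_fin t0).2. Qed.

Lemma module_ge0 (t : K) : 0 <= md t.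
Proof. by have [->|/module_gt0/ltW//] := eqVneq t 0; rewrite module0. Qed.

Lemma module_ball (t : K) : t != 0 ->
  mu [set x : K | (a x <= a t)%R] = (md t * b1)%:E.
Proof.
move=> t0; rewrite moduleE (negbTE t0) -(haar_scale_fin t0).1; congr (mu _).
have at0 : 0 < a t by rewrite absv_gt0.
by apply/seteqP; split=> x /=; rewrite /B1 /= absvM absvV mulrC ler_pdivrMr// mul1r.
Qed.

Lemma module_preimage (t : K) (E : set B) : t != 0 -> measurable E ->
  mu ((fun x : K => t * x) @^-1` E) = (((md t)^-1)%:E * mu E)%E.
Proof.
move=> t0 mE; have mtE : measurable ((fun x : K => t * x) @^-1` E : set B).
  by apply: (@preimage_measurable (fun x : K => t * x)) => //; apply: mfun_mul.
have := haar_scale t0 mtE.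
have -> : (fun x : K => t^-1 * x) @^-1` ((fun x : K => t * x) @^-1` E) = E.
  by apply/seteqP; split=> x /=; rewrite mulVKf.
move=> ->; rewrite moduleE (negbTE t0) muleA -EFinM mulVf ?mul1e//.
by rewrite gt_eqF//; exact: (haar_scale_fin t0).2.
Qed.

Lemma int_scale (t : K) (f : B -> \bar R) : t != 0 -> mfun f ->
  (forall x, 0 <= f x)%E ->
  (\int[mu]_x f (t * (x : K))%R = ((md t)^-1)%:E * \int[mu]_x f x)%E.
Proof.
move=> t0 mf f0; apply: (@int_map (fun x : K => t * x)) => //.
- exact: mfun_mul.
- by rewrite invr_ge0 module_ge0.
- by move=> E; exact: module_preimage.
Qed.

Lemma moduleM (s t : K) : md (s * t) = md s * md t.
Proof.
have [->|s0] := eqVneq s 0; first by rewrite mul0r module0 mul0r.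
have [->|t0] := eqVneq t 0; first by rewrite mulr0 module0 mulr0.
have st0 : s * t != 0 by rewrite mulf_neq0.
have h1 := module_preimage st0 mB1.
have mt : measurable ((fun x : K => s * x) @^-1` B1 : set B).
  by apply: (@preimage_measurable (fun x : K => s * x)) => //; apply: mfun_mul.
have h2 : mu ((fun x : K => t * x) @^-1` ((fun x : K => s * x) @^-1` B1)) = _ :=
  module_preimage t0 mt.
rewrite (module_preimage s0 mB1) in h2.
have e : (fun x : K => s * t * x) @^-1` B1 =
    (fun x : K => t * x) @^-1` ((fun x : K => s * x) @^-1` B1).
  by apply/seteqP; split=> x /=; rewrite mulrA.
move: h1; rewrite e h2 b1E -!EFinM => -[]; rewrite mulrA.
move=> /(mulIf (lt0r_neq0 b10)) h.
by apply: invr_inj; rewrite -h invfM mulrC.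
Qed.

Lemma module1 : md 1 = 1.
Proof.
have m1 : md 1 != 0 by rewrite gt_eqF// module_gt0// oner_eq0.
by apply: (mulfI m1); rewrite -moduleM !mulr1.
Qed.

Lemma moduleV (t : K) : md t^-1 = (md t)^-1.
Proof.
have [->|t0] := eqVneq t 0; first by rewrite invr0 module0 invr0.
have mt : md t != 0 by rewrite gt_eqF// module_gt0.
by apply: (mulfI mt); rewrite -moduleM !mulfV// module1.
Qed.

Lemma module_le (s t : K) : a s <= a t -> md s <= md t.
Proof.
have [->|s0] := eqVneq s 0; first by rewrite module0 module_ge0.
have [->|t0] := eqVneq t 0.
  by rewrite absv0 leNgt absv_gt0 s0.
move=> st; rewrite -(ler_pM2r b10) -lee_fin -!module_ball//.
by apply: le_measure; rewrite ?inE; [exact: ball_measurable|exact: ball_measurable|];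
  move=> x /= h; exact: le_trans st.
Qed.

Lemma module_X (t : K) n : md (t ^+ n) = md t ^+ n.
Proof. by elim: n => [|n IH]; rewrite ?expr0 ?module1// !exprS moduleM IH. Qed.

Lemma module_gt1 : 1 < md p.
Proof. by rewrite moduleE (negbTE p0) mscaleB_gt1. Qed.

(* A monotone homomorphism on the value group is a multiple of the logarithm:
   compare t^n with p^m. *)
Lemma monotone_hom_log (h : K -> R) :
  (forall s t, s != 0 -> t != 0 -> h (s * t) = h s + h t) ->
  (forall s t, s != 0 -> t != 0 -> a s <= a t -> h s <= h t) ->
  forall t, t != 0 -> h t = h p / ln (a p) * ln (a t).
Proof.
move=> hM hle.
have h1 : h 1 = 0.
  have := hM 1 1 (oner_neq0 _) (oner_neq0 _); rewrite mulr1.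
  by move=> h1; apply: (addIr (h 1)); rewrite add0r -h1.
have hX t n : t != 0 -> h (t ^+ n) = n%:R * h t.
  move=> t0; elim: n => [|n IH]; first by rewrite expr0 h1 mul0r.
  by rewrite exprS hM ?expf_neq0// IH -natr1 mulrDl mul1r addrC.
have hV t : t != 0 -> h t^-1 = - h t.
  move=> t0; apply/eqP; rewrite -addr_eq0 -hM ?invr_neq0// mulVf// h1//.
have lp : 0 < ln (a p) by rewrite ln_gt0.
have hp : 0 <= h p by rewrite -h1 hle ?oner_neq0// absv1 ltW.
have key t : t != 0 -> 1 <= a t -> h t = h p / ln (a p) * ln (a t).
  move=> t0 t1; pose x := ln (a t) / ln (a p).
  have x0 : 0 <= x by rewrite divr_ge0 ?ln_ge0// ltW.
  have ht0 : 0 <= h t by rewrite -h1 hle ?oner_neq0// absv1.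
  have at0 : 0 < a t by rewrite absv_gt0.
  have ap0 : 0 < a p by rewrite absv_gt0.
  have xE : h p / ln (a p) * ln (a t) = h p * x by rewrite /x; ring.
  rewrite xE; apply/eqP; rewrite -subr_eq0 -normr_eq0 eq_le normr_ge0 andbT.
  apply/ler_addgt0Pl => e e0; rewrite addr0.
  have [n nP] : exists n : nat, (h p + 1) / e < n%:R.
    by exists (Num.bound ((h p + 1) / e)); apply: archi_boundP; rewrite divr_ge0 ?ltW//; lra.
  have n0 : 0 < n%:R :> R by apply: le_lt_trans nP; rewrite divr_ge0 ?ltW//; lra.
  have /andP[m1 m2] := truncn_itv (mulr_ge0 (ler0n R n) x0).
  set m := Num.truncn _ in m1 m2.
  have lt_ m' : ln (a p ^+ m') = m'%:R * ln (a p) by rewrite lnXn// mulr_natl.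
  have ltn' : ln (a t ^+ n) = n%:R * ln (a t) by rewrite lnXn// mulr_natl.
  have xl : x * ln (a p) = ln (a t) by rewrite /x divfK// gt_eqF.
  have l1 : h (p ^+ m) <= h (t ^+ n).
    apply: hle; rewrite ?expf_neq0// !absvX -ler_ln ?posrE ?exprn_gt0//.
    by rewrite lt_ ltn' -xl mulrA ler_pM2r.
  have l2 : h (t ^+ n) <= h (p ^+ m.+1).
    apply: hle; rewrite ?expf_neq0// !absvX -ler_ln ?posrE ?exprn_gt0//.
    by rewrite lt_ ltn' -xl mulrA ler_pM2r// ltW.
  rewrite !hX// in l1 l2; rewrite -natr1 in l2 m2.
  have : n%:R * `|h t - h p * x| <= h p.
    rewrite -[n%:R]ger0_norm// -normrM ler_norml; apply/andP.
    split; nra.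
  rewrite ltr_pdivrMr// in nP; move=> h3.
  have : n%:R * `|h t - h p * x| <= n%:R * e by lra.
  by rewrite ler_pM2l.
move=> t t0; have [t1|t1] := lerP 1 (a t); first exact: key.
have at0 : 0 < a t by rewrite absv_gt0.
have := key t^-1; rewrite invr_neq0// absvV invf_ge1// hV// lnV ?posrE//.
by move=> /(_ isT (ltW t1)) /eqP; rewrite mulrN eqr_opp => /eqP.
Qed.

(** Larger balls have larger measure, so [ln (md t)] is a monotone homomorphism and hence a multiple
    of [ln (a t)]; the multiple is positive by [module_gt1]. *)
Lemma module_absv : exists2 s : R, 0 < s & forall t, md t = a t `^ s.
Proof.
have lp : 0 < ln (a p) by rewrite ln_gt0.
exists (ln (md p) / ln (a p)); first by rewrite divr_gt0// ln_gt0// module_gt1.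
move=> t; have [->|t0] := eqVneq t 0.
  by rewrite module0 absv0 powR0// gt_eqF// divr_gt0// ln_gt0// module_gt1.
have at0 : 0 < a t by rewrite absv_gt0.
apply: ln_inj; rewrite ?posrE ?module_gt0 ?powR_gt0// ln_powR.
apply: (@monotone_hom_log (fun t => ln (md t))) => //.
  by move=> s u s0 u0; rewrite moduleM lnM ?posrE ?module_gt0.
by move=> s u s0 u0 su; rewrite ler_ln ?posrE ?module_gt0// module_le.
Qed.

End Haar.

(** * Power weights, the logarithm of the module and the kernel *)

Lemma exp_between {R : realType} (b y : R) : 1 < b -> 1 <= y ->
  exists n, b ^+ n <= y < b ^+ n.+1.
Proof.
move=> b1 y1; have [N yN] : exists N, y < b ^+ N.
  have [n yn] := exp_unbounded y b1; exists n.+1; apply: le_lt_trans yn _.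
  by rewrite exprS ltr_pMl// exprn_gt0// (lt_trans ltr01).
have exN : exists n, y < b ^+ n by exists N.
case: (ex_minnP exN) => [[|n]]; first by rewrite expr0 ltNge y1.
move=> h1 h2; exists n; rewrite h1 andbT leNgt; apply/negP => /h2.
by rewrite ltnn.
Qed.

Lemma ln_le_powR {R : realType} (b x : R) : 0 < b -> 0 < x ->
  `|ln x| <= b^-1 * (x `^ b + x `^ (- b)).
Proof.
move=> b0 x0; have h (y : R) : 0 < y -> ln y <= b^-1 * y `^ b.
  move=> y0; rewrite -(ler_pM2l b0) mulVKf ?gt_eqF// -ln_powR.
  by apply: ltW; apply: ln_sublinear; exact: powR_gt0.
have h1 := h _ x0; have := h x^-1; rewrite invr_gt0 => /(_ x0).
rewrite lnV ?posrE// -(powR_inv1 (ltW x0)) -powRrM mulN1r => h2.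
have p1 : 0 <= b^-1 * x `^ b by rewrite mulr_ge0 ?invr_ge0 ?powR_ge0 ?ltW.
have p2 : 0 <= b^-1 * x `^ (- b) by rewrite mulr_ge0 ?invr_ge0 ?powR_ge0 ?ltW.
by rewrite mulrDr ler_norml; apply/andP; split; lra.
Qed.

Lemma ln_near1 {R : realType} (y e : R) : e <= 2^-1 -> `|y - 1| <= e ->
  `|ln y| <= 2 * e.
Proof.
move=> e2; rewrite ler_norml => /andP[h1 h2].
have y2 : 2^-1 <= y by lra.
have y0 : 0 < y by lra.
have := @le_ln1Dx R (y - 1); rewrite [1 + _]addrC subrK => l1.
have := @le_ln1Dx R (y^-1 - 1); rewrite [1 + _]addrC subrK lnV ?posrE// => l2.
have yi : y^-1 - 1 <= 2 * e.
  rewrite lerBlDr -(ler_pM2l y0) mulfV ?gt_eqF//; nra.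
have {}l1 : ln y <= y - 1 by apply: l1; lra.
have {}l2 : - ln y <= y^-1 - 1 by apply: l2; rewrite ltrBrDr addNr invr_gt0.
by rewrite ler_norml; apply/andP; split; lra.
Qed.

Lemma meas_invr {R : realType} d (T : measurableType d) (f : T -> R) :
  mfun f -> (forall x, 0 <= f x) -> mfun (fun x => (f x)^-1).
Proof.
move=> mf f0; rewrite (_ : (fun x => _) = (fun x => f x `^ (-1))).
  exact: mfun_comp (measurable_powR (-1)) mf.
by apply/funext => x; rewrite powR_inv1.
Qed.

Lemma ge0_intD d (T : measurableType d) {R : realType}
    (mu : {measure set T -> \bar R}) (u v : T -> R) :
  mfun u -> mfun v ->
  (forall x, 0 <= u x) -> (forall x, 0 <= v x) ->
  (\int[mu]_x (u x + v x)%:E = \int[mu]_x (u x)%:E + \int[mu]_x (v x)%:E)%E.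
Proof.
move=> mu' mv u0 v0; under eq_integral do rewrite EFinD.
rewrite ge0_integralD//; first by move=> x _; rewrite lee_fin.
- exact/measurable_EFinP.
- by move=> x _; rewrite lee_fin.
- exact/measurable_EFinP.
Qed.

Lemma ge0_intZr d (T : measurableType d) {R : realType}
    (mu : {measure set T -> \bar R}) (u : T -> R) (k : \bar R) :
  mfun u -> (forall x, 0 <= u x) -> (0 <= k)%E ->
  (\int[mu]_x ((u x)%:E * k) = (\int[mu]_x (u x)%:E) * k)%E.
Proof.
move=> mu' u0 k0; rewrite ge0_integralZr//; first exact/measurable_EFinP.
by move=> x _; rewrite lee_fin.
Qed.

Section HaarIntegrals.
Context {R : realType} {K : valuedFieldType R}.
Variable mu : {sigma_finite_measure set (borel K) -> \bar R}.
Hypothesis lh : local_haar mu.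
Notation a := (@absv R K).
Notation B := (borel K).
Notation md := (module mu).
Notation p := (lh_base lh).
Implicit Types x y t : K.

Definition ell x : R := ln (md x).

Lemma mfun_absv : mfun (a : B -> R).
Proof. exact: (continuous_borel_real (@continuous_absv R K)). Qed.

Lemma mfun_module : mfun (md : B -> R).
Proof.
have [s s0 ms] := module_absv lh.
rewrite (_ : (md : B -> R) = (fun x : B => a x `^ s)); last exact/funext.
exact: mfun_comp (measurable_powR s) mfun_absv.
Qed.

Lemma mfun_sqrt_module : mfun (fun x : B => Num.sqrt (md x)).
Proof.
rewrite (_ : (fun x => _) = (fun x : B => md x `^ 2^-1)).
  exact: mfun_comp (measurable_powR 2^-1) mfun_module.
by apply/funext => x; rewrite powR12_sqrt// module_ge0.
Qed.

Lemma mfun_ell : mfun (ell : B -> R).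
Proof. exact: mfun_comp (@measurable_ln R) mfun_module. Qed.

Lemma moduleN x : md (- x) = md x.
Proof. by have [s s0 ms] := module_absv lh; rewrite !ms absvN. Qed.

Lemma module_distC x y : md (x - y) = md (y - x).
Proof. by rewrite -opprB moduleN. Qed.

Lemma module_eq0 x : (md x == 0) = (x == 0).
Proof.
have [->|x0] := eqVneq x 0; first by rewrite (module0 lh) eqxx.
by rewrite gt_eqF// module_gt0.
Qed.

Lemma ell0 : ell 0 = 0. Proof. by rewrite /ell (module0 lh) ln0. Qed.
Lemma ellM x y : x != 0 -> y != 0 -> ell (x * y) = ell x + ell y.
Proof. by move=> x0 y0; rewrite /ell (moduleM lh) lnM ?posrE ?module_gt0. Qed.
Lemma ellV x : ell x^-1 = - ell x.
Proof.
have [->|x0] := eqVneq x 0; first by rewrite invr0 ell0 oppr0.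
by rewrite /ell (moduleV lh) lnV ?posrE ?module_gt0.
Qed.
Lemma ellN x : ell (- x) = ell x. Proof. by rewrite /ell moduleN. Qed.

Lemma ler_module x y : (md x <= md y) = (a x <= a y).
Proof.
have [s s0 ms] := module_absv lh; apply/idP/idP; last exact: module_le.
apply: contraTT; rewrite -!ltNge => xy; rewrite !ms.
by apply: gt0_ltr_powR; rewrite ?nnegrE ?absv_ge0.
Qed.

(** This is |t|^(b-1) near 0 and |t|^(-b-1) near infinity, the integrable models with which
    singularities are compared below. *)
Definition wt (b : R) t : R := Num.min (md t `^ b) (md t `^ (- b)) / md t.

Lemma wt_ge0 b t : 0 <= wt b t.
Proof. by rewrite divr_ge0 ?module_ge0// le_min !powR_ge0. Qed.

Lemma mfun_wt b : mfun (wt b : B -> R).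
Proof.
apply: mfun_prod.
  apply: measurable_minr; [exact: mfun_comp (measurable_powR b) mfun_module|
  exact: mfun_comp (measurable_powR (- b)) mfun_module].
by apply: meas_invr; [exact: mfun_module|exact: module_ge0].
Qed.

Lemma wt_small b t : 0 <= b -> md t <= 1 -> wt b t = md t `^ b / md t.
Proof.
move=> b0 t1; have [->|t0] := eqVneq t 0; first by rewrite /wt (module0 lh) !invr0 !mulr0.
have m0 := module_gt0 lh t0.
rewrite /wt (min_idPl _)//; apply: (@le_trans _ _ 1).
  by rewrite -[leRHS](powRr0 (md t)); apply: ger_powR => //; rewrite m0.
by rewrite -[leLHS](powRr0 (md t)); apply: ger_powR; rewrite ?m0// oppr_le0.
Qed.

Lemma wt_large b t : 0 <= b -> 1 <= md t -> wt b t = md t `^ (- b) / md t.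
Proof.
move=> b0 t1; rewrite /wt (min_idPr _)// ler_powR//.
by apply: le_trans (_ : 0 <= b); rewrite ?oppr_le0.
Qed.

(** Decomposition into shells between powers of [p]. The measure of the ball around the n-th shell
    compensates the factor [1 / md t] up to [P], and a geometric series of ratio [r] remains on each
    side of the unit sphere. *)
Lemma wt_int b : 0 < b -> (\int[mu]_t (wt b t)%:E < +oo)%E.
Proof.
move=> b0.
set P := md p; have P1 : 1 < P by exact: (module_gt1 lh).
have P0 : 0 < P by rewrite (lt_trans ltr01).
have p0 : p != 0 by rewrite -module_eq0 gt_eqF.
pose Bl (x : K) : set B := [set y : K | a y <= a x].
have mBl x : measurable (Bl x) by exact: ball_measurable.
pose r := P `^ (- b).
have r0 : 0 < r by exact: powR_gt0.
have r1 : r < 1.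
  rewrite /r powRN invf_lt1 ?powR_gt0// -[ltLHS](congr1 (@^~ b) (powR1 R)).
  by apply: gt0_ltr_powR; rewrite ?nnegrE// ltW.
have rn n : r ^+ n = (P ^+ n) `^ (- b).
  by rewrite -(powR_mulrn n (powR_ge0 _ _)) -(powR_mulrn n (ltW P0)) /r powRAC.
pose T n (t : K) : R := P ^- n * r ^+ n * \1_(Bl (p ^+ n.+1)) t
  + P ^+ n.+1 * r ^+ n * \1_(Bl (p ^- n)) t.
have T0 n t : 0 <= T n t.
  by rewrite addr_ge0// !mulr_ge0// ?invr_ge0 ?exprn_ge0// ltW.
have mT1 (c : R) x : mfun ((fun t : K => c * \1_(Bl x) t) : B -> R).
  by apply: mfun_prod => //; apply: measurable_indic.
have mT n : mfun (T n : B -> R) by exact: measurable_funD.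
have key t : exists n, wt b t <= T n t.
  have [->|t0] := eqVneq t 0.
    by exists 0%N; apply: le_trans (T0 _ _); rewrite /wt (module0 lh) invr0 mulr0.
  have m0 := module_gt0 lh t0.
  have [t1|t1] := lerP 1 (md t).
    have [n /andP[n1 n2]] := exp_between P1 t1; exists n.
    rewrite wt_large ?(ltW b0)//.
    apply: (@le_trans _ _ (P ^- n * r ^+ n * \1_(Bl (p ^+ n.+1)) t)); last first.
      by rewrite lerDl !mulr_ge0// ?exprn_ge0// ltW.
    rewrite indicE mem_set /=; last first.
      by rewrite /Bl /= -ler_module (module_X lh) ltW.
    rewrite mulr1 mulrC ler_pM ?invr_ge0 ?powR_ge0 ?(ltW m0)//.
      by rewrite lef_pV2 ?posrE ?exprn_gt0.
    rewrite rn !powRN lef_pV2 ?posrE ?powR_gt0 ?exprn_gt0//.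
    by rewrite ge0_ler_powR ?nnegrE ?(ltW b0) ?(ltW m0) ?exprn_ge0 ?(ltW P0).
  have ti1 : 1 <= (md t)^-1 by rewrite invf_ge1 ?ltW.
  have [n /andP[n1 n2]] := exp_between P1 ti1; exists n.
  have n1' : md t <= P ^- n by rewrite -[md t]invrK lef_pV2 ?posrE ?exprn_gt0 ?invr_gt0.
  rewrite wt_small ?(ltW b0) ?(ltW t1)//.
  apply: (@le_trans _ _ (P ^+ n.+1 * r ^+ n * \1_(Bl (p ^- n)) t)); last first.
    by rewrite lerDr !mulr_ge0// ?invr_ge0 ?exprn_ge0// ltW.
  rewrite indicE mem_set /=; last first.
    by rewrite /Bl /= -ler_module (moduleV lh) (module_X lh).
  rewrite mulr1 mulrC ler_pM ?invr_ge0 ?powR_ge0 ?(ltW m0) ?(ltW n2)//.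
    rewrite rn -mulN1r powRrM powR_inv1 ?exprn_ge0 ?(ltW P0)//.
    by rewrite ge0_ler_powR ?nnegrE ?invr_ge0 ?exprn_ge0 ?(ltW b0) ?(ltW m0) ?(ltW P0).
pose b1 := fine (mu [set x : K | a x <= 1]).
have b10 : 0 <= b1 by rewrite fine_ge0.
have intT n : (\int[mu]_t (T n t)%:E <= (2 * P * b1 * r ^+ n)%:E)%E.
  have iB (c : R) x : x != 0 -> 0 <= c ->
      (\int[mu]_t (c * \1_(Bl x) t)%:E = (c * (md x * b1))%:E)%E.
    move=> x0 c0; have mi : mfun (\1_(Bl x) : B -> R).
      exact: measurable_indic.
    have i0 (t : B) : 0 <= \1_(Bl x) t :> R by [].
    rewrite (ge0_intZ mu mi i0 c0).
    have -> : (\int[mu]_t (\1_(Bl x) t)%:E = (md x * b1)%:E)%E.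
      by rewrite integral_indic// setIT; exact: module_ball.
    by rewrite -EFinM.
  have c1 : 0 <= P ^- n * r ^+ n by rewrite mulr_ge0// ?invr_ge0 ?exprn_ge0// ltW.
  have c2 : 0 <= P ^+ n.+1 * r ^+ n by rewrite mulr_ge0// ?exprn_ge0// ltW.
  have i0 (c : R) x t : 0 <= c -> 0 <= c * \1_(Bl x) t by move=> c0; exact: mulr_ge0.
  rewrite (ge0_intD mu (mT1 _ _) (mT1 _ _) (fun t => i0 _ _ t c1) (fun t => i0 _ _ t c2)).
  rewrite !iB ?invr_neq0 ?expf_neq0// (moduleV lh) !(module_X lh) -/P -EFinD lee_fin.
  have Pn : P ^+ n != 0 by rewrite expf_neq0// gt_eqF.
  rewrite le_eqVlt; apply/orP; left; apply/eqP; rewrite exprS; field.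
  by [].
have mwt := mfun_wt b.
apply: (@le_lt_trans _ _ (\int[mu]_t \big[+%E/0%R]_(0 <= n <oo) (T n t)%:E)%E).
  apply: ge0_le_integral => //.
  - by move=> t _; rewrite lee_fin wt_ge0.
  - exact/measurable_EFinP.
  - by apply: ge0_emeasurable_sum => [n t _ _|n _]; [rewrite lee_fin|exact/measurable_EFinP].
  - move=> t _; have [n wn] := key t.
    apply: le_trans (nneseries_lim_ge n.+1 _); last by move=> k _ _; rewrite lee_fin.
    rewrite big_nat_recr//=; apply: le_trans (_ : ((T n t)%:E <= _)%E); rewrite ?lee_fin//.
    by apply: leeDr; apply: sume_ge0 => k _; rewrite lee_fin.
rewrite integral_nneseries//.
- by apply: (nneseries_lty_geometric (ltW r0) r1 _ intT) => n; apply: integral_ge0 => t _; rewrite lee_fin.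
- by move=> n; exact/measurable_EFinP.
- by move=> n t _; rewrite lee_fin.
Qed.

Lemma ell_wt b : 0 < b -> exists2 C, 0 <= C &
  forall t, `|ell t| * Num.min (md t `^ b) (md t `^ (- b)) <= C.
Proof.
move=> b0; exists (2 * b^-1) => [|t]; first by rewrite mulr_ge0// invr_ge0 ltW.
have [->|t0] := eqVneq t 0.
  by rewrite ell0 normr0 mul0r mulr_ge0// invr_ge0 ltW.
have m0 := module_gt0 lh t0.
set u := md t `^ b; have u0 : 0 < u by exact: powR_gt0.
have l : `|ell t| <= b^-1 * (u + u^-1) by rewrite -powRN; exact: ln_le_powR.
have mn0 : 0 <= Num.min u u^-1 by rewrite le_min invr_ge0 (ltW u0).
rewrite powRN; apply: le_trans (ler_wpM2r mn0 l) _.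
rewrite -mulrA mulrC ler_pM2r ?invr_gt0//.
have h1 : u * Num.min u u^-1 <= 1.
  by rewrite -(mulfV (lt0r_neq0 u0)) ler_pM2l// ge_min lexx orbT.
have h2 : u^-1 * Num.min u u^-1 <= 1.
  by rewrite -(mulVf (lt0r_neq0 u0)) ler_pM2l ?invr_gt0// ge_min lexx.
by rewrite mulrDl; lra.
Qed.

Lemma ell_near1 : exists2 C, 0 <= C &
  forall h, a h <= 2^-1 -> `|ell (1 + h)| <= C * a h.
Proof.
have [s s0 ms] := module_absv lh; exists (2 * s); first by rewrite mulr_ge0// ltW.
move=> h h2; rewrite /ell ms ln_powR normrM gtr0_norm// -mulrA mulrCA.
rewrite ler_pM2l//; apply: ln_near1 => //.
rewrite ler_norml; apply/andP; split.
  have := absvD (1 + h) (- h); rewrite addrK absvN absv1; lra.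
by have := absvD (1 : K) h; rewrite absv1; lra.
Qed.

(** A bounded integrable majorant that a bounded translation changes only by a constant factor
    ([decay_shift]). *)
Definition decay x : R := (1 + md x) ^- 2.

Lemma decay_gt0 x : 0 < decay x.
Proof. by rewrite invr_gt0 exprn_gt0// ltr_wpDr// module_ge0. Qed.

Lemma mfun_decay : mfun (decay : B -> R).
Proof.
apply: meas_invr; last by move=> x; rewrite exprn_ge0// addr_ge0// module_ge0.
by apply: measurable_funX; apply: measurable_funD => //; exact: mfun_module.
Qed.

Lemma decay_wt x : x != 0 -> decay x <= wt 1 x.
Proof.
move=> x0; have m0 := module_gt0 lh x0.
rewrite /wt powRr1 ?(ltW m0)// powR_inv1 ?(ltW m0)// ler_pdivlMr// le_min.
rewrite /decay; apply/andP; split.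
  rewrite ger_pMl// invf_le1 ?exprn_gt0 ?ltr_wpDr// ?(ltW m0)//.
  by rewrite exprn_ege1// lerDl ltW.
rewrite -ler_pdivlMr// -invfM lef_pV2 ?posrE ?mulr_gt0 ?exprn_gt0 ?ltr_wpDr ?(ltW m0)//.
by nra.
Qed.

Lemma ae_neq0 (P : B -> Prop) : (forall x : K, x != 0 -> P x) -> {ae mu, forall x, P x}.
Proof.
move=> H; exists [set (0 : K)]; split; [exact: mfun_set1_borel|exact: haar_set1|].
move=> x /= nP; apply/eqP; apply: contrapT => /negP x0; apply: nP; exact: H.
Qed.

Lemma decay_int : (\int[mu]_x (decay x)%:E < +oo)%E.
Proof.
apply: le_lt_trans (wt_int ltr01).
apply: ae_ge0_le_integral => //.
- by move=> x _; rewrite lee_fin ltW// decay_gt0.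
- by apply/measurable_EFinP; exact: mfun_decay.
- by move=> x _; rewrite lee_fin wt_ge0.
- by apply/measurable_EFinP; exact: mfun_wt.
- by apply: (@ae_neq0 (fun x => setT x -> _)) => x x0 _; rewrite lee_fin decay_wt.
Qed.

(** The kernel with its Schur weight as a function of [v = x / y]; homogeneity leaves only the outer
    factor [1 / md y]. *)
Definition ker1 (v : K) : R := `|ell v| / md (1 - v) / Num.sqrt (md v).

Lemma ker1_ge0 v : 0 <= ker1 v.
Proof. by rewrite !divr_ge0// ?module_ge0// sqrtr_ge0. Qed.

Lemma mfun_ker1 : mfun (ker1 : B -> R).
Proof.
have m1 : mfun (fun v : B => md (1 - v : K)).
  apply: (mfun_comp mfun_module); exact: (mfun_sub lh).
apply: mfun_prod; last first.
  apply: meas_invr => [|x]; last exact: sqrtr_ge0.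
  exact: mfun_sqrt_module.
apply: mfun_prod; first exact: mfun_comp (@normr_measurable R setT) mfun_ell.
by apply: meas_invr => // x; exact: module_ge0.
Qed.

(** At [v = 1] the zero of the logarithm compensates that of [1 - v] up to an integrable power. Near
    0 and near infinity the logarithm costs a power 1/4 and leaves |v|^(1/4 - 1) and |v|^(-1/4 -
    1). *)
Lemma ker1_bound : exists C b, [/\ 0 <= C, 0 < b &
  forall v, ker1 v <= C * wt (4^-1) v + C * wt b (v - 1)].
Proof.
have [s s0 ms] := module_absv lh.
have [C1 C10 H1] := ell_near1.
have b4 : 0 < 4^-1 :> R by rewrite invr_gt0.
have [C2 C20 H2] := ell_wt b4.
pose c := (3^-1 : R) `^ s; have c0 : 0 < c by apply: powR_gt0; rewrite invr_gt0.
pose c' := Num.sqrt ((2^-1 : R) `^ s).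
have c'0 : 0 < c' by rewrite sqrtr_gt0; apply: powR_gt0; rewrite invr_gt0.
pose C := C1 / c' + C2 / c.
have e1 : 0 <= C1 / c' by rewrite divr_ge0// ltW.
have e2 : 0 <= C2 / c by rewrite divr_ge0// ltW.
have C0 : 0 <= C by exact: addr_ge0.
exists C, s^-1; split => //; first by rewrite invr_gt0.
move=> v; have [->|v0] := eqVneq v 0.
  by rewrite /ker1 ell0 normr0 !mul0r addr_ge0// mulr_ge0// wt_ge0.
have m0 := module_gt0 lh v0; have sm0 : 0 < Num.sqrt (md v) by rewrite sqrtr_gt0.
have [h2|h2] := lerP (a (v - 1)) 2^-1.
  apply: le_trans (_ : C * wt s^-1 (v - 1) <= _); last first.
    by rewrite lerDr mulr_ge0// wt_ge0.
  have := H1 _ h2; rewrite addrC subrK => l1.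
  have m1 : md (v - 1) <= 1 by rewrite -(module1 lh) ler_module absv1; lra.
  have -> : wt s^-1 (v - 1) = a (v - 1) / md (v - 1).
    rewrite wt_small ?invr_ge0 ?(ltW s0)//; congr (_ / _).
    by rewrite ms -powRrM mulfV ?gt_eqF// powRr1 ?absv_ge0.
  rewrite /ker1 module_distC.
  have av : 2^-1 <= a v by have := absvD v (- (v - 1)); rewrite absvN opprB addrCA subrr addr0 absv1; lra.
  have sv : c' <= Num.sqrt (md v).
    by rewrite ler_wsqrtr// ms ge0_ler_powR ?nnegrE ?(ltW s0) ?absv_ge0 ?invr_ge0.
  have [->|v1] := eqVneq (md (v - 1)) 0; first by rewrite invr0 !mulr0 mul0r.
  have mv1 : 0 < md (v - 1) by rewrite lt_neqAle eq_sym v1 module_ge0.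
  rewrite mulrAC mulrA ler_pM2r ?invr_gt0//.
  apply: (@le_trans _ _ (C1 / c' * a (v - 1))); last by rewrite ler_wpM2r ?absv_ge0// lerDl.
  rewrite mulrAC ler_pM ?invr_ge0 ?(ltW sm0)//.
  by rewrite lef_pV2 ?posrE.
apply: le_trans (_ : C * wt 4^-1 v <= _); last by rewrite lerDl mulr_ge0// wt_ge0.
apply: (@le_trans _ _ (C2 / c * wt 4^-1 v)); last by rewrite ler_wpM2r ?wt_ge0// lerDr.
have sq : Num.sqrt (md v) = md v `^ 2^-1 by rewrite powR12_sqrt// ltW.
(* Away from 1 the distance [a (v - 1)] is at least a third of both 1 and [a v]. *)
have a1 : 3^-1 <= a (v - 1) by lra.
have a2 : a v * 3^-1 <= a (v - 1).
  by have := absvD (v - 1) (1 : K); rewrite subrK absv1; lra.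
have n1 : c <= md (1 - v).
  by rewrite module_distC ms ge0_ler_powR ?nnegrE ?(ltW s0) ?absv_ge0 ?invr_ge0.
have n2 : md v * c <= md (1 - v).
  rewrite module_distC !ms -powRM ?absv_ge0 ?invr_ge0//.
  by rewrite ge0_ler_powR ?nnegrE ?(ltW s0) ?absv_ge0// mulr_ge0 ?absv_ge0.
have n0 : 0 < md (1 - v) by exact: lt_le_trans n1.
have l := H2 v; set u := md v `^ 4^-1 in l; have u0 : 0 < u by exact: powR_gt0.
have sqE : Num.sqrt (md v) = u ^+ 2.
  rewrite sq -powR_mulrn ?ltW// /u -powRrM; congr (_ `^ _).
  by rewrite (_ : 4 = 2 * 2 :> R) ?invfM ?mulfVK// -natrM.
have mE : md v = u ^+ 4 by rewrite -(sqr_sqrtr (ltW m0)) sqE -exprM.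
have nE (x : R) : 0 <= x -> x / md (1 - v) <= x / c.
  by move=> x0; rewrite ler_wpM2l// lef_pV2 ?posrE.
rewrite /ker1; have [t1|t1] := lerP (md v) 1.
  have w4 := wt_small (ltW b4) t1; rewrite w4 -/u.
  have mn : Num.min u (md v `^ (- 4^-1)) = u.
    by move: w4; rewrite /wt -/u => /(mulIf _) ->//; rewrite invr_eq0 gt_eqF.
  rewrite mn in l; rewrite sqE mE.
  have l' : `|ell v| <= C2 / u by rewrite ler_pdivlMr.
  apply: le_trans (_ : C2 / u / c / u ^+ 2 <= _).
    by rewrite ler_pM2r ?invr_gt0 ?exprn_gt0//; apply: le_trans (nE _ _) _ => //; rewrite ler_pM2r ?invr_gt0.
  rewrite le_eqVlt; apply/orP; left; apply/eqP; field.
  by rewrite !gt_eqF.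
have w4 := wt_large (ltW b4) (ltW t1); rewrite w4 powRN -/u.
have mn : Num.min u (md v `^ (- 4^-1)) = u^-1.
  by move: w4; rewrite /wt powRN -/u => /(mulIf _) ->//; rewrite invr_eq0 gt_eqF.
rewrite mn ler_pdivrMr// in l; rewrite sqE.
have n0' : 0 < md v * c by exact: mulr_gt0.
apply: le_trans (_ : C2 * u / (md v * c) / u ^+ 2 <= _).
  rewrite ler_pM2r ?invr_gt0 ?exprn_gt0//.
  by apply: ler_pM => //; rewrite ?invr_ge0 ?(ltW n0)// lef_pV2 ?posrE.
rewrite mE le_eqVlt; apply/orP; left; apply/eqP; field.
by rewrite !gt_eqF.
Qed.

Lemma ker1_int : (\int[mu]_v (ker1 v)%:E < +oo)%E.
Proof.
have [C [b [C0 b0 H]]] := ker1_bound.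
have b4 : 0 < 4^-1 :> R by rewrite invr_gt0.
have mw := mfun_wt; have w0 := wt_ge0.
have mb : mfun (fun v : B => wt b (v - 1 : K)).
  by apply: (mfun_comp (mfun_wt b)); exact: (mfun_sub lh).
apply: (@le_lt_trans _ _ (\int[mu]_v (C * wt 4^-1 v + C * wt b (v - 1 : K))%:E)%E).
  apply: ge0_int_le => //; [exact: mfun_ker1| |exact: ker1_ge0].
  by apply: measurable_funD; apply: mfun_prod => //; exact: mfun_wt.
apply: ge0_intD_lty; try by move=> v; rewrite mulr_ge0.
- by apply: mfun_prod => //; exact: mfun_wt.
- by apply: mfun_prod.
- by apply: ge0_intZ_lty => //; exact: wt_int.
apply: ge0_intZ_lty => //; rewrite (int_shift lh (- 1 : K) (f := fun v => (wt b v)%:E)).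
- exact: wt_int.
- by apply/measurable_EFinP; exact: mfun_wt.
- by move=> v; rewrite lee_fin wt_ge0.
Qed.

Definition ker (x y : K) : R := `|ell y - ell x| / md (y - x).

Lemma ker_ge0 x y : 0 <= ker x y. Proof. by rewrite divr_ge0// module_ge0. Qed.

Lemma kerC x y : ker x y = ker y x.
Proof. by rewrite /ker distrC module_distC. Qed.

Lemma mfun_ker : mfun (fun z : B * B => ker z.1 z.2).
Proof.
have m1 : mfun (fun z : B * B => z.1) by exact: measurable_fst.
have m2 : mfun (fun z : B * B => z.2) by exact: measurable_snd.
apply: mfun_prod.
  apply: (mfun_comp (@normr_measurable R setT)); apply: measurable_funB.
    exact: (mfun_comp mfun_ell m2).
  exact: (mfun_comp mfun_ell m1).
apply: meas_invr => [|x]; last exact: module_ge0.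
by apply: (mfun_comp mfun_module); exact: (mfun_sub lh).
Qed.

Definition kerC1 : R := fine (\int[mu]_v (ker1 v)%:E)%E.

Lemma kerC1_ge0 : 0 <= kerC1.
Proof. by apply: fine_ge0; apply: integral_ge0 => v _; rewrite lee_fin ker1_ge0. Qed.

(* The kernel is homogeneous of degree -1, so Schur's test with the weight
   |x|^(1/2) reduces to a single one-variable integral. *)
Lemma ker_schur y : y != 0 ->
  (\int[mu]_x (ker x y * (Num.sqrt (md y) / Num.sqrt (md x)))%:E = kerC1%:E)%E.
Proof.
move=> y0; have m0 := module_gt0 lh y0.
have kf : (\int[mu]_v (ker1 v)%:E = kerC1%:E)%E.
  rewrite /kerC1 fineK// ge0_fin_numE ?ker1_int//.
  by apply: integral_ge0 => v _; rewrite lee_fin ker1_ge0.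
have yi0 : y^-1 != 0 by rewrite invr_eq0.
have := int_scale lh (f := fun v => (ker1 v)%:E) yi0.
rewrite kf (moduleV lh) invrK => h.
transitivity (\int[mu]_x ((md y)^-1%:E * (ker1 (y^-1 * x : K))%:E))%E.
  apply: eq_integral => x _; rewrite -EFinM; congr (_%:E).
  have [->|x0] := eqVneq (x : K) 0.
    by rewrite (module0 lh) sqrtr0 invr0 !mulr0 /ker1 ell0 normr0 !mul0r mulr0.
  rewrite /ker /ker1 ellM// ellV distrC [- _ + _]addrC.
  have -> : 1 - y^-1 * x = y^-1 * (y - x) by rewrite mulrBr mulVf.
  rewrite !(moduleM lh) (moduleV lh) sqrtrM ?invr_ge0 ?module_ge0// sqrtrV ?module_ge0//.
  rewrite !invfM !invrK; have -> : `|ell x - ell y| / md (y - x) * (Num.sqrt (md y) / Num.sqrt (md x)) = (md y)^-1 * md y * (`|ell x - ell y| / md (y - x) * (Num.sqrt (md y) / Num.sqrt (md x))).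
    by rewrite mulVf ?gt_eqF// mul1r.
  by ring.
have mk : mfun (fun x : B => (ker1 (y^-1 * x : K))%:E).
  apply/measurable_EFinP; apply: (mfun_comp mfun_ker1).
  exact: (mfun_mul lh).
rewrite ge0_integralZl ?lee_fin ?invr_ge0 ?(ltW m0)//; last by move=> x _; rewrite lee_fin ker1_ge0.
rewrite h; last 2 first.
- by apply/measurable_EFinP; exact: mfun_ker1.
- by move=> x; rewrite lee_fin ker1_ge0.
by rewrite -!EFinM mulKf// gt_eqF.
Qed.

(** Inversion preserves dx/|x|. The proof needs only dilations: f(1/x) |x|^-1 g(xy) is integrated
    over x and y in both orders, and the indicator [g] of the punctured unit ball contributes the
    same factor [b1] to both results. *)
Lemma int_inv (f : B -> R) : mfun f -> (forall x, 0 <= f x) ->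
  (\int[mu]_x (f (x^-1 : K)%R * (md x)^-2)%:E = \int[mu]_x (f x)%:E)%E.
Proof.
(* Making the function vanish at 0 changes no integral and neutralises the convention [0^-1 = 0]. *)
move=> mf0 f00; pose f' (x : B) : R := f x * \1_(~` [set (0 : K)] : set B) x.
have m01 : measurable (~` [set (0 : K)] : set B).
  by apply: measurableC; exact: mfun_set1_borel.
have mi1 : mfun (\1_(~` [set (0 : K)] : set B) : B -> R).
  exact: measurable_indic.
have i1 (x : K) : x != 0 -> \1_(~` [set (0 : K)] : set B) x = 1 :> R.
  by move=> x0; rewrite indicE mem_set//=; apply/eqP.
have i0 : \1_(~` [set (0 : K)] : set B) (0 : K) = 0 :> R.
  by rewrite indicE memNset//= => /(_ erefl).
have -> : (\int[mu]_x (f x)%:E = \int[mu]_x (f' x)%:E)%E.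
  apply: ae_eq_integral => //.
  - exact/measurable_EFinP.
  - by apply/measurable_EFinP; exact: mfun_prod.
  - by apply: (@ae_neq0 (fun x => setT x -> _)) => x x0 _; rewrite /f' i1 ?mulr1.
transitivity (\int[mu]_x (f' (x^-1 : K) * (md x)^-2)%:E)%E.
  apply: eq_integral => x _; congr (_%:E); have [->|x0] := eqVneq (x : K) 0.
    by rewrite (module0 lh) expr0n /= !invr0 !mulr0.
  by rewrite /f' i1 ?mulr1// invr_neq0.
have mf : mfun f' by exact: mfun_prod.
have fp x : 0 <= f' x by rewrite mulr_ge0.
have f'0 : f' (0 : K) = 0 by rewrite /f' i0 mulr0.
move: f' mf fp f'0 => {mf0 f00}f mf f0 fz.
pose B1 := [set x : K | a x <= 1] : set B.
have mB1 : measurable B1 by exact: ball_measurable.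
pose g (x : B) : R := \1_B1 x * \1_(~` [set (0 : K)] : set B) x.
have mg : mfun g by apply: mfun_prod => //; exact: measurable_indic.
have g0 x : 0 <= g x by rewrite mulr_ge0.
pose b1 := fine (mu B1).
have b10 : 0 < b1 by rewrite fine_gt0// haar_ball_lty// haar_ball_gt0.
have gi : (\int[mu]_x (g x)%:E = b1%:E)%E.
  transitivity (\int[mu]_x (\1_B1 x)%:E)%E.
    apply: ae_eq_integral => //.
    - exact/measurable_EFinP.
    - by apply/measurable_EFinP; exact: measurable_indic.
    - by apply: (@ae_neq0 (fun x => setT x -> _)) => x x0 _; rewrite /g i1 ?mulr1.
  rewrite integral_indic// setIT fineK// ge0_fin_numE//; exact: haar_ball_lty.
have m1 : mfun (fun z : B * B => z.1) by exact: measurable_fst.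
have m2 : mfun (fun z : B * B => z.2) by exact: measurable_snd.
have mmd1 d (T : measurableType d) (h : T -> B) : mfun h ->
    mfun (fun x : T => (md (h x))^-1).
  move=> mh; apply: meas_invr => [|x]; last exact: module_ge0.
  exact: (mfun_comp mfun_module mh).
have mEF d (T : measurableType d) (h : T -> R) : mfun h ->
    mfun (fun x : T => (h x)%:E) by move=> ?; exact/measurable_EFinP.
have xy0 (x y : K) : 0 <= (f (x^-1 : K) * (md x)^-1) * g (x * y : K).
  by rewrite !mulr_ge0// invr_ge0 module_ge0.
have uy0 (x y : K) : 0 <= (g x * (md x)^-1) * f (x^-1 * y : K).
  by rewrite !mulr_ge0// invr_ge0 module_ge0.
have I1 (x : K) : (\int[mu]_y ((f (x^-1 : K) * (md x)^-1) * g (x * (y : K))%R)%:E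
    = (f (x^-1 : K) * (md x)^-2)%:E * b1%:E)%E.
  have [->|x0] := eqVneq x 0.
    rewrite (module0 lh) expr0n /= !invr0 !mulr0 mul0e; apply: integral0_eq => y _.
    by rewrite mul0r.
  rewrite ge0_intZ//; last 2 first.
  - by apply: (mfun_comp mg); exact: (mfun_mul lh).
  - by rewrite mulr_ge0// invr_ge0 module_ge0.
  rewrite (int_scale lh (f := fun y => (g y)%:E) x0)//; last exact: mEF.
  by rewrite gi !muleA -!EFinM expr2 invfM mulrA.
have I2 (u : K) : (\int[mu]_y ((g u * (md u)^-1) * f (u^-1 * (y : K))%R)%:E
    = (g u)%:E * \int[mu]_y (f y)%:E)%E.
  have [->|u0] := eqVneq u 0.
    rewrite /g i0 mulr0 mul0e; apply: integral0_eq => y _; by rewrite !mul0r.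
  have ui0 : u^-1 != 0 by rewrite invr_eq0.
  rewrite ge0_intZ//; last 2 first.
  - by apply: (mfun_comp mf); exact: (mfun_mul lh).
  - by rewrite mulr_ge0// invr_ge0 module_ge0.
  rewrite (int_scale lh (f := fun y => (f y)%:E) ui0)//; last exact: mEF.
  rewrite (moduleV lh) invrK muleA -EFinM -mulrA mulVf ?mulr1//.
  by rewrite gt_eqF// module_gt0.
have I3 (y : K) : (\int[mu]_x ((f (x^-1 : K)%R * (md x)^-1) * g ((x : K) * y)%R)%:E
    = \int[mu]_u ((g u * (md u)^-1) * f ((u : K)^-1 * y)%R)%:E)%E.
  have [->|y0] := eqVneq y 0.
    rewrite [LHS]integral0_eq => [|x _]; last by rewrite mulr0 /g i0 !mulr0.
    by rewrite integral0_eq// => x _; rewrite mulr0 fz mulr0.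
  have yi0 : y^-1 != 0 by rewrite invr_eq0.
  have mh : mfun (fun x : B => ((f (x^-1 : K)%R * (md x)^-1) * g ((x : K) * y)%R)%:E).
    apply: mEF; apply: mfun_prod; first apply: mfun_prod.
    - by apply: (mfun_comp mf); exact: mfun_inv_borel.
    - exact: mmd1.
    - by apply: (mfun_comp mg); exact: (mfun_mul lh).
  have := int_scale lh yi0 mh (fun x => xy0 x y).
  rewrite (moduleV lh) invrK => h.
  have my : md y != 0 by rewrite module_eq0.
  have := congr1 (fun z => (md y)^-1%:E * z)%E h.
  rewrite muleA -EFinM mulVf// mul1e => <-.
  rewrite -ge0_integralZl//; last 3 first.
  - apply: mEF; apply: mfun_prod; first apply: mfun_prod.
    + apply: (mfun_comp mf); apply: mfun_inv; exact: (mfun_mul lh).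
    + by apply: mmd1; exact: (mfun_mul lh).
    + apply: (mfun_comp mg); apply: (mfun_mul lh) => //; exact: (mfun_mul lh).
  - by move=> x _; rewrite lee_fin.
  - by rewrite lee_fin invr_ge0 module_ge0.
  apply: eq_integral => u _; rewrite -EFinM; congr (_%:E).
  have -> : y^-1 * (u : K) * y = u by rewrite mulrAC mulVf// mul1r.
  have -> : (y^-1 * (u : K))^-1 = (u : K)^-1 * y by rewrite invfM invrK mulrC.
  rewrite (moduleM lh) (moduleV lh) invfM invrK.
  set F := f _; set G := g _; set m := (md u)^-1.
  have -> : (md y)^-1 * (F * (md y * m) * G) = (md y)^-1 * md y * (G * m * F) by ring.
  by rewrite mulVf// mul1r.
have swp1 : mfun (fun z : B * B =>
    (f ((z.1 : K)^-1 : K) * (md z.1)^-1) * g ((z.1 : K) * z.2 : K)).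
  apply: mfun_prod; first apply: mfun_prod.
  - by apply: (mfun_comp mf); exact: (mfun_inv m1).
  - exact: mmd1.
  - by apply: (mfun_comp mg); exact: (mfun_mul lh).
have swp2 : mfun (fun z : B * B =>
    (g z.1 * (md z.1)^-1) * f ((z.1 : K)^-1 * z.2 : K)).
  apply: mfun_prod; first apply: mfun_prod.
  - exact: (mfun_comp mg m1).
  - exact: mmd1.
  - by apply: (mfun_comp mf); apply: (mfun_mul lh) => //; exact: (mfun_inv m1).
have E1 : (\int[mu]_x ((f (x^-1 : K)%R * (md x)^-2)%:E * b1%:E) =
    \int[mu]_x ((g x)%:E * \int[mu]_y (f y)%:E))%E.
  transitivity (\int[mu]_x \int[mu]_y
      ((f (x^-1 : K)%R * (md x)^-1) * g ((x : K) * y)%R)%:E)%E.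
    by apply: eq_integral => x _; rewrite I1.
  rewrite (tonelli2 (g := fun x y : B =>
    (f ((x : K)^-1 : K) * (md x)^-1) * g ((x : K) * y : K)) mu swp1 xy0).
  transitivity (\int[mu]_y \int[mu]_u
      ((g u * (md u)^-1) * f ((u : K)^-1 * y)%R)%:E)%E.
    by apply: eq_integral => y _; exact: I3.
  by rewrite -(tonelli2 (g := fun x y : B =>
    (g x * (md x)^-1) * f ((x : K)^-1 * y : K)) mu swp2 uy0); apply: eq_integral => u _; exact: I2.
have mL : mfun (fun x : B => f (x^-1 : K) * (md x)^-2).
  apply: mfun_prod; first by apply: (mfun_comp mf); exact: mfun_inv_borel.
  apply: meas_invr => [|x]; last by rewrite exprn_ge0// module_ge0.
  by apply: measurable_funX; exact: mfun_module.
have L0 (x : B) : 0 <= f (x^-1 : K) * (md x)^-2.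
  by rewrite mulr_ge0// invr_ge0 exprn_ge0// module_ge0.
rewrite (ge0_intZr mu mL L0) ?lee_fin ?(ltW b10)// (ge0_intZr mu mg g0) ?gi in E1; last first.
  by apply: integral_ge0 => x _; rewrite lee_fin.
rewrite [RHS]muleC in E1.
have := congr1 (fun z => z * (b1^-1)%:E)%E E1.
by rewrite -!muleA -EFinM mulfV ?gt_eqF// !mule1.
Qed.

End HaarIntegrals.

(** * Change of variables for complex integrals *)

Section ChangeOfVariables.
Context d (T : measurableType d) {R : realType} (mu : {measure set T -> \bar R}).
Variables (phi : T -> T) (rho : T -> R) (c : R).
Hypotheses (mphi : mfun phi) (mrho : mfun rho).
Hypotheses (rho0 : forall x, 0 <= rho x) (c0 : 0 <= c).
Hypothesis cov : forall f : T -> R, mfun f -> (forall x, 0 <= f x) ->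
  (\int[mu]_x (f (phi x) * rho x)%:E = c%:E * \int[mu]_x (f x)%:E)%E.

Lemma cov_real (f : T -> R) : mfun f ->
  (\int[mu]_x `|f x|%:E < +oo)%E ->
  \int[mu]_x (f (phi x) * rho x) = c * \int[mu]_x f x.
Proof.
move=> mf fi; rewrite /Rintegral integralE [X in _ = _ * fine X]integralE.
pose fp x := Num.max (f x) 0; pose fn x := Num.max (- f x) 0.
have mfp : mfun fp by apply: measurable_maxr.
have mfn : mfun fn by apply: measurable_maxr => //; exact: measurable_funN.
have fp0 x : 0 <= fp x by rewrite le_max lexx orbT.
have fn0 x : 0 <= fn x by rewrite le_max lexx orbT.
have e1 : (\int[mu]_x (EFin \o f)^\+ x = \int[mu]_x (fp x)%:E)%E.
  by apply: eq_integral => x _; rewrite funepos.unlock /= -EFin_max.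
have e2 : (\int[mu]_x (EFin \o f)^\- x = \int[mu]_x (fn x)%:E)%E.
  by apply: eq_integral => x _; rewrite funeneg.unlock /= -EFin_max.
have e3 : (\int[mu]_x (EFin \o (fun x => f (phi x) * rho x)%R)^\+ x = c%:E * \int[mu]_x (fp x)%:E)%E.
  rewrite -cov//; apply: eq_integral => x _; rewrite funepos.unlock /= -EFin_max.
  by rewrite /fp maxr_pMl// mul0r.
have e4 : (\int[mu]_x (EFin \o (fun x => f (phi x) * rho x)%R)^\- x = c%:E * \int[mu]_x (fn x)%:E)%E.
  rewrite -cov//; apply: eq_integral => x _; rewrite funeneg.unlock /= -EFin_max.
  by rewrite /fn maxr_pMl// mul0r mulNr.
have i1 : (\int[mu]_x (fp x)%:E < +oo)%E.
  apply: le_lt_trans fi; apply: ge0_int_le => //.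
    exact: mfun_comp (@normr_measurable R setT) mf.
  by move=> x; rewrite ge_max ler_norm normr_ge0.
have i2 : (\int[mu]_x (fn x)%:E < +oo)%E.
  apply: le_lt_trans fi; apply: ge0_int_le => //.
    exact: mfun_comp (@normr_measurable R setT) mf.
  by move=> x; rewrite ge_max ler_normr lexx orbT normr_ge0.
have j1 : (0 <= \int[mu]_x (fp x)%:E)%E by apply: integral_ge0 => x _; rewrite lee_fin.
have j2 : (0 <= \int[mu]_x (fn x)%:E)%E by apply: integral_ge0 => x _; rewrite lee_fin.
move: e1 e2 e3 e4 => /= -> -> -> ->.
have k1 : (\int[mu]_x (fp x)%:E)%E \is a fin_num by rewrite ge0_fin_numE.
have k2 : (\int[mu]_x (fn x)%:E)%E \is a fin_num by rewrite ge0_fin_numE.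
by rewrite -(fineK k1) -(fineK k2) -!EFinM -!EFinB /= mulrBr.
Qed.

Lemma cov_cint (f : T -> R[i]) : cinteg mu f ->
  cinteg mu (fun x => f (phi x) * (rho x)%:C%C) /\
  cint mu (fun x => f (phi x) * (rho x)%:C%C) = c%:C%C * cint mu f.
Proof.
move=> fi; have [mf ff] := fi; split.
  split; first by apply: cmeasM; [exact: cmeas_comp|exact: cmeasR].
  rewrite (eq_integral (fun x => (cabs (f (phi x)) * rho x)%:E)); last first.
    by move=> x _; rewrite cabsM cabs_real.
  rewrite (cov (f := fun x => cabs (f x)))//; last 2 first.
  - exact: cmeas_cabs.
  - by move=> x; exact: cabs_ge0.
  by apply: lte_mul_pinfty.
have rint (h : T -> R) : mfun h -> (forall x, `|h x| <= cabs (f x)) ->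
    \int[mu]_x (h (phi x) * rho x) = c * \int[mu]_x h x.
  move=> mh hf; apply: cov_real => //; apply: le_lt_trans ff.
  apply: ge0_int_le => //; last exact: cmeas_cabs.
  exact: mfun_comp (@normr_measurable R setT) mh.
apply: ReIm_eq; rewrite ?ReM ?ImM /cint /= !mul0r ?subr0 ?addr0 -rint.
- by congr Rintegral; apply/funext => x; rewrite ReM /= mulr0 subr0.
- exact: mf.1.
- by move=> x; exact: Re_le_cabs.
- by congr Rintegral; apply/funext => x; rewrite ImM /= mulr0 add0r.
- exact: mf.2.
- by move=> x; exact: Im_le_cabs.
Qed.

End ChangeOfVariables.

(** * Flat functions and smoothness at archimedean places *)

Section ExpFlat.
Context {R : realType}.
Implicit Types (P : {poly R}) (t x : R).

Lemma pow_exp_bounded n : exists C : R, forall x, 0 <= x -> x ^+ n * expR (- x) <= C.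
Proof.
case: n => [|n]; first by exists 1 => x x0; rewrite mul1r expR_le1 oppr_le0.
exists (n.+1)`!%:R => x x0; rewrite expRN ler_pdivrMr ?expR_gt0//.
have f0 : 0 < (n.+1)`!%:R :> R by rewrite ltr0n fact_gt0.
by rewrite mulrC -ler_pdivrMr//; apply: le_trans (expR_ge1Dxn n x0); rewrite lerDr.
Qed.

Lemma poly_exp_bounded P : exists C : R, forall x, 0 <= x -> `|P.[x]| * expR (- x) <= C.
Proof.
have /choice[C HC] := pow_exp_bounded.
exists (\sum_(i < size P) `|P`_i| * C i) => x x0; rewrite horner_coef.
apply: le_trans (ler_wpM2r (expR_ge0 _) (ler_norm_sum _ _ _)) _.
rewrite mulr_suml; apply: ler_sum => i _.
by rewrite normrM -mulrA ler_wpM2l// ger0_norm ?exprn_ge0//; exact: HC.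
Qed.

(** The flat functions P(1/t) exp(-1/t). The polynomial factor closes the family under derivation,
    which acts on it by [pexp_next]. *)
Definition pexp P t : R := if 0 < t then P.[t^-1] * expR (- t^-1) else 0.

Lemma pexp_bound P : exists C : R, forall t, `|pexp P t| <= C * t ^+ 2.
Proof.
have [C HC] := poly_exp_bounded ('X^2 * P); exists C => t; rewrite /pexp.
have C0 : 0 <= C.
  by apply: le_trans (HC 0 (lexx _)); rewrite mulr_ge0 ?expR_ge0.
case: ltP => t0; last by rewrite normr0 mulr_ge0// sqr_ge0.
have := HC t^-1; rewrite invr_ge0 (ltW t0) => /(_ isT).
rewrite hornerM hornerXn normrM -mulrA exprVn ger0_norm ?invr_ge0 ?exprn_ge0 ?(ltW t0)//.
rewrite mulrC ler_pdivrMr ?exprn_gt0// normrM.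
by rewrite (ger0_norm (expR_ge0 _)).
Qed.

Definition pexp_next P : {poly R} := 'X^2 * (P - P^`()).

Lemma is_derive_pexp P t : is_derive t 1 (pexp P) (pexp (pexp_next P) t).
Proof.
have [t0|t0|t0] := ltgtP t 0.
- have -> : pexp (pexp_next P) t = 0 by rewrite /pexp ltNge (ltW t0).
  have d0 : is_derive t 1 (cst 0 : R -> R) 0 by exact: is_derive_cst.
  apply: near_eq_is_derive d0.
  near=> u; rewrite /pexp ltNge (_ : u <= 0)//.
  by apply: ltW; near: u; exact: lt_nbhsl.
- have dI : is_derive t 1 (id : R -> R) 1 by exact: is_derive_id.
  have dV : is_derive t 1 (fun u : R => u^-1) (- (t ^- 2)).
    have := @is_deriveV R id t 1 1 _ dI; rewrite /GRing.scale /= mulr1; apply.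
    by rewrite gt_eqF.
  have dPV := @is_derive1_comp _ (horner P) (fun u : R => u^-1) t _ _ (is_derive_poly P _) dV.
  have dE := @is_derive1_comp _ expR (fun u : R => - u^-1) t _ _ (is_derive_expR _) (is_deriveN dV).
  have dM := is_deriveM dPV dE.
  have -> : pexp (pexp_next P) t = (horner P \o (fun u : R => u^-1)) t *:
      (expR (- t^-1) * - - (t ^- 2)) + (expR \o (fun u : R => - u^-1)) t *: (P^`().[t^-1] * - (t ^- 2)).
    by rewrite /pexp t0 /pexp_next hornerM hornerXn hornerD hornerN exprVn /GRing.scale /=; ring.
  apply: near_eq_is_derive dM; near=> u; rewrite /pexp (_ : 0 < u)//.
  by near: u; exact: lt_nbhsr.
(* At 0 the bound by [C * t ^+ 2] forces the difference quotient to tend to 0. *)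
rewrite t0; have -> : pexp (pexp_next P) 0 = 0 by rewrite /pexp ltxx.
have [C HC] := pexp_bound P.
have p0 : pexp P 0 = 0 by rewrite /pexp ltxx.
have C0 : 0 <= C by have := HC 1; rewrite expr1n mulr1; apply: le_trans.
have lim : h^-1 *: (pexp P (h *: 1 + 0) - pexp P 0) @[h --> 0^'] --> 0.
  apply/cvgrPdist_lt => e e0; rewrite /= p0; near=> h.
  rewrite subr0 sub0r normrN addr0 /GRing.scale /= mulr1 normrM normfV.
  have h0 : 0 < `|h| by rewrite normr_gt0; near: h; exact: nbhs_dnbhs_neq.
  rewrite mulrC ltr_pdivrMr//; apply: le_lt_trans (HC h) _.
  rewrite -real_normK ?num_real// expr2 mulrA ltr_pM2r//.
  apply: (@le_lt_trans _ _ ((C + 1) * `|h|)); first by rewrite ler_wpM2r// lerDl.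
  rewrite mulrC -ltr_pdivlMr ?ltr_wpDl//.
  by near: h; apply: dnbhs0_lt; rewrite divr_gt0// ltr_wpDl.
apply: DeriveDef; first by apply/cvg_ex; exists 0.
exact/cvg_lim.
Unshelve. all: by end_near.
Qed.

End ExpFlat.

(* Real coordinates on an archimedean completion, for a basis over the closure of Q. *)
Record arch_coords {R : realType} {K : valuedFieldType R} (n : nat) (e : nat -> K)
    (co : nat -> K -> R) (s C : R) : Prop := {
  ac_s : 0 < s ;
  ac_C : 0 < C ;
  ac_abs : forall r : R, absv (of_real K r) = `|r| `^ s ;
  ac_sum : forall x, x = \sum_(i < n) of_real K (co i x) * e i ;
  ac_line : forall i x h (t : R), (i < n)%N ->
    co i (x + of_real K t * h) = co i x + t * co i h ;
  ac_sub : forall i x y, (i < n)%N -> co i (x - y) = co i x - co i y ;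
  ac_le : forall i x, (i < n)%N -> `|co i x| `^ s <= C * absv x ;
  ac_realD : forall r t : R, of_real K (r + t) = of_real K r + of_real K t
}.

(** Coordinates are obtained by choice; freeness of the basis makes them unique, and uniqueness
    makes them real linear. *)
Lemma completion_coords {R : realType} {F : fieldExtType rat} {K : valuedFieldType R}
    (iota : {rmorphism F -> K}) : is_completion iota -> ~ finite_place K ->
  exists n e co s C, @arch_coords R K n e co s C.
Proof.
move=> iotaC arch.
have cpl := completion_cauchy iotaC.
have rD := completion_ratrD iota; have rM := completion_ratrM iota.
have rN := completion_ratrN iota.
have [s s0 as_] := ostrowski arch.
have [n [e [C [fr [C0 bd] sp]]]] := completion_basis iotaC.
have /choice[c cP] : forall x, exists c : nat -> K,
    (forall i, prime_completion (c i)) /\ x = \sum_(i < n) c i * e i.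
  by move=> x; have [c c1 c2] := sp x; exists c.
have c1 x i : prime_completion (c x i) by have [] := cP x.
have c2 x : x = \sum_(i < n) c x i * e i by have [] := cP x.
have cuniq x (d : nat -> K) i : (forall i, prime_completion (d i)) ->
    x = \sum_(i < n) d i * e i -> (i < n)%N -> c x i = d i.
  move=> dP xd ilt; apply/eqP; rewrite -subr_eq0; apply/eqP.
  apply: (fr (fun i => c x i - d i)) => //.
    by move=> j; apply: (@primeB _ _ rD rM).
  apply/eqP; under eq_bigr do rewrite mulrBl.
  by rewrite sumrB -c2 -xd subrr.
have rK := @real_ofK _ _ cpl rD rN s s0 as_.
exists n, e, (fun i x => real_of (c x i)), s, C; split => //.
- exact: (absv_of_real cpl rD rN s0 as_).
- by move=> x; rewrite {1}(c2 x); apply: eq_bigr => i _; rewrite rK.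
- move=> i x h t ilt.
  have tP : prime_completion (of_real K t) by exact: (@prime_of_real _ _ cpl rD rN s s0 as_).
  have thP : prime_completion (of_real K t * c h i) by exact: (@primeM _ _ rM).
  rewrite (@cuniq _ (fun i => c x i + of_real K t * c h i))//.
  + rewrite (@real_ofD _ _ cpl rD rN s s0 as_)//; congr (_ + _).
    have -> : c h i = of_real K (real_of (c h i)) by rewrite rK.
    rewrite -(@of_realM _ _ cpl rD rM rN s s0 as_).
    by rewrite !(@of_realK _ _ cpl rD rN s s0 as_).
  + by move=> j; apply: (@primeD _ _ rD) => //; exact: (@primeM _ _ rM).
  + rewrite {1}(c2 x) {1}(c2 h) mulr_sumr -big_split /=.
    by apply: eq_bigr => j _; rewrite mulrDl mulrA.
- move=> i x y ilt; rewrite (@cuniq _ (fun i => c x i - c y i))//.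
  + have := @real_ofD _ _ cpl rD rN s s0 as_ (c x i - c y i) (c y i).
    rewrite subrK => ->//; first by rewrite addrK.
    by apply: (@primeB _ _ rD rM).
  + by move=> j; apply: (@primeB _ _ rD rM).
  + rewrite {1}(c2 x) {1}(c2 y) -sumrB.
    by apply: eq_bigr => j _; rewrite mulrBl.
- move=> i x ilt; rewrite -(@real_of_absv _ _ rD rN s s0 as_)// {2}(c2 x).
  exact: bd.
- exact: (of_realD cpl rD rN s0 as_).
Qed.

Section Smooth.
Context {R : realType} {K : valuedFieldType R}.
Notation a := (@absv R K).
Variables (n : nat) (e : nat -> K) (co : nat -> K -> R) (s C : R).
Hypothesis ac : arch_coords n e co s C.

(* A class of smooth functions that is visibly stable under derivation. *)
Inductive Smooth : (K -> R) -> Prop :=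
| Smooth_cst c : Smooth (fun _ => c)
| Smooth_flat P i c d : (i < n)%N -> Smooth (fun x => pexp P (c + d * co i x))
| Smooth_expN g : Smooth g -> Smooth (fun x => expR (- g x))
| SmoothD f g : Smooth f -> Smooth g -> Smooth (fun x => f x + g x)
| SmoothM f g : Smooth f -> Smooth g -> Smooth (fun x => f x * g x).

Lemma co_continuous i : (i < n)%N -> continuous (co i : K -> R).
Proof.
move=> ilt; apply/continuous_realP => x r r0.
have s0 := ac_s ac; have C0 := ac_C ac.
have rs : 0 < r `^ s by exact: powR_gt0.
exists (r `^ s / C); first exact: divr_gt0.
move=> y; rewrite ltr_pdivlMr// mulrC => h.
have := le_lt_trans (ac_le ac (x - y) ilt) h; rewrite (ac_sub ac)// => h'.
rewrite ltNge; apply/negP => h2; move: h'; rewrite ltNge => /negP; apply.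
by apply: ge0_ler_powR; rewrite ?nnegrE// ltW.
Qed.

Lemma of_real_line0 x h : x + of_real K 0 * h = x.
Proof.
have := ac_realD ac 0 0; rewrite addr0 => h0.
have -> : of_real K 0 = 0 by apply: (addIr (of_real K 0)); rewrite add0r -h0.
by rewrite mul0r addr0.
Qed.

Lemma Smooth_facts g : Smooth g -> continuous g /\
  forall h, exists2 g', Smooth g' &
    forall x (t : R), is_derive t (1 : R) (line g x h) (g' (x + of_real K t * h)).
Proof.
elim=> {g}[c|P i c d ilt|g sg [cg dg]|f g sf [cf df] sg [cg dg]|f g sf [cf df] sg [cg dg]].
- split=> [x|h]; first exact: cvg_cst.
  by exists (fun _ => 0); [exact: Smooth_cst|move=> x t; exact: is_derive_cst].
- split=> [x|h].
    have cp : {for c + d * co i x, continuous (pexp P)}.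
      by apply: differentiable_continuous; apply/derivable1_diffP; have [] := is_derive_pexp P (c + d * co i x).
    apply: (continuous_comp (f := fun x => c + d * co i x)) cp.
    apply: cvgD; first exact: cvg_cst.
    by apply: cvgM; [exact: cvg_cst|exact: co_continuous].
  exists (fun x => pexp (pexp_next P) (c + d * co i x) * (d * co i h)).
    by apply: SmoothM; [exact: Smooth_flat|exact: Smooth_cst].
  move=> x t; rewrite (ac_line ac)//.
  have -> : line (fun x => pexp P (c + d * co i x)) x h =
     pexp P \o (fun t : R => c + d * (co i x + t * co i h)).
    by apply/funext => u; rewrite /line /= (ac_line ac).
  apply: is_derive1_comp; first exact: is_derive_pexp.
  apply: is_derive_eq; rewrite /GRing.scale /= ?mulr1 ?add0r ?addr0 ?mulr0 ?addr0//.
  by rewrite !mul1r add0r.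
- split=> [x|h].
    apply: (continuous_comp (f := fun x => - g x) (g := expR)); first by apply: cvgN; exact: cg.
    exact: continuous_expR.
  have [g' sg' dg'] := dg h; exists (fun x => expR (- g x) * (- 1 * g' x)).
    by apply: SmoothM; [exact: Smooth_expN|apply: SmoothM => //; exact: Smooth_cst].
  move=> x t; rewrite mulN1r.
  exact: (is_derive1_comp (f := expR) (g := fun t => - line g x h t)).
- split=> [x|h]; first by apply: cvgD; [exact: cf|exact: cg].
  have [f' sf' df'] := df h; have [g' sg' dg'] := dg h.
  exists (fun x => f' x + g' x); first exact: SmoothD.
  by move=> x t; exact: is_deriveD.
split=> [x|h]; first by apply: cvgM; [exact: cf|exact: cg].
have [f' sf' df'] := df h; have [g' sg' dg'] := dg h.
exists (fun x => f x * g' x + g x * f' x).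
  by apply: SmoothD; exact: SmoothM.
by move=> x t; exact: is_deriveM.
Qed.

Lemma Smooth_derive g h : Smooth g -> Smooth (dir_derive h g) /\
  forall x, derivable (line g x h) 0 1.
Proof.
move=> /Smooth_facts[_ /(_ h)[g' sg' dg']]; split; last by move=> x; have [] := dg' x 0.
rewrite (_ : dir_derive h g = g')//; apply/funext => x.
by rewrite /dir_derive derive1E (@derive_val _ _ _ _ _ _ _ (dg' x 0)) of_real_line0.
Qed.

Lemma dir_derive_supp g h (r : R) : (forall x, r < a x -> g x = 0) ->
  forall x, r < a x -> dir_derive h g x = 0.
Proof.
move=> g0 x rx; rewrite /dir_derive derive1E.
suff : is_derive (0 : R) 1 (line g x h) 0 by move=> d; rewrite derive_val.
have d0 : is_derive (0 : R) 1 (cst 0 : R -> R) 0 by exact: is_derive_cst.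
apply: near_eq_is_derive d0.
(* With [a (of_real K t) < m] the displacement [of_real K t * h] is shorter than [a x - r], so the
   line stays where [g] vanishes. *)
have s0 := ac_s ac; pose m := (a x - r) / (a h + 1).
have ah : 0 < a h + 1 by rewrite ltr_wpDl// absv_ge0.
have m0 : 0 < m by rewrite divr_gt0// subr_gt0.
have sm0 : 0 < m `^ s^-1 by exact: powR_gt0.
near=> t; rewrite /line /= g0//.
have tm : `|t| < m `^ s^-1 by near: t; apply/nbhs_ballP; exists (m `^ s^-1) => //= u; rewrite /ball /= sub0r normrN.
have at_ : a (of_real K t) < m.
  rewrite (ac_abs ac) -[ltRHS](powRr1 (ltW m0)) -(mulVf (lt0r_neq0 s0)) powRrM.
  by apply: gt0_ltr_powR; rewrite ?nnegrE// ltW.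
have := absv_dist_ge x (- (of_real K t * h)); rewrite opprK absvN => h1.
have h2 : a (of_real K t) * a h <= m * a h by rewrite ler_wpM2r ?absv_ge0// ltW.
have h3 : m * a h < a x - r.
  by rewrite /m mulrAC ltr_pdivrMr// ltr_pM2l ?subr_gt0// ltrDl.
have h4 := le_trans (ler_norm _) h1.
have := le_lt_trans h2 h3; rewrite absvM in h4; lra.
Unshelve. all: by end_near.
Qed.

End Smooth.

Lemma exists_inv_lt {R : realType} (e : R) : 0 < e -> exists m : nat, m.+1%:R^-1 < e.
Proof.
move=> e0; have ei0 : 0 < e^-1 by rewrite invr_gt0.
exists (Num.bound e^-1); rewrite -[ltRHS]invrK ltf_pV2 ?posrE//.
by apply: lt_le_trans (archi_boundP (ltW ei0)) _; rewrite ler_nat.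
Qed.

(** * Test functions supported in annuli *)

Section TestFunctions.
Context {R : realType} {K : valuedFieldType R}.
Notation a := (@absv R K).
Hypothesis compact_ball : forall r : R, compact [set x : K | a x <= r].
Variables (n : nat) (e : nat -> K) (co : nat -> K -> R) (s C : R).
Hypothesis ac : ~ finite_place K -> arch_coords n e co s C.

Lemma continuous_bounded_ball (g : K -> R) r : continuous g ->
  exists M : R, forall x, a x <= r -> `|g x| <= M.
Proof.
move=> cg; have cK : compact (g @` [set x | a x <= r]).
  by apply: continuous_compact (@compact_ball r); exact: continuous_subspaceT.
have [M [_ MP]] := compact_bounded cK.
exists (M + 1) => x xr; apply: (MP (M + 1)); first by rewrite ltrDl.
by exists x.
Qed.

Lemma closed_ball_absv (r : R) : closed [set x : K | a x <= r].
Proof.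
rewrite (_ : [set x | _] = a @^-1` [set t | t <= r]); last by [].
apply: preimage_closed; first by move=> x _; exact: continuous_absv.
exact: closed_le.
Qed.

Lemma compact_closure_bounded (A : set K) r : (forall x, A x -> a x <= r) ->
  compact (closure A).
Proof.
move=> h; apply: (@subclosed_compact _ _ [set x | a x <= r]); [exact: closed_closure|exact: compact_ball|].
have := @closure_subset _ A [set x | a x <= r] h.
by rewrite -(proj1 (closure_id _) (closed_ball_absv (r := r))).
Qed.

Definition annular (A : set K) : Prop := exists2 eps : R, 0 < eps &
  exists r : R, forall x, A x -> eps <= a x <= r.

Definition test (g : K -> R) : Prop :=
  [/\ annular [set x | g x != 0],
      finite_place K -> forall x, \forall y \near x, g y = g x
    & ~ finite_place K -> Smooth n co g].

Lemma annular_sub (A A' : set K) : A `<=` A' -> annular A' -> annular A.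
Proof. by move=> AA' [eps e0 [r H]]; exists eps => //; exists r => x /AA'/H. Qed.

Lemma annularU (A A' : set K) : annular A -> annular A' -> annular (A `|` A').
Proof.
move=> [e1 e10 [r1 H1]] [e2 e20 [r2 H2]].
exists (Num.min e1 e2); first by rewrite lt_min e10.
exists (Num.max r1 r2) => x [/H1|/H2]/andP[h1 h2].
  by rewrite ge_min le_max h1 h2.
by rewrite ge_min le_max h1 h2 !orbT.
Qed.

Lemma annular0 : annular set0.
Proof. by exists 1 => //; exists 0. Qed.

Lemma test0 : test (fun _ => 0).
Proof.
split; last by move=> _; exact: Smooth_cst.
  by apply: annular_sub annular0 => x /=; rewrite eqxx.
by move=> _ x; apply: nearW.
Qed.

Lemma testD f g : test f -> test g -> test (fun x => f x + g x).
Proof.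
move=> [f1 f2 f3] [g1 g2 g3]; split.
- apply: annular_sub (annularU f1 g1) => x /= h; apply: contrapT => /not_orP[].
  by move=> /negP/negPn/eqP p1 /negP/negPn/eqP p2; move: h; rewrite p1 p2 addr0 eqxx.
- move=> fin x; near=> y; rewrite (_ : f y = f x) 1?(_ : g y = g x)//; near: y; [exact: g2|exact: f2].
- by move=> arch; apply: SmoothD; [exact: f3|exact: g3].
Unshelve. all: by end_near. Qed.

Lemma testM f g : test f -> test g -> test (fun x => f x * g x).
Proof.
move=> [f1 f2 f3] [g1 g2 g3]; split.
- by apply: annular_sub f1 => x /=; apply: contraNneq => ->; rewrite mul0r.
- move=> fin x; near=> y; rewrite (_ : f y = f x) 1?(_ : g y = g x)//; near: y; [exact: g2|exact: f2].
- by move=> arch; apply: SmoothM; [exact: f3|exact: g3].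
Unshelve. all: by end_near. Qed.

Lemma testZ c g : test g -> test (fun x => c * g x).
Proof.
move=> [g1 g2 g3]; split.
- by apply: annular_sub g1 => x /=; apply: contraNneq => ->; rewrite mulr0.
- by move=> fin x; near=> y; rewrite (_ : g y = g x)//; near: y; exact: g2.
- by move=> arch; apply: SmoothM; [exact: Smooth_cst|exact: g3].
Unshelve. all: by end_near. Qed.

Lemma test_schwartz g : ~ finite_place K -> test g -> schwartz g.
Proof.
move=> arch [[eps e0 [r H]] _ /(_ arch) sg] hs.
have g0 x : r < a x -> g x = 0.
  by move=> rx; apply/eqP; apply: contraTT rx => /H/andP[_]; rewrite -leNgt.
have {sg g0}[sD D0] : Smooth n co (foldr (@dir_derive R K) g hs) /\
    forall x, r < a x -> foldr (@dir_derive R K) g hs x = 0.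
  elim: hs => [//|h hs [IH1 IH2]] /=; split.
    by have [] := Smooth_derive (ac arch) h IH1.
  exact: (dir_derive_supp (ac arch)).
have [cD _] := Smooth_facts (ac arch) sD; split => //=.
  by move=> x h; have [] := Smooth_derive (ac arch) h sD.
move=> m; have [M HM] := continuous_bounded_ball r cD.
exists (`|r| ^+ m * `|M|) => x; have [xr|xr] := lerP (a x) r; last first.
  by rewrite D0// normr0 mulr0 mulr_ge0 ?exprn_ge0.
apply: (@le_trans _ _ (`|r| ^+ m * M)); last by rewrite ler_wpM2l ?exprn_ge0// ler_norm.
by apply: ler_pM => //; [rewrite exprn_ge0// absv_ge0|rewrite lerXn2r ?nnegrE ?absv_ge0// (le_trans xr)// ler_norm|exact: HM].
Qed.

Lemma test_S0 f g : test f -> test g -> S0 (fun x => (f x +i* g x)%C).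
Proof.
move=> tf tg; have [f1 f2 _] := tf; have [g1 g2 _] := tg.
have [eps e0 [r H]] := annularU f1 g1.
have H' x : (f x +i* g x)%C != 0 -> eps <= a x <= r.
  move=> h; apply: H; apply: contrapT => /not_orP[].
  move=> /negP/negPn/eqP p1 /negP/negPn/eqP p2; move: h.
  by rewrite p1 p2 eqxx.
have cs : compactly_supported (fun x : K => (f x +i* g x)%C).
  by apply: (@compact_closure_bounded _ r) => x /H'/andP[].
split => //.
  rewrite /schwartz_bruhat; case: asboolP => fin.
    split=> // x; near=> y; congr (_ +i* _)%C; near: y; [exact: f2|exact: g2].
  by split; exact: test_schwartz.
suff : nbhs (0 : K) [set x | (f x +i* g x)%C = 0] by [].
rewrite nbhsE; exists eps => //= x; rewrite sub0r absvN => xe.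
by apply/eqP; apply: contraTT xe => /H'/andP[h _]; rewrite -leNgt.
Unshelve. all: by end_near. Qed.

(** Sets whose indicator is a limit of test functions lying below it. They form a pi-system, the
    starting point for the approximation of arbitrary Borel sets. *)
Definition test_set (U : set K) : Prop := annular U /\ exists v : nat -> K -> R,
  [/\ forall k, test (v k), forall k x, 0 <= v k x <= \1_U x
    & forall x, v k x @[k --> \oo] --> (\1_U x : R)].

Lemma test_set0 : test_set set0.
Proof.
split; first exact: annular0.
exists (fun _ _ => 0); split; first by move=> _; exact: test0.
- by move=> _ x; rewrite indicE in_set0 lexx.
- by move=> x; rewrite indicE in_set0; exact: cvg_cst.
Qed.

Lemma test_setI U V : test_set U -> test_set V -> test_set (U `&` V).
Proof.
move=> [aU [u [u1 u2 u3]]] [_ [v [v1 v2 v3]]].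
split; first by apply: annular_sub aU => x [].
exists (fun k x => u k x * v k x); rewrite indicI.
split; first by move=> k; exact: testM.
- move=> k x; have /andP[a1 a2] := u2 k x; have /andP[b1 b2] := v2 k x.
  by rewrite mulr_ge0//= ler_pM.
- by move=> x; exact: cvgM.
Qed.

(** An ultrametric ball has a locally constant indicator. At an archimedean place a cube in the
    coordinates replaces it, since the coordinates enter the class [Smooth] directly. *)
Definition tbox (c : K) (m : nat) : set K :=
  if `[< finite_place K >] then [set y | a (y - c) < m.+1%:R^-1]
  else [set y | forall i, (i < n)%N -> `|co i (y - c)| < m.+1%:R^-1].

Lemma tbox_mem m : exists2 d : R, 0 < d & forall x c, a (x - c) < d -> tbox c m x.
Proof.
have m0 : 0 < m.+1%:R^-1 :> R by rewrite invr_gt0.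
rewrite /tbox; case: asboolP => fin; first by exists m.+1%:R^-1.
have s0 := ac_s (ac fin); have C0 := ac_C (ac fin).
exists ((m.+1%:R^-1) `^ s / C); first by rewrite divr_gt0// powR_gt0.
move=> x c; rewrite ltr_pdivlMr// mulrC => h i ilt.
have h' := le_lt_trans (ac_le (ac fin) (x - c) ilt) h.
rewrite ltNge; apply/negP => h2; move: h'; rewrite ltNge => /negP; apply.
by apply: ge0_ler_powR; rewrite ?nnegrE// ltW.
Qed.

Lemma tbox_small (eps : R) : 0 < eps -> exists m, forall c x y,
  tbox c m x -> tbox c m y -> a (x - y) < eps.
Proof.
move=> e0; rewrite /tbox; case: asboolP => fin.
  have [m mP] := exists_inv_lt (divr_gt0 e0 (ltr0Sn R 1)).
  exists m => c x y /= h1 h2; rewrite (splitr eps).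
  apply: le_lt_trans (absv_dist_trans c x y) _.
  by apply: ltrD; [|rewrite absv_distC]; apply: lt_trans mP.
have s0 := ac_s (ac fin).
pose A := \sum_(i < n) a (e i); have A0 : 0 <= A by apply: sumr_ge0 => i _; exact: absv_ge0.
have A1 : 0 < A + 1 by rewrite ltr_wpDl.
pose t := (eps / (A + 1)) `^ s^-1; have t0 : 0 < t by apply: powR_gt0; exact: divr_gt0.
have [m mP] := exists_inv_lt (divr_gt0 t0 (ltr0Sn R 1)).
exists m => c x y /= h1 h2.
have co_small i : (i < n)%N -> `|co i (x - y)| <= t.
  move=> ilt; have -> : x - y = (x - c) - (y - c) by rewrite opprB addrA subrK.
  rewrite (ac_sub (ac fin))//; apply: le_trans (ler_normB _ _) _.
  by rewrite (splitr t); apply: lerD; apply: ltW; apply: lt_trans mP; [exact: h1|exact: h2].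
rewrite (ac_sum (ac fin) (x - y)); apply: le_lt_trans (absv_sum _ _ _) _.
apply: (@le_lt_trans _ _ (\sum_(i < n) (eps / (A + 1)) * a (e i))).
  apply: ler_sum => i _; rewrite absvM (ac_abs (ac fin)) ler_wpM2r ?absv_ge0//.
  have -> : eps / (A + 1) = t `^ s.
    by rewrite /t -powRrM mulVf ?gt_eqF// powRr1// ltW// divr_gt0.
  by apply: ge0_ler_powR; rewrite ?nnegrE ?powR_ge0 ?(ltW s0)//; exact: co_small.
by rewrite -mulr_sumr -/A mulrAC ltr_pdivrMr// ltr_pM2l// ltrDl.
Qed.

Lemma Smooth_prod (I : Type) (r : seq I) (F : I -> K -> R) :
  (forall i, Smooth n co (F i)) -> Smooth n co (fun x => \prod_(i <- r) F i x).
Proof.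
move=> sF; elim: r => [|i r IH].
  by rewrite (_ : (fun _ => _) = (fun _ => 1)); [exact: Smooth_cst|apply/funext => x; rewrite big_nil].
rewrite (_ : (fun _ => _) = (fun x => F i x * \prod_(j <- r) F j x)); first exact: SmoothM.
by apply/funext => x; rewrite big_cons.
Qed.

Lemma pexp1_gt0 (t : R) : (0 < pexp 1 t) = (0 < t).
Proof. by rewrite /pexp; case: ifP => t0; rewrite ?ltxx// hornerE mul1r expR_gt0. Qed.

Lemma pexp1_ge0 (t : R) : 0 <= pexp 1 t.
Proof. by rewrite /pexp; case: ifP => t0//; rewrite hornerE mul1r expR_ge0. Qed.

(** At an archimedean place the cube is the positivity set of the product [chi] of flat functions,
    and 1 - exp(- k chi) increases to its indicator. *)
Lemma tbox_test c m : annular (tbox c m) -> test_set (tbox c m).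
Proof.
have r0 : 0 < m.+1%:R^-1 :> R by rewrite invr_gt0.
rewrite /tbox; case: asboolP => fin Ub.
  set U := [set y | _] in Ub *; split=> //; exists (fun _ => \1_U); split => //; last by move=> x; exact: cvg_cst.
    move=> _; split => //.
      by apply: annular_sub Ub => x /=; rewrite indicE; case: (boolP (x \in U)) => [/set_mem//|_]; rewrite eqxx.
    move=> _ x; suff : nbhs x [set y | \1_U y = \1_U x :> R] by [].
    rewrite nbhsE; exists m.+1%:R^-1 => //= y xy.
    rewrite !indicE; congr (_%:R); congr nat_of_bool; apply/idP/idP => /set_mem h; apply/mem_set; rewrite /U /= in h *.
      have -> : x - c = (x - y) + (y - c) by rewrite addrA subrK.
      by apply: le_lt_trans (fin _ _) _; rewrite gt_max xy.
    have -> : y - c = (y - x) + (x - c) by rewrite addrA subrK.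
    by apply: le_lt_trans (fin _ _) _; rewrite gt_max absv_distC xy.
  by move=> _ x; rewrite lexx andbT.
set U := [set y | _] in Ub *; set r := m.+1%:R^-1 in r0 U Ub *.
pose chi x := \prod_(i < n) (pexp 1 ((r - co i c) + 1 * co i x) * pexp 1 ((r + co i c) + -1 * co i x)).
have chi_i (i : 'I_n) x : (0 < pexp 1 ((r - co i c) + 1 * co i x) * pexp 1 ((r + co i c) + -1 * co i x))
    = (`|co i (x - c)| < r).
  have p1 := pexp1_ge0 ((r - co i c) + 1 * co i x); have p2 := pexp1_ge0 ((r + co i c) + -1 * co i x).
  have := pexp1_gt0 ((r - co i c) + 1 * co i x); have := pexp1_gt0 ((r + co i c) + -1 * co i x).
  rewrite (ac_sub (ac fin))// ltr_norml => e2 e1.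
  apply/idP/andP => [h|[h1 h2]].
    have q1 : 0 < pexp 1 ((r - co i c) + 1 * co i x).
      by rewrite lt_neqAle p1 andbT eq_sym; apply: contraTneq h => ->; rewrite mul0r ltxx.
    have q2 : 0 < pexp 1 ((r + co i c) + -1 * co i x).
      by rewrite lt_neqAle p2 andbT eq_sym; apply: contraTneq h => ->; rewrite mulr0 ltxx.
    by rewrite e1 in q1; rewrite e2 in q2; split; lra.
  by rewrite mulr_gt0// ?e1 ?e2; lra.
have chi0 x : 0 <= chi x by apply: prodr_ge0 => i _; rewrite mulr_ge0// pexp1_ge0.
have chiU x : U x -> 0 < chi x by move=> Ux; apply: prodr_gt0 => i _; rewrite chi_i; exact: Ux.
have chiNU x : ~ U x -> chi x = 0.
  move=> nU; apply/eqP; rewrite eq_le chi0 andbT leNgt; apply/negP => h; apply: nU => i ilt.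
  rewrite -(chi_i (Ordinal ilt)) lt_neqAle mulr_ge0 ?pexp1_ge0// andbT eq_sym.
  apply: contraTneq h => h0; rewrite -leNgt /chi (bigD1 (Ordinal ilt))//= in h0 *.
  by rewrite h0 mul0r.
pose v k x := 1 + -1 * expR (- (k%:R * chi x)).
have vU k x : ~ U x -> v k x = 0 by move=> nU; rewrite /v chiNU// mulr0 oppr0 expR0 mulr1 subrr.
split=> //; exists v; split.
- move=> k; split.
  + by apply: annular_sub Ub => x /=; apply: contraPP => nU; rewrite vU// eqxx.
  + by move=> /fin.
  + move=> _; apply: SmoothD; first exact: Smooth_cst.
    apply: SmoothM; first exact: Smooth_cst.
    apply: Smooth_expN; apply: SmoothM; first exact: Smooth_cst.
    by apply: Smooth_prod => i; apply: SmoothM; exact: Smooth_flat.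
- move=> k x; rewrite indicE; case: (boolP (x \in U)) => [_|/negP xU]; last first.
    by rewrite vU ?lexx// => /mem_set.
  rewrite /v mulN1r subr_ge0 expR_le1 oppr_le0 mulr_ge0//= gerBl.
  exact: expR_ge0.
- move=> x; rewrite indicE; case: (boolP (x \in U)) => [/set_mem xU|/negP xU]; last first.
    have -> : v ^~ x = (fun=> 0) by apply/funext => k; apply: vU => /mem_set.
    exact: cvg_cst.
  rewrite -[X in _ --> X](_ : 1 + -1 * 0 = 1%:R :> R); last by rewrite mulr0 addr0.
  apply: cvgD; first exact: cvg_cst.
  apply: cvgM; first exact: cvg_cst.
  have -> : (fun k : nat => expR (- (k%:R * chi x))) = (fun k => expR (- chi x) ^+ k).
    by apply/funext => k; rewrite -mulrN expRM_natl.
  by apply: cvg_expr; rewrite ger0_norm ?expR_ge0// expR_lt1 oppr_lt0 chiU.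
Qed.

(** The default [set0] turns the boxes contained in an annulus into a family indexed by all pairs of
    integers. *)
Definition tball (q : nat -> K) (k m : nat) : set K :=
  if `[< annular (tbox (q k) m) >] then tbox (q k) m else set0.

Lemma tball_test q k m : test_set (tball q k m).
Proof. by rewrite /tball; case: asboolP => [|_]; [exact: tbox_test|exact: test_set0]. Qed.

Lemma tball_mem (q : nat -> K) : (forall x (d : R), 0 < d -> exists k, a (x - q k) < d) ->
  forall x (eps : R), x != 0 -> 0 < eps -> exists k m, tball q k m x /\
    forall y, tball q k m y -> a (x - y) < eps.
Proof.
move=> qd x eps x0 e0; have ax : 0 < a x by rewrite absv_gt0.
have e1 : 0 < Num.min eps (a x / 2) by rewrite lt_min e0 divr_gt0.
have [m mP] := tbox_small e1; have [d d0 dP] := tbox_mem m.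
have [k kP] := qd x d d0; have bx := dP _ _ kP.
have h y : tbox (q k) m y -> a (x - y) < eps /\ a (x - y) < a x / 2.
  by move=> /(mP _ _ _ bx); rewrite lt_min => /andP.
exists k, m; rewrite /tball; case: asboolP => [_|]; first by split=> // y /h[].
case; exists (a x / 2); first by rewrite divr_gt0.
exists (2 * a x) => y /h[_ h2].
have := absvD (x - y) y; rewrite subrK.
have := absvD (y - x) x; rewrite subrK absv_distC => h3 h4.
by apply/andP; split; lra.
Qed.

End TestFunctions.

Lemma mem_setD T (A D : set T) x : (x \in A `\` D) = (x \in A) && (x \notin D).
Proof.
apply/idP/andP => [/set_mem[Ax Dx]|[/set_mem Ax /negP Dx]].
  by split; [exact: mem_set|apply/negP => /set_mem].
by apply: mem_set; split=> // /mem_set.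
Qed.

(** * Density of test functions in L1 and L2 *)

Section Density.
Context {R : realType} {K : valuedFieldType R}.
Variable mu : {sigma_finite_measure set (borel K) -> \bar R}.
Hypothesis lh : local_haar mu.
Notation a := (@absv R K).
Notation B := (borel K).
Variables (n : nat) (e : nat -> K) (co : nat -> K -> R) (s C : R).
Hypothesis ac : ~ finite_place K -> arch_coords n e co s C.
Notation test := (test n co).
Notation test_set := (test_set n co).

Lemma test_continuous g : test g -> continuous g.
Proof.
move=> [_ h1 h2]; have [fin|arch] := pselect (finite_place K); last first.
  by have [] := Smooth_facts (ac arch) (h2 arch).
move=> x A; rewrite /= => /nbhs_singleton Ax.
by rewrite /nbhs /=; near=> y; rewrite /= (_ : g y = g x)//; near: y; exact: h1.
Unshelve. all: by end_near. Qed.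

Lemma test_measurable g : test g -> mfun (g : B -> R).
Proof. by move=> /test_continuous cg; exact: continuous_borel_real. Qed.

Lemma test_set_open U : test_set U -> open U.
Proof.
move=> [_ [v [v1 v2 v3]]]; rewrite (_ : U = \bigcup_k (v k @^-1` [set t | t > 0])).
  apply: bigcup_open => k _; apply: open_comp; last exact: open_gt.
  by move=> x _; exact: test_continuous.
apply/seteqP; split=> x.
  move=> Ux; have := v3 x; rewrite indicE mem_set// => /cvgrPdist_lt /(_ 1 ltr01) [k _ /(_ k (leqnn k))] /= h.
  by exists k => //=; move: h; rewrite ltr_norml => /andP[_]; rewrite ltrBlDr -ltrBlDl subrr.
move=> [k _ /= h]; apply: contrapT => nU; have := v2 k x.
by rewrite indicE memNset// => /andP[_]; rewrite leNgt h.
Qed.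

Lemma test_set_measurable U : test_set U -> measurable (U : set B).
Proof. by move=> /test_set_open; exact: borel_open. Qed.

Lemma test_set_bounded U : test_set U -> exists r, forall x, U x -> a x <= r.
Proof. by move=> [[ep _ [r H]] _]; exists r => x /H/andP[]. Qed.

(** Controls the L1 norm and the squared L2 norm at once. It is not homogeneous, hence the factor in
    [nnZ]. *)
Definition nn (d : B -> R) : \bar R := (\int[mu]_x (`|d x| + d x ^+ 2)%:E)%E.

Lemma mfun_nn (d : B -> R) : mfun d ->
  mfun (fun x => `|d x| + d x ^+ 2).
Proof.
move=> md; apply: measurable_funD; last exact: measurable_funX.
exact: (mfun_comp (@normr_measurable R setT) md).
Qed.

Let nnf0 (d : B -> R) x : 0 <= `|d x| + d x ^+ 2.
Proof. by rewrite addr_ge0// sqr_ge0. Qed.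

Lemma nnD (f g : B -> R) : mfun f -> mfun g ->
  (nn (fun x => f x + g x)%R <= 2%:E * nn f + 2%:E * nn g)%E.
Proof.
move=> mf mg; have m1 := mfun_nn mf; have m2 := mfun_nn mg.
rewrite /nn -(ge0_intZ mu m1 (nnf0 f))// -(ge0_intZ mu m2 (nnf0 g))//.
have m1' : mfun (fun x => 2 * (`|f x| + f x ^+ 2)) by exact: mfun_prod.
have m2' : mfun (fun x => 2 * (`|g x| + g x ^+ 2)) by exact: mfun_prod.
rewrite -(ge0_intD mu m1' m2'); try by move=> x; rewrite mulr_ge0 ?nnf0.
apply: ge0_int_le.
- by apply: mfun_nn; exact: measurable_funD.
- exact: measurable_funD.
- exact: (nnf0 (fun x => f x + g x)).
move=> x; have := ler_normD (f x) (g x); have := normr_ge0 (f x); have := normr_ge0 (g x).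
by have := sqr_ge0 (f x - g x); rewrite !expr2; nra.
Qed.

Lemma nn_ge0 d : (0 <= nn d)%E.
Proof. by apply: integral_ge0 => x _; rewrite lee_fin; exact: nnf0. Qed.

Lemma nnZ (c : R) (f : B -> R) : mfun f ->
  (nn (fun x => c * f x)%R <= (`|c| + c ^+ 2)%:E * nn f)%E.
Proof.
move=> mf; have m1 := mfun_nn mf.
have c0 : 0 <= `|c| + c ^+ 2 by rewrite addr_ge0// sqr_ge0.
rewrite /nn -(ge0_intZ mu m1 (nnf0 f) c0); apply: ge0_int_le.
- by apply: mfun_nn; exact: mfun_prod.
- exact: mfun_prod.
- exact: (nnf0 (fun x => c * f x)).
move=> x; rewrite normrM exprMn; have := normr_ge0 (f x); have := sqr_ge0 (f x).
by have := normr_ge0 c; have := sqr_ge0 c; nra.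
Qed.

Definition appr (f : B -> R) : Prop := mfun f /\
  forall eps : R, 0 < eps -> exists2 g, test g & (nn (fun x => f x - g x)%R < eps%:E)%E.

Lemma appr_lim (f : B -> R) : mfun f ->
  (forall eps : R, 0 < eps -> exists2 g, appr g & (nn (fun x => f x - g x)%R <= eps%:E)%E) ->
  appr f.
Proof.
move=> mf H; split=> // eps e0; have e4 : 0 < eps / 8 by rewrite divr_gt0.
have [g [mg /(_ _ e4)[h th h1]] h2] := H _ e4; exists h => //.
have mh := test_measurable th.
rewrite (_ : (fun x => f x - h x) = (fun x => (f x - g x) + (g x - h x))); last first.
  by apply/funext => x; rewrite addrA subrK.
apply: le_lt_trans (nnD _ _) _; [exact: measurable_funB|exact: measurable_funB|].
have k1 : (2%:E * nn (fun x => f x - g x)%R <= 2%:E * (eps / 8)%:E)%E by rewrite lee_pmul2l.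
have k2 : (2%:E * nn (fun x => g x - h x)%R <= 2%:E * (eps / 8)%:E)%E.
  by rewrite lee_pmul2l// ltW.
apply: le_lt_trans (leeD k1 k2) _; rewrite -!EFinM -EFinD lte_fin; lra.
Qed.

Lemma appr_test g : test g -> appr g.
Proof.
move=> tg; split; first exact: test_measurable.
move=> eps e0; exists g => //; rewrite /nn integral0_eq// => x _.
by rewrite subrr normr0 expr0n addr0.
Qed.

Lemma apprD f g : appr f -> appr g -> appr (fun x => f x + g x).
Proof.
move=> [mf Hf] [mg Hg]; split; first exact: measurable_funD.
move=> eps e0; have e4 : 0 < eps / 8 by rewrite divr_gt0.
have [h1 t1 n1] := Hf _ e4; have [h2 t2 n2] := Hg _ e4.
exists (fun x => h1 x + h2 x); first exact: (testD t1 t2).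
have mh1 := test_measurable t1; have mh2 := test_measurable t2.
rewrite (_ : (fun x => _) = (fun x => (f x - h1 x) + (g x - h2 x))); last first.
  by apply/funext => x; rewrite opprD addrACA.
apply: le_lt_trans (nnD _ _) _; [exact: measurable_funB|exact: measurable_funB|].
have k1 : (2%:E * nn (fun x => f x - h1 x)%R <= 2%:E * (eps / 8)%:E)%E by rewrite lee_pmul2l// ltW.
have k2 : (2%:E * nn (fun x => g x - h2 x)%R <= 2%:E * (eps / 8)%:E)%E.
  by rewrite lee_pmul2l// ltW.
apply: le_lt_trans (leeD k1 k2) _; rewrite -!EFinM -EFinD lte_fin; lra.
Qed.

Lemma apprZ (c : R) f : appr f -> appr (fun x => c * f x).
Proof.
move=> [mf Hf]; split; first exact: mfun_prod.
move=> eps e0; set k := `|c| + c ^+ 2 + 1.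
have k0 : 0 < k by rewrite ltr_wpDl// addr_ge0// sqr_ge0.
have [h t1 n1] := Hf _ (divr_gt0 e0 k0); have mh := test_measurable t1.
exists (fun x => c * h x); first exact: testZ.
rewrite (_ : (fun x => _) = (fun x => c * (f x - h x))); last first.
  by apply/funext => x; rewrite mulrBr.
apply: le_lt_trans (nnZ _ _) _; first exact: measurable_funB.
apply: (@le_lt_trans _ _ (k%:E * nn (fun x => f x - h x)%R)%E).
  apply: lee_wpmul2r; first exact: nn_ge0.
  by rewrite lee_fin lerDl.
by apply: lt_le_trans (_ : (k%:E * (eps / k)%:E <= _)%E); rewrite ?lte_pmul2l// -EFinM mulrCA mulfV ?mulr1 ?gt_eqF.
Qed.

Lemma apprB f g : appr f -> appr g -> appr (fun x => f x - g x).
Proof.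
move=> hf hg; rewrite (_ : (fun x => _) = (fun x => f x + (-1) * g x)).
  by apply: apprD => //; exact: apprZ.
by apply/funext => x; rewrite mulN1r.
Qed.

Lemma appr_sum (I : Type) (r : seq I) (F : I -> B -> R) :
  (forall i, appr (F i)) -> appr (fun x => \sum_(i <- r) F i x).
Proof.
move=> tF; elim: r => [|i r IH].
  rewrite (_ : (fun _ => _) = (fun _ => 0)); last by apply/funext => x; rewrite big_nil.
  by apply: appr_test; exact: test0.
rewrite (_ : (fun _ => _) = (fun x => F i x + \sum_(j <- r) F j x)); first exact: apprD.
by apply/funext => x; rewrite big_cons.
Qed.

Lemma appr_dct (f : B -> R) (u : nat -> B -> R) (G : B -> R) :
  mfun f -> (forall k, appr (u k)) -> mfun G ->
  (forall k x, `|f x - u k x| <= G x) ->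
  (\int[mu]_x (G x + G x ^+ 2)%:E < +oo)%E ->
  (forall x, u k x @[k --> \oo] --> f x) -> appr f.
Proof.
move=> mf hu mG dom Gi cv; apply: appr_lim => // eps e0.
have mu' k : mfun (fun x => f x - u k x).
  by apply: measurable_funB => //; have [] := hu k.
have [|||||N HN] := @dominated_to0 _ _ _ mu (fun k x => `|f x - u k x| + (f x - u k x) ^+ 2)
  (fun x => G x + G x ^+ 2) _ _ _ _ Gi _ _ e0.
- by move=> k; exact: mfun_nn.
- by apply: measurable_funD => //; exact: measurable_funX.
- by move=> k x; exact: (nnf0 (fun x => f x - u k x)).
- move=> k x; apply: lerD => //; rewrite -real_normK ?num_real//.
  by rewrite lerXn2r ?nnegrE// (le_trans _ (dom k x)).
- move=> x; have c1 : (f x - u k x) @[k --> \oo] --> 0.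
    by rewrite -[X in _ --> X](subrr (f x)); apply: cvgB => //; exact: cvg_cst.
  rewrite -[X in _ --> X](_ : `|0 : R| + 0 ^+ 2 = 0); last by rewrite normr0 expr0n addr0.
  apply: cvgD; first exact: cvg_norm.
  by under eq_cvg do rewrite expr2; rewrite expr2; exact: cvgM.
by exists (u N) => //; exact: HN.
Qed.

Let ind_ball_int r : (\int[mu]_x ((\1_[set x : K | a x <= r] x + \1_[set x : K | a x <= r] x ^+ 2)%R%:E) < +oo)%E.
Proof.
have mb := ball_measurable (K := K) r.
rewrite (eq_integral (fun x => (2 * \1_([set x : K | a x <= r] : set B) x)%:E)); last first.
  by move=> x _; rewrite indicE; case: (_ \in _); rewrite ?expr1n ?expr0n ?mulr1 ?mulr0 ?addr0.
apply: ge0_intZ_lty => //; rewrite integral_indic// setIT; exact: haar_ball_lty.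
Qed.

Let mind (E : set B) : measurable E -> mfun (\1_E : B -> R).
Proof. by move=> mE; exact: measurable_indic. Qed.

Lemma appr_test_set U : test_set U -> appr (\1_U).
Proof.
move=> tU; have [r Hr] := test_set_bounded tU; have mU := test_set_measurable tU.
have [_ [v [v1 v2 v3]]] := tU.
apply: (@appr_dct _ v (\1_([set x : K | a x <= r] : set B))) => //.
- by move=> k; exact: appr_test.
- by apply: mind; exact: ball_measurable.
move=> k x; have /andP[h1 h2] := v2 k x.
apply: (@le_trans _ _ (\1_U x : R)); first by rewrite ger0_norm ?subr_ge0// gerBl.
by rewrite !indicE ler_nat; case: (boolP (x \in U)) => // /set_mem/Hr h; rewrite mem_set.
Qed.

Definition ts_sigma : set_system B := <<s setT, test_set >>.

(** Countably many test balls form a base of the topology outside 0. The point 0 lies in none of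
    them and is recovered as the complement of their union. *)
Lemma ts_sigma_measurable (E : set B) : measurable E -> ts_sigma E.
Proof.
have sT : sigma_algebra setT (ts_sigma) by exact: smallest_sigma_algebra.
have [s0 sD sU] := sT.
apply: smallest_sub => // O; rewrite openE' => oO.
pose T (i : nat) : set K := if unpickle i is Some (k, m) then
  (if `[< tball n co (lh_seq lh) k m `<=` O >] then tball n co (lh_seq lh) k m else set0) else set0.
pose T' (i : nat) : set K := if unpickle i is Some (k, m) then tball n co (lh_seq lh) k m else set0.
have tts U : test_set U -> ts_sigma U by move=> tU; exact: sub_sigma_algebra.
have sTi i : ts_sigma (T i).
  rewrite /T; case: unpickle => [[k m]|]; last exact: s0.
  by case: ifP => _; [apply: tts; exact: (tball_test ac)|exact: s0].
have sT'i i : ts_sigma (T' i).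
  by rewrite /T'; case: unpickle => [[k m]|]; [apply: tts; exact: (tball_test ac)|exact: s0].
have memT x : x != 0 -> O x -> exists i, T i x.
  move=> x0 /oO[d d0 Hd]; have [k [m [h1 h2]]] := tball_mem ac (lh_dense lh) x0 d0.
  exists (pickle (k, m)); rewrite /T pickleK; case: asboolP => // -[].
  by move=> y /h2; exact: Hd.
have not0 k m : ~ tball n co (lh_seq lh) k m 0.
  rewrite /tball; case: asboolP => [[ep e0 [r H]] /H|_ []].
  by rewrite absv0 leNgt e0.
have s1 : ts_sigma [set (0 : K)].
  rewrite (_ : [set 0] = setT `\` \bigcup_i T' i); first by apply: sD; exact: sU.
  apply/seteqP; split=> x /=.
    by move=> ->; split=> // -[i _]; rewrite /T'; case: unpickle => [[l j]|//] /not0.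
  move=> [_ nT]; apply/eqP; apply: contrapT => /negP x0; apply: nT.
  have [k [m [h1 h2]]] := tball_mem ac (lh_dense lh) x0 ltr01.
  by exists (pickle (k, m)) => //; rewrite /T' pickleK.
pose T2 (i : nat) : set K := if i is j.+1 then T j else (if `[< O 0 >] then [set 0] else set0).
rewrite (_ : O = \bigcup_i T2 i).
  by apply: sU => -[|i] //=; case: ifP => _.
apply/seteqP; split=> x.
  move=> Ox; have [x0|x0] := eqVneq x 0.
    by exists 0%N => //=; rewrite -x0; case: asboolP.
  by have [i Ti] := memT _ x0 Ox; exists i.+1.
move=> [[|i] _] /=; first by case: asboolP => // O0 ->.
by rewrite /T; case: unpickle => [[k m]|//]; case: asboolP => // h /h.
Qed.

(** Dynkin's lemma: the sets whose trace on [V] can be approximated form a lambda-system containing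
    the pi-system of test sets. The bounded set [V] supplies an integrable majorant for the monotone
    unions. *)
Lemma appr_indicI (E V : set B) : measurable E -> test_set V -> appr (\1_(E `&` V)).
Proof.
move=> mE tV; have mV := test_set_measurable tV; have [r Hr] := test_set_bounded tV.
pose H : set (set B) := fun E => measurable E /\ appr (\1_(E `&` V)).
suff : ts_sigma `<=` H by move=> /(_ E (ts_sigma_measurable mE))[].
apply: lambda_system_subset; first by move=> U W; exact: test_setI.
- split => //.
  + by split; [exact: measurableT|rewrite setTI; exact: appr_test_set].
  + move=> A D DA [mA HA] [mD HD]; split; first exact: measurableD.
    rewrite (_ : \1_((A `\` D) `&` V) = (fun x => \1_(A `&` V) x - \1_(D `&` V) x :> R)).
      exact: apprB.
    apply/funext => x; rewrite !indicE in_setI mem_setD !in_setI.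
    case: (boolP (x \in V)) => xV; rewrite ?andbT ?andbF ?subrr//.
    case: (boolP (x \in D)) => xD /=; rewrite ?andbT ?andbF ?subr0//.
    by rewrite (_ : x \in A) ?subrr//; apply/mem_set/DA/set_mem.
  + move=> F ndF HF; have mF i : measurable (F i) by have [] := HF i.
    have mU : measurable (\bigcup_i F i) by exact: bigcup_measurable.
    split=> //.
    apply: (@appr_dct _ (fun k => \1_(F k `&` V)) (\1_([set x : K | a x <= r] : set B))) => //.
    * by apply: mind; exact: measurableI.
    * by move=> k; have [] := HF k.
    * by apply: mind; exact: ball_measurable.
    * move=> k x; rewrite !indicE !in_setI; case: (boolP (x \in V)) => xV; rewrite ?andbF ?andbT ?subrr ?normr0//.
      rewrite [in leRHS]mem_set; last by apply: Hr; exact/set_mem.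
      by case: (_ \in _); case: (_ \in _); rewrite ?subrr ?normr0 ?subr0 ?sub0r ?normrN ?normr1.
    * move=> x; have [[k _ Fx]|nx] := pselect ((\bigcup_i F i) x).
        apply/cvgrPdist_lt => eps e0; exists k => // j /= kj.
        have Fj : F j x by have := ndF _ _ kj => /subsetPset; apply.
        have U' : (\bigcup_i F i) x by exists j.
        by rewrite !indicE !in_setI (mem_set Fj) (mem_set U') subrr normr0.
      rewrite (_ : (fun k => _) = (fun=> \1_((\bigcup_i F i) `&` V) x)); first exact: cvg_cst.
      apply/funext => k; rewrite !indicE !in_setI (memNset nx) memNset//.
      by move=> Fx; apply: nx; exists k.
- by move=> U tU; split; [exact: test_set_measurable|apply: appr_test_set; exact: test_setI].
- by move=> X _.
Qed.

Definition cov (i : nat) : set B :=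
  if @unpickle (nat * nat)%type i is Some (l, m) then tball n co (lh_seq lh) l m else set0.

Definition cover (k : nat) : set B := \big[setU/set0]_(i < k) cov i.

Lemma appr_cover (E : set B) k : measurable E -> appr (\1_(E `&` cover k)) /\ measurable (cover k).
Proof.
move=> mE; elim: k E mE => [|k IH] E mE.
  by rewrite /cover big_ord0 setI0 indic0; split => //; apply: appr_test; exact: test0.
have [_ mC] := IH _ measurableT.
set V := cov k; have tV : test_set V.
  by rewrite /V /cov; case: unpickle => [[l m]|]; [exact: (tball_test ac)|exact: test_set0].
have mV := test_set_measurable tV.
have cE : cover k.+1 = cover k `|` V by rewrite /cover big_ord_recr.
rewrite cE; split; last exact: measurableU.
rewrite (_ : \1_(E `&` (cover k `|` V)) = (fun x => \1_(E `&` cover k) x + \1_((E `\` cover k) `&` V) x :> R)).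
  by apply: apprD; [have [] := IH _ mE|apply: appr_indicI => //; exact: measurableD].
apply/funext => x; rewrite !indicE [x \in (E `\` _) `&` _]in_setI mem_setD !in_setI in_setU.
by case: (x \in E); case: (x \in cover k); case: (x \in V); rewrite /= ?addr0 ?add0r.
Qed.

Lemma cover_eventually (x : K) : x != 0 -> exists k, forall j, (k <= j)%N -> cover j x.
Proof.
move=> x0; have [k [m [h1 h2]]] := tball_mem ac (lh_dense lh) x0 ltr01.
exists (pickle (k, m)).+1 => j kj; rewrite /cover -(bigcup_mkord j cov).
by exists (pickle (k, m)) => //; rewrite /cov pickleK.
Qed.

(** The staircase with steps [k.+1%:R^-1] below the height [k.+1], cut to [cover k], lies below [f]
    and converges to it. At 0, which the covers miss, convergence is the hypothesis on the value of
    [f]. *)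
Lemma appr_ge0 (f : B -> R) : mfun f -> (forall x, 0 <= f x) ->
  f (0 : K) = 0 -> (\int[mu]_x (f x + f x ^+ 2)%:E < +oo)%E -> appr f.
Proof.
move=> mf f0 fz fi.
pose A k i : set B := [set x | i%:R <= k.+1%:R * f x < i%:R + 1].
have mA k i : measurable (A k i).
  rewrite (_ : A k i = (fun x => k.+1%:R * f x) @^-1` `[i%:R, (i%:R + 1)[); last first.
    by apply/seteqP; split=> x /=; rewrite in_itv.
  rewrite -[X in measurable X]setTI.
  by apply: (mfun_prod (f := cst k.+1%:R)) => //; exact: measurable_itv.
pose u k x : R := \sum_(i < k.+1 * k.+1) (i%:R / k.+1%:R) * \1_(A k i `&` cover k) x.
have uE k x : u k x = if (Num.truncn (k.+1%:R * f x) < k.+1 * k.+1)%N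
    then (Num.truncn (k.+1%:R * f x))%:R / k.+1%:R * \1_(cover k) x else 0.
  have kf : 0 <= k.+1%:R * f x by rewrite mulr_ge0.
  have AE i : (x \in A k i) = (i == Num.truncn (k.+1%:R * f x)).
    apply/idP/eqP => [/set_mem h|->].
      by apply/esym/truncn_def; move: h; rewrite /A /= natr1.
    by apply/mem_set; have := truncn_itv kf; rewrite /A /= natr1.
  rewrite /u; case: ltnP => h.
    rewrite (bigD1 (Ordinal h))//= big1 ?addr0.
      by rewrite !indicE in_setI AE eqxx.
    by move=> i ih; rewrite indicE in_setI AE -(inj_eq val_inj)/= in ih *; rewrite (negbTE ih) mulr0.
  apply: big1 => i _; rewrite indicE in_setI AE.
  by rewrite (_ : (_ == _) = false) ?mulr0//; apply/eqP => ih; move: (ltn_ord i); rewrite ih ltnNge h.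
have ufle k x : 0 <= u k x <= f x.
  rewrite uE; case: ifP => _; last by rewrite lexx f0.
  have kf : 0 <= k.+1%:R * f x by rewrite mulr_ge0.
  have /andP[h _] := truncn_itv kf.
  rewrite mulr_ge0//= ?divr_ge0//; apply: (@le_trans _ _ ((Num.truncn (k.+1%:R * f x))%:R / k.+1%:R)).
    by rewrite ler_piMr ?divr_ge0// indicE; case: (_ \in _).
  by rewrite ler_pdivrMr// [f x * _]mulrC.
apply: (@appr_dct _ u f) => //.
- move=> k; apply: (@appr_sum _ _ (fun (i : 'I_(k.+1 * k.+1)) x => (i%:R / k.+1%:R) * \1_(A k i `&` cover k) x)) => i.
  by apply: apprZ; have [] := appr_cover k (mA k i).
- by move=> k x; have /andP[h1 h2] := ufle k x; rewrite ger0_norm ?subr_ge0// gerBl.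
move=> x; have [x0|x0] := eqVneq (x : K) 0.
  rewrite x0 fz (_ : (fun k => _) = (fun=> 0)); first exact: cvg_cst.
  apply/funext => k; have /andP[h1 h2] := ufle k (0 : K).
  by apply/eqP; rewrite eq_le h1 andbT -fz.
have [k1 Hk1] := cover_eventually x0.
apply/cvgrPdist_lt => eps e0; have [k2 Hk2] := exists_inv_lt e0.
have [k3 Hk3] : exists k3 : nat, f x < k3%:R by exists (Num.bound (f x)); exact: archi_boundP.
exists (maxn k1 (maxn k2 k3)) => // k /=; rewrite !geq_max => /andP[a1 /andP[a2 a3]].
have kf : 0 <= k.+1%:R * f x by rewrite mulr_ge0.
have /andP[h1 h2] := truncn_itv kf.
have lt1 : (Num.truncn (k.+1%:R * f x) < k.+1 * k.+1)%N.
  rewrite -(ltr_nat R); apply: le_lt_trans h1 _; rewrite natrM ltr_pM2l//.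
  by apply: lt_le_trans Hk3 _; rewrite ler_nat ltnW.
rewrite uE lt1 indicE mem_set ?mulr1; last exact: Hk1.
rewrite ger0_norm; last by rewrite subr_ge0 ler_pdivrMr// [f x * _]mulrC.
apply: le_lt_trans Hk2; apply: (@le_trans _ _ k.+1%:R^-1); last first.
  by rewrite lef_pV2 ?posrE// ler_nat.
rewrite lerBlDl -(ler_pM2l (ltr0Sn R k)) mulrDr mulfV// mulrCA mulfV// mulr1 natr1.
exact: ltW.
Qed.

Lemma appr_dense (f : B -> R) : mfun f -> f (0 : K) = 0 ->
  (\int[mu]_x (`|f x| + f x ^+ 2)%:E < +oo)%E -> appr f.
Proof.
move=> mf fz fi.
pose fp x := Num.max (f x) 0; pose fn x := Num.max (- f x) 0.
have mfp : mfun fp by apply: measurable_maxr.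
have mfn : mfun fn by apply: measurable_maxr => //; exact: measurable_funN.
have fp0 x : 0 <= fp x by rewrite le_max lexx orbT.
have fn0 x : 0 <= fn x by rewrite le_max lexx orbT.
have fE : f = (fun x => fp x - fn x).
  by apply/funext => x; rewrite /fp /fn; case: (lerP (f x) 0); case: (lerP (- f x) 0) => h1 h2; lra.
have le (g : B -> R) : (forall x, 0 <= g x) -> mfun g ->
   (forall x, g x <= `|f x|) -> (\int[mu]_x (g x + g x ^+ 2)%:E < +oo)%E.
  move=> g0 mg gf; apply: le_lt_trans fi; apply: ge0_int_le => //.
  - by apply: measurable_funD => //; exact: measurable_funX.
  - exact: mfun_nn.
  - by move=> x; rewrite addr_ge0// sqr_ge0.
  - move=> x; apply: lerD => //; rewrite -[leRHS]real_normK ?num_real//.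
    by rewrite lerXn2r ?nnegrE.
rewrite fE; apply: apprB; apply: appr_ge0 => //.
- by rewrite /fp fz maxxx.
- by apply: le => // x; rewrite ge_max ler_norm normr_ge0.
- by rewrite /fn fz oppr0 maxxx.
- by apply: le => // x; rewrite ge_max ler_normr lexx orbT normr_ge0.
Qed.

(** Both norms are approximated by the same function: the L1 norm controls the Fourier integral
    pointwise, the L2 norm its extension by continuity, and the two have to be compared. *)
Lemma S0_dense (f : B -> R[i]) (eps : R) : cinteg mu f -> sqL mu f -> 0 < eps ->
  exists g h, [/\ test g, test h,
    (\int[mu]_x (cabs (f x - (g x +i* h x)%C)%R)%:E <= eps%:E)%E
    & (sqn mu (fun x => f x - (g x +i* h x)%C)%R <= eps%:E)%E].
Proof.
move=> [[m1 m2] fi] [_ f2] e0.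
pose z : B -> R := \1_(~` [set (0 : K)]).
have mz : mfun z.
  by apply: mind; apply: measurableC; exact: mfun_set1_borel.
have z01 x : 0 <= z x <= 1.
  by rewrite /z indicE; case: (x \in _); rewrite /= ?ler01 ?lexx.
have key (p : B -> R) : mfun p -> (forall x, `|p x| <= cabs (f x)) ->
    exists2 g, test g & (nn (fun x => p x - g x)%R <= (eps / 2)%:E)%E.
  move=> mp pf; have mzp : mfun (fun x => z x * p x) by exact: mfun_prod.
  have zp x : `|z x * p x| <= cabs (f x).
    apply: le_trans (pf x); have /andP[z0 z1] := z01 x.
    by rewrite normrM ger0_norm// ler_piMl.
  have [|||_ /(_ _ (divr_gt0 e0 (ltr0Sn R 1)))[g tg Hg]] := @appr_dense (fun x => z x * p x).
  - by [].
  - by rewrite /z indicE memNset ?mul0r//= => /(_ erefl).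
  - apply: (@le_lt_trans _ _ (\int[mu]_x (cabs (f x) + cabs (f x) ^+ 2)%:E)%E).
      apply: ge0_int_le; [exact: mfun_nn| |exact: (nnf0 (fun x => z x * p x))|].
        by apply: measurable_funD; [|apply: measurable_funX]; exact: cmeas_cabs.
      move=> x; apply: lerD => //; rewrite -[leLHS]real_normK ?num_real//.
      by rewrite lerXn2r ?nnegrE ?cabs_ge0.
    apply: ge0_intD_lty => //; try by move=> x; rewrite ?cabs_ge0 ?sqr_ge0.
    + exact: cmeas_cabs.
    + by apply: measurable_funX; exact: cmeas_cabs.
  exists g => //; apply: le_trans (ltW Hg); rewrite le_eqVlt; apply/orP; left; apply/eqP.
  have mg := test_measurable tg.
  apply: ae_eq_integral => //.
  - by apply/measurable_EFinP; apply: mfun_nn; exact: measurable_funB.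
  - by apply/measurable_EFinP; apply: mfun_nn; exact: measurable_funB.
  - apply: (@ae_neq0 _ _ _ lh (fun x => setT x -> _)) => x x0 _.
    by rewrite /z indicE mem_set ?mul1r//=; exact/eqP.
have [g tg Hg] := key _ m1 (fun x => Re_le_cabs _).
have [h th Hh] := key _ m2 (fun x => Im_le_cabs _).
have mg := test_measurable tg; have mh := test_measurable th.
have M1 : mfun (fun x => Re (f x) - g x) by exact: measurable_funB.
have M2 : mfun (fun x => Im (f x) - h x) by exact: measurable_funB.
exists g, h; split=> //.
- apply: (@le_trans _ _ (nn (fun x => Re (f x) - g x)%R + nn (fun x => Im (f x) - h x)%R)%E); last first.
    by apply: le_trans (leeD Hg Hh) _; rewrite -EFinD -splitr.
  rewrite /nn -(ge0_intD mu (mfun_nn M1) (mfun_nn M2) (nnf0 _) (nnf0 _)).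
  apply: ge0_int_le => //.
  + apply: cmeas_cabs; apply: cmeasB => //; split => //=.
  + by apply: measurable_funD; apply: mfun_nn; exact: measurable_funB.
  + by move=> x; exact: cabs_ge0.
  move=> x; apply: le_trans (cabs_le_ReIm _) _; rewrite ReD ReN ImD ImN /=.
  by apply: lerD; rewrite lerDl sqr_ge0.
- apply: (@le_trans _ _ (nn (fun x => Re (f x) - g x)%R + nn (fun x => Im (f x) - h x)%R)%E); last first.
    by apply: le_trans (leeD Hg Hh) _; rewrite -EFinD -splitr.
  rewrite /nn /sqn -(ge0_intD mu (mfun_nn M1) (mfun_nn M2) (nnf0 _) (nnf0 _)).
  apply: ge0_int_le => //.
  + apply: measurable_funX; apply: cmeas_cabs; apply: cmeasB => //; split => //=.
  + by apply: measurable_funD; apply: mfun_nn; exact: measurable_funB.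
  + by move=> x; rewrite sqr_ge0.
  move=> x; rewrite cabs_sqr ReD ReN ImD ImN /=.
  by apply: lerD; rewrite lerDr.
Qed.

End Density.

(** * Iterated differences *)

Section RealDifferences.
Context {R : realType}.

Definition diff (t : R) (u : R -> R) : R -> R := fun x => u (x + t) - u x.

(** The mean value theorem applied [m] times. Differences are preferred to derivatives because
    translation turns into multiplication by [lambda] under the Fourier integral. *)
Lemma iter_diff (m : nat) (phi : nat -> R -> R) (t : R) :
  (forall k x, is_derive x (1 : R) (phi k) (phi k.+1 x)) ->
  forall k x, exists2 xi : R, 0 <= xi <= m%:R &
    iter m (diff t) (phi k) x = t ^+ m * phi (k + m)%N (x + xi * t).
Proof.
elim: m phi => [|m IH] phi dphi k x.
  by exists 0; rewrite ?lexx//= mul0r addr0 expr0 mul1r addn0.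
have dpsi j y : is_derive y (1 : R) (diff t (phi j)) (diff t (phi j.+1) y).
  apply: is_deriveB.
  have := @is_derive1_comp _ (phi j) (fun z => z + t) y _ 1 (dphi j (y + t)).
  rewrite mulr1; apply.
  by have := @is_deriveD _ _ _ id (cst t) y 1 _ _ (is_derive_id _ _) (is_derive_cst _ _ _); rewrite addr0.
have [xi /andP[x0 xm] E] := IH (fun j => diff t (phi j)) dpsi k x.
rewrite iterSr E /diff; set y := x + xi * t.
have [th /andP[t0 t1] ->] : exists2 th : R, 0 <= th <= 1 &
    phi (k + m)%N (y + t) - phi (k + m)%N y = t * phi (k + m).+1 (y + th * t).
  pose psi u := phi (k + m)%N (y + u * t).
  have dps u : is_derive u (1 : R) psi (t * phi (k + m).+1 (y + u * t)).
    rewrite mulrC; apply: (@is_derive1_comp _ (phi (k + m)%N) (fun u => y + u * t)).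
    have := @is_deriveD _ _ _ (cst y) (fun u : R => u * t) u 1 _ _ (is_derive_cst _ _ _) (is_deriveM (is_derive_id u 1) (is_derive_cst t u 1)).
    by rewrite /GRing.scale /= mulr0 add0r mulr1 add0r.
  have cps : {within `[0, 1], continuous psi}.
    apply: continuous_subspaceT => u.
    by apply: differentiable_continuous; apply/derivable1_diffP; have [] := dps u.
  have [th] := MVT_segment ler01 (fun u _ => dps u) cps.
  rewrite in_itv /= => th01 Eth; exists th => //.
  by move: Eth; rewrite /psi mul1r mul0r addr0 subr0 mulr1.
exists (xi + th); first by rewrite addr_ge0//= -natr1 lerD.
by rewrite exprSr mulrA addnS /y mulrDl addrA.
Qed.

End RealDifferences.

(** Collects the facts about the place on which the Fourier analysis rests, so that finite and
    archimedean places are treated alike. *)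
Record local_place {R : realType} {K : valuedFieldType R}
    (mu : {sigma_finite_measure set (borel K) -> \bar R})
    (n : nat) (e : nat -> K) (co : nat -> K -> R) (s C : R) : Prop := {
  lp_haar : local_haar mu ;
  lp_coords : ~ finite_place K -> arch_coords n e co s C ;
  lp_lambdaD : forall x y : K, lambda (x + y) = lambda x * lambda y :> R[i] ;
  lp_cabs_lambda : forall x : K, cabs (lambda x : R[i]) = 1 ;
  lp_lambda0 : lambda (0 : K) = 1 :> R[i] ;
  lp_lambdaN : forall x : K, lambda (- x) = (lambda x)^*%C :> R[i] ;
  lp_hoelder : exists C b : R, [/\ 0 < C, 0 < b &
    forall z : K, cabs (lambda z - 1 : R[i]) <= C * absv z `^ b] ;
  lp_self_dual : self_dual mu
}.

(** * The Fourier transform *)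

Section SchwartzBounds.
Context {R : realType} {K : valuedFieldType R}.
Variable mu : {sigma_finite_measure set (borel K) -> \bar R}.
Variables (n : nat) (e : nat -> K) (co : nat -> K -> R) (s C : R).
Hypothesis lp : local_place mu n e co s C.
Let lh := lp_haar lp.
Let ac := lp_coords lp.
Notation a := (@absv R K).
Notation B := (borel K).
Notation md := (module mu).
Notation decay := (decay mu).

Lemma decay_inv (r : R) : 0 <= r -> exists2 M : R, 0 < M &
  forall x, a x <= r -> 1 <= M * decay x.
Proof.
move=> r0; have [s' s0 ms] := module_absv lh.
have rs0 : 0 <= r `^ s' by exact: powR_ge0.
exists ((1 + r `^ s') ^+ 2); first by rewrite exprn_gt0// ltr_wpDr.
move=> x xr; rewrite /decay ler_pdivlMr ?exprn_gt0 ?ltr_wpDr ?module_ge0// mul1r.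
rewrite lerXn2r ?nnegrE ?addr_ge0 ?module_ge0// lerD2l ms.
by apply: ge0_ler_powR; rewrite ?nnegrE ?absv_ge0 ?(ltW s0).
Qed.

Lemma decay_shift (r : R) : 0 <= r -> exists2 M : R, 0 < M &
  forall x z, a z <= r -> decay (x + z) <= M * decay x.
Proof.
move=> r0; have [s' s0 ms] := module_absv lh.
have rs0 : 0 <= (2 * r) `^ s' by exact: powR_ge0.
have t0 : 0 < (2 : R) `^ s' by exact: powR_gt0.
set D := 1 + 2 `^ s' + (2 * r) `^ s'.
have D0 : 0 < D by rewrite /D; lra.
exists (D ^+ 2); first by rewrite exprn_gt0.
move=> x z zr; rewrite /decay ler_pdivlMr ?exprn_gt0 ?ltr_wpDr ?module_ge0//.
rewrite mulrC ler_pdivrMr ?exprn_gt0 ?ltr_wpDr ?module_ge0// -exprMn.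
rewrite lerXn2r ?nnegrE ?mulr_ge0 ?addr_ge0 ?module_ge0 ?(ltW D0) ?ler01//.
have m0 := module_ge0 lh (x + z).
have h : md x <= 2 `^ s' * md (x + z) + (2 * r) `^ s'.
  have ax : a x <= a (x + z) + r.
    by have := absvD (x + z) (- z); rewrite addrK absvN; lra.
  have b0 := absv_ge0 (x + z).
  rewrite !ms -powRM//; have [h1|h1] := lerP (a (x + z)) r.
    apply: ler_wpDl; first exact: powR_ge0.
    by apply: ge0_ler_powR; rewrite ?nnegrE ?absv_ge0 ?(ltW s0) ?mulr_ge0//; lra.
  apply: ler_wpDr => //.
  by apply: ge0_ler_powR; rewrite ?nnegrE ?absv_ge0 ?(ltW s0) ?mulr_ge0//; lra.
have D1 : 2 `^ s' <= D by rewrite /D; lra.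
have : 2 `^ s' * md (x + z) <= D * md (x + z) by rewrite ler_wpM2r.
by rewrite mulrDr mulr1 {2}/D; lra.
Qed.

Lemma schwartz_decay (g : K -> R) : schwartz g ->
  exists2 M : R, 0 <= M & forall x, `|g x| <= M * decay x.
Proof.
move=> sg; have [_ _ H] := sg [::].
have [s' s0 ms] := module_absv lh.
(* [m] is large enough for [a x ^+ m] to dominate [md x ^+ 2] when [a x > 1]. *)
have [M0 H0] := H 0%N; pose m := (Num.bound (s' * 2)).
have [M1 H1] := H m.
have sm : s' * 2 <= m%:R by apply: ltW; apply: archi_boundP; rewrite mulr_ge0// ltW.
have M00 : 0 <= M0 by have := H0 0; rewrite expr0 mul1r; apply: le_trans.
have M10 : 0 <= M1 by have := H1 0; apply: le_trans; rewrite mulr_ge0// exprn_ge0// absv_ge0.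
exists (4 * M0 + 2 * M1); first by lra.
move=> x; rewrite /decay ler_pdivlMr ?exprn_gt0 ?ltr_wpDr ?module_ge0//.
have := H0 x; have := H1 x; rewrite expr0 mul1r /=.
have g0 := normr_ge0 (g x); have m0 := module_ge0 lh x.
have m2 : md x ^+ 2 <= 1 + a x ^+ m.
  rewrite ms -powR_mulrn ?powR_ge0// -powRrM -powR_mulrn ?absv_ge0//.
  have [x1|x1] := lerP (a x) 1.
    apply: ler_wpDr; first exact: powR_ge0.
    rewrite -[leRHS](congr1 (@^~ (s' * 2)) (powR1 R)).
    by apply: ge0_ler_powR; rewrite ?nnegrE ?absv_ge0 ?mulr_ge0 ?(ltW s0).
  by apply: ler_wpDl => //; apply: ler_powR => //; exact: ltW.
have p0 : 0 <= a x ^+ m by rewrite exprn_ge0// absv_ge0.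
move=> h1 h2.
have h3 : (1 + md x) ^+ 2 <= 2 * (2 + a x ^+ m).
  by have := sqr_ge0 (1 - md x); rewrite !expr2 in m2 *; nra.
apply: le_trans (ler_wpM2l g0 h3) _; nra.
Qed.

Lemma schwartz_dir h (g : K -> R) m : schwartz g -> schwartz (iter m (dir_derive h) g).
Proof.
elim: m => //= m IH /IH sg hs; have := sg (rcons hs h).
by rewrite foldr_rcons.
Qed.

Section Arch.
Hypothesis arch : ~ finite_place K.
Let acr := ac arch.
Notation or := (of_real K).

Lemma of_realM_coords (r t : R) h : or (r + t) * h = or r * h + or t * h.
Proof. by rewrite (ac_realD acr) mulrDl. Qed.

Lemma schwartz_line (g : K -> R) h x t : schwartz g ->
  is_derive t (1 : R) (line g x h) (dir_derive h g (x + or t * h)).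
Proof.
move=> sg; have [_ /(_ (x + or t * h) h) dg _] := sg [::].
set y := x + or t * h in dg *.
have lE u : line g x h (u + t) = line g y h u.
  by rewrite /line /y -addrA -of_realM_coords [t + u]addrC.
have FE : (fun z : R => z^-1 *: ((line g x h \o shift t) (z *: (1 : R)) - line g x h t)) =
    (fun z : R => z^-1 *: ((line g y h \o shift 0) (z *: (1 : R)) - line g y h 0)).
  apply/funext => z; rewrite /= addr0 lE.
  by have -> : line g x h t = line g y h 0 by rewrite -lE add0r.
apply: DeriveDef; first by move: dg; rewrite /derivable /= -FE.
by rewrite /dir_derive derive1E /derive -FE.
Qed.

Lemma schwartz_diff (g : K -> R) h m : schwartz g -> exists2 M : R, 0 <= M &
  forall t x, `|t| <= 1 ->
    `|iter m (fun u x => u (x + or t * h) - u x) g x| <= M * `|t| ^+ m * decay x.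
Proof.
move=> sg; have [M M0 HM] := schwartz_decay (schwartz_dir h m sg).
have s0 := ac_s acr.
pose r := m%:R `^ s * a h.
have r0 : 0 <= r by rewrite mulr_ge0 ?powR_ge0 ?absv_ge0.
have [D D0 HD] := decay_shift r0.
exists (M * D); first by rewrite mulr_ge0// ltW.
move=> t x t1; pose phi k (u : R) := iter k (dir_derive h) g (x + or u * h).
have dphi k u : is_derive u (1 : R) (phi k) (phi k.+1 u).
  exact: (schwartz_line h x u (schwartz_dir h k sg)).
have [xi /andP[x0 xm] E] := iter_diff m t dphi 0%N 0.
have E2 j (v : R) : iter j (diff t) (phi 0%N) v =
    iter j (fun u x => u (x + or t * h) - u x) g (x + or v * h).
  elim: j v => [//|j IH] v; rewrite /= /diff !IH.
  by rewrite of_realM_coords addrA.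
have -> : iter m (fun u x => u (x + or t * h) - u x) g x = t ^+ m * phi m (xi * t).
  by rewrite -[in X in _ = X * _]/(t ^+ m) -[in RHS](add0r (xi * t)) -E E2 (of_real_line0 acr).
rewrite normrM normrX mulrC /phi.
apply: (@le_trans _ _ (M * decay (x + or (xi * t) * h) * `|t| ^+ m)).
  by rewrite ler_wpM2r ?exprn_ge0//; exact: HM.
have -> : M * D * `|t| ^+ m * decay x = M * (D * decay x) * `|t| ^+ m by ring.
rewrite ler_wpM2r ?exprn_ge0// ler_wpM2l//.
apply: HD; rewrite absvM ler_wpM2r ?absv_ge0// (ac_abs acr).
apply: ge0_ler_powR; rewrite ?nnegrE ?(ltW s0)// normrM.
by rewrite (ger0_norm x0) -[leRHS]mulr1 ler_pM.
Qed.

(** The displacement [h] is performed one coordinate at a time. Each step costs [co i h] times a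
    bound for a directional derivative, and the coordinate is at most a constant times [a h] to the
    power [s^-1]. *)
Lemma schwartz_hoelder (g : K -> R) : schwartz g -> exists2 M : R, 0 <= M &
  forall x h, `|g (x + h) - g x| <= M * a h `^ s^-1.
Proof.
move=> sg; have s0 := ac_s acr; have C0 := ac_C acr.
have /choice[D HD] : forall i : nat, exists D : R, 0 <= D /\
    forall x, `|dir_derive (e i) g x| <= D.
  move=> i; have [_ _ /(_ 0%N)[D HD]] := sg [:: e i].
  exists `|D|; split=> // x; have := HD x; rewrite expr0 mul1r => /le_trans; apply.
  exact: ler_norm.
exists (\sum_(i < n) D i * C `^ s^-1).
  by apply: sumr_ge0 => i _; rewrite mulr_ge0 ?powR_ge0//; have [] := HD i.
move=> x h.
have step i (t : R) y : `|g (y + or t * e i) - g y| <= `|t| * D i.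
  pose phi k (u : R) := iter k (dir_derive (e i)) g (y + or u * e i).
  have dphi k u : is_derive u (1 : R) (phi k) (phi k.+1 u).
    exact: (schwartz_line (e i) y u (schwartz_dir (e i) k sg)).
  have [xi _] := iter_diff 1 t dphi 0%N 0.
  rewrite /= /diff /phi /= add0r (of_real_line0 acr) expr1 => ->.
  by rewrite normrM ler_wpM2l//; have [_] := HD i; apply.
have part m : (m <= n)%N -> `|g (x + \sum_(i < m) or (co i h) * e i) - g x| <=
    \sum_(i < m) `|co i h| * D i.
  elim: m => [|m IH] mn; first by rewrite !big_ord0 addr0 subrr normr0.
  rewrite !big_ord_recr /= addrA.
  set y := x + \sum_(i < m) _; have := IH (ltnW mn); rewrite -/y => h1.
  have -> : g (y + or (co m h) * e m) - g x = (g (y + or (co m h) * e m) - g y) + (g y - g x).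
    by rewrite addrA subrK.
  by apply: le_trans (ler_normD _ _) _; rewrite addrC lerD.
have := part n (leqnn n); rewrite -(ac_sum acr h) => h1; apply: le_trans h1 _.
rewrite mulr_suml; apply: ler_sum => i _; have [D0 _] := HD i.
rewrite mulrC -mulrA ler_wpM2l// -powRM ?absv_ge0 ?(ltW C0)//.
rewrite -[leLHS]powRr1// -(mulfV (lt0r_neq0 s0)) powRrM.
apply: ge0_ler_powR; rewrite ?nnegrE ?powR_ge0 ?invr_ge0 ?(ltW s0) ?mulr_ge0 ?absv_ge0 ?(ltW C0)//.
exact: (ac_le acr).
Qed.

End Arch.

Section Finite.
Hypothesis fin : finite_place K.

(** Compactness of the support gives a common radius at its points. If [f x = 0] while [f (x + h)]
    is nonzero, the conclusion is read from [x + h] with the increment [- h]. *)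
Lemma uniformly_locally_constant (f : K -> R[i]) :
  (forall x : K, \forall y \near x, f y = f x) -> compactly_supported f ->
  exists2 d : R, 0 < d & forall x h, a h < d -> f (x + h) = f x.
Proof.
move=> lc /compact_near_coveringP cs.
have : \forall h \near (0 : K), closure [set x | f x != 0] `<=` (fun y => f (y + h) = f y).
  apply: cs => x _; have : nbhs x [set y | f y = f x] by exact: lc.
  move=> /nbhsE[r r0 H].
  exists ([set y | a (x - y) < r], [set h | a h < r]) => /=.
    split; first exact: nbhs_ball_absv.
    by apply/nbhsE; exists r => // y; rewrite sub0r absvN.
  move=> [y h] /= [xy hr]; rewrite (H _ xy); apply: H.
  by rewrite opprD addrA; apply: le_lt_trans (fin _ _) _; rewrite absvN gt_max xy.
move=> /nbhsE[d d0 Hd]; exists d => // x h hd.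
have [fx|Sx] := eqVneq (f x) 0; last first.
  by apply: (Hd h); [rewrite sub0r absvN|exact: subset_closure].
have [->//|Sx] := eqVneq (f (x + h)) 0; have := Hd (- h) _ (x + h) (@subset_closure _ [set x | f x != 0] _ Sx).
by rewrite addrK sub0r opprK => ->.
Qed.
End Finite.

Lemma lambda_cont (g : R[i] -> R) : (forall z w, `|g z - g w| <= cabs (z - w)) ->
  mfun (fun x : B => g (lambda (x : K))).
Proof.
move=> gl; have [D [b [D0 b0 H]]] := lp_hoelder lp.
apply: (continuous_borel_real (g := fun x : K => g (lambda x))).
apply/continuous_realP => x r r0; exists ((r / D) `^ b^-1); first by apply: powR_gt0; exact: divr_gt0.
move=> y xy; apply: le_lt_trans (gl _ _) _.
have -> : lambda x - lambda y = lambda y * (lambda (x - y) - 1) :> R[i].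
  by rewrite mulrBr -(lp_lambdaD lp) mulr1 [y + _]addrC subrK.
rewrite cabsM (lp_cabs_lambda lp) mul1r; apply: le_lt_trans (H _) _.
rewrite -ltr_pdivlMl// mulrC -[ltRHS]powRr1 ?ltW ?divr_gt0// -(mulVf (lt0r_neq0 b0)) powRrM.
by apply: gt0_ltr_powR; rewrite ?nnegrE ?absv_ge0 ?powR_ge0.
Qed.

Lemma cmeas_lambda d (T : measurableType d) (f : T -> B) : mfun f ->
  cmeas (fun x => lambda (f x : K) : R[i]).
Proof.
move=> mf; split.
- apply: (mfun_comp (lambda_cont _) mf) => z w.
  by rewrite -ReN -ReD; exact: Re_le_cabs.
- apply: (mfun_comp (lambda_cont _) mf) => z w.
  by rewrite -ImN -ImD; exact: Im_le_cabs.
Qed.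

Notation F := (fourier mu).

Lemma fourierE f y : F f y = cint mu (fun x => f x * lambda (- (x * y))).
Proof. by []. Qed.

Let mN (y : K) : mfun (fun x : B => - ((x : K) * y) : B).
Proof. by apply: (mfun_opp lh); exact: (mfun_mul lh). Qed.

Lemma cinteg_lambda f y : cinteg mu f -> cinteg mu (fun x => f x * lambda (- (x * y))).
Proof.
move=> [mf ff]; split; first by apply: cmeasM => //; exact: cmeas_lambda.
by under eq_integral do rewrite cabsM (lp_cabs_lambda lp) mulr1.
Qed.

Lemma fourier_bound f y : cinteg mu f -> ((cabs (F f y))%:E <= \int[mu]_x (cabs (f x))%:E)%E.
Proof.
move=> fi; have := cabs_cint_le (cinteg_lambda y fi); rewrite -fourierE.
by under [in leRHS]eq_integral do rewrite cabsM (lp_cabs_lambda lp) mulr1.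
Qed.

(** Measurability comes from Fubini, but the integrand has constant modulus in [y]. The factor
    [decay y] makes it integrable on the product and is divided out afterwards. *)
Lemma fourier_cmeas f : cinteg mu f -> cmeas (F f : B -> R[i]).
Proof.
move=> fi; have [mf ff] := fi.
have mfst : mfun (fun z : B * B => z.1) by exact: measurable_fst.
have msnd : mfun (fun z : B * B => z.2) by exact: measurable_snd.
have d0 (y : K) : 0 < decay y by exact: decay_gt0.
pose phi (z : B * B) : R[i] := (decay z.1)%:C%C * (f z.2 * lambda (- ((z.2 : K) * z.1))).
have mphi : cmeas phi.
  apply: cmeasM; first by apply: cmeasR; exact: (mfun_comp (mfun_decay lh) mfst).
  apply: cmeasM; first exact: (cmeas_comp msnd mf).
  by apply: cmeas_lambda; apply: (mfun_opp lh); exact: (mfun_mul lh).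
have cphi y x : cabs (phi (y, x)) = decay y * cabs (f x).
  by rewrite /phi !cabsM (lp_cabs_lambda lp) mulr1 cabs_real// ltW.
have fine_f : (\int[mu]_x (cabs (f x))%:E)%E \is a fin_num.
  by rewrite ge0_fin_numE//; apply: integral_ge0 => x _; rewrite lee_fin cabs_ge0.
have foo : (\int[mu]_y \int[mu]_x (cabs (phi (y, x)))%:E < +oo)%E.
  rewrite (eq_integral (fun y : B => (decay y)%:E * \int[mu]_x (cabs (f x))%:E)%E).
    rewrite ge0_intZr; first last.
    - by apply: integral_ge0 => x _; rewrite lee_fin cabs_ge0.
    - by move=> y; rewrite ltW.
    - exact: mfun_decay.
    rewrite -(fineK fine_f) muleC; apply: lte_mul_pinfty; rewrite ?lee_fin ?(decay_int lh)//.
    by apply: fine_ge0; apply: integral_ge0 => x _; rewrite lee_fin cabs_ge0.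
  move=> y _; under eq_integral do rewrite cphi.
  by rewrite ge0_intZ ?ltW//; [exact: cmeas_cabs|move=> x; exact: cabs_ge0].
have [mF _] := cinteg_fubini1 mphi foo.
have -> : F f = (fun y => ((decay y)^-1)%:C%C * cint mu (fun x => phi (y, x))).
  apply/funext => y; rewrite /phi /= cintZ; last exact: cinteg_lambda.
  rewrite mulrA -rmorphM mulVf ?mul1r ?gt_eqF//.
apply: cmeasM => //; apply: cmeasR; apply: meas_invr => [|y]; last by rewrite ltW.
exact: mfun_decay.
Qed.

Lemma cinteg_shift f h : cinteg mu f -> cinteg mu (fun x => f (x + h)) /\
  cint mu (fun x => f (x + h)) = cint mu f.
Proof.
move=> fi.
have [|||||] := @cov_cint _ _ _ mu (fun x : K => x + h) (fun _ => 1) 1 _ _ _ _ _ f fi.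
- exact: (mfun_add lh).
- exact: measurable_cst.
- by [].
- by [].
- move=> g mg g0; rewrite mul1e; under eq_integral do rewrite mulr1.
  rewrite (int_shift lh h (f := fun x => (g x)%:E))//.
  exact/measurable_EFinP.
have -> : (fun x : B => f ((x : K) + h) * (1 : R)%:C%C) = (fun x => f (x + h)).
  by apply/funext => x; rewrite mulr1.
by move=> h1; rewrite mul1r.
Qed.

Lemma fourier_shift f h y : cinteg mu f ->
  F (fun x => f (x + h)) y = lambda (h * y) * F f y.
Proof.
move=> fi; rewrite !fourierE -cintZ; last exact: cinteg_lambda.
have fl := cinteg_lambda y fi.
have [_] := cinteg_shift h (cintegZ (lambda (h * y)) fl); move=> <-.
apply: cint_ext => x; rewrite mulrCA -(lp_lambdaD lp); congr (_ * lambda _).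
by rewrite mulrDl opprD addrCA subrr addr0.
Qed.

Lemma fourier_diff f h y m : cinteg mu f ->
  cinteg mu (iter m (fun u x => u (x + h) - u x) f) /\
  F (iter m (fun u x => u (x + h) - u x) f) y = (lambda (h * y) - 1) ^+ m * F f y.
Proof.
move=> fi; elim: m => [|m [IH1 IH2]]; first by rewrite expr0 mul1r.
have [sh _] := cinteg_shift h IH1.
split=> /=; first exact: cintegB.
rewrite exprS mulrBl mul1r mulrBl -mulrA -IH2 -(fourier_shift _ _ IH1).
rewrite !fourierE -cintB; try exact: cinteg_lambda.
by apply: cint_ext => x; rewrite mulrBl.
Qed.

End SchwartzBounds.

(** * Plancherel's theorem and the Fourier transform on L2 *)

Section FourierL2.
Context {R : realType} {K : valuedFieldType R}.
Variable mu : {sigma_finite_measure set (borel K) -> \bar R}.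
Variables (n : nat) (e : nat -> K) (co : nat -> K -> R) (s C : R).
Hypothesis lp : local_place mu n e co s C.
Let lh := lp_haar lp.
Let ac := lp_coords lp.
Notation a := (@absv R K).
Notation B := (borel K).
Notation md := (module mu).
Notation decay := (decay mu).
Notation F := (fourier mu).
Notation test := (test n co).
Notation SB := (@schwartz_bruhat R K).
Implicit Types f g : K -> R[i].

Definition ctest f := exists u v, [/\ test u, test v & f = (fun x => (u x +i* v x)%C)].

Lemma ctest_S0 f : ctest f -> S0 f.
Proof. by move=> [u [v [tu tv ->]]]; exact: (test_S0 (lh_compact lh) ac). Qed.

Lemma S0_SB f : S0 f -> SB f. Proof. by case. Qed.

(** For a trivial character every Fourier transform is constant, so inversion would give equal
    values at 0 and 1 to a test function that vanishes at 0 but not at 1. *)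
Lemma exists_char : exists z : K, lambda z != 1 :> R[i].
Proof.
have [k [m [h1 _]]] := tball_mem ac (lh_dense lh) (oner_neq0 K) ltr01.
have [_ [v [v1 v2 v3]]] := @tball_test _ _ _ _ _ _ _ ac (lh_seq lh) k m.
have [j vj] : exists j, v j 1 != 0.
  apply: contrapT => /forallNP H; have := v3 1.
  rewrite (_ : (fun k => _) = (fun=> 0)); last first.
    by apply/funext => j; apply/eqP; have := H j; move=> /negP/negPn.
  rewrite indicE mem_set// => /cvg_lim => /(_ (@norm_hausdorff _ _)).
  by rewrite lim_cst => // /esym/eqP; rewrite oner_eq0.
have tv := v1 j; pose f (x : K) : R[i] := (v j x +i* 0)%C.
have Sf : S0 f by apply: ctest_S0; exists (v j), (fun=> 0); split=> //; exact: test0.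
have f0 : f 0 = 0.
  have [[ep e0 [r H]] _ _] := tv; rewrite /f; congr (_ +i* _)%C; apply/eqP.
  by apply: contraT => /H; rewrite absv0 leNgt e0.
apply: contrapT => /forallNP H.
have l1 (z : K) : lambda z = 1 :> R[i] by apply/eqP; have := H z; move=> /negP/negPn.
have sd := lp_self_dual lp (S0_SB Sf).
have : f (- - 1) = f (- 0).
  rewrite -!sd !fourierE; apply: cint_ext => x.
  by rewrite !l1.
rewrite opprK oppr0 f0 /f => /eqP; rewrite eq_complex /= => /andP[/eqP h _].
by move: vj; rewrite h eqxx.
Qed.

Lemma continuous_bounded_compact (A : set K) (g : K -> R) : compact A -> continuous g ->
  exists2 M : R, 0 <= M & forall x, A x -> `|g x| <= M.
Proof.
move=> cA cg; have cK : compact (g @` A).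
  by apply: continuous_compact cA; exact: continuous_subspaceT.
have [M [_ MP]] := compact_bounded cK.
exists (`|M| + 1) => [|x xr]; first by rewrite addr_ge0.
by apply: (MP (`|M| + 1)); [have := ler_norm M; lra|exists x].
Qed.

Lemma SB_bound f : SB f -> cmeas (f : B -> R[i]) /\
  exists2 M : R, 0 <= M & forall x, cabs (f x) <= M * decay x.
Proof.
rewrite /schwartz_bruhat; case: asboolP => fin; last first.
  move=> [s1 s2]; have [c1 _ _] := s1 [::]; have [c2 _ _] := s2 [::].
  have [M1 M10 H1] := schwartz_decay lp s1; have [M2 M20 H2] := schwartz_decay lp s2.
  split; first by split; exact: continuous_borel_real.
  exists (M1 + M2); first exact: addr_ge0.
  by move=> x; rewrite mulrDl; apply: le_trans (cabs_le_ReIm _) _; exact: lerD.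
move=> [lc cs]; have cont (p : R[i] -> R) : continuous (fun x : K => p (f x)).
  move=> x A; rewrite /= => /nbhs_singleton Ax.
  by rewrite /nbhs /=; near=> y; rewrite /= (_ : f y = f x)//; near: y; exact: lc.
split; first by split; exact: (continuous_borel_real (cont _)).
have [M M0 HM] := continuous_bounded_compact cs (cont cabs).
have [r r0 Hr] := continuous_bounded_compact cs (@continuous_absv R K).
have [D D0 HD] := decay_inv lp r0.
exists (M * D); first by rewrite mulr_ge0// ltW.
move=> x; have d0 := decay_gt0 lh x.
have [->|fx] := eqVneq (f x) 0; first by rewrite cabs0 !mulr_ge0// ltW.
have Sx : closure [set x | f x != 0] x by exact: subset_closure.
have := HM _ Sx; rewrite ger0_norm ?cabs_ge0// => h1; apply: le_trans h1 _.
rewrite -mulrA ler_peMr//; apply: HD; have := Hr _ Sx.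
by rewrite ger0_norm ?absv_ge0.
Unshelve. all: by end_near. Qed.

Lemma SB_cinteg f : SB f -> cinteg mu f.
Proof.
move=> /SB_bound[mf [M M0 H]]; apply: (cinteg_le (v := fun x : B => M * decay x)) => //.
  by apply: mfun_prod => //; exact: mfun_decay.
apply: ge0_intZ_lty => //; [exact: mfun_decay|by move=> x; rewrite ltW// decay_gt0|exact: decay_int].
Qed.

Lemma decay_le1 x : decay x <= 1.
Proof. by rewrite invf_le1 ?exprn_gt0 ?ltr_wpDr ?module_ge0// exprn_ege1// lerDl module_ge0. Qed.

Lemma decay_sqL f M : cmeas (f : B -> R[i]) -> 0 <= M ->
  (forall x, cabs (f x) <= M * decay x) -> sqL mu f.
Proof.
move=> mf M0 H; apply: (sqL_le (v := fun x : B => M ^+ 2 * decay x)) => //.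
- by apply: mfun_prod => //; exact: mfun_decay.
- move=> x; have d0 := decay_gt0 lh x; have d1 := decay_le1 x.
  apply: le_trans (_ : (M * decay x) ^+ 2 <= _).
    by rewrite lerXn2r ?nnegrE ?cabs_ge0// mulr_ge0// ltW.
  by rewrite exprMn ler_wpM2l ?sqr_ge0// expr2 ger_pMl.
apply: ge0_intZ_lty; [exact: mfun_decay|by move=> x; rewrite ltW// decay_gt0|exact: sqr_ge0|exact: decay_int].
Qed.

Lemma SB_sqL f : SB f -> sqL mu f.
Proof. by move=> /SB_bound[mf [M M0 H]]; exact: decay_sqL M0 H. Qed.

Lemma fourier_bounded f : cinteg mu f -> exists2 M : R, 0 <= M &
  forall y, cabs (F f y) <= M.
Proof.
move=> fi; have [_ ff] := fi; exists (fine (\int[mu]_x (cabs (f x))%:E)%E).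
  by apply: fine_ge0; apply: integral_ge0 => x _; rewrite lee_fin cabs_ge0.
move=> y; rewrite -lee_fin fineK; first exact: (fourier_bound lp).
by rewrite ge0_fin_numE//; apply: integral_ge0 => x _; rewrite lee_fin cabs_ge0.
Qed.

(* An estimate at large y and boundedness give a global one. *)
Lemma decay_of_large (u : K -> R) (Y M1 M2 : R) : 0 <= Y ->
  (forall y, u y <= M1) -> (forall y, Y < a y -> u y <= M2 * decay y) ->
  exists2 M : R, 0 <= M & forall y, u y <= M * decay y.
Proof.
move=> Y0 H1 H2; have [D D0 HD] := decay_inv lp Y0.
exists (`|M1| * D + `|M2|); first by rewrite addr_ge0// mulr_ge0// ltW.
move=> y; have d0 := decay_gt0 lh y; rewrite mulrDl.
have p1 : 0 <= `|M1| * D * decay y by rewrite !mulr_ge0// ltW.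
have p2 : 0 <= `|M2| * decay y by rewrite mulr_ge0// ltW.
have [yY|yY] := lerP (a y) Y.
  have h := H1 y; have h2 := ler_norm M1.
  have : `|M1| <= `|M1| * (D * decay y) by rewrite ler_peMr//; exact: HD.
  by rewrite mulrA; lra.
have h := H2 _ yY; have : M2 * decay y <= `|M2| * decay y by apply: ler_wpM2r; [exact: ltW|exact: ler_norm].
lra.
Qed.

(** For large [y] the shift by [h = z0 / y] is small while [lambda (h * y) = lambda z0] differs from
    1. At a finite place [f] is invariant under this shift, so [F f y] vanishes; at an archimedean
    place an m-th difference along one basis direction gives the decay. *)
Lemma SB_fourier_decay f : SB f ->
  exists2 M : R, 0 <= M & forall y, cabs (F f y) <= M * decay y.
Proof.
move=> sf; have fi := SB_cinteg sf; have [M1 M10 H1] := fourier_bounded fi.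
have [z0 lz] := exists_char.
have lz1 : lambda z0 - 1 != 0 :> R[i] by rewrite subr_eq0.
have z00 : z0 != 0 by apply: contraNneq lz => ->; rewrite (lp_lambda0 lp).
have az0 : 0 < a z0 by rewrite absv_gt0.
have y_neq0 Y (y : K) : 0 <= Y -> Y < a y -> y != 0.
  by move=> Y0 h; rewrite -absv_gt0; exact: le_lt_trans h.
move: (sf); rewrite /schwartz_bruhat; case: asboolP => fin.
  move=> [lc cs]; have [d d0 Hd] := uniformly_locally_constant fin lc cs.
  have Y0 : 0 <= a z0 / d by rewrite divr_ge0 ?ltW.
  apply: (decay_of_large (M2 := 0) Y0 H1) => y Yy; have y0 := y_neq0 _ _ Y0 Yy.
  have hd : a (z0 / y) < d.
    by rewrite absvM absvV ltr_pdivrMr ?absv_gt0// mulrC -ltr_pdivrMr.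
  have := fourier_shift lp (z0 / y) y fi; rewrite divfK//.
  have -> : (fun x => f (x + z0 / y)) = f by apply/funext => x; exact: Hd.
  move=> /eqP; rewrite -{1}[F f y]mul1r -subr_eq0 -mulrBl mulf_eq0 => /orP[|/eqP ->].
    by rewrite subr_eq0 eq_sym (negbTE lz).
  by rewrite cabs0 mul0r.
move=> [s1 s2]; have acr := ac fin.
have s0 := ac_s acr; have C0 := ac_C acr.
have [s' s'0 ms] := module_absv lh.
(* The m-th difference decays like [a y] to the power [- m / s], which has to beat [md y ^+ 2], that
   is [a y] to the power [2 * s']. *)
pose m := Num.bound (2 * s' * s).
have mP : 2 * s' * s <= m%:R by apply: ltW; apply: archi_boundP; rewrite !mulr_ge0// ltW.
pose c := cabs (lambda z0 - 1 : R[i]) / n.+1%:R.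
have c0 : 0 < c by rewrite divr_gt0// lt_neqAle eq_sym cabs_eq0 lz1 cabs_ge0.
have di := decay_int lh.
pose I := fine (\int[mu]_x (decay x)%:E)%E.
have I0 : 0 <= I by apply: fine_ge0; apply: integral_ge0 => x _; rewrite lee_fin ltW// decay_gt0.
have IE : (\int[mu]_x (decay x)%:E = I%:E)%E.
  by rewrite fineK// ge0_fin_numE//; apply: integral_ge0 => x _; rewrite lee_fin ltW// decay_gt0.
have /choice[D HD] : forall i : nat, exists D : R, 0 <= D /\
    forall (t : R) x, `|t| <= 1 ->
    cabs (iter m (fun u x => u (x + of_real K t * e i) - u x) f x) <= D * `|t| ^+ m * decay x.
  move=> i; have [D1 D10 E1] := schwartz_diff lp fin (e i) m s1.
  have [D2 D20 E2] := schwartz_diff lp fin (e i) m s2.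
  exists (D1 + D2); split; first exact: addr_ge0.
  move=> t x t1; apply: le_trans (cabs_le_ReIm _) _.
  rewrite !mulrDl; apply: lerD.
    apply: le_trans (E1 _ x t1); rewrite le_eqVlt; apply/orP; left; apply/eqP; congr `|_|.
    elim: (m) x => //= j IH x; by rewrite ReD ReN !IH.
  apply: le_trans (E2 _ x t1); rewrite le_eqVlt; apply/orP; left; apply/eqP; congr `|_|.
  elim: (m) x => //= j IH x; by rewrite ImD ImN !IH.
pose A := C * a z0; have A0 : 0 < A by rewrite mulr_gt0.
pose Y := Num.max 1 A.
have Y1 : 1 <= Y by rewrite le_max lexx.
have Y0 : 0 <= Y by exact: le_trans Y1.
pose M2 := c ^- m * (\sum_(i < n) D i) * I * A `^ (m%:R / s) * 4.
apply: (decay_of_large (M2 := M2) Y0 H1) => y Yy; have y0 := y_neq0 _ _ Y0 Yy.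
have ay0 : 0 < a y by rewrite absv_gt0.
have ay1 : 1 < a y by exact: le_lt_trans Yy.
pose h := z0 / y; pose t i := co i h.
have hE : h = \sum_(i < n) of_real K (t i) * e i by exact: (ac_sum acr).
have ts i : (i < n)%N -> `|t i| `^ s <= A / a y.
  by move=> ilt; have := ac_le acr h ilt; rewrite {2}/h absvM absvV mulrA.
have Ay1 : A / a y <= 1 by rewrite ler_pdivrMr// mul1r; apply: le_trans (ltW Yy); rewrite le_max lexx orbT.
have t1 i : (i < n)%N -> `|t i| <= 1.
  move=> ilt; rewrite leNgt; apply/negP => h1; have := le_trans (ts _ ilt) Ay1.
  rewrite leNgt => /negP; apply.
  rewrite -[ltLHS](congr1 (@^~ s) (powR1 R)).
  by apply: gt0_ltr_powR; rewrite ?nnegrE.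
(* If all directions contributed less than [c], multiplicativity of [lambda] would bound the modulus
   of [lambda z0 - 1] by [n%:R * c]; the denominator [n.+1] in [c] makes this too small. *)
have [i ilt ci] : exists2 i : nat, (i < n)%N & c <= cabs (lambda (of_real K (t i) * e i * y) - 1 : R[i]).
  apply: contrapT => H; have lt_c i : (i < n)%N -> cabs (lambda (of_real K (t i) * e i * y) - 1 : R[i]) <= c.
    by move=> ilt; rewrite leNgt; apply/negP => h1; apply: H; exists i => //; exact: ltW.
  have part j : (j <= n)%N -> cabs (lambda ((\sum_(i < j) of_real K (t i) * e i) * y) - 1 : R[i]) <= j%:R * c.
    elim: j => [|j IH] jn; first by rewrite big_ord0 mul0r (lp_lambda0 lp) subrr cabs0 mul0r.
    rewrite big_ord_recr /= mulrDl (lp_lambdaD lp).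
    set u := lambda _; set v := lambda _.
    have -> : u * v - 1 = u * (v - 1) + (u - 1) by rewrite mulrBr mulr1 addrA subrK.
    apply: le_trans (cabsD _ _) _; rewrite cabsM (lp_cabs_lambda lp) mul1r -natr1 mulrDl mul1r addrC.
    by apply: lerD; [exact: IH (ltnW jn)|exact: lt_c].
  have := part n (leqnn n); rewrite -hE /h divfK// /c mulrA leNgt => /negP; apply.
  rewrite ltr_pdivrMr// mulrC ltr_pM2l; first by rewrite ltr_nat.
  by rewrite lt_neqAle eq_sym cabs_eq0 lz1 cabs_ge0.
have [d1 d2] := fourier_diff lp (of_real K (t i) * e i) y m fi.
have [Di0 HDi] := HD i.
have b1 : cabs (lambda (of_real K (t i) * e i * y) - 1 : R[i]) ^+ m * cabs (F f y) <= D i * `|t i| ^+ m * I.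
  rewrite -cabsX -cabsM -d2 -lee_fin; apply: le_trans (fourier_bound lp _ d1) _.
  have Dt0 : 0 <= D i * `|t i| ^+ m by rewrite mulr_ge0// exprn_ge0.
  have md_ := mfun_decay lh.
  rewrite EFinM -IE -(ge0_intZ mu md_ (fun x => ltW (decay_gt0 lh x)) Dt0).
  apply: ge0_int_le => //; last by move=> x; exact: HDi _ _ (t1 _ ilt).
  - by apply: cmeas_cabs; have [] := d1.
  - exact: mfun_prod.
  - by move=> x; exact: cabs_ge0.
have tm : `|t i| ^+ m <= A `^ (m%:R / s) * (a y) `^ (- (m%:R / s)).
  have -> : A `^ (m%:R / s) * (a y) `^ (- (m%:R / s)) = (A / a y) `^ (m%:R / s).
    rewrite powRM ?(ltW A0) ?invr_ge0 ?(ltW ay0)//; congr (_ * _).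
    by rewrite -[(a y)^-1]powR_inv1 ?(ltW ay0)// -powRrM mulN1r.
  rewrite -powR_mulrn// -[X in `|t i| `^ X](divfK (lt0r_neq0 s0)) mulrC powRrM.
  apply: ge0_ler_powR; rewrite ?nnegrE ?powR_ge0 ?divr_ge0 ?(ltW s0) ?(ltW A0) ?(ltW ay0)//.
  exact: ts.
have dy : a y `^ (- (m%:R / s)) <= 4 * decay y.
  rewrite /decay ler_pdivlMr ?exprn_gt0 ?ltr_wpDr ?module_ge0// powRN.
  rewrite mulrC ler_pdivrMr ?powR_gt0//.
  have my1 : 1 <= md y.
    rewrite ms -[leLHS](congr1 (@^~ s') (powR1 R)).
    by apply: ge0_ler_powR; rewrite ?nnegrE ?(ltW s'0) ?(ltW ay0) ?(ltW ay1).
  have : md y ^+ 2 <= a y `^ (m%:R / s).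
    rewrite ms -powR_mulrn ?powR_ge0// -powRrM; apply: ler_powR; first exact: ltW.
    by rewrite ler_pdivlMr// [s' * 2]mulrC.
  by rewrite !expr2; nra.
have cm : c ^+ m * cabs (F f y) <= D i * `|t i| ^+ m * I.
  apply: le_trans b1; rewrite ler_wpM2r ?cabs_ge0// lerXn2r ?nnegrE ?cabs_ge0 ?(ltW c0)//.
have Dsum : D i <= \sum_(i < n) D i.
  rewrite (bigD1 (Ordinal ilt))//= lerDl; apply: sumr_ge0 => j _; by have [] := HD j.
have cm0 : 0 < c ^+ m by exact: exprn_gt0.
rewrite -(ler_pM2l cm0); apply: le_trans cm _.
have -> : c ^+ m * (M2 * decay y) = (\sum_(i < n) D i) * I * (A `^ (m%:R / s) * (4 * decay y)).
  by rewrite /M2; field; rewrite gt_eqF.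
have -> : D i * `|t i| ^+ m * I = D i * I * `|t i| ^+ m by ring.
apply: ler_pM => //; rewrite ?mulr_ge0 ?exprn_ge0//.
  by rewrite ler_wpM2r.
by apply: le_trans tm _; rewrite ler_wpM2l ?powR_ge0.
Qed.

Lemma SB_fourier f : SB f -> cinteg mu (F f) /\ sqL mu (F f).
Proof.
move=> sf; have mF := fourier_cmeas lp (SB_cinteg sf).
have [M M0 H] := SB_fourier_decay sf; split; last exact: decay_sqL M0 H.
apply: (cinteg_le (v := fun x : B => M * decay x)) => //.
  by apply: mfun_prod => //; exact: mfun_decay.
apply: ge0_intZ_lty => //; [exact: mfun_decay|by move=> x; rewrite ltW// decay_gt0|exact: decay_int].
Qed.

(** Fubini carries the character from the transform of [g] over to [F f], and inversion for the
    Schwartz-Bruhat factor [f] finishes. *)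
Lemma plancherel f g : SB f -> cinteg mu g -> ip mu (F f) (F g) = ip mu f g.
Proof.
move=> sf gi; have [[mF iF] _] := SB_fourier sf; have [mg ig] := gi.
have mfst : mfun (fun z : B * B => z.1) by exact: measurable_fst.
have msnd : mfun (fun z : B * B => z.2) by exact: measurable_snd.
pose phi (z : B * B) : R[i] := F f z.1 * (g z.2 * lambda (- ((z.2 : K) * z.1)))^*%C.
have mphi : cmeas phi.
  apply: cmeasM; first exact: (cmeas_comp mfst mF).
  apply: cmeasJ; apply: cmeasM; first exact: (cmeas_comp msnd mg).
  by apply: (cmeas_lambda lp); apply: (mfun_opp lh); exact: (mfun_mul lh).
have cphi y x : cabs (phi (y, x)) = cabs (F f y) * cabs (g x).
  by rewrite /phi cabsM cabsJ cabsM (lp_cabs_lambda lp) mulr1.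
have g0 : (0 <= \int[mu]_x (cabs (g x))%:E)%E by apply: integral_ge0 => x _; rewrite lee_fin cabs_ge0.
have fine_g : (\int[mu]_x (cabs (g x))%:E)%E \is a fin_num by rewrite ge0_fin_numE.
have foo : (\int[mu]_y \int[mu]_x (cabs (phi (y, x)))%:E < +oo)%E.
  rewrite (eq_integral (fun y : B => (cabs (F f y))%:E * \int[mu]_x (cabs (g x))%:E)%E).
    rewrite ge0_intZr//; [|exact: cmeas_cabs|by move=> y; exact: cabs_ge0].
    by rewrite -(fineK fine_g) muleC; apply: lte_mul_pinfty; rewrite ?lee_fin ?fine_ge0.
  move=> y _; under eq_integral do rewrite cphi.
  by rewrite ge0_intZ ?cabs_ge0//; [exact: cmeas_cabs|move=> x; exact: cabs_ge0].
have sd := lp_self_dual lp sf.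
transitivity (cint mu (fun y => cint mu (fun x => phi (y, x)))).
  apply: cint_ext => y.
  rewrite -[RHS]/(cint mu (fun x : B => F f y * (g x * lambda (- ((x : K) * y)))^*%C)).
  rewrite cintZ; last first.
    by apply: cintegJ; exact: (cinteg_lambda lp).
  by rewrite cintJ; last exact: (cinteg_lambda lp).
rewrite (cint_fubini mphi foo); apply: cint_ext => x.
have fi : cinteg mu (F f) by split.
transitivity (cint mu (fun y => (g x)^*%C * (F f y * lambda (- (y * - x))))).
  apply: cint_ext => y; rewrite /phi /= conjcM -(lp_lambdaN lp) opprK mulrN opprK.
  by rewrite mulrCA [(x : K) * _]mulrC.
rewrite cintZ; last exact: (cinteg_lambda lp).
by rewrite -fourierE sd opprK mulrC.
Qed.

Lemma ctest_dense f (eps : R) : cinteg mu f -> sqL mu f -> 0 < eps ->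
  exists h, [/\ ctest h, (\int[mu]_x (cabs (f x - h x)%R)%:E <= eps%:E)%E
    & nr mu (fun x => f x - h x) <= eps].
Proof.
move=> fi f2 e0; have [u [v [tu tv h1 h2]]] := S0_dense lh ac fi f2 e0.
exists (fun x => (u x +i* v x)%C); split=> //; first by exists u, v.
exact: sqn_le.
Qed.

Lemma sqL_truncate f (eps : R) : sqL mu f -> 0 < eps -> exists g,
  [/\ cinteg mu g, sqL mu g & nr mu (fun x => f x - g x) <= eps].
Proof.
move=> f2 e0; have [mf ff] := f2.
(* Where [cabs (f x)] is at least [k.+1%:R^-1], it is at most [k.+1%:R * cabs (f x) ^+ 2], so the
   truncation is integrable. *)
pose g k (x : B) : R[i] := (\1_[set y : B | k.+1%:R^-1 <= cabs (f y)] x)%:C%C * f x.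
have mS k : measurable [set y : B | k.+1%:R^-1 <= cabs (f y)].
  rewrite (_ : [set y | _] = (fun y => cabs (f y)) @^-1` `[k.+1%:R^-1, +oo[); last first.
    by apply/seteqP; split=> y /=; rewrite in_itv /= andbT.
  by rewrite -[X in measurable X]setTI; apply: cmeas_cabs.
have mi k : cmeas (fun x : B => (\1_[set y : B | k.+1%:R^-1 <= cabs (f y)] x)%:C%C : R[i]).
  by apply: cmeasR; exact: measurable_indic.
have i1 k (x : B) : cabs ((\1_[set y : B | k.+1%:R^-1 <= cabs (f y)] x)%:C%C : R[i]) <= 1.
  by rewrite cabs_real// indicE; case: (_ \in _).
have g2 k : sqL mu (g k) by exact: sqLMl f2 (mi k) (i1 k).
have gi k : cinteg mu (g k).
  apply: (cinteg_le (v := fun x : B => k.+1%:R * cabs (f x) ^+ 2)).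
  - by have [] := g2 k.
  - by apply: mfun_prod => //; exact: meas_sq.
  - move=> x; rewrite /g cabsM indicE; case: (boolP (x \in _)) => [/set_mem /= h|_]; last first.
      by rewrite cabs0 mul0r mulr_ge0// sqr_ge0.
    rewrite cabs1 mul1r expr2 mulrA ler_peMl ?cabs_ge0//.
    by rewrite mulrC -ler_pdivrMr// mul1r.
  - apply: ge0_intZ_lty => //; [exact: meas_sq|by move=> x; rewrite sqr_ge0].
have [|||||N HN] := @dominated_to0 _ _ _ mu (fun k x => cabs (f x - g k x) ^+ 2)
  (fun x => cabs (f x) ^+ 2) _ _ _ _ ff _ _ e0.
- by move=> k; apply: meas_sq; apply: cmeasB => //; have [] := g2 k.
- exact: meas_sq.
- by move=> k x; rewrite sqr_ge0.
- move=> k x; rewrite lerXn2r ?nnegrE ?cabs_ge0// /g -{1}[f x]mul1r -mulrBl cabsM ler_piMl ?cabs_ge0//.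
  by rewrite indicE; case: (_ \in _); rewrite ?subrr ?cabs0 ?subr0 ?cabs1.
- move=> x; have [fx|fx] := eqVneq (f x) 0.
    rewrite (_ : (fun k => _) = (fun=> 0)); first exact: cvg_cst.
    by apply/funext => k; rewrite /g fx mulr0 subrr cabs0 expr0n.
  have cf : 0 < cabs (f x) by rewrite lt_neqAle eq_sym cabs_eq0 fx cabs_ge0.
  have [N HN] := exists_inv_lt cf.
  apply/cvgrPdist_lt => ep ep0; exists N => // k /= Nk.
  rewrite /g indicE mem_set ?mul1r ?subrr ?cabs0 ?expr0n ?subr0 ?normr0//=.
  by apply: le_trans (ltW HN); rewrite lef_pV2 ?posrE// ler_nat.
exists (g N); split => //; apply: sqn_le; exact: HN.
Qed.

Lemma ctest_dense2 f (eps : R) : sqL mu f -> 0 < eps ->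
  exists2 h, ctest h & nr mu (fun x => f x - h x) <= eps.
Proof.
move=> f2 e0; have e4 : 0 < eps / 4 by rewrite divr_gt0.
have [g [gi g2 fg]] := sqL_truncate f2 e4.
have [h [th _ gh]] := ctest_dense gi g2 e4; exists h => //.
have h2 : sqL mu h by apply: SB_sqL; apply: S0_SB; exact: ctest_S0.
by apply: le_trans (nr_split f2 g2 h2) _; lra.
Qed.

Lemma ctest_seq f : sqL mu f -> exists u : nat -> K -> R[i],
  (forall k, ctest (u k)) /\ cvg2 mu u f.
Proof.
move=> f2; have /choice[u Hu] : forall k : nat, exists h, ctest h /\
    nr mu (fun x => f x - h x) <= k.+1%:R^-1.
  by move=> k; have [|h h1 h2] := @ctest_dense2 _ k.+1%:R^-1 f2; [rewrite invr_gt0|exists h].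
exists u; split; first by move=> k; have [] := Hu k.
move=> ep ep0; have [N HN] := exists_inv_lt ep0; exists N => k Nk.
rewrite nr_distC; have [_ h] := Hu k; apply: le_trans h _; apply: le_trans (ltW HN).
by rewrite lef_pV2 ?posrE// ler_nat.
Qed.

(** The graph of the Fourier transform on L2, closed under almost everywhere equality ([FL_ae]);
    [opFP] identifies it with [opF]. *)
Definition FL f g : Prop := [/\ sqL mu f, sqL mu g & exists u : nat -> K -> R[i],
  [/\ forall k, SB (u k), cvg2 mu u f & cvg2 mu (fun k => F (u k)) g]].

Lemma FL_ip f g f' g' : FL f g -> FL f' g' -> ip mu g g' = ip mu f f'.
Proof.
move=> [f2 g2 [u [su uf ug]]] [f2' g2' [v [sv vf vg]]].
have u2 k : sqL mu (u k) by exact: SB_sqL.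
have v2 k : sqL mu (v k) by exact: SB_sqL.
have Fu2 k : sqL mu (F (u k)) by have [] := SB_fourier (su k).
have Fv2 k : sqL mu (F (v k)) by have [] := SB_fourier (sv k).
have h1 l : ip mu g (F (v l)) = ip mu f (v l).
  apply: (cvg2_ip_lim Fu2 g2 (Fv2 l) ug) => ep ep0.
  have [N HN] := cvg2_ip u2 f2 (v2 l) uf ep0; exists N => k Nk.
  by rewrite plancherel//; [exact: HN|exact: SB_cinteg].
rewrite (ipJ g2' g2) (ipJ f2' f2); congr (_^*%C).
apply: (cvg2_ip_lim Fv2 g2' g2 vg) => ep ep0.
have [N HN] := cvg2_ip v2 f2' f2 vf ep0; exists N => k Nk.
by rewrite (ipJ g2 (Fv2 k)) h1 -(ipJ f2 (v2 k)); exact: HN.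
Qed.

Lemma iso_nr f g f' g' : sqL mu f -> sqL mu g -> sqL mu f' -> sqL mu g' ->
  ip mu g g = ip mu f f -> ip mu g' g' = ip mu f' f' -> ip mu g g' = ip mu f f' ->
  nr mu (fun x => g x - g' x) = nr mu (fun x => f x - f' x).
Proof.
move=> f2 g2 f2' g2' h1 h2 h3.
have h4 : ip mu g' g = ip mu f' f by rewrite (ipJ g2 g2') h3 -ipJ.
have d2 := sqLB f2 f2'; have D2 := sqLB g2 g2'.
suff : (nr mu (fun x => g x - g' x))%:C%C = (nr mu (fun x => f x - f' x))%:C%C by case.
rewrite -!ip_self// !ipBl// !ipBr// h1 h2 h3 h4//.
Qed.

Lemma FL_nr f g f' g' : FL f g -> FL f' g' ->
  nr mu (fun x => g x - g' x) = nr mu (fun x => f x - f' x).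
Proof.
move=> h h'; have [f2 g2 _] := h; have [f2' g2' _] := h'.
by apply: iso_nr => //; exact: FL_ip.
Qed.

Lemma FL_nr1 f g : FL f g -> nr mu g = nr mu f.
Proof.
move=> h; have [f2 g2 _] := h; have := FL_ip h h; rewrite !ip_self//.
by case.
Qed.

Lemma FL_uniq f g g' : FL f g -> FL f g' -> {ae mu, forall x, g x = g' x}.
Proof.
move=> h h'; have [f2 g2 _] := h; have [_ g2' _] := h'.
have d2 := sqLB g2 g2'.
have := nr_eq0_ae d2; rewrite (FL_nr h h') => /(_ _)H.
have ff : {ae mu, forall x : B, f x = f x} by exact: aeW.
by apply: filterS (H (nr_ae f2 f2 ff)) => x /eqP; rewrite subr_eq0 => /eqP.
Qed.

Lemma SB_FL f : SB f -> FL f (F f).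
Proof.
move=> sf; have [_ F2] := SB_fourier sf; split=> //; first exact: SB_sqL.
have c g : sqL mu g -> cvg2 mu (fun=> g) g.
  move=> g2 ep ep0; exists 0%N => k _; rewrite nr_ae ?ltW//.
  by apply: aeW.
by exists (fun=> f); split => //; apply: c => //; exact: SB_sqL.
Qed.

Lemma cvg2_cauchy u f : (forall k, sqL mu (u k)) -> sqL mu f -> cvg2 mu u f ->
  forall ep : R, 0 < ep -> exists N, forall k l, (N <= k)%N -> (N <= l)%N ->
    nr mu (fun x => u k x - u l x) <= ep.
Proof.
move=> u2 f2 uf ep ep0; have [N HN] := uf _ (divr_gt0 ep0 (ltr0Sn R 3)).
exists N => k l Nk Nl; apply: le_trans (nr_split (u2 k) f2 (u2 l)) _.
have h1 := HN _ Nk; have h2 := HN _ Nl; rewrite nr_distC in h2.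
lra.
Qed.

Lemma FL_limit (u v : nat -> K -> R[i]) f : (forall k, FL (u k) (v k)) -> sqL mu f ->
  cvg2 mu u f -> exists2 g, sqL mu g & cvg2 mu v g.
Proof.
move=> H f2 uf; have u2 k : sqL mu (u k) by have [] := H k.
apply: sqL_complete => [k|ep ep0]; first by have [] := H k.
have [N HN] := cvg2_cauchy u2 f2 uf ep0; exists N => k l Nk Nl.
by rewrite (FL_nr (H k) (H l)); exact: HN.
Qed.

Lemma ctest_SB f : ctest f -> SB f.
Proof. by move=> /ctest_S0/S0_SB. Qed.

Lemma FL_total f : sqL mu f -> exists g, FL f g.
Proof.
move=> f2; have [u [tu uf]] := ctest_seq f2.
have su k : SB (u k) by exact: ctest_SB.
have [g g2 vg] := FL_limit (fun k => SB_FL (su k)) f2 uf.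
by exists g; split=> //; exists u.
Qed.

Lemma ae_sub0 f g : {ae mu, forall x : B, f x - g x = 0} -> {ae mu, forall x : B, f x = g x}.
Proof. by apply: filterS => x /eqP; rewrite subr_eq0 => /eqP. Qed.

Lemma cvg2_ae u f g : (forall k, sqL mu (u k)) -> sqL mu f -> sqL mu g ->
  {ae mu, forall x : B, f x = g x} -> cvg2 mu u f -> cvg2 mu u g.
Proof.
move=> u2 f2 g2 fg uf ep ep0; have [N HN] := uf _ (divr_gt0 ep0 (ltr0Sn R 1)).
exists N => k Nk; apply: le_trans (nr_split (u2 k) f2 g2) _.
rewrite (nr_ae f2 g2 fg) mulr0 addr0; have := HN _ Nk; lra.
Qed.

Lemma FL_ae f g f' g' : FL f g -> sqL mu f' -> sqL mu g' ->
  {ae mu, forall x : B, f x = f' x} -> {ae mu, forall x : B, g x = g' x} -> FL f' g'.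
Proof.
move=> [f2 g2 [u [su uf ug]]] f2' g2' ff gg; split=> //; exists u; split=> //.
  by apply: cvg2_ae uf => // k; exact: SB_sqL.
by apply: cvg2_ae ug => // k; have [] := SB_fourier (su k).
Qed.

Lemma FL_closed (u v : nat -> K -> R[i]) f g : (forall k, FL (u k) (v k)) ->
  sqL mu f -> sqL mu g -> cvg2 mu u f -> cvg2 mu v g -> FL f g.
Proof.
move=> H f2 g2 uf vg; have [g' Hg'] := FL_total f2; have [_ g2' _] := Hg'.
have v2 k : sqL mu (v k) by have [] := H k.
have vg' : cvg2 mu v g'.
  move=> ep ep0; have [N HN] := uf _ ep0; exists N => k Nk.
  by rewrite (FL_nr (H k) Hg'); exact: HN.
by apply: FL_ae Hg' _ _ _ _ => //; [exact: aeW|exact: (cvg2_unique v2 g2' g2 vg' vg)].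
Qed.

(** Approximation in L1 and L2 at once makes the transforms converge uniformly to the integral and
    in norm to the L2 transform; Fatou's lemma shows that the two limits agree. *)
Lemma FL_L1 f : cinteg mu f -> sqL mu f -> FL f (F f).
Proof.
move=> fi f2.
have /choice[u Hu] : forall k : nat, exists h, [/\ ctest h,
    (\int[mu]_x (cabs (f x - h x)%R)%:E <= (k.+1%:R^-1)%:E)%E
    & nr mu (fun x => f x - h x) <= k.+1%:R^-1].
  by move=> k; apply: ctest_dense => //; rewrite invr_gt0.
have su k : SB (u k) by apply: ctest_SB; have [] := Hu k.
have inv_le (ep : R) : 0 < ep -> exists N : nat, forall k, (N <= k)%N -> k.+1%:R^-1 <= ep.
  move=> ep0; have [N HN] := exists_inv_lt ep0; exists N => k Nk.
  by apply: le_trans (ltW HN); rewrite lef_pV2 ?posrE// ler_nat.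
have uf : cvg2 mu u f.
  move=> ep /inv_le[N HN]; exists N => k /HN; rewrite nr_distC.
  by have [_ _] := Hu k; exact: le_trans.
have [g g2 vg] := FL_limit (fun k => SB_FL (su k)) f2 uf.
have Fg : FL f g by split=> //; exists u.
have ui k : cinteg mu (u k) by exact: SB_cinteg.
have unif k y : cabs (F f y - F (u k) y) <= k.+1%:R^-1.
  have [_ h _] := Hu k; rewrite -lee_fin; apply: le_trans h.
  have di := cintegB fi (ui k).
  have -> : F f y - F (u k) y = F (fun x => f x - u k x) y.
    rewrite !fourierE -cintB; try exact: (cinteg_lambda lp).
    by apply: cint_ext => x; rewrite mulrBl.
  exact: (fourier_bound lp).
have mF := fourier_cmeas lp fi; have [mg _] := g2.
have mFu k : cmeas (F (u k) : B -> R[i]) by have [[]] := SB_fourier (su k).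
have Fu2 k : sqL mu (F (u k)) by have [] := SB_fourier (su k).
have small (ep : R) : 0 < ep -> (sqn mu (fun x => F f x - g x)%R <= ep%:E)%E.
  move=> ep0; have [N HN] := vg _ ep0.
  apply: (@fatou_nr _ _ _ mu (fun k x => F (u (k + N)%N) x - g x)).
  - by move=> k; exact: cmeasB.
  - exact: cmeasB.
  - move=> k; rewrite sqnE; last exact: sqLB.
    by rewrite lee_fin; apply: HN; rewrite leq_addl.
  - apply: aeW => x; have fE z : cabs (z - g x) = cabs (g x - z) by rewrite -cabsN opprB.
    rewrite /= [X in _ --> X](_ : _ = cabs (g x - F f x) ^+ 2); last by rewrite fE.
    have -> : (fun k => cabs (F (u (k + N)%N) x - g x) ^+ 2) = (fun k => cabs (g x - F (u (k + N)%N) x) ^+ 2).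
      by apply/funext => k; rewrite fE.
    have lim_ (p : R[i] -> R) : (forall z w, `|p z - p w| <= cabs (z - w)) ->
        p (F (u (k + N)%N) x) @[k --> \oo] --> p (F f x).
      move=> pl; apply/cvgrPdist_le => d d0; have [M HM] := inv_le _ d0.
      exists M => // k /= Mk; apply: le_trans (pl _ _) _; apply: le_trans (unif _ _) _.
      by apply: HM; apply: leq_trans Mk _; rewrite leq_addr.
    apply: cvg_cabs_sub.
      by apply: lim_ => z w; rewrite -ReN -ReD; exact: Re_le_cabs.
    by apply: lim_ => z w; rewrite -ImN -ImD; exact: Im_le_cabs.
have F2 : sqL mu (F f).
  have d2 : sqL mu (fun x => F f x - g x).
    by split; [exact: cmeasB|apply: le_lt_trans (small 1 ltr01) _; rewrite ltry].
  have := sqLD d2 g2; congr sqL; apply/funext => x; exact: subrK.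
have d2 := sqLB F2 g2.
apply: FL_ae Fg _ _ _ _ => //; first exact: aeW.
have : nr mu (fun x => g x - F f x) = 0.
  apply/eqP; rewrite nr_distC eq_le; apply/andP; split; last first.
    by rewrite -lee_fin -sqnE// sqn_ge0.
  by apply/ler_addgt0Pl => ep ep0; rewrite addr0; apply: sqn_le; exact: small.
by move=> h; apply: ae_sub0; apply: (nr_eq0_ae (sqLB g2 F2) h).
Qed.

Lemma reflection_cov f : cinteg mu f -> cinteg mu (fun x : K => f (- x)) /\
  cint mu (fun x : K => f (- x)) = cint mu f.
Proof.
move=> fi.
have [|||||] := @cov_cint _ _ _ mu (fun x : K => - x) (fun _ => 1) 1 _ _ _ _ _ f fi.
- exact: (mfun_opp lh).
- exact: measurable_cst.
- by [].
- by [].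
- move=> g mg g0; rewrite mul1e; under eq_integral do rewrite mulr1.
  rewrite (int_reflection lh (f := fun x => (g x)%:E))//.
  exact/measurable_EFinP.
have -> : (fun x : B => f (- (x : K)) * (1 : R)%:C%C) = (fun x => f (- x)).
  by apply/funext => x; rewrite mulr1.
by move=> h1; rewrite mul1r.
Qed.

Lemma sqn_reflection f : cmeas (f : B -> R[i]) -> sqn mu (fun x : K => f (- x)) = sqn mu f.
Proof.
move=> mf; rewrite /sqn (int_reflection lh (f := fun x => (cabs (f x) ^+ 2)%:E))//.
  by apply/measurable_EFinP; exact: meas_sq.
by move=> x; rewrite lee_fin sqr_ge0.
Qed.

Lemma sqL_reflection f : sqL mu f -> sqL mu (fun x : K => f (- x)).
Proof.
move=> [mf f2]; split; last by rewrite sqn_reflection.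
by apply: (cmeas_comp _ mf); exact: (mfun_opp lh).
Qed.

Lemma FL_inv f g : FL f g -> FL g (fun x => f (- x)).
Proof.
move=> [f2 g2 [u [su uf ug]]].
have u2 k : sqL mu (u k) by exact: SB_sqL.
apply: (@FL_closed (fun k => F (u k)) (fun k x => u k (- x))) => //.
- move=> k; have [Fi F2] := SB_fourier (su k).
  have -> : (fun x => u k (- x)) = F (F (u k)).
    by apply/funext => x; rewrite (lp_self_dual lp (su k)).
  exact: FL_L1.
- exact: sqL_reflection.
- move=> ep /uf[N HN]; exists N => k /HN; rewrite /nr; congr (fine _ <= _).
  have mB : cmeas (fun x : B => u k x - f x) by apply: cmeasB; [have [] := u2 k|have [] := f2].
  by rewrite -(sqn_reflection mB).
Qed.

End FourierL2.

Lemma meas_sqrtr {R : realType} d (T : measurableType d) (f : T -> R) :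
  mfun f -> (forall x, 0 <= f x) ->
  mfun (fun x => Num.sqrt (f x)).
Proof.
move=> mf f0; rewrite (_ : (fun x => _) = (fun x => f x `^ 2^-1)).
  exact: mfun_comp (measurable_powR 2^-1) mf.
by apply/funext => x; rewrite powR12_sqrt.
Qed.

(** * The kernel operator and Schur's test *)

Section KernelOperator.
Context {R : realType} {K : valuedFieldType R}.
Variable mu : {sigma_finite_measure set (borel K) -> \bar R}.
Hypothesis lh : local_haar mu.
Notation B := (borel K).
Notation md := (module mu).
Notation decay := (decay mu).
Notation ell := (ell mu).
Notation ker := (ker mu).
Notation C1 := (kerC1 mu).
Implicit Types (f g h : K -> R[i]) (x y : K).

Lemma int_le_neq0 (f g : B -> \bar R) : mfun f -> mfun g ->
  (forall x, 0 <= f x)%E -> (forall x, 0 <= g x)%E ->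
  (forall x : K, (x != 0)%R -> f x <= g x)%E -> (\int[mu]_x f x <= \int[mu]_x g x)%E.
Proof.
move=> mf mg f0 g0 fg; apply: ae_ge0_le_integral => //.
by apply: (@ae_neq0 _ _ _ lh (fun x => setT x -> _)) => x x0 _; exact: fg.
Qed.

Lemma int_eq_neq0 (f g : B -> \bar R) : mfun f -> mfun g ->
  (forall x : K, (x != 0)%R -> f x = g x)%E -> (\int[mu]_x f x = \int[mu]_x g x)%E.
Proof.
move=> mf mg fg; apply: ae_eq_integral => //.
by apply: (@ae_neq0 _ _ _ lh (fun x => setT x -> _)) => x x0 _; exact: fg.
Qed.

Let mfst : mfun (fun z : B * B => z.1). Proof. exact: measurable_fst. Qed.
Let msnd : mfun (fun z : B * B => z.2). Proof. exact: measurable_snd. Qed.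

Lemma mfun_section (u : B * B -> R) x : mfun u ->
  mfun (fun y : B => u (x, y)).
Proof.
move=> mu'; apply: (mfun_comp mu').
by apply: measurable_fun_pair => //; exact: measurable_cst.
Qed.

Lemma mfun_partial (u : B * B -> R) : mfun u -> (forall z, 0 <= u z) ->
  mfun (fun x : B => \int[mu]_y (u (x, y))%:E)%E.
Proof.
move=> mu' u0; apply: (measurable_fun_fubini_tonelli_F (fun z => (u z)%:E)).
  exact/measurable_EFinP.
by move=> z; rewrite lee_fin.
Qed.

Definition schur (x y : K) : R := ker x y * (Num.sqrt (md y) / Num.sqrt (md x)).

Lemma schur_ge0 x y : 0 <= schur x y.
Proof. by rewrite mulr_ge0 ?ker_ge0// divr_ge0// sqrtr_ge0. Qed.

Lemma mfun_schur : mfun (fun z : B * B => schur z.1 z.2).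
Proof.
apply: mfun_prod; first exact: mfun_ker.
apply: mfun_prod; first exact: (mfun_comp (mfun_sqrt_module lh) msnd).
apply: meas_invr => [|z]; last exact: sqrtr_ge0.
exact: (mfun_comp (mfun_sqrt_module lh) mfst).
Qed.

Lemma schur_int1 y : y != 0 -> (\int[mu]_x (schur x y)%:E = C1%:E)%E.
Proof. exact: ker_schur. Qed.

(** Tonelli puts the integral over [x] inside, where [schur_int1] evaluates it to [C1] for every
    nonzero [y]. *)
Lemma schur_sqn f : sqL mu f ->
  (\int[mu]_x \int[mu]_y (schur x y * cabs (f y) ^+ 2)%:E = (C1 * nr mu f)%:E)%E.
Proof.
move=> f2; have [mf _] := f2; have m2 := meas_sq mf.
have mm : mfun (fun z : B * B => schur z.1 z.2 * cabs (f z.2) ^+ 2).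
  by apply: mfun_prod; [exact: mfun_schur|exact: (mfun_comp m2 msnd)].
rewrite (tonelli2 (g := fun x y => schur x y * cabs (f y) ^+ 2) mu mm); last first.
  by move=> x y; rewrite mulr_ge0 ?schur_ge0 ?sqr_ge0.
rewrite EFinM -sqnE// /sqn -ge0_intZ ?(kerC1_ge0 lh)//; last by move=> x; rewrite sqr_ge0.
have mmC : mfun (fun z : B * B => schur z.2 z.1 * cabs (f z.1) ^+ 2).
  apply: mfun_prod; last exact: (mfun_comp m2 mfst).
  exact: (mfun_comp mfun_schur (measurable_fun_pair msnd mfst)).
apply: int_eq_neq0.
- apply: (mfun_partial mmC) => z; by rewrite mulr_ge0 ?schur_ge0 ?sqr_ge0.
- by apply/measurable_EFinP; exact: mfun_prod.
move=> y y0; under eq_integral do rewrite mulrC.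
rewrite ge0_intZ ?sqr_ge0//.
- by rewrite schur_int1// -EFinM mulrC.
- by have := mfun_section y (mfun_comp mfun_schur (measurable_fun_pair msnd mfst)).
- by move=> x; exact: schur_ge0.
Qed.

Definition q (x y : K) : R := (ell y - ell x) / md (y - x).

Lemma mfun_q : mfun (fun z : B * B => q z.1 z.2).
Proof.
apply: mfun_prod.
  apply: measurable_funB; first exact: (mfun_comp (mfun_ell lh) msnd).
  exact: (mfun_comp (mfun_ell lh) mfst).
apply: meas_invr => [|x]; last exact: module_ge0.
by apply: (mfun_comp (mfun_module lh)); exact: (mfun_sub lh).
Qed.

Lemma norm_q x y : `|q x y| = ker x y.
Proof. by rewrite /q /ker normrM normfV (ger0_norm (module_ge0 lh _)). Qed.

Lemma qC x y : q y x = - q x y.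
Proof. by rewrite /q (module_distC lh) -mulNr opprB. Qed.

Definition kform f h (z : B * B) : R[i] := (q z.1 z.2)%:C%C * (f z.2 * (h z.1)^*%C).

Definition cw x : R[i] := ((1 + md x)^-1)%:C%C.

(* [kop f x] is the integral of [q x y * f y] where this converges; the weight
   [cw] makes it measurable in [x] everywhere. *)
Definition kop f x : R[i] := (1 + md x)%:C%C * cint mu (fun y => kform f cw (x, y)).

Lemma cwJ x : (cw x)^*%C = cw x.
Proof. by apply: ReIm_eq; rewrite /cw //= oppr0. Qed.

Lemma kopE f x : cinteg mu (fun y => (q x y)%:C%C * f y) ->
  kop f x = cint mu (fun y => (q x y)%:C%C * f y).
Proof.
move=> fi; rewrite /kop.
transitivity ((1 + md x)%:C%C * cint mu (fun y => cw x * ((q x y)%:C%C * f y))).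
  congr (_ * _); apply: cint_ext => y.
  by rewrite -[LHS]/((q x y)%:C%C * (f y * (cw x)^*%C)) cwJ; ring.
rewrite cintZ// mulrA /cw -rmorphM mulfV ?mul1r// gt_eqF// ltr_wpDr//.
exact: module_ge0.
Qed.

(* Cauchy-Schwarz for the weights of Schur's test *)
Lemma kop_pointwise f x : x != 0 -> cmeas (f : B -> R[i]) ->
  (\int[mu]_y (schur x y * cabs (f y) ^+ 2)%:E < +oo)%E ->
  cinteg mu (fun y => (q x y)%:C%C * f y) /\
  ((cabs (kop f x) ^+ 2)%:E <= (4 * C1)%:E * \int[mu]_y (schur x y * cabs (f y) ^+ 2)%:E)%E.
Proof.
move=> x0 mf fin; have m2 := meas_sq mf.
have ms := mfun_section x mfun_schur.
have ms' := mfun_section x (mfun_comp mfun_schur (measurable_fun_pair msnd mfst)).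
have mw : mfun (fun y : B => schur x y * cabs (f y) ^+ 2) by exact: mfun_prod.
have w0 y : 0 <= schur x y * cabs (f y) ^+ 2 by rewrite mulr_ge0 ?schur_ge0 ?sqr_ge0.
pose f1 (y : B) : R[i] := (Num.sqrt (schur y x))%:C%C.
pose f2 (y : B) : R[i] := (Num.sqrt (schur x y * cabs (f y) ^+ 2))%:C%C.
have s1 y : cabs (f1 y) ^+ 2 = schur y x.
  by rewrite cabs_real ?sqrtr_ge0// sqr_sqrtr ?schur_ge0.
have s2 y : cabs (f2 y) ^+ 2 = schur x y * cabs (f y) ^+ 2.
  by rewrite cabs_real ?sqrtr_ge0// sqr_sqrtr.
have f12 : sqL mu f1.
  split; first by apply: cmeasR; apply: meas_sqrtr => // y; exact: schur_ge0.
  by rewrite /sqn; under eq_integral do rewrite s1; rewrite schur_int1// ltry.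
have f22 : sqL mu f2.
  split; first by apply: cmeasR; exact: meas_sqrtr.
  by rewrite /sqn; under eq_integral do rewrite s2.
have n1 : nr mu f1 = C1.
  by rewrite /nr /sqn; under eq_integral do rewrite s1; rewrite schur_int1.
have [mi fi] := cinteg_ip f12 f22; have cs := cauchy_schwarz f12 f22.
have mq : cmeas (fun y : B => (q x y)%:C%C * f y).
  by apply: cmeasM => //; apply: cmeasR; exact: (mfun_section x mfun_q).
have E (y : K) : y != 0 -> cabs ((q x y)%:C%C * f y) = Re (f1 y * (f2 y)^*%C).
  move=> y0; have mx0 := module_gt0 lh x0; have my0 := module_gt0 lh y0.
  rewrite /f1 /f2 ReM /= oppr0 !mul0r subr0 -sqrtrM ?schur_ge0//.
  rewrite cabsM cabsR norm_q.
  have -> : schur y x * (schur x y * cabs (f y) ^+ 2) = (ker x y * cabs (f y)) ^+ 2.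
    rewrite /schur (kerC lh y x); field.
    by rewrite !gt_eqF ?sqrtr_gt0.
  by rewrite sqrtr_sqr ger0_norm// mulr_ge0 ?ker_ge0 ?cabs_ge0.
have Re0 (y : B) : cabs (f1 y * (f2 y)^*%C) = Re (f1 y * (f2 y)^*%C).
  rewrite cabsM cabsJ /f1 /f2 !cabs_real ?sqrtr_ge0// ReM /= oppr0 !mul0r subr0//.
have EI : (\int[mu]_y (cabs ((q x y)%:C%C * f y))%:E = \int[mu]_y (cabs (f1 y * (f2 y)^*%C))%:E)%E.
  apply: int_eq_neq0.
  - by apply/measurable_EFinP; exact: cmeas_cabs.
  - by apply/measurable_EFinP; exact: cmeas_cabs.
  - by move=> y y0; rewrite E// Re0.
have qi : cinteg mu (fun y => (q x y)%:C%C * f y) by split=> //; rewrite EI.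
split=> //.
have b1 : ((cabs (kop f x))%:E <= (cabs (ip mu f1 f2))%:E)%E.
  rewrite kopE//; apply: le_trans (cabs_cint_le qi) _; rewrite EI.
  have e1 : ip mu f1 f2 = (\int[mu]_y Re (f1 y * (f2 y)^*%C))%:C%C.
    rewrite /ip -cint_real; apply: cint_ext => y.
    by apply: ReIm_eq => //; rewrite ImM /= oppr0 mul0r mulr0 addr0.
  rewrite e1 cabs_real; last by apply: Rintegral_ge0 => y _; rewrite -Re0 cabs_ge0.
  rewrite /Rintegral fineK.
    rewrite le_eqVlt; apply/orP; left; apply/eqP.
    by apply: eq_integral => y _; rewrite Re0.
  under eq_integral do rewrite -Re0.
  by rewrite ge0_fin_numE//; apply: integral_ge0 => y _; rewrite lee_fin cabs_ge0.
have <- : ((4 * (nr mu f1 * nr mu f2))%:E = (4 * C1)%:E * \int[mu]_y (schur x y * cabs (f y) ^+ 2)%:E)%E.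
  rewrite n1 mulrA EFinM; congr (_ * _)%E; rewrite -sqnE// /sqn.
  by under eq_integral do rewrite s2.
rewrite lee_fin; apply: le_trans cs; rewrite lerXn2r ?nnegrE ?cabs_ge0//.
Qed.

Lemma schur_ae f : sqL mu f -> {ae mu, forall x : B, (x : K) != 0 /\
  (\int[mu]_y (schur x y * cabs (f y) ^+ 2)%:E < +oo)%E}.
Proof.
move=> f2; have [mf _] := f2; have m2 := meas_sq mf.
have mm : mfun (fun z : B * B => schur z.1 z.2 * cabs (f z.2) ^+ 2).
  by apply: mfun_prod; [exact: mfun_schur|exact: (mfun_comp m2 msnd)].
have mp := mfun_partial mm (fun z => mulr_ge0 (schur_ge0 _ _) (sqr_ge0 _)).
have h0 (x : B) : (0 <= \int[mu]_y (schur x y * cabs (f y) ^+ 2)%:E)%E.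
  by apply: integral_ge0 => y _; rewrite lee_fin mulr_ge0 ?schur_ge0 ?sqr_ge0.
have ii : mu.-integrable setT (fun x : B => \int[mu]_y (schur x y * cabs (f y) ^+ 2)%:E)%E.
  apply/integrableP; split=> //; under eq_integral do rewrite gee0_abs//.
  by rewrite schur_sqn// ltry.
have := integrable_ae measurableT ii.
have z := @ae_neq0 _ _ _ lh (fun x : B => (x : K) != 0) (fun x xx => xx).
by move: z; apply: filterS2 => x x0 /(_ I) h; split=> //; move: h; rewrite ge0_fin_numE.
Qed.

Lemma kop_cinteg f : sqL mu f ->
  {ae mu, forall x : B, cinteg mu (fun y => (q x y)%:C%C * f y)}.
Proof.
move=> f2; have [mf _] := f2; apply: filterS (schur_ae f2) => x [x0 h].
by have [] := kop_pointwise x0 mf h.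
Qed.

(** Schur's test in bilinear form: [b * c] is bounded by [w * b ^+ 2 + w^-1 * c ^+ 2] with [w] the
    ratio of the two weights, and the two summands are the integrals of [schur x y] and [schur y x].
    It supplies the absolute convergence that Fubini requires. *)
Lemma ker_form f h : sqL mu f -> sqL mu h ->
  (\int[mu]_x \int[mu]_y (ker x y * (cabs (f y) * cabs (h x)))%:E
   <= (C1 * nr mu f + C1 * nr mu h)%:E)%E.
Proof.
move=> f2 h2; have [mf _] := f2; have [mh _] := h2.
have mm : mfun (fun z : B * B => ker z.1 z.2 * (cabs (f z.2) * cabs (h z.1))).
  apply: mfun_prod; first exact: mfun_ker.
  by apply: mfun_prod; [exact: (mfun_comp (cmeas_cabs mf) msnd)|exact: (mfun_comp (cmeas_cabs mh) mfst)].
have sC := mfun_comp mfun_schur (measurable_fun_pair msnd mfst).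
have m1 : mfun (fun z : B * B => schur z.1 z.2 * cabs (f z.2) ^+ 2).
  by apply: mfun_prod; [exact: mfun_schur|exact: (mfun_comp (meas_sq mf) msnd)].
have m2 : mfun (fun z : B * B => schur z.2 z.1 * cabs (h z.1) ^+ 2).
  by apply: mfun_prod; [exact: sC|exact: (mfun_comp (meas_sq mh) mfst)].
have p1 z : 0 <= schur z.1 z.2 * cabs (f z.2) ^+ 2 by rewrite mulr_ge0 ?schur_ge0 ?sqr_ge0.
have p2 z : 0 <= schur z.2 z.1 * cabs (h z.1) ^+ 2 by rewrite mulr_ge0 ?schur_ge0 ?sqr_ge0.
have p0 z : 0 <= ker z.1 z.2 * (cabs (f z.2) * cabs (h z.1)).
  by rewrite mulr_ge0 ?ker_ge0// mulr_ge0 ?cabs_ge0.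
apply: (@le_trans _ _ (\int[mu]_x (\int[mu]_y (schur x y * cabs (f y) ^+ 2)%:E +
   \int[mu]_y (schur y x * cabs (h x) ^+ 2)%:E))%E).
  apply: int_le_neq0.
  - exact: (mfun_partial mm).
  - by apply: emeasurable_funD; [exact: (mfun_partial m1)|exact: (mfun_partial m2)].
  - by move=> x; apply: integral_ge0 => y _; rewrite lee_fin (p0 (x, y)).
  - move=> x; apply: adde_ge0; apply: integral_ge0 => y _; rewrite lee_fin.
      exact: (p1 (x, y)).
    exact: (p2 (x, y)).
  move=> x x0.
  rewrite -ge0_intD; last first.
  - by move=> y; exact: (p2 (x, y)).
  - by move=> y; exact: (p1 (x, y)).
  - exact: (mfun_section x m2).
  - exact: (mfun_section x m1).
  apply: int_le_neq0.
  - apply/measurable_EFinP; exact: (mfun_section x mm).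
  - apply/measurable_EFinP; apply: measurable_funD; [exact: (mfun_section x m1)|exact: (mfun_section x m2)].
  - by move=> y; rewrite lee_fin (p0 (x, y)).
  - by move=> y; rewrite lee_fin addr_ge0 ?(p1 (x, y)) ?(p2 (x, y)).
  move=> y y0; rewrite lee_fin /schur (kerC lh y x) /=.
  move: (ker x y) (ker_ge0 lh x y) => k k0; rewrite -[_ * _ * cabs (f y) ^+ 2]mulrA
    -[_ * _ * cabs (h x) ^+ 2]mulrA -mulrDr.
  apply: ler_wpM2l => //.
  have mx0 := module_gt0 lh x0; have my0 := module_gt0 lh y0.
  set w := Num.sqrt (md y) / Num.sqrt (md x).
  have w0 : 0 < w by rewrite divr_gt0 ?sqrtr_gt0.
  have -> : Num.sqrt (md x) / Num.sqrt (md y) = w^-1 by rewrite invf_div.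
  clearbody w.
  set b := cabs (f y); set c := cabs (h x).
  have b0 : 0 <= b by exact: cabs_ge0.
  have c0 : 0 <= c by exact: cabs_ge0.
  rewrite -(ler_pM2l w0) mulrDr !mulrA mulfV ?gt_eqF// mul1r.
  have := sqr_ge0 (w * b - c); rewrite !expr2 => h'.
  have : 0 <= w * b * c by rewrite !mulr_ge0// ltW.
  nra.
rewrite ge0_integralD//; first last.
- exact: (mfun_partial m2).
- by move=> x _; apply: integral_ge0 => y _; rewrite lee_fin (p2 (x, y)).
- exact: (mfun_partial m1).
- by move=> x _; apply: integral_ge0 => y _; rewrite lee_fin (p1 (x, y)).
rewrite schur_sqn// EFinD; apply: leeD => //.
rewrite EFinM -sqnE// /sqn -ge0_intZ ?(kerC1_ge0 lh)//; last 2 first.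
- exact: meas_sq.
- by move=> x; rewrite sqr_ge0.
rewrite le_eqVlt; apply/orP; left; apply/eqP; apply: int_eq_neq0.
- exact: (mfun_partial m2).
- by apply/measurable_EFinP; apply: mfun_prod => //; exact: meas_sq.
move=> x x0; under eq_integral do rewrite mulrC.
rewrite ge0_intZ ?sqr_ge0//.
- by rewrite schur_int1// -EFinM mulrC.
- exact: (mfun_section x sC).
- by move=> y; exact: schur_ge0.
Qed.

Lemma cmeas_kform f h : cmeas (f : B -> R[i]) -> cmeas (h : B -> R[i]) -> cmeas (kform f h).
Proof.
move=> mf mh; apply: cmeasM; first by apply: cmeasR; exact: mfun_q.
by apply: cmeasM; [exact: (cmeas_comp msnd mf)|apply: cmeasJ; exact: (cmeas_comp mfst mh)].
Qed.

Lemma kform_fin f h : sqL mu f -> sqL mu h ->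
  (\int[mu]_x \int[mu]_y (cabs (kform f h (x, y)))%:E < +oo)%E.
Proof.
move=> f2 h2; apply: le_lt_trans (_ : (_ <= (C1 * nr mu f + C1 * nr mu h)%:E)%E) (ltry _).
apply: le_trans (ker_form f2 h2); rewrite le_eqVlt; apply/orP; left; apply/eqP.
apply: eq_integral => x _; apply: eq_integral => y _.
by rewrite /kform !cabsM cabsJ cabsR norm_q.
Qed.

Lemma kop_cmeas f : sqL mu f -> cmeas (kop f : B -> R[i]).
Proof.
move=> f2; have [mf _] := f2.
have c0 x : 0 < (1 + md x)^-1 by rewrite invr_gt0 ltr_wpDr// module_ge0.
have m1 : mfun (fun x : B => 1 + md x).
  by apply: measurable_funD => //; exact: mfun_module.
have mc : mfun (fun x : B => (1 + md x)^-1).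
  by apply: meas_invr => // x; rewrite addr_ge0// module_ge0.
have h2 : sqL mu cw.
  apply: (sqL_le (v := fun x : B => decay x)) => //.
  - exact: mfun_decay.
  - by move=> x; rewrite /cw cabs_real ?(ltW (c0 _))// exprVn.
  - exact: decay_int.
have mh : cmeas (cw : B -> R[i]) by have [] := h2.
have [m _] := cinteg_fubini1 (cmeas_kform mf mh) (kform_fin f2 h2).
by apply: cmeasM => //; exact: cmeasR.
Qed.

(** One factor [C1], with the 4 of [cauchy_schwarz], comes from the pointwise estimate, the other
    from integrating that estimate with [schur_sqn]. *)
Lemma kop_bound f : sqL mu f -> sqL mu (kop f) /\ nr mu (kop f) <= 4 * C1 ^+ 2 * nr mu f.
Proof.
move=> f2; have [mf _] := f2; have mk := kop_cmeas f2.
have C10 := kerC1_ge0 lh.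
have mm : mfun (fun z : B * B => schur z.1 z.2 * cabs (f z.2) ^+ 2).
  by apply: mfun_prod; [exact: mfun_schur|exact: (mfun_comp (meas_sq mf) msnd)].
have mp := mfun_partial mm (fun z => mulr_ge0 (schur_ge0 _ _) (sqr_ge0 _)).
have h0 (x : B) : (0 <= \int[mu]_y (schur x y * cabs (f y) ^+ 2)%:E)%E.
  by apply: integral_ge0 => y _; rewrite lee_fin mulr_ge0 ?schur_ge0 ?sqr_ge0.
suff b : (sqn mu (kop f) <= (4 * C1 ^+ 2 * nr mu f)%:E)%E.
  by split; [split=> //; exact: le_lt_trans b (ltry _)|exact: sqn_le].
have -> : ((4 * C1 ^+ 2 * nr mu f)%:E = \int[mu]_x ((4 * C1)%:E * \int[mu]_y (schur x y * cabs (f y) ^+ 2)%:E))%E.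
  rewrite ge0_integralZl//; last by rewrite lee_fin mulr_ge0.
  by rewrite schur_sqn// -EFinM; congr (_%:E); ring.
apply: ae_ge0_le_integral => //.
- by move=> x _; rewrite lee_fin sqr_ge0.
- by apply/measurable_EFinP; exact: meas_sq.
- by move=> x _; rewrite mule_ge0// lee_fin mulr_ge0.
- by apply: measurable_funeM.
- by apply: filterS (schur_ae f2) => x [x0 h] _; have [] := kop_pointwise x0 mf h.
Qed.

Lemma kop_ip f h : sqL mu f -> sqL mu h ->
  ip mu (kop f) h = cint mu (fun x => cint mu (fun y => kform f h (x, y))).
Proof.
move=> f2 h2; have [mf _] := f2; have [mh _] := h2.
have mk := kop_cmeas f2.
have [m _] := cinteg_fubini1 (cmeas_kform mf mh) (kform_fin f2 h2).
apply: cint_ae => //; first by apply: cmeasM => //; exact: cmeasJ.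
apply: filterS (kop_cinteg f2) => x fi; rewrite kopE// mulrC -cintZ//.
by apply: cint_ext => y; rewrite /kform /= mulrC mulrA.
Qed.

(** The kernel [q] is real and changes sign when its arguments are exchanged; [kform_fin] justifies
    the exchange of the integrals. *)
Lemma kop_anti f h : sqL mu f -> sqL mu h -> ip mu (kop f) h = - ip mu f (kop h).
Proof.
move=> f2 h2; have [mf _] := f2; have [mh _] := h2.
have mkf := cmeas_kform mf mh; have fin := kform_fin f2 h2.
have fi := cinteg_fubini2 mkf fin.
rewrite kop_ip// (cint_fubini mkf fin).
suff -> : ip mu f (kop h) = cint mu (fun x => - cint mu (fun y => kform f h (y, x))).
  by rewrite cintN ?opprK.
apply: cint_ae.
- by apply: cmeasM => //; apply: cmeasJ; exact: kop_cmeas.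
- by apply: cmeasN; have [] := fi.
apply: filterS (kop_cinteg h2) => x hi; rewrite kopE// -cintJ//.
have hJ := cintegJ hi; rewrite -cintZ// -cintN; last first.
  have := cintegZ (- f x) hJ; congr (cinteg mu _); apply/funext => y.
  by rewrite -[RHS]/((q y x)%:C%C * (f x * (h y)^*%C)) qC conjcM conjc_real rmorphN; ring.
apply: cint_ext => y.
by rewrite -[X in - X]/((q y x)%:C%C * (f x * (h y)^*%C)) qC conjcM conjc_real rmorphN; ring.
Qed.

Lemma kopB f g : sqL mu f -> sqL mu g ->
  {ae mu, forall x : B, kop (fun y => f y - g y) x = kop f x - kop g x}.
Proof.
move=> f2 g2; have h := sqLB f2 g2.
move: (kop_cinteg f2) (kop_cinteg g2) (kop_cinteg h).
apply: filterS3 => x h1 h2 h3; rewrite !kopE// -cintB//.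
by apply: cint_ext => y; rewrite mulrBr.
Qed.

End KernelOperator.

(** * Frullani's formula *)

Section RealToComplex.
Context {R : realType}.
Implicit Types x y : R.
Lemma RCD x y : (x + y)%:C%C = x%:C%C + y%:C%C. Proof. exact: rmorphD. Qed.
Lemma RCB x y : (x - y)%:C%C = x%:C%C - y%:C%C. Proof. exact: rmorphB. Qed.
Lemma RCN x : (- x)%:C%C = - x%:C%C. Proof. exact: rmorphN. Qed.
Lemma RCM x y : (x * y)%:C%C = x%:C%C * y%:C%C. Proof. exact: rmorphM. Qed.
End RealToComplex.

Section LogFormula.
Context {R : realType} {K : valuedFieldType R}.
Variable mu : {sigma_finite_measure set (borel K) -> \bar R}.
Variables (n : nat) (e : nat -> K) (co : nat -> K -> R) (s C : R).
Hypothesis lp : local_place mu n e co s C.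
Let lh := lp_haar lp.
Notation a := (@absv R K).
Notation B := (borel K).
Notation md := (module mu).
Notation ell := (ell mu).
Notation wt := (wt mu).
Notation F := (fourier mu).
Notation kop := (kop mu).
Notation kform := (kform mu).
Implicit Types f g u v : K -> R[i].

Let mfst : mfun (fun z : B * B => z.1). Proof. exact: measurable_fst. Qed.
Let msnd : mfun (fun z : B * B => z.2). Proof. exact: measurable_snd. Qed.

Lemma cint_scale (t : K) f : t != 0 -> cinteg mu f -> cinteg mu (fun x => f (t * x)) /\
  cint mu (fun x => f (t * x)) = ((md t)^-1)%:C%C * cint mu f.
Proof.
move=> t0 fi.
have [|||||] := @cov_cint _ _ _ mu (fun x : K => t * x) (fun _ => 1) (md t)^-1 _ _ _ _ _ f fi.
- exact: (mfun_mul lh).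
- exact: measurable_cst.
- by [].
- by rewrite invr_ge0 module_ge0.
- move=> g mg g0; under eq_integral do rewrite mulr1.
  rewrite (int_scale lh (f := fun x => (g x)%:E))//.
  exact/measurable_EFinP.
have -> // : (fun x : B => f (t * (x : K)) * (1 : R)%:C%C) = (fun x => f (t * x)).
by apply/funext => x; rewrite mulr1.
Qed.

(** A tent over the unit ball: the Lipschitz constant 1 gives the decay in [G_large], the bounded
    support the estimate of [G_near0]. *)
Definition bump0 (x : K) : R := Num.max 0 (1 - a x).

Lemma bump0_ge0 x : 0 <= bump0 x. Proof. by rewrite le_max lexx. Qed.

Lemma mfun_bump0 : mfun (bump0 : B -> R).
Proof.
apply: measurable_maxr => //; apply: measurable_funB => //; exact: mfun_absv.
Qed.

Let ball (r : R) : set B := [set x : K | a x <= r].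
Let mball r : measurable (ball r). Proof. exact: ball_measurable. Qed.
Let mindball r : mfun (\1_(ball r) : B -> R).
Proof. exact: measurable_indic. Qed.
Let ball_int r : (\int[mu]_x (\1_(ball r) x)%:E < +oo)%E.
Proof. by rewrite integral_indic// setIT; exact: haar_ball_lty. Qed.

Lemma bump0_ball x : bump0 x <= \1_(ball 1) x.
Proof.
rewrite /bump0 ge_max indicE; case: (boolP (x \in _)) => [_|].
  by rewrite ler01 gerBl absv_ge0.
rewrite notin_setE /ball /= => /negP; rewrite -ltNge => h.
by rewrite lexx subr_le0 ltW.
Qed.

Lemma bump0_lip x h : `|bump0 (x + h) - bump0 x| <= a h.
Proof.
have h1 := absv_dist_ge (x + h) x; rewrite addrAC subrr add0r in h1.
rewrite /bump0; move: h1; rewrite !ler_norml => /andP[h1 h2].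
have a0 := absv_ge0 h.
by case: (leP 0 (1 - a (x + h))); case: (leP 0 (1 - a x)) => h3 h4; apply/andP; split; lra.
Qed.

Definition cb : R := fine (\int[mu]_x (bump0 x)%:E)%E.

Lemma cbE : (\int[mu]_x (bump0 x)%:E = cb%:E)%E.
Proof.
rewrite /cb fineK// ge0_fin_numE; last by apply: integral_ge0 => x _; rewrite lee_fin bump0_ge0.
apply: le_lt_trans (ball_int 1); apply: ge0_int_le => //.
- exact: mfun_bump0.
- exact: bump0_ge0.
- exact: bump0_ball.
Qed.

Lemma cb_gt0 : 0 < cb.
Proof.
rewrite -lte_fin -cbE.
apply: (@lt_le_trans _ _ (\int[mu]_x (2^-1 * \1_(ball 2^-1) x)%:E)%E).
  rewrite ge0_intZ// integral_indic// setIT.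
  by apply: mule_gt0; [rewrite lte_fin|exact: haar_ball_gt0].
apply: ge0_int_le.
- exact: mfun_prod.
- exact: mfun_bump0.
- by move=> x; rewrite mulr_ge0.
move=> x; rewrite indicE; case: (boolP (x \in _)) => [/set_mem|_]; last by rewrite mulr0 bump0_ge0.
by rewrite /ball /= mulr1 /bump0 le_max => h; apply/orP; right; lra.
Qed.

Definition bump x : R := bump0 x / cb.
Definition gb x : R[i] := (bump x)%:C%C.

Lemma bump_ge0 x : 0 <= bump x.
Proof. by rewrite divr_ge0 ?bump0_ge0// ltW// cb_gt0. Qed.

Lemma mfun_bump : mfun (bump : B -> R).
Proof. by apply: mfun_prod => //; exact: mfun_bump0. Qed.

Lemma bump_int : (\int[mu]_x (bump x)%:E = 1)%E.
Proof.
under eq_integral do rewrite /bump mulrC.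
rewrite ge0_intZ ?invr_ge0 ?(ltW cb_gt0)//.
- by rewrite cbE -EFinM mulVf// gt_eqF// cb_gt0.
- exact: mfun_bump0.
- exact: bump0_ge0.
Qed.

Lemma bump_ball x : bump x != 0 -> a x <= 1.
Proof.
apply: contraNT; rewrite -ltNge => h; rewrite /bump /bump0 (max_idPl _) ?mul0r//.
by rewrite subr_le0 ltW.
Qed.

Lemma cabs_gb x : cabs (gb x) = bump x. Proof. by rewrite cabs_real// bump_ge0. Qed.

Lemma gb_cinteg : cinteg mu gb.
Proof.
split; first by apply: cmeasR; exact: mfun_bump.
by under eq_integral do rewrite cabs_gb; rewrite bump_int ltry.
Qed.

Lemma gb_cint : cint mu gb = 1.
Proof. by rewrite /gb cint_real /Rintegral bump_int. Qed.

Definition G : K -> R[i] := F gb.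

Lemma cabs_G t : cabs (G t) <= 1.
Proof.
rewrite -lee_fin; apply: le_trans (fourier_bound lp t gb_cinteg) _.
by under eq_integral do rewrite cabs_gb; rewrite bump_int.
Qed.

Lemma cmeas_G : cmeas (G : B -> R[i]).
Proof. exact: (fourier_cmeas lp gb_cinteg). Qed.

(** Since the bump has integral 1, [G t - 1] is the average of [lambda (- (x * t)) - 1] over the
    unit ball, so it inherits the Hoelder bound of [lambda]. *)
Lemma G_near0 : exists D b : R, [/\ 0 <= D, 0 < b & forall t, cabs (G t - 1) <= D * a t `^ b].
Proof.
have [D [b [D0 b0 H]]] := lp_hoelder lp; exists D, b; split=> //; first exact: ltW.
move=> t; have gi := gb_cinteg; have gl := cinteg_lambda lp t gi.
rewrite /G fourierE -gb_cint -cintB//.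
have di := cintegB gl gi.
rewrite -lee_fin; apply: le_trans (cabs_cint_le di) _.
apply: (@le_trans _ _ (\int[mu]_x ((D * a t `^ b) * bump x)%:E)%E).
  have E x : cabs (gb x * lambda (- (x * t)) - gb x) = bump x * cabs (lambda (- (x * t)) - 1 : R[i]).
    by rewrite -{2}[gb x]mulr1 -mulrBr cabsM cabs_gb.
  apply: ge0_int_le.
  - by apply: cmeas_cabs; have [] := di.
  - by apply: mfun_prod => //; exact: mfun_bump.
  - by move=> x; exact: cabs_ge0.
  move=> x; rewrite E [leRHS]mulrC; have [->|bx] := eqVneq (bump x) 0; first by rewrite !mul0r.
  apply: ler_wpM2l; first exact: bump_ge0.
  apply: le_trans (H _) _; apply: ler_wpM2l; first exact: ltW.
  apply: ge0_ler_powR; rewrite ?nnegrE ?absv_ge0 ?(ltW b0)//.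
  by rewrite absvN absvM ler_piMl ?absv_ge0//; exact: bump_ball.
rewrite ge0_intZ//; first by rewrite bump_int mule1.
- exact: mfun_bump.
- exact: bump_ge0.
- by rewrite mulr_ge0 ?powR_ge0// ltW.
Qed.

(** Translating the bump by [h = z0 / t] multiplies [G t] by [lambda z0], yet changes the bump by at
    most [a h / cb] on the ball of radius 2. The summand [a z0] of the constant covers
    [a t <= a z0], where only [cabs (G t) <= 1] is used. *)
Lemma G_large : exists2 D : R, 0 <= D & forall t, 1 < a t -> cabs (G t) <= D / a t.
Proof.
have [z0 lz] := exists_char lp.
have lz1 : 0 < cabs (lambda z0 - 1 : R[i]).
  by rewrite lt_neqAle eq_sym cabs_eq0 subr_eq0 lz cabs_ge0.
have gi := gb_cinteg; have cb0 := cb_gt0.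
pose m2 := fine (mu (ball 2)).
have m20 : 0 <= m2 by exact: fine_ge0.
have m2E : mu (ball 2) = m2%:E by rewrite fineK// ge0_fin_numE//; exact: haar_ball_lty.
pose D1 := a z0 / cb * m2 / cabs (lambda z0 - 1 : R[i]).
have D10 : 0 <= D1 by rewrite !mulr_ge0 ?invr_ge0 ?absv_ge0// ltW.
exists (D1 + a z0); first by rewrite addr_ge0 ?absv_ge0.
move=> t t1; have at0 : 0 < a t by lra.
have t0 : t != 0 by rewrite -absv_gt0.
have [tz|tz] := lerP (a t) (a z0).
  apply: le_trans (cabs_G t) _; rewrite ler_pdivlMr// mul1r; lra.
apply: (@le_trans _ _ (D1 / a t)); last by rewrite ler_pM2r ?invr_gt0// lerDl absv_ge0.
pose h := z0 / t; have ah : a h <= 1 by rewrite absvM absvV ler_pdivrMr// mul1r ltW.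
have [d1] := fourier_diff lp h t 1 gi; rewrite /= expr1 /h divfK// -/h => d2.
rewrite -(ler_pM2l lz1) -cabsM -/(G t) in d2 *.
have -> : (lambda z0 - 1) * G t = F (fun x => gb (x + h) - gb x) t by rewrite d2.
rewrite -lee_fin; apply: le_trans (fourier_bound lp t d1) _.
apply: (@le_trans _ _ (\int[mu]_x ((a h / cb) * \1_(ball 2) x)%:E)%E).
  apply: ge0_int_le.
  - by apply: cmeas_cabs; have [] := d1.
  - exact: mfun_prod.
  - by move=> x; exact: cabs_ge0.
  move=> x; have -> : cabs (gb (x + h) - gb x) = `|bump0 (x + h) - bump0 x| / cb.
    by rewrite /gb /bump -RCB cabsR -mulrBl normrM normfV (ger0_norm (ltW cb0)).
  rewrite mulrAC ler_pM2r ?invr_gt0// indicE; case: (boolP (x \in _)) => [_|].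
    by rewrite mulr1 bump0_lip.
  rewrite notin_setE /ball /= => /negP; rewrite -ltNge => h2.
  have -> : bump0 x = 0 by rewrite /bump0 (max_idPl _)//; lra.
  have -> : bump0 (x + h) = 0.
    rewrite /bump0 (max_idPl _)//; have := absvD (x + h) (- h); rewrite addrK absvN; lra.
  by rewrite subrr normr0 mulr0.
rewrite ge0_intZ//; last by rewrite divr_ge0 ?absv_ge0// ltW.
have -> : (\int[mu]_x (\1_(ball 2) x)%:E = m2%:E)%E.
  by rewrite integral_indic// setIT; exact: m2E.
rewrite -EFinM lee_fin le_eqVlt; apply/orP; left; apply/eqP.
by rewrite /D1 /h absvM absvV; field; rewrite !gt_eqF.
Qed.

Definition D t : R := \1_(ball 1) t.

Lemma DE t : D t = (nat_of_bool (a t <= 1)%R)%:R.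
Proof.
rewrite /D indicE; congr (nat_of_bool _)%:R.
by apply/idP/idP; rewrite inE.
Qed.

Lemma mfun_D d (T : measurableType d) (h : T -> B) : mfun h ->
  mfun (fun x => D (h x)).
Proof. by move=> mh; exact: (mfun_comp (mindball 1) mh). Qed.

(** Division by |t| is singular at 0, where [G] tends to 1. Subtracting the indicator of the unit
    ball makes the quotient integrable there and leaves it unchanged at infinity. *)
Definition ek t : R[i] := (G t - (D t)%:C%C) * ((md t)^-1)%:C%C.

Let mmdV : mfun (fun t : B => (md t)^-1).
Proof. by apply: meas_invr => [|x]; [exact: mfun_module|exact: module_ge0]. Qed.

Lemma ek_cinteg : cinteg mu ek.
Proof.
have [D1 [b [D10 b0 H1]]] := G_near0; have [D2 D20 H2] := G_large.
have [s' s'0 ms] := module_absv lh.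
have b1 : 0 < b / s' by rewrite divr_gt0.
have b2 : 0 < s'^-1 by rewrite invr_gt0.
have aE t : a t = md t `^ s'^-1 by rewrite ms -powRrM mulfV ?gt_eqF// powRr1 ?absv_ge0.
have abE t : a t `^ b = md t `^ (b / s') by rewrite ms -powRrM mulrCA mulfV ?gt_eqF// mulr1.
apply: (cinteg_le (v := fun t : B => D1 * wt (b / s') t + D2 * wt s'^-1 t)).
- apply: cmeasM; last exact: cmeasR.
  by apply: cmeasB; [exact: cmeas_G|apply: cmeasR; exact: mfun_D].
- by apply: measurable_funD; apply: mfun_prod => //; exact: mfun_wt.
- move=> t; rewrite /ek cabsM cabs_real ?invr_ge0 ?module_ge0//.
  have w1 := wt_ge0 lh (b / s') t; have w2 := wt_ge0 lh s'^-1 t.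
  rewrite DE; have [t1|t1] := lerP (a t) 1.
    apply: (@le_trans _ _ (D1 * wt (b / s') t)); last by rewrite lerDl mulr_ge0.
    have m1 : md t <= 1 by rewrite -(module1 lh) (ler_module lh) absv1.
    rewrite (wt_small lh) ?(ltW b1)// mulrA -abE; apply: ler_wpM2r; last exact: H1.
    by rewrite invr_ge0 module_ge0.
  apply: (@le_trans _ _ (D2 * wt s'^-1 t)); last by rewrite lerDr mulr_ge0.
  have m1 : 1 <= md t by rewrite -(module1 lh) (ler_module lh) absv1 ltW.
  rewrite subr0 wt_large ?(ltW b2)// mulrA powRN -aE; apply: ler_wpM2r; last exact: H2.
  by rewrite invr_ge0 module_ge0.
- apply: ge0_intD_lty.
  + by apply: mfun_prod => //; exact: mfun_wt.
  + by apply: mfun_prod => //; exact: mfun_wt.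
  + by move=> x; rewrite mulr_ge0// wt_ge0.
  + by move=> x; rewrite mulr_ge0// wt_ge0.
  + by apply: ge0_intZ_lty => //; [exact: mfun_wt|exact: wt_ge0|exact: wt_int].
  + by apply: ge0_intZ_lty => //; [exact: mfun_wt|exact: wt_ge0|exact: wt_int].
Qed.

Definition dk (y t : K) : R := (D t - D (y * t)) / md t.

Lemma mfun_dk : mfun (fun z : B * B => dk z.1 z.2).
Proof.
apply: mfun_prod; last exact: (mfun_comp mmdV msnd).
by apply: measurable_funB; apply: mfun_D => //; exact: (mfun_mul lh).
Qed.

(** The numerator vanishes where the two cut-offs agree. Elsewhere [t] is bounded, and [1 / md t] is
    at most [md y] or at most 1. *)
Lemma dk_cinteg y : y != 0 -> cinteg mu (fun t => (dk y t)%:C%C).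
Proof.
move=> y0; have ay0 : 0 < a y by rewrite absv_gt0.
apply: (cinteg_le (v := fun t : B => (1 + md y) * \1_(ball (1 + (a y)^-1)) t)).
- by apply: cmeasR; exact: (mfun_section y mfun_dk).
- exact: mfun_prod.
- move=> t; rewrite cabsR /dk !DE absvM.
  have y1 : 0 <= 1 + md y by rewrite addr_ge0// module_ge0.
  have [t0|t0] := eqVneq t 0.
    by rewrite t0 (module0 lh) invr0 mulr0 normr0 mulr_ge0.
  have m0 := module_gt0 lh t0.
  have [t1|t1] := lerP (a t) 1; have [t2|t2] := lerP (a y * a t) 1.
  + by rewrite subrr mul0r normr0 mulr_ge0.
  + rewrite subr0 mul1r gtr0_norm ?invr_gt0// indicE mem_set; last first.
      by rewrite /ball /=; have : 0 < (a y)^-1 by [rewrite invr_gt0]; lra.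
    rewrite mulr1; apply: (@le_trans _ _ (md y)); last by rewrite lerDr.
    rewrite -[leLHS]mul1r ler_pdivrMr// -(moduleM lh) -(module1 lh) (ler_module lh) absv1 absvM.
    exact: ltW.
  + rewrite sub0r mulN1r normrN gtr0_norm ?invr_gt0// indicE mem_set; last first.
      by rewrite /ball /=; apply: ler_wpDl => //; rewrite -[leRHS]mul1r ler_pdivlMr// mulrC.
    rewrite mulr1; apply: (@le_trans _ _ 1); last by rewrite lerDl module_ge0.
    by rewrite invf_le1// -(module1 lh) (ler_module lh) absv1 ltW.
  + by rewrite subrr mul0r normr0 mulr_ge0.
- by apply: ge0_intZ_lty => //; rewrite addr_ge0// module_ge0.
Qed.

Definition hk y : R := \int[mu]_t dk y t.

Lemma hkE y : cint mu (fun t => (dk y t)%:C%C) = (hk y)%:C%C.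
Proof. exact: cint_real. Qed.

Let RC_inj (x y : R) : x%:C%C = y%:C%C -> x = y. Proof. by case. Qed.

(** Pointwise, [dk (y * z) t] is [dk y t + md y * dk z (y * t)], and the dilation by [y] cancels the
    factor [md y]. *)
Lemma hkM y z : y != 0 -> z != 0 -> hk (y * z) = hk y + hk z.
Proof.
move=> y0 z0; apply: RC_inj; rewrite RCD -!hkE.
have my0 := module_gt0 lh y0.
have [i1 e1] := cint_scale y0 (dk_cinteg z0).
have -> : cint mu (fun t => (dk z t)%:C%C) = (md y)%:C%C * cint mu (fun t => (dk z (y * t))%:C%C).
  by rewrite e1 mulrA -RCM mulfV ?gt_eqF// mul1r.
rewrite -cintZ// -cintD//; [|exact: dk_cinteg|exact: cintegZ].
apply: cint_ext => t; rewrite -RCM -RCD; congr (_%:C)%C.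
rewrite /dk (moduleM lh) [z * (y * _)]mulrA [z * y]mulrC.
have [t0|t0] := eqVneq (t : K) 0; first by rewrite t0 (module0 lh) !(mulr0, invr0) addr0.
by field; rewrite !gt_eqF// module_gt0.
Qed.

Lemma ge0_hkB (p1 p2 : K -> R) : cinteg mu (fun t => (p1 t)%:C%C) ->
  cinteg mu (fun t => (p2 t)%:C%C) -> (forall t, p1 t <= p2 t) ->
  \int[mu]_t p1 t <= \int[mu]_t p2 t.
Proof.
move=> i1 i2 le12; rewrite -subr_ge0.
have -> : \int[mu]_t p2 t - \int[mu]_t p1 t = \int[mu]_t (p2 t - p1 t).
  apply: RC_inj; rewrite RCB -!cint_real -cintB//.
  by apply: cint_ext => t; rewrite RCB.
by apply: Rintegral_ge0 => t _; rewrite subr_ge0.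
Qed.

Lemma hk_le y z : y != 0 -> z != 0 -> a y <= a z -> hk y <= hk z.
Proof.
move=> y0 z0 yz; apply: ge0_hkB; [exact: dk_cinteg|exact: dk_cinteg|].
move=> t; rewrite /dk ler_wpM2r ?invr_ge0 ?module_ge0// lerB// !DE ler_nat !absvM.
case: (lerP (a z * a t) 1) => // h; rewrite (le_trans _ h)// ler_wpM2r ?absv_ge0//.
Qed.

(** The difference [D t - D (p * t)] is nonnegative and supported in the unit ball, where [1 / md t]
    is at least 1. Hence the integral is at least [b1 - b1 / md p], which is positive. *)
Lemma hk_gt0 : 0 < hk (lh_base lh).
Proof.
set p := lh_base lh; have p1 : 1 < a p by exact: lh_base_gt1.
have p0 : p != 0 by rewrite -absv_gt0 (lt_trans ltr01).
pose b1 := fine (mu (ball 1)).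
have b10 : 0 < b1 by rewrite fine_gt0// haar_ball_lty// haar_ball_gt0.
have Di : cinteg mu (fun t => (D t)%:C%C).
  split; first by apply: cmeasR; exact: mfun_D.
  by under eq_integral do rewrite cabs_real//; exact: ball_int.
have Dc : cint mu (fun t => (D t)%:C%C) = b1%:C%C.
  by rewrite cint_real /Rintegral integral_indic// setIT.
have [Dpi Dpc] := cint_scale p0 Di.
have h : \int[mu]_t (D t - D (p * t)) <= hk p.
  apply: ge0_hkB; last 2 first.
  - exact: dk_cinteg.
  - move=> t; rewrite /dk; have [->|t0] := eqVneq t 0.
      by rewrite mulr0 subrr mul0r.
    rewrite !DE; have m0 := module_gt0 lh t0.
    have [t1|t1] := lerP (a t) 1; have [t2|t2] := lerP (a (p * t)) 1; rewrite ?subrr ?mul0r//.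
      rewrite subr0 mul1r invf_ge1// -(module1 lh) (ler_module lh) absv1//.
    exfalso; move: t2; rewrite leNgt => /negP; apply; apply: lt_trans t1 _.
    by rewrite absvM ltr_pMl// absv_gt0.
  have := cintegB Di Dpi; congr (cinteg mu _); apply/funext => t.
  by rewrite RCB.
apply: lt_le_trans h.
have -> : \int[mu]_t (D t - D (p * t)) = b1 - (md p)^-1 * b1.
  apply: RC_inj; rewrite -cint_real RCB RCM -Dc -Dpc -cintB//.
  by apply: cint_ext => t; rewrite RCB.
rewrite -{1}[b1]mul1r -mulrBl mulr_gt0// subr_gt0 invf_lt1 ?module_gt0//.
exact: module_gt1.
Qed.

(** The function [hk] is monotone and turns products into sums, so [monotone_hom_log] makes it a
    multiple of the logarithm; positivity is read off at the base [p]. *)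
Lemma log_constant : exists2 kappa : R, 0 < kappa &
  forall y, y != 0 -> hk y = kappa * ell y.
Proof.
have [s' s'0 ms] := module_absv lh; have p1 := lh_base_gt1 lh.
exists (hk (lh_base lh) / ln (a (lh_base lh)) / s').
  by rewrite !divr_gt0// ?hk_gt0// ln_gt0.
move=> y y0; rewrite (monotone_hom_log lh hkM hk_le y0) /ell ms ln_powR.
by rewrite mulrA divfK ?gt_eqF.
Qed.

(** [dk y] has constant sign, decided by whether [a y] is at least 1, so its L1 norm is the absolute
    value of its integral. *)
Lemma dk_abs y : y != 0 -> (\int[mu]_t (cabs (dk y t)%:C%C)%:E = `|hk y|%:E)%E.
Proof.
move=> y0; have [m _] := dk_cinteg y0.
have fin (p1 : K -> R) : cinteg mu (fun t => (p1 t)%:C%C) -> (forall t, 0 <= p1 t) ->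
    (\int[mu]_t (p1 t)%:E = (\int[mu]_t p1 t)%:E)%E.
  move=> [_ fi] p10; rewrite /Rintegral fineK// ge0_fin_numE.
    by move: fi; under eq_integral do rewrite cabs_real//.
  by apply: integral_ge0 => t _; rewrite lee_fin.
have Dmono t : a y <= 1 -> D t <= D (y * t).
  move=> y1; rewrite !DE ler_nat absvM; case: (lerP (a t) 1) => // t1.
  by rewrite (le_trans _ t1)// ler_piMl ?absv_ge0.
have Dmono2 t : 1 <= a y -> D (y * t) <= D t.
  move=> y1; rewrite !DE ler_nat absvM; case: (lerP (a y * a t) 1) => // t1.
  by rewrite (le_trans _ t1)// ler_peMl ?absv_ge0.
have [y1|/ltW y1] := lerP 1 (a y).
  have d0 t : 0 <= dk y t by rewrite mulr_ge0 ?invr_ge0 ?module_ge0// subr_ge0 Dmono2.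
  under eq_integral do rewrite cabs_real//.
  rewrite fin//; last exact: dk_cinteg.
  by rewrite ger0_norm//; apply: Rintegral_ge0 => t _.
have d0 t : 0 <= - dk y t.
  by rewrite /dk -mulNr mulr_ge0 ?invr_ge0 ?module_ge0// opprB subr_ge0 Dmono.
under eq_integral do rewrite -cabsN -RCN cabs_real//.
have iN : cinteg mu (fun t => (- dk y t)%:C%C).
  by have := cintegN (dk_cinteg y0); congr (cinteg mu _); apply/funext => t; rewrite RCN.
rewrite fin//; congr (_%:E).
have -> : \int[mu]_t (- dk y t) = - hk y.
  apply: RC_inj; rewrite RCN -hkE -cint_real -cintN; last exact: dk_cinteg.
  by apply: cint_ext => t; rewrite RCN.
rewrite ler0_norm// -oppr_ge0.
have -> : - hk y = \int[mu]_t (- dk y t).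
  apply: RC_inj; rewrite RCN -hkE -cint_real -cintN; last exact: dk_cinteg.
  by apply: cint_ext => t; rewrite RCN.
by apply: Rintegral_ge0 => t _.
Qed.

Definition frk (y t : K) : R[i] := (G t - G (y * t)) * ((md t)^-1)%:C%C.

Lemma cmeas_frk : cmeas (fun z : B * B => frk z.1 z.2).
Proof.
apply: cmeasM; last by apply: cmeasR; exact: (mfun_comp mmdV msnd).
by apply: cmeasB; apply: (cmeas_comp _ cmeas_G) => //; exact: (mfun_mul lh).
Qed.

Definition Jk : R := fine (\int[mu]_t (cabs (ek t))%:E)%E.

Lemma JkE : (\int[mu]_t (cabs (ek t))%:E = Jk%:E)%E.
Proof.
have [_ h] := ek_cinteg; rewrite fineK// ge0_fin_numE//.
by apply: integral_ge0 => t _; rewrite lee_fin cabs_ge0.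
Qed.

Lemma frullani_split (L : comRingType) (g1 g2 d1 d2 m v w : L) : v * w = 1 ->
  (g1 - g2) * m = ((g1 - d1) * m - v * ((g2 - d2) * (w * m))) + (d1 - d2) * m.
Proof.
by move=> vw; rewrite [v * _]mulrCA [v * (w * m)]mulrA vw mul1r; ring.
Qed.

(** Replacing [G] by the cut-off [D] costs [ek t - md y * ek (y * t)], whose integral vanishes by
    dilation. The L1 bound grows only like the logarithm of [y], which makes Fubini applicable in
    [log_pairing]. *)
Lemma frullani y : y != 0 -> [/\ cinteg mu (frk y), cint mu (frk y) = (hk y)%:C%C
  & (\int[mu]_t (cabs (frk y t))%:E <= (2 * Jk + `|hk y|)%:E)%E].
Proof.
move=> y0; have ei := ek_cinteg; have my0 := module_gt0 lh y0.
have [si se] := cint_scale y0 ei; have di := dk_cinteg y0.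
have zi := cintegZ ((md y)%:C%C) si.
have E t : frk y t = (ek t - (md y)%:C%C * ek (y * t)) + (dk y t)%:C%C.
  have [->|t0] := eqVneq t 0.
    by rewrite /frk /ek /dk mulr0 (module0 lh) !invr0 !mulr0 subrr add0r.
  have mt0 := module_gt0 lh t0.
  have [H1 H2] : (md y)%:C%C * ((md y)^-1)%:C%C = 1 :> R[i] /\ (dk y t)%:C%C = ((D t)%:C%C - (D (y * t))%:C%C) * ((md t)^-1)%:C%C.
    by split; [rewrite -RCM mulfV ?gt_eqF//|rewrite -RCB -RCM].
  rewrite H2 /frk /ek (moduleM lh) invfM RCM.
  exact: frullani_split H1.
have ext : frk y = (fun t => (ek t - (md y)%:C%C * ek (y * t)) + (dk y t)%:C%C) by apply/funext.
have bi := cintegB ei zi.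
have mi : cinteg mu (frk y) by rewrite ext; exact: cintegD.
split=> //.
  rewrite ext cintD// cintB// cintZ// se mulrA -RCM mulfV ?gt_eqF// mul1r subrr add0r.
  exact: hkE.
have mm1 : mfun (fun t : B => cabs (ek t)) by apply: cmeas_cabs; have [] := ei.
have mm2 : mfun (fun t : B => md y * cabs (ek (y * t))).
  by apply: mfun_prod => //; apply: cmeas_cabs; have [] := si.
have mm3 : mfun (fun t : B => cabs ((dk y t)%:C%C : R[i])).
  by apply: cmeas_cabs; have [] := di.
have p1 t : 0 <= cabs (ek t) by exact: cabs_ge0.
have p2 t : 0 <= md y * cabs (ek (y * t)) by rewrite mulr_ge0 ?cabs_ge0 ?module_ge0.
have p3 t : 0 <= cabs ((dk y t)%:C%C : R[i]) by exact: cabs_ge0.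
apply: (@le_trans _ _ (\int[mu]_t (cabs (ek t) + md y * cabs (ek (y * t)) + cabs (dk y t)%:C%C)%:E)%E).
  apply: ge0_int_le.
  - by apply: cmeas_cabs; have [] := mi.
  - by apply: measurable_funD => //; exact: measurable_funD.
  - by move=> t; exact: cabs_ge0.
  move=> t; rewrite E; apply: le_trans (cabsD _ _) _; rewrite lerD2r.
  apply: le_trans (cabsD _ _) _; rewrite cabsN cabsM cabs_real//.
  exact: module_ge0.
rewrite (ge0_intD mu (measurable_funD mm1 mm2) mm3)//; last by move=> t; rewrite addr_ge0.
rewrite (ge0_intD mu mm1 mm2)// JkE dk_abs//.
have -> : (\int[mu]_t (md y * cabs (ek (y * t)))%:E = Jk%:E)%E.
  have mm4 : mfun (fun t : B => cabs (ek (y * t))).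
    by apply: cmeas_cabs; have [] := si.
  have p4 (t : B) : 0 <= cabs (ek (y * t)) by exact: cabs_ge0.
  rewrite (ge0_intZ mu mm4 p4 (ltW my0)).
  rewrite (int_scale lh (f := fun t => (cabs (ek t))%:E))// ?JkE.
  - by rewrite -!EFinM mulrA mulfV ?gt_eqF// mul1r.
  - exact/measurable_EFinP.
by rewrite -!EFinD lee_fin mulrDl mul1r.
Qed.

Lemma fin_mul2 (f g : K -> R[i]) : cinteg mu f -> cinteg mu g ->
  (\int[mu]_x \int[mu]_y (cabs (f x) * cabs (g y))%:E < +oo)%E.
Proof.
move=> [mf ff] [mg gg].
have mcf : mfun (fun x : B => cabs (f x)) by exact: cmeas_cabs.
have mcg : mfun (fun x : B => cabs (g x)) by exact: cmeas_cabs.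
have g0 (y : B) : 0 <= cabs (g y) by exact: cabs_ge0.
have f0 (y : B) : 0 <= cabs (f y) by exact: cabs_ge0.
pose m := fine (\int[mu]_y (cabs (g y))%:E)%E.
have mE : (\int[mu]_y (cabs (g y))%:E = m%:E)%E.
  by rewrite fineK// ge0_fin_numE//; apply: integral_ge0 => x _; rewrite lee_fin.
have m0 : 0 <= m by rewrite -lee_fin -mE; apply: integral_ge0 => x _; rewrite lee_fin.
have E (x : B) : (\int[mu]_y (cabs (f x) * cabs (g y))%:E = (m * cabs (f x))%:E)%E.
  by rewrite (ge0_intZ mu mcg g0 (f0 x)) mE mulrC.
under eq_integral do rewrite E.
by rewrite (ge0_intZ mu mcf f0 m0) lte_mul_pinfty// lee_fin.
Qed.

Lemma sqL_shift h f : sqL mu f -> sqL mu (fun x => f (x + h)).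
Proof.
move=> [mf ff]; split; first by apply: (cmeas_comp _ mf); exact: (mfun_add lh).
rewrite /sqn (int_shift lh h (f := fun x => (cabs (f x) ^+ 2)%:E))//.
- by apply/measurable_EFinP; exact: meas_sq.
- by move=> x; rewrite lee_fin sqr_ge0.
Qed.

(** * Matrix coefficients of B and of the commutator *)

Section Pairing.
Variables u v : K -> R[i].
Hypotheses (ui : cinteg mu u) (u2 : sqL mu u) (vi : cinteg mu v) (v2 : sqL mu v).

Let U2 : sqL mu (F u). Proof. by have [] := FL_L1 lp ui u2. Qed.
Let V2 : sqL mu (F v). Proof. by have [] := FL_L1 lp vi v2. Qed.
Let UV : cinteg mu (fun y => F u y * (F v y)^*%C). Proof. exact: cinteg_ip. Qed.
Let UVf (y : B) := F u y * (F v y)^*%C.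
Let mUV : cmeas (fun y : B => F u y * (F v y)^*%C). Proof. by have [] := UV. Qed.

Let P1 (t : K) (z : B * B) : R[i] :=
  gb z.1 * (lambda (- (z.1 * (z.2 * t))) * (F u z.2 * (F v z.2)^*%C)).

Let P1m t : cmeas (P1 t).
Proof.
apply: cmeasM; first by apply: (cmeas_comp mfst); have [] := gb_cinteg.
apply: cmeasM; last exact: (cmeas_comp msnd mUV).
apply: (cmeas_lambda lp); apply: (mfun_opp lh).
by do 2 apply: (mfun_mul lh) => //.
Qed.

Let P1fin t : (\int[mu]_x \int[mu]_y (cabs (P1 t (x, y)))%:E < +oo)%E.
Proof.
apply: le_lt_trans (fin_mul2 gb_cinteg UV).
rewrite le_eqVlt; apply/orP; left; apply/eqP.
apply: eq_integral => x _; apply: eq_integral => y _.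
by rewrite /P1 /= cabsM cabsM (lp_cabs_lambda lp) mul1r.
Qed.

Let P1E t x : cint mu (fun y => P1 t (x, y)) = gb x * ip mu (fun z => u (z - x * t)) v.
Proof.
have E : FL mu (fun z => u (z - x * t)) (F (fun z => u (z - x * t))).
  have [i1 _] := cinteg_shift lp (- (x * t)) ui; exact: (FL_L1 lp i1 (sqL_shift (- (x * t)) u2)).
rewrite -(FL_ip lp E (FL_L1 lp vi v2)) /ip -cintZ; last first.
  by have [_ s2 _] := E; exact: (cinteg_ip s2 V2).
apply: cint_ext => y; rewrite (fourier_shift lp _ _ ui).
rewrite -[LHS]/(gb x * (lambda (- (x * (y * t))) * (F u y * (F v y)^*%C))).
have -> : - (x * t) * y = - (x * (y * t)) by rewrite mulNr -mulrA (mulrC t).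
by rewrite [X in gb x * X]mulrA.
Qed.

(** Multiplication by [G (y * t)] on the Fourier side is convolution with a dilated bump, that is,
    an average of the translates of [u] by [x * t]. *)
Lemma pairing_average t :
  [/\ cinteg mu (fun x => gb x * ip mu (fun z => u (z - x * t)) v),
      cinteg mu (fun y => G (y * t) * (F u y * (F v y)^*%C))
    & cint mu (fun y => G (y * t) * (F u y * (F v y)^*%C)) =
      cint mu (fun x => gb x * ip mu (fun z => u (z - x * t)) v)].
Proof.
have E : (fun x => cint mu (fun y => P1 t (x, y))) =
    (fun x => gb x * ip mu (fun z => u (z - x * t)) v) by apply/funext => x; exact: P1E.
have E2 : (fun y => cint mu (fun x => P1 t (x, y))) =
    (fun y => G (y * t) * (F u y * (F v y)^*%C)).
  apply/funext => y; rewrite /G fourierE [RHS]mulrC -cintZ; last exact: (cinteg_lambda lp _ gb_cinteg).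
  by apply: cint_ext => x; rewrite /P1 /= mulrA mulrC.
rewrite -E -E2; split.
- exact: (cinteg_fubini1 (P1m t) (P1fin t)).
- exact: (cinteg_fubini2 (P1m t) (P1fin t)).
- exact: (esym (cint_fubini (P1m t) (P1fin t))).
Qed.

Variable kappa : R.
Hypothesis kappa0 : 0 < kappa.
Hypothesis hkE' : forall y, y != 0 -> hk y = kappa * ell y.
Hypothesis lU2 : sqL mu (fun y => (ell y)%:C%C * F u y).

Let P2 (z : B * B) : R[i] := frk z.1 z.2 * (F u z.1 * (F v z.1)^*%C).

Let P2m : cmeas P2.
Proof. by apply: cmeasM; [exact: cmeas_frk|exact: (cmeas_comp mfst mUV)]. Qed.

Let lUV : cinteg mu (fun y => (ell y)%:C%C * F u y * (F v y)^*%C).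
Proof. exact: cinteg_ip. Qed.

Let P2fin : (\int[mu]_x \int[mu]_y (cabs (P2 (x, y)))%:E < +oo)%E.
Proof.
have J0 : 0 <= Jk by rewrite -lee_fin -JkE; apply: integral_ge0 => x _; rewrite lee_fin cabs_ge0.
have m1 : mfun (fun y : B => cabs (F u y * (F v y)^*%C)) by exact: cmeas_cabs.
have m2 : mfun (fun y : B => cabs ((ell y)%:C%C * F u y * (F v y)^*%C)).
  by apply: cmeas_cabs; have [] := lUV.
have p1 (y : B) : 0 <= cabs (F u y * (F v y)^*%C) by exact: cabs_ge0.
have p2 (y : B) : 0 <= cabs ((ell y)%:C%C * F u y * (F v y)^*%C) by exact: cabs_ge0.
have J20 : 0 <= 2 * Jk by rewrite mulr_ge0.
have k0 := ltW kappa0.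
apply: (@le_lt_trans _ _ (\int[mu]_y ((2 * Jk) * cabs (F u y * (F v y)^*%C) +
   kappa * cabs ((ell y)%:C%C * F u y * (F v y)^*%C))%:E)%E); last first.
  rewrite (ge0_intD mu (mfun_prod (measurable_cst (2 * Jk)) m1) (mfun_prod (measurable_cst kappa) m2)).
  - rewrite (ge0_intZ mu m1 p1 J20) (ge0_intZ mu m2 p2 k0).
    by apply: lte_add_pinfty; apply: lte_mul_pinfty; rewrite ?lee_fin//; [have [] := UV|have [] := lUV].
  - by move=> y; rewrite mulr_ge0.
  - by move=> y; rewrite mulr_ge0.
apply: ae_ge0_le_integral => //.
- by move=> y _; apply: integral_ge0 => t _; rewrite lee_fin cabs_ge0.
- have := cmeas_cabs P2m; move=> /(@mfun_partial R K mu (fun z => cabs (P2 z))); apply => z; exact: cabs_ge0.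
- by move=> y _; rewrite lee_fin addr_ge0// mulr_ge0.
- by apply/measurable_EFinP; apply: measurable_funD; exact: mfun_prod.
apply: (ae_neq0 lh) => y y0 _.
have [fi _ fb] := frullani y0; have [mfr _] := fi.
have mcfr : mfun (fun t : B => cabs (frk y t)) by exact: cmeas_cabs.
have -> : (\int[mu]_t (cabs (P2 (y, t)))%:E =
   (cabs (F u y * (F v y)^*%C))%:E * \int[mu]_t (cabs (frk y t))%:E)%E.
  rewrite -(ge0_intZ mu mcfr (fun t => cabs_ge0 _) (p1 y)).
  by apply: eq_integral => t _; rewrite /P2 /= cabsM mulrC.
apply: le_trans (lee_wpmul2l _ fb) _; first by rewrite lee_fin.
have -> : cabs ((ell y)%:C%C * F u y * (F v y)^*%C) = `|ell y| * cabs (F u y * (F v y)^*%C).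
  by rewrite -[_ * F u y * _]mulrA cabsM cabsR.
rewrite -EFinM lee_fin hkE'// normrM (gtr0_norm kappa0) mulrDr [X in X + _]mulrC lerD2l.
by rewrite mulrC mulrA.
Qed.

(** Frullani's formula replaces [ell y] under the pairing of transforms. The integral over [y] is
    then taken inside, where Plancherel evaluates the first term and [pairing_average] the
    second. *)
Lemma log_pairing :
  [/\ cinteg mu (fun t => ((md t)^-1)%:C%C * (G t * ip mu u v -
        cint mu (fun x => gb x * ip mu (fun z => u (z - x * t)) v)))
    & kappa%:C%C * ip mu (fun y => (ell y)%:C%C * F u y) (F v) =
      cint mu (fun t => ((md t)^-1)%:C%C * (G t * ip mu u v -
        cint mu (fun x => gb x * ip mu (fun z => u (z - x * t)) v)))].
Proof.
have E : (fun t => cint mu (fun y => P2 (y, t))) =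
  (fun t => ((md t)^-1)%:C%C * (G t * ip mu u v -
        cint mu (fun x => gb x * ip mu (fun z => u (z - x * t)) v))).
  have e0 : cint mu UVf = ip mu u v := FL_ip lp (FL_L1 lp ui u2) (FL_L1 lp vi v2).
  apply/funext => t; have [_ i1 i3] := pairing_average t.
  transitivity (((md t)^-1)%:C%C * (G t * cint mu UVf - cint mu (fun y => G (y * t) * UVf y))).
    have i2 := cintegZ (G t) UV.
    have i4 : cinteg mu (fun y => G t * UVf y - G (y * t) * UVf y) := cintegB i2 i1.
    have h1 := cintZ (((md t)^-1)%:C%C) i4; have h2 := cintB i2 i1; have h3 := cintZ (G t) UV.
    transitivity (cint mu (fun y => ((md t)^-1)%:C%C * (G t * UVf y - G (y * t) * UVf y))).
      apply: cint_ext => y; rewrite -[LHS]/((G t - G (y * t)) * ((md t)^-1)%:C%C * UVf y).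
      by move: (G t) (G (y * t)) (((md t)^-1)%:C%C) (UVf y) => A1 A2 A3 A4; ring.
    exact: (etrans h1 (congr1 (fun z => ((md t)^-1)%:C%C * z)
      (etrans h2 (congr1 (fun z => z - cint mu (fun y => G (y * t) * UVf y)) h3)))).
  by rewrite i3 e0.
rewrite -E; split; first exact: (cinteg_fubini2 P2m P2fin).
rewrite -(cint_fubini P2m P2fin) /ip -(cintZ _ lUV).
apply: cint_ae; first by have [] := cintegZ kappa%:C%C lUV.
  by have [] := cinteg_fubini1 P2m P2fin.
apply: (ae_neq0 lh) => y y0; have [fi fE _] := frullani y0.
transitivity (UVf y * cint mu (frk y)).
  rewrite fE (hkE' y0) RCM -[(ell y)%:C%C * F u y * _]mulrA -/(UVf y).
  by move: (UVf y) (kappa%:C%C) ((ell y)%:C%C) => A1 A2 A3; ring.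
by rewrite -(cintZ _ fi); apply: cint_ext => t; rewrite mulrC.
Qed.
End Pairing.

(** For fixed nonzero [x] the dilation of [t] by [x] absorbs [md x], so the inner integral no longer
    depends on [x], and the bump has integral 1. *)
Lemma average_dilations (Psi : K -> R[i]) : cinteg mu Psi ->
  [/\ cinteg mu (fun t => cint mu (fun x => gb x * ((md x)%:C%C * Psi (x * t))))
    & cint mu (fun t => cint mu (fun x => gb x * ((md x)%:C%C * Psi (x * t)))) = cint mu Psi].
Proof.
move=> Pi; have [mP fP] := Pi; have [mg fg] := gb_cinteg.
pose P (z : B * B) : R[i] := gb z.1 * ((md z.1)%:C%C * Psi ((z.1 : K) * (z.2 : K))).
have mPm : cmeas P.
  apply: cmeasM; first exact: (cmeas_comp mfst mg).
  apply: cmeasM; first by apply: cmeasR; exact: (mfun_comp (mfun_module lh) mfst).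
  by apply: (cmeas_comp _ mP); exact: (mfun_mul lh).
have mcP : mfun (fun x : B => cabs (Psi x)) by exact: cmeas_cabs.
have E (x : B) : (x : K) != 0 -> (\int[mu]_t (cabs (P (x, t)))%:E = (cabs (gb x))%:E * \int[mu]_t (cabs (Psi t))%:E)%E.
  move=> x0; have [[ms _] _] := cint_scale x0 Pi.
  have ms2 : mfun (fun t : B => cabs (Psi ((x : K) * t))).
    by apply: cmeas_cabs; have [[]] := cint_scale x0 Pi.
  have c0 : 0 <= cabs (gb x) * md x by rewrite mulr_ge0 ?cabs_ge0 ?module_ge0.
  transitivity (\int[mu]_t ((cabs (gb x) * md x) * cabs (Psi ((x : K) * t)))%:E)%E.
    apply: eq_integral => t _; rewrite /P [in LHS]cabsM [in LHS]cabsM mulrA cabs_real//.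
    exact: module_ge0.
  rewrite (ge0_intZ mu ms2 (fun t => cabs_ge0 _) c0).
  have mE : mfun (fun t : B => (cabs (Psi t))%:E) by exact/measurable_EFinP.
  have pE (t : B) : (0 <= (cabs (Psi t))%:E)%E by rewrite lee_fin cabs_ge0.
  rewrite (int_scale lh x0 mE pE).
  have mx := module_gt0 lh x0.
  by rewrite muleA -EFinM mulfK// gt_eqF.
have Pfin : (\int[mu]_x \int[mu]_t (cabs (P (x, t)))%:E < +oo)%E.
  apply: (@le_lt_trans _ _ (\int[mu]_x ((cabs (gb x))%:E * \int[mu]_t (cabs (Psi t))%:E))%E).
    rewrite le_eqVlt; apply/orP; left; apply/eqP.
    apply: ge0_ae_eq_integral => //.
    - have := cmeas_cabs mPm; move=> /(@mfun_partial R K mu (fun z => cabs (P z))); apply => z; exact: cabs_ge0.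
    - apply: emeasurable_funM => //; apply/measurable_EFinP; exact: cmeas_cabs.
    - by move=> z _; apply: integral_ge0 => t _; rewrite lee_fin cabs_ge0.
    - move=> z _; apply: mule_ge0; rewrite ?lee_fin ?cabs_ge0//.
      by apply: integral_ge0 => t _; rewrite lee_fin cabs_ge0.
    - by apply: (ae_neq0 lh) => z z0 _; exact: E.
  rewrite ge0_integralZr//.
  - apply: lte_mul_pinfty => //.
    + by apply: integral_ge0 => t _; rewrite lee_fin cabs_ge0.
    + by rewrite ge0_fin_numE//; apply: integral_ge0 => t _; rewrite lee_fin cabs_ge0.
  - by apply/measurable_EFinP; exact: cmeas_cabs.
  - by move=> z _; rewrite lee_fin cabs_ge0.
  - by apply: integral_ge0 => t _; rewrite lee_fin cabs_ge0.
split; first exact: (cinteg_fubini2 mPm Pfin).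
rewrite -[LHS]/(cint mu (fun t => cint mu (fun x => P (x, t)))) -(cint_fubini mPm Pfin).
transitivity (cint mu (fun x => cint mu Psi * gb x)); last first.
  by rewrite (cintZ _ gb_cinteg) gb_cint mulr1.
apply: cint_ae; first by have [] := cinteg_fubini1 mPm Pfin.
  by have [] := cintegZ (cint mu Psi) gb_cinteg.
apply: (ae_neq0 lh) => x x0; have [si se] := cint_scale x0 Pi.
have si2 := cintegZ ((md x)%:C%C) si.
transitivity (gb x * ((md x)%:C%C * cint mu (fun t => Psi (x * t)))).
  by rewrite -(cintZ _ si) -(cintZ _ si2).
by rewrite se mulrA -mulrA mulrA mulrA -[gb x * _ * _]mulrA -RCM mulfV ?gt_eqF ?(module_gt0 lh)// mulr1 mulrC.
Qed.

Section CommutatorForm.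
Variables f v : K -> R[i].
Hypotheses (f2 : sqL mu f) (v2 : sqL mu v).

(** The substitution [y = x - h] makes the length of the translation the outer variable, the form in
    which the kernel comes out of the pairings. *)
Lemma shear_kform :
  cinteg mu (fun h => cint mu (fun x => kform f v (x, x - h))) /\
  cint mu (fun h => cint mu (fun x => kform f v (x, x - h))) = ip mu (kop f) v.
Proof.
have [mf _] := f2; have [mv _] := v2.
have mk := cmeas_kform lh mf mv; have kf := kform_fin lh f2 v2.
pose P (z : B * B) : R[i] := kform f v (z.1, (z.1 : K) - (z.2 : K)).
have mP : cmeas P.
  apply: (cmeas_comp (h := fun z : B * B => (z.1, (z.1 : K) - (z.2 : K) : B)) _ mk).
  by apply/measurable_fun_pairP; split=> //; exact: (mfun_sub lh).
have reindex (g : B -> \bar R) (x : K) : mfun g -> (forall y, 0 <= g y)%E ->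
    (\int[mu]_h g (x - h)%R = \int[mu]_y g y)%E.
  move=> mg g0; rewrite -(int_reflection lh mg g0).
  rewrite -(int_shift lh (- x) (f := fun y => g (- (y : K))%R)) //.
    by apply: eq_integral => h _; rewrite opprD opprK addrC.
  by apply: (mfun_comp mg); exact: (mfun_opp lh).
have Pfin : (\int[mu]_x \int[mu]_h (cabs (P (x, h)))%:E < +oo)%E.
  apply: le_lt_trans kf; rewrite le_eqVlt; apply/orP; left; apply/eqP.
  apply: eq_integral => x _; apply: (reindex (fun y => (cabs (kform f v (x, y)))%:E)).
  - apply/measurable_EFinP; have := cmeas_cabs mk; move=> /(@mfun_section R K (fun z => cabs (kform f v z))) h; apply: h.
  - by move=> y; rewrite lee_fin cabs_ge0.
split; first exact: (cinteg_fubini2 mP Pfin).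
rewrite -[LHS]/(cint mu (fun t => cint mu (fun x => P (x, t)))) -(cint_fubini mP Pfin).
rewrite (kop_ip lh f2 v2).
apply: cint_ae; [by have [] := cinteg_fubini1 mP Pfin|by have [] := cinteg_fubini1 mk kf|].
have [mkv _] := v2; apply: filterS (kop_cinteg lh f2) => x qi.
have ki : cinteg mu (fun y => kform f v (x, y)).
  have := cintegZ ((v x)^*%C) qi; congr (cinteg mu _); apply/funext => y.
  by rewrite /kform /= mulrC mulrA.
have [r1 r2] := reflection_cov lp ki.
have [s1 s2] := cinteg_shift lp (- x) r1.
rewrite -r2 -s2; apply: cint_ext => h.
by rewrite -[LHS]/(kform f v (x, x - h)) opprD opprK addrC.
Qed.

Hypotheses (lf2 : sqL mu (fun x => (ell x)%:C%C * f x))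
  (lv2 : sqL mu (fun x => (ell x)%:C%C * v x)).

(** Both pairings involve the same product [f (x - h) * (v x)^*]; their difference carries
    [ell (x - h) - ell x], which is [md h] times the kernel. *)
Lemma shift_pairing (h : K) :
  ip mu (fun x => (ell (x - h))%:C%C * f (x - h)) v -
  ip mu (fun x => f (x - h)) (fun x => (ell x)%:C%C * v x) =
  (md h)%:C%C * cint mu (fun x => kform f v (x, x - h)).
Proof.
have a1 := sqL_shift (- h) lf2; have a2 := sqL_shift (- h) f2.
have i1 := cinteg_ip a1 v2; have i2 := cinteg_ip a2 lv2; have iB := cintegB i1 i2.
have [->|h0] := eqVneq h 0.
  rewrite (module0 lh) mul0r; apply/eqP; rewrite subr_eq0; apply/eqP.
  by apply: cint_ext => x; rewrite !subr0 conjcM conjc_real mulrCA mulrA.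
have pB := cintB i1 i2; have pZ := cintZ ((md h)^-1)%:C%C iB.
have mV : ((md h)^-1)%:C%C * (md h)%:C%C = 1 :> R[i] by rewrite -RCM mulVf ?gt_eqF// (module_gt0 lh).
apply: (mulfI (x := ((md h)^-1)%:C%C)); first by apply/eqP => z0; move: mV; rewrite z0 mul0r => /esym/eqP; rewrite oner_eq0.
rewrite [RHS]mulrA mV mul1r; apply: (etrans (congr1 (fun z => ((md h)^-1)%:C%C * z) (esym pB))).
apply: (etrans (esym pZ)); apply: cint_ext => x.
rewrite -[RHS]/(((ell (x - h) - ell x) / md (x - h - x))%:C%C * (f (x - h) * (v x)^*%C)).
have -> : x - h - x = - h by ring.
rewrite (moduleN lh) RCM RCB conjcM conjc_real.
move: (f (x - h)) (v x)^*%C (ell (x - h))%:C%C (ell x)%:C%C ((md h)^-1)%:C%C => A1 A2 A3 A4 A5.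
ring.
Qed.
End CommutatorForm.

Lemma gt0_RC (c : R) : 0 < c -> c%:C%C != 0 :> R[i].
Proof. by move=> c0; apply/eqP => -[] /eqP; rewrite gt_eqF. Qed.

Lemma cintegZ_inv (c : R[i]) (f : K -> R[i]) : c != 0 ->
  cinteg mu (fun x => c * f x) -> cinteg mu f.
Proof.
move=> c0 /(cintegZ c^-1); congr (cinteg mu _); apply/funext => x.
by rewrite mulrA mulVf// mul1r.
Qed.

(** In the difference of two instances of [log_pairing] the terms with [G t] cancel, because
    multiplication by [ell] is symmetric ([ipE]). By [shift_pairing] the translates leave a factor
    [md (x * t)], whose part [md t] cancels the weight of the outer integral. *)
Lemma log_commutator_form (kappa : R) f v : 0 < kappa ->
  (forall y, y != 0 -> hk y = kappa * ell y) ->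
  cinteg mu f -> sqL mu f ->
  cinteg mu (fun x => (ell x)%:C%C * f x) -> sqL mu (fun x => (ell x)%:C%C * f x) ->
  cinteg mu v -> sqL mu v ->
  cinteg mu (fun x => (ell x)%:C%C * v x) -> sqL mu (fun x => (ell x)%:C%C * v x) ->
  sqL mu (fun y => (ell y)%:C%C * F f y) ->
  sqL mu (fun y => (ell y)%:C%C * F (fun x => (ell x)%:C%C * f x) y) ->
  kappa%:C%C * (ip mu (fun y => (ell y)%:C%C * F (fun x => (ell x)%:C%C * f x) y) (F v) -
    ip mu (fun y => (ell y)%:C%C * F f y) (F (fun x => (ell x)%:C%C * v x))) =
  - ip mu (kop f) v.
Proof.
move=> k0 hE fi f2 lfi lf2 vi v2 lvi lv2 lF1 lF2.
have [c1 e1] := log_pairing lfi lf2 vi v2 k0 hE lF2.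
have [c2 e2] := log_pairing fi f2 lvi lv2 k0 hE lF1.
have [Pi PE] := shear_kform f2 v2; have [j1 j2] := average_dilations Pi.
have h1 := cintB c1 c2; have h2 := cintN j1.
rewrite mulrBr -PE -j2; apply: (etrans (congr2 (fun a b => a - b) e1 e2)).
apply: (etrans (esym h1)); apply: (etrans _ h2).
apply: cint_ae; [by have [] := cintegB c1 c2|by have [] := cintegN j1|].
apply: (ae_neq0 lh) => t t0.
have [p1 _ _] := pairing_average lfi lf2 vi v2 t.
have [p2 _ _] := pairing_average fi f2 lvi lv2 t.
have ipE : ip mu (fun x => (ell x)%:C%C * f x) v = ip mu f (fun x => (ell x)%:C%C * v x).
  by apply: cint_ext => x; rewrite conjcM conjc_real; ring.
have mt0 := module_gt0 lh t0.
have key : cint mu (fun x => gb x * ip mu (fun z => (ell (z - x * t))%:C%C * f (z - x * t)) v) -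
    cint mu (fun x => gb x * ip mu (fun z => f (z - x * t)) (fun z => (ell z)%:C%C * v z)) =
    (md t)%:C%C * cint mu (fun x => gb x * ((md x)%:C%C * cint mu (fun z => kform f v (z, z - x * t)))).
  have pw x : gb x * ip mu (fun z => (ell (z - x * t))%:C%C * f (z - x * t)) v -
      gb x * ip mu (fun z => f (z - x * t)) (fun z => (ell z)%:C%C * v z) =
      (md t)%:C%C * (gb x * ((md x)%:C%C * cint mu (fun z => kform f v (z, z - x * t)))).
    have hs := shift_pairing f2 v2 lf2 lv2 (x * t).
    rewrite -[LHS]mulrBr hs (moduleM lh) RCM.
    by move: (gb x) ((md x)%:C%C) ((md t)%:C%C) (cint _ _) => A1 A2 A3 A4; ring.
  have pB := cintegB p1 p2; rewrite (funext pw) in pB.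
  have j := cintegZ_inv (gt0_RC mt0) pB.
  apply: (etrans (esym (cintB p1 p2))); apply: (etrans _ (cintZ _ j)).
  by apply: cint_ext => x; exact: pw.
have m1 : ((md t)^-1)%:C%C * (md t)%:C%C = 1 :> R[i] by rewrite -RCM mulVf ?gt_eqF.
rewrite -mulrBr ipE; move: key m1.
move: (G t * _) (cint _ _) (cint _ _) (cint _ _) => X1 X2 X3 X4.
move: ((md t)^-1)%:C%C (md t)%:C%C => A1 A2 key m1.
rewrite -[RHS]mul1r -m1 mulrN -mulrA -key; ring.
Qed.

End LogFormula.

(** * Operators as graphs *)

Section OperatorGraphs.
Context {R : realType} {K : valuedFieldType R}.
Variable mu : {sigma_finite_measure set (borel K) -> \bar R}.
Notation B := (borel K).
Notation aeq f g := {ae mu, forall x : B, f x = g x}.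
Implicit Types (f g : K -> R[i]).

Lemma L2normE f : L2norm mu f = (sqn mu f `^ 2^-1)%E.
Proof.
rewrite /L2norm unlock /=; congr (_ `^ _)%E; apply: eq_integral => x _.
congr (_%:E); rewrite powR_mulrn ?normr_ge0// -[X in `|X|]/(cabs (f x)).
by rewrite ger0_norm ?cabs_ge0.
Qed.

Lemma L2P f : L2 mu f <-> sqL mu f.
Proof.
have i2 : (2^-1 : R) != 0 by rewrite invr_eq0.
split=> [[m1 m2 ff]|[[m1 m2] ff]].
  by rewrite L2normE in ff; split; [split|exact: lty_poweRy i2 ff].
by split=> //; rewrite L2normE; exact: poweR_lty.
Qed.

Lemma L2norm_nr f : sqL mu f -> L2norm mu f = (Num.sqrt (nr mu f))%:E.
Proof. by move=> f2; rewrite L2normE (sqnE f2) poweR_EFin powR12_sqrt// nr_ge0. Qed.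

Lemma L2cvgP (u : nat -> K -> R[i]) f : (forall k, sqL mu (u k)) -> sqL mu f ->
  L2cvg mu u f <-> cvg2 mu u f.
Proof.
move=> u2 f2; rewrite /L2cvg.
have -> : (fun k => L2norm mu (fun x => u k x - f x)) =
    (fun k => (Num.sqrt (nr mu (fun x => u k x - f x)))%:E).
  by apply/funext => k; rewrite L2norm_nr//; exact: sqLB.
split=> [/fine_cvgP[_ /cvgrPdist_le H] ep ep0|H].
  have s0 : 0 < Num.sqrt ep by rewrite sqrtr_gt0.
  have [N _ HN] := H _ s0; exists N => k Nk.
  have := HN k Nk; rewrite /= sub0r normrN ger0_norm ?sqrtr_ge0// ler_sqrt ?(ltW ep0)//.
apply/fine_cvgP; split; first by apply: nearW.
apply/cvgrPdist_le => ep ep0; have [N HN] := H _ (exprn_gt0 2 ep0).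
exists N => // k Nk; rewrite /= sub0r normrN ger0_norm ?sqrtr_ge0//.
have sE : Num.sqrt (ep ^+ 2) = ep by rewrite sqrtr_sqr ger0_norm ?ltW.
by rewrite -[leRHS]sE ler_sqrt ?sqr_ge0// HN.
Qed.

Lemma nr_sub_ae f f' g g' : sqL mu f -> sqL mu f' -> sqL mu g -> sqL mu g' ->
  aeq f f' -> aeq g g' -> nr mu (fun x => f x - g x) = nr mu (fun x => f' x - g' x).
Proof.
move=> f2 f'2 g2 g'2 ff gg; rewrite /nr; congr fine; apply: sqn_ae.
- by have [] := sqLB f2 g2.
- by have [] := sqLB f'2 g'2.
- by apply: filterS2 ff gg => x -> ->.
Qed.

Lemma nr0_ae f g : sqL mu f -> sqL mu g -> nr mu (fun x => f x - g x) = 0 -> aeq f g.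
Proof.
move=> f2 g2 h; apply: filterS (nr_eq0_ae (sqLB f2 g2) h) => x /eqP.
by rewrite subr_eq0 => /eqP.
Qed.

Lemma cvg2_congr (u u' : nat -> K -> R[i]) f : (forall k, sqL mu (u k)) ->
  (forall k, sqL mu (u' k)) -> sqL mu f -> (forall k, aeq (u k) (u' k)) ->
  cvg2 mu u f -> cvg2 mu u' f.
Proof.
move=> u2 u'2 f2 uu uf ep ep0; have [N HN] := uf _ ep0; exists N => k Nk.
by rewrite -(@nr_sub_ae (u k) (u' k) f f) ?HN//; exact: aeW.
Qed.

Lemma op_closureP (T : operator) f g : (forall h k, T h k -> sqL mu h /\ sqL mu k) ->
  op_closure mu T f g <-> [/\ sqL mu f, sqL mu g & exists u v : nat -> K -> R[i],
    [/\ forall k, T (u k) (v k), cvg2 mu u f & cvg2 mu v g]].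
Proof.
move=> HT; split=> [[/L2P f2 /L2P g2 [u [v [Tuv uf vg]]]]|[f2 g2 [u [v [Tuv uf vg]]]]].
  split=> //; exists u, v; split=> //; first by apply/L2cvgP => // k; have [] := HT _ _ (Tuv k).
  by apply/L2cvgP => // k; have [] := HT _ _ (Tuv k).
split; [exact/L2P|exact/L2P|exists u, v; split=> //].
  by apply/L2cvgP => // k; have [] := HT _ _ (Tuv k).
by apply/L2cvgP => // k; have [] := HT _ _ (Tuv k).
Qed.

(* [phi] computes the operator [V], up to almost everywhere equality. *)
Record represents (V : operator) (phi : (K -> R[i]) -> K -> R[i]) : Prop := {
  rep_sqL : forall f, sqL mu f -> sqL mu (phi f) ;
  rep_ae : forall f g, sqL mu f -> sqL mu g -> aeq f g -> aeq (phi f) (phi g) ;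
  repP : forall f g, V f g <-> [/\ sqL mu f, sqL mu g & aeq g (phi f)] }.

Lemma rep_comp V W phi psi f g : represents V phi -> represents W psi ->
  op_comp V W f g <-> [/\ sqL mu f, sqL mu g & aeq g (phi (psi f))].
Proof.
move=> rV rW; split=> [[h /(repP rW)[f2 h2 hf] /(repP rV)[_ g2 gh]]|[f2 g2 gf]].
  split=> //; have fh := rep_ae rV h2 (rep_sqL rW f2) hf.
  by apply: filterS2 gh fh => x -> ->.
have w2 := rep_sqL rW f2.
exists (psi f); first by apply/(repP rW); split=> //; exact: aeW.
by apply/(repP rV); split.
Qed.

Lemma rep_commutes V T phi psi : represents V phi -> represents (op_closure mu T) psi ->
  (forall f, sqL mu f -> aeq (phi (psi f)) (psi (phi f))) -> commutes mu V T.
Proof.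
move=> rV rT H f g; split=> [/(rep_comp _ _ rV rT)|/(rep_comp _ _ rT rV)] [f2 g2 gf].
  by apply/(rep_comp _ _ rT rV); split=> //; apply: filterS2 gf (H f f2) => x -> ->.
by apply/(rep_comp _ _ rV rT); split=> //; apply: filterS2 gf (H f f2) => x -> ->.
Qed.

Lemma rep_anti_commutes V T phi psi : represents V phi -> represents (op_closure mu T) psi ->
  (forall f, sqL mu f -> aeq (phi (psi f)) (fun x => - psi (phi f) x)) -> anti_commutes mu V T.
Proof.
move=> rV rT H f g; split=> [/(rep_comp _ _ rV rT)|/(rep_comp _ _ rT rV)] [f2 g2 gf].
  apply/(rep_comp _ _ rT rV); split=> //; first exact: sqLN.
  by apply: filterS2 gf (H f f2) => x -> ->; rewrite opprK.
have g2' : sqL mu g.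
  by have := sqLN g2; congr (sqL mu _); apply/funext => x; rewrite opprK.
apply/(rep_comp _ _ rV rT); split=> //.
by apply: filterS2 gf (H f f2) => x h ->; rewrite -h opprK.
Qed.

Lemma op_of_rep phi : (forall f, sqL mu f -> sqL mu (phi f)) ->
  (forall f g, aeq f g -> aeq (phi f) (phi g)) -> represents (op_of mu setT phi) phi.
Proof.
move=> H1 H2; split=> // [f g _ _|f g]; first exact: H2.
split=> [[/L2P f2 /L2P g2 [f0 [_ ff gf]]]|[f2 g2 gf]].
  split=> //; have gf' : aeq g (phi f0) := gf.
  by apply: filterS2 gf' (H2 _ _ ff) => x -> ->.
by split; [exact/L2P|exact/L2P|exists f; split=> //; exact: aeW].
Qed.
End OperatorGraphs.

(** * Fourier transforms weighted by the logarithm *)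

Section PowerFunction.
Context {R : realType}.
Implicit Types x p q : R.

Lemma powR_add x p q : 0 < x -> x `^ (p + q) = x `^ p * x `^ q.
Proof. by move=> x0; rewrite powRD// (gt_eqF x0) implybT. Qed.

Lemma powR_half x p : 0 < x -> (x `^ (p / 2)) ^+ 2 = x `^ p.
Proof. by move=> x0; rewrite expr2 -powR_add// -splitr. Qed.

Lemma powR_invl x p : 0 < x -> x^-1 `^ p = (x `^ p)^-1.
Proof. by move=> x0; rewrite -(powR_inv1 (ltW x0)) -powRrM mulN1r powRN. Qed.

End PowerFunction.

Section LogRegularity.
Context {R : realType} {K : valuedFieldType R}.
Variable mu : {sigma_finite_measure set (borel K) -> \bar R}.
Variables (n : nat) (e : nat -> K) (co : nat -> K -> R) (s C : R).
Hypothesis lp : local_place mu n e co s C.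
Let lh := lp_haar lp.
Notation a := (@absv R K).
Notation B := (borel K).
Notation md := (module mu).
Notation ell := (ell mu).
Notation wt := (wt mu).
Notation F := (fourier mu).
Notation kop := (kop mu).
Notation FL := (FL mu).
Notation q := (q mu).
Notation ctest := (ctest n co).
Notation SB := (@schwartz_bruhat R K).
Notation aeq f g := {ae mu, forall x : B, f x = g x}.
Implicit Types f g u v : K -> R[i].

Let mfst : mfun (fun z : B * B => z.1). Proof. exact: measurable_fst. Qed.
Let msnd : mfun (fun z : B * B => z.2). Proof. exact: measurable_snd. Qed.
Let ball (r : R) : set B := [set x : K | a x <= r].
Let mball r : measurable (ball r). Proof. exact: ball_measurable. Qed.
Let mindball r : mfun (\1_(ball r) : B -> R).
Proof. exact: measurable_indic. Qed.
Let ball_int r : (\int[mu]_x (\1_(ball r) x)%:E < +oo)%E.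
Proof. by rewrite integral_indic// setIT; exact: haar_ball_lty. Qed.
Let indball r (x : K) : \1_(ball r) x = (nat_of_bool (a x <= r)%R)%:R :> R.
Proof. by rewrite indicE; congr (nat_of_bool _)%:R; apply/idP/idP; rewrite inE. Qed.

Lemma module_bdd r : exists2 rho : R, 1 <= rho & forall x, a x <= r -> md x <= rho.
Proof.
have [t t0 mt] := module_absv lh; exists (Num.max 1 (`|r| `^ t)); first by rewrite le_max lexx.
move=> x xr; rewrite le_max mt; apply/orP; right.
by apply: ge0_ler_powR; rewrite ?nnegrE ?absv_ge0 ?(ltW t0)//; exact: le_trans xr (ler_norm _).
Qed.

Lemma ell_large b : 0 < b -> exists2 D : R, 0 <= D &
  forall x, 1 <= md x -> ell x ^+ 2 <= D * md x `^ b.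
Proof.
move=> b0; have b20 : 0 < b / 2 by rewrite divr_gt0.
have [D D0 H] := ell_wt lh b20; exists (D ^+ 2); first exact: sqr_ge0.
move=> x x1; have m0 : 0 < md x by lra.
have p0 : 0 < md x `^ (b / 2) by exact: powR_gt0.
have := H x; rewrite (min_idPr _); last first.
  by apply: ler_powR => //; lra.
rewrite powRN ler_pdivrMr// => h.
rewrite -(powR_half b m0).
by rewrite -exprMn -real_normK ?num_real// ler_sqr ?nnegrE// mulr_ge0// ltW.
Qed.

(** Shows that the square of the logarithm is integrable on balls, by comparison with a weight of
    finite integral. *)
Lemma ell_local r : exists2 D : R, 0 <= D &
  forall x, a x <= r -> ell x ^+ 2 <= D * wt 2^-1 x.
Proof.
have [rho rho1 hr] := module_bdd r.
have [D1 D10 H1] := @ell_large 1 ltr01.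
have b20 : (0 : R) < 2^-1 / 2 by lra.
have [D D0 H] := ell_wt lh b20.
(* [q] is a lower bound for the weight where the module lies between 1 and [rho]; there the
   logarithm is merely bounded. *)
pose q := rho `^ (- 2^-1) / rho.
have q0 : 0 < q by rewrite divr_gt0 ?powR_gt0//; lra.
exists (D ^+ 2 + D1 * rho / q).
  by rewrite addr_ge0 ?sqr_ge0// !mulr_ge0 ?invr_ge0 ?(ltW q0)//; lra.
move=> x xr; have w0 : 0 <= wt 2^-1 x by exact: wt_ge0.
have [->|x0] := eqVneq x 0.
  rewrite (ell0 lh) expr0n /= mulr_ge0 ?wt_ge0// addr_ge0 ?sqr_ge0// !mulr_ge0 ?invr_ge0 ?(ltW q0)//; lra.
have m0 := module_gt0 lh x0.
have i2 : (0 : R) <= 2^-1 by rewrite invr_ge0.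
have [x1|/ltW x1] := lerP 1 (md x).
  apply: (@le_trans _ _ (D1 * rho)).
    apply: le_trans (H1 x x1) _; apply: ler_wpM2l => //.
    by rewrite powRr1 ?(ltW m0)//; exact: hr.
  rewrite mulrDl; apply: (@le_trans _ _ (D1 * rho / q * wt 2^-1 x)); last first.
    by rewrite lerDr mulr_ge0 ?sqr_ge0.
  rewrite -mulrA ler_peMr ?mulr_ge0//; first lra.
  rewrite mulrC ler_pdivlMr// mul1r wt_large// /q; apply: ler_pM.
  - exact: powR_ge0.
  - by rewrite invr_ge0; lra.
  - rewrite !powRN lef_pV2 ?posrE ?powR_gt0//; last lra.
    by apply: ge0_ler_powR; rewrite ?nnegrE ?hr//; lra.
  - by rewrite lef_pV2 ?posrE ?hr//; lra.
apply: (@le_trans _ _ (D ^+ 2 * wt 2^-1 x)); last first.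
  by rewrite ler_wpM2r// lerDl !mulr_ge0 ?invr_ge0 ?(ltW q0)//; lra.
rewrite (wt_small lh)//.
have := H x; rewrite (min_idPl _); last by apply: ger_powR; rewrite ?m0//; lra.
have p0 : 0 < md x `^ (2^-1 / 2) by exact: powR_gt0.
have p20 : 0 < md x `^ 2^-1 by exact: powR_gt0.
rewrite -ler_pdivlMr// => h.
have -> : md x `^ 2^-1 / md x = (md x `^ (2^-1 / 2)) ^- 2.
  have e1 : md x `^ 2^-1 * md x `^ 2^-1 = md x.
    by rewrite -powR_add// (_ : 2^-1 + 2^-1 = 1 :> R) ?powRr1 ?ltW//; lra.
  by rewrite powR_half// -{2}e1; field; exact: lt0r_neq0.
rewrite -exprVn -exprMn -real_normK ?num_real// ler_sqr ?nnegrE//.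
by rewrite divr_ge0// ltW.
Qed.

Section FourierLog.
Variables (psi : K -> R[i]) (M b delta : R).
Hypotheses (pi : cinteg mu psi) (p2 : sqL mu psi) (b0 : 0 < b) (d0 : 0 < delta)
  (d1 : delta <= 1) (M0 : 0 <= M).
Hypothesis modulus : forall h, a h <= delta ->
  nr mu (fun x => psi (x + h) - psi x) <= M * md h `^ (2 * b).

Let Y := F psi.
Let Y2 : sqL mu Y. Proof. by have [] := FL_L1 lp pi p2. Qed.
Let mY : cmeas (Y : B -> R[i]). Proof. by have [] := Y2. Qed.

(** Integrating the squared L2 modulus of continuity against this weight gives a Besov seminorm. It
    is finite because the modulus is of order |h|^(2b), and on the Fourier side it dominates |y|^b
    |F psi y|^2 for large [y]. *)
Let k (h : K) : R := \1_(ball delta) h * md h `^ (- (1 + b)).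
Let k_ge0 h : 0 <= k h. Proof. by rewrite mulr_ge0 ?powR_ge0. Qed.

Let r (h y : K) : R := cabs (lambda (h * y) - 1 : R[i]) ^+ 2 * cabs (Y y) ^+ 2.
Let r_ge0 h y : 0 <= r h y. Proof. by rewrite mulr_ge0 ?sqr_ge0. Qed.

Let mr : mfun (fun z : B * B => r z.1 z.2).
Proof.
apply: mfun_prod; last exact: (mfun_comp (meas_sq mY) msnd).
apply: meas_sq; apply: cmeasB; last exact: cmeas_cst.
by apply: (cmeas_lambda lp); exact: (mfun_mul lh).
Qed.

Let mk : mfun (k : B -> R).
Proof.
apply: mfun_prod; first exact: mindball.
exact: (mfun_comp (measurable_powR _) (mfun_module lh)).
Qed.

Let r_int h : (\int[mu]_y (r h y)%:E = (nr mu (fun x => (psi (x + h) - psi x)%R))%:E)%E.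
Proof.
have D1 y := fourier_diff lp h y 1 pi.
have [di _] := D1 0; rewrite /= in di.
have d2 : sqL mu (fun x => psi (x + h) - psi x) by apply: sqLB => //; exact: (sqL_shift lp).
have FLd := FL_L1 lp di d2; have [_ Fd2 _] := FLd.
rewrite -(FL_nr1 lp FLd) -(sqnE Fd2) /sqn; apply: eq_integral => y _.
by have [_] := D1 y; rewrite /= expr1 => ->; rewrite cabsM exprMn.
Qed.

(** After Tonelli, Plancherel turns the integral over [y] into the squared modulus of continuity at
    [h]; multiplied by [k h] this is at most [M * wt b h]. *)
Let upper : (\int[mu]_y \int[mu]_h (k h * r h y)%:E < +oo)%E.
Proof.
have mg : mfun (fun z : B * B => k z.1 * r z.1 z.2).
  by apply: mfun_prod => //; exact: (mfun_comp mk mfst).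
rewrite -(tonelli2 mu (g := fun h y => k h * r h y) mg); last by move=> h y; rewrite mulr_ge0.
have wi : (\int[mu]_h (M * wt b h)%:E < +oo)%E.
  apply: ge0_intZ_lty => //; [exact: mfun_wt|by move=> h; exact: wt_ge0|exact: wt_int].
apply: le_lt_trans wi; apply: ge0_le_integral => //.
- by move=> h _; apply: integral_ge0 => y _; rewrite lee_fin mulr_ge0.
- apply: (@mfun_partial _ _ mu _ mg) => z; exact: mulr_ge0.
- by apply/measurable_EFinP; apply: mfun_prod => //; exact: mfun_wt.
move=> h _.
have mrh : mfun (fun y : B => r h y) by exact: (@mfun_section _ _ _ h mr).
rewrite (ge0_intZ mu mrh (fun y => r_ge0 h y) (k_ge0 h)) r_int -EFinM lee_fin.
rewrite /k indball; have [hd|hd] := lerP (a h) delta; last by rewrite !mul0r mulr_ge0 ?wt_ge0.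
rewrite mul1r; apply: le_trans (ler_wpM2l (powR_ge0 _ _) (modulus hd)) _.
have [->|h0] := eqVneq h 0.
  have nb : - (1 + b) != 0 by rewrite oppr_eq0 gt_eqF// addr_gt0.
  rewrite (module0 lh) (powR0 nb) mul0r; apply: mulr_ge0 => //; exact: wt_ge0.
have m0 := module_gt0 lh h0.
rewrite mulrCA; apply: ler_wpM2l => //.
have m1 : md h <= 1.
  by rewrite -(module1 lh) (ler_module lh) absv1; exact: le_trans hd d1.
rewrite (wt_small lh) ?(ltW b0)//.
rewrite -powR_add// -[X in _ / X](powRr1 (ltW m0)) -powRN -powR_add//.
by rewrite (_ : - (1 + b) + 2 * b = b + - 1)//; lra.
Qed.

(** For large [y] all [h] with [y * h] near [z0] lie in the ball of radius [delta]. On this set, of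
    measure [m / md y], the factor [lambda (h * y) - 1] stays away from 0. *)
Let lower : exists c r0 : R, [/\ 0 < c, 0 < r0 & forall y, r0 <= a y ->
  ((c * (md y `^ b * cabs (Y y) ^+ 2))%:E <= \int[mu]_h (k h * r h y)%:E)%E].
Proof.
have [z0 lz] := exists_char lp.
pose c := cabs (lambda z0 - 1 : R[i]).
have c0 : 0 < c by rewrite lt_neqAle eq_sym cabs_eq0 subr_eq0 lz cabs_ge0.
have [Cl [bl [Cl0 bl0 Hl]]] := lp_hoelder lp.
(* The radius at which the Hoelder bound of [lambda] equals [c / 2]. *)
pose eta := (c / (2 * Cl)) `^ bl^-1.
have cC0 : 0 < c / (2 * Cl) by rewrite divr_gt0// mulr_gt0.
have eta0 : 0 < eta by exact: powR_gt0.
pose q := a z0 + eta; have q0 : 0 < q by rewrite ltr_wpDl// absv_ge0.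
have [rho rho1 hrho] := module_bdd q.
pose m := fine (mu (ball eta)).
have mE : mu (ball eta) = m%:E.
  by rewrite fineK// ge0_fin_numE//; exact: haar_ball_lty.
have m0 : 0 < m by rewrite -lte_fin -mE; exact: haar_ball_gt0.
pose ez (x : B) : R := \1_(ball eta) ((x : K) - z0).
have mez : mfun ez.
  by apply: (mfun_comp (mindball eta)); exact: (mfun_add lh).
have ez0 (x : B) : 0 <= ez x by [].
have ezi : (\int[mu]_x (ez x)%:E = m%:E)%E.
  rewrite /ez (int_shift lh (- z0) (f := fun x => (\1_(ball eta) x)%:E)).
  - by rewrite integral_indic// setIT.
  - exact/measurable_EFinP.
  - by move=> x; rewrite lee_fin.
have rho0 : 0 < rho by lra.
have near (z : K) : a (z - z0) <= eta -> c / 2 <= cabs (lambda z - 1 : R[i]).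
  move=> hz; have h1 : cabs (lambda z - lambda z0 : R[i]) <= c / 2.
    have -> : lambda z - lambda z0 = lambda z0 * (lambda (z - z0) - 1) :> R[i].
      by rewrite mulrBr mulr1 -(lp_lambdaD lp) [z0 + _]addrC subrK.
    rewrite cabsM (lp_cabs_lambda lp) mul1r; apply: le_trans (Hl _) _.
    have h2 : a (z - z0) `^ bl <= c / (2 * Cl).
      have -> : c / (2 * Cl) = eta `^ bl by rewrite /eta -powRrM mulVf ?gt_eqF// powRr1// ltW.
      by apply: ge0_ler_powR; rewrite ?nnegrE ?absv_ge0 ?(ltW bl0) ?(ltW eta0).
    apply: le_trans (ler_wpM2l (ltW Cl0) h2) _.
    by rewrite le_eqVlt; apply/orP; left; apply/eqP; field; exact: lt0r_neq0.
  have := cabsD (lambda z - 1 : R[i]) (- (lambda z - lambda z0)).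
  rewrite cabsN (_ : _ + - (_ - _) = lambda z0 - 1) -/c; [lra|ring].
exists (m * (c / 2) ^+ 2 / rho `^ (1 + b)), (q / delta); split.
- by rewrite !mulr_gt0 ?invr_gt0 ?powR_gt0.
- by rewrite divr_gt0.
move=> y yr; have ay0 : 0 < a y by apply: lt_le_trans yr; rewrite divr_gt0.
have y0 : y != 0 by rewrite -absv_gt0.
have my0 := module_gt0 lh y0.
pose L := (rho / md y) `^ (1 + b).
have L0 : 0 < L by rewrite powR_gt0// divr_gt0.
pose t := L^-1 * ((c / 2) ^+ 2 * cabs (Y y) ^+ 2).
have t0 : 0 <= t.
  by apply: mulr_ge0; [rewrite invr_ge0 ltW|apply: mulr_ge0; exact: sqr_ge0].
have mey : mfun (fun h : B => ez (y * (h : K))).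
  by apply: (mfun_comp mez); exact: (mfun_mul lh).
have -> : ((m * (c / 2) ^+ 2 / rho `^ (1 + b) * (md y `^ b * cabs (Y y) ^+ 2))%:E =
    \int[mu]_h (t * ez (y * (h : K))%R)%:E)%E.
  rewrite (ge0_intZ mu mey (fun h => ez0 _) t0).
  rewrite (int_scale lh y0 (f := fun x => (ez x)%:E)); last 2 first.
  - exact/measurable_EFinP.
  - by move=> x; rewrite lee_fin.
  rewrite ezi -!EFinM; congr (_%:E); rewrite /t /L powRM ?(ltW rho0) ?invr_ge0 ?(ltW my0)//.
  have -> : (md y)^-1 `^ (1 + b) = (md y * md y `^ b)^-1.
    by rewrite powR_invl// powR_add// powRr1// ltW.
  by field; rewrite !gt_eqF ?powR_gt0.
apply: ge0_int_le.
- exact: mfun_prod.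
- apply: mfun_prod => //.
  have ms : mfun (fun h : B => (h, y : B)).
    by apply: measurable_fun_pair => //; exact: measurable_cst.
  exact: (mfun_comp mr ms).
- by move=> h; rewrite mulr_ge0.
move=> h; rewrite {1}/ez indball; have [hy|hy] := lerP (a (y * h - z0)) eta; last first.
  by rewrite mulr0 mulr_ge0.
have yhq : a (y * h) <= q.
  by have := absvD (y * h - z0) z0; rewrite subrK /q; move: hy; set A1 := a _; set A2 := a _; lra.
have hd : a h <= delta.
  have : a h <= q / a y by rewrite ler_pdivlMr// mulrC -absvM.
  move=> /le_trans; apply; rewrite ler_pdivrMr//.
  by move: yr; rewrite ler_pdivrMr// mulrC.
have lam := near _ hy; rewrite [y * _]mulrC in lam.
have h0 : h != 0.
  apply/eqP => h0; move: lam; rewrite h0 mul0r (lp_lambda0 lp) subrr cabs0; lra.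
have mh0 := module_gt0 lh h0.
rewrite mulr1 /k indball hd mul1r /t /r; apply: ler_pM.
- by rewrite invr_ge0 ltW.
- by rewrite mulr_ge0 ?sqr_ge0.
- have hL : md h `^ (1 + b) <= L.
    rewrite /L; apply: ge0_ler_powR.
    + by rewrite addr_ge0// ltW.
    + by rewrite nnegrE ltW.
    + by rewrite nnegrE divr_ge0// ltW.
    + by rewrite ler_pdivlMr// mulrC -(moduleM lh); exact: hrho.
  by rewrite powRN; rewrite lef_pV2// posrE powR_gt0.
apply: ler_wpM2r; first exact: sqr_ge0.
by rewrite ler_sqr ?nnegrE ?cabs_ge0 ?divr_ge0 ?(ltW c0).
Qed.

(** For large [y] the squared logarithm is below |y|^b and the seminorm takes over; on a ball the
    transform is bounded and the squared logarithm integrable. *)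
Lemma log_fourier_sqL : sqL mu (fun y => (ell y)%:C%C * F psi y).
Proof.
have [c [r0 [c0 r00 H]]] := lower.
have [D D0 HD] := ell_large b0.
pose r1 := Num.max r0 1; have [E E0 HE] := ell_local r1.
have [N N0 HN] := fourier_bounded lp pi.
have mg : mfun (fun z : B * B => k z.2 * r z.2 z.1).
  apply: mfun_prod; first exact: (mfun_comp mk msnd).
  have m3 : mfun (fun z : B * B => (z.2, z.1)) by exact: measurable_swap.
  exact: (mfun_comp mr m3).
have mp := @mfun_partial _ _ mu _ mg (fun z => mulr_ge0 (k_ge0 _) (r_ge0 _ _)).
have mW : mfun (fun y : B => (E * N ^+ 2) * wt 2^-1 y).
  by apply: mfun_prod => //; exact: mfun_wt.
have W0 y : 0 <= (E * N ^+ 2) * wt 2^-1 y.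
  by apply: mulr_ge0; [apply: mulr_ge0 => //; exact: sqr_ge0|exact: wt_ge0].
have I0 y : (0 <= \int[mu]_h (k h * r h y)%:E)%E.
  by apply: integral_ge0 => h _; rewrite lee_fin mulr_ge0.
have ml : cmeas (fun y : B => (ell y)%:C%C * F psi y).
  by apply: cmeasM => //; apply: cmeasR; exact: mfun_ell.
split=> //; rewrite /sqn.
have Dc : 0 <= D / c by rewrite divr_ge0// ltW.
apply: (@le_lt_trans _ _ (\int[mu]_y (((E * N ^+ 2) * wt 2^-1 y)%:E + (D / c)%:E * \int[mu]_h (k h * r h y)%:E))%E).
  apply: ge0_le_integral => //.
  - by move=> y _; rewrite lee_fin sqr_ge0.
  - by apply/measurable_EFinP; exact: meas_sq.
  - by apply: emeasurable_funD; [exact/measurable_EFinP|apply: emeasurable_funM].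
  move=> y _; rewrite cabsM cabsR exprMn -normrX (ger0_norm (sqr_ge0 _)).
  have [yr|yr] := lerP (a y) r1.
    apply: (@le_trans _ _ (((E * N ^+ 2) * wt 2^-1 y)%:E)); last first.
      by rewrite leeDl// mule_ge0// lee_fin.
    rewrite lee_fin [leRHS]mulrAC; apply: ler_pM; rewrite ?sqr_ge0 ?HE//.
    by rewrite ler_sqr ?nnegrE ?cabs_ge0// HN.
  have [yr0 y1] : r0 <= a y /\ 1 <= a y by move: yr; rewrite gt_max => /andP[/ltW ? /ltW ?].
  have my1 : 1 <= md y.
    by rewrite -(module1 lh) (ler_module lh) absv1.
  apply: (@le_trans _ _ ((D / c)%:E * (c * (md y `^ b * cabs (Y y) ^+ 2))%:E)%E).
    rewrite -EFinM lee_fin.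
    have -> : D / c * (c * (md y `^ b * cabs (Y y) ^+ 2)) = (D * md y `^ b) * cabs (Y y) ^+ 2.
      by field; exact: lt0r_neq0.
    apply: ler_wpM2r; first exact: sqr_ge0.
    exact: HD.
  apply: (@le_trans _ _ ((D / c)%:E * \int[mu]_h (k h * r h y)%:E)%E).
    by apply: lee_wpmul2l; [rewrite lee_fin|exact: H].
  by rewrite leeDr// lee_fin.
have mIm : mfun (fun y : B => ((D / c)%:E * \int[mu]_h (k h * r h y)%:E)%E).
  exact: emeasurable_funM.
have mWE : mfun (fun y : B => ((E * N ^+ 2) * wt 2^-1 y)%:E) by exact/measurable_EFinP.
rewrite ge0_integralD//; last 2 first.
- by move=> y _; rewrite lee_fin.
- by move=> y _; apply: mule_ge0; rewrite ?lee_fin.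
rewrite ge0_integralZl//.
apply: lte_add_pinfty; last by apply: lte_mul_pinfty => //; rewrite lee_fin.
apply: ge0_intZ_lty => //; rewrite ?mulr_ge0 ?sqr_ge0//.
- exact: mfun_wt.
- by move=> y; exact: wt_ge0.
- by apply: wt_int => //; rewrite invr_gt0.
Qed.

End FourierLog.
Lemma bounded_ball_integrable f (M r : R) : cmeas (f : B -> R[i]) -> 0 <= M ->
  (forall x, cabs (f x) <= M) -> (forall x, f x != 0 -> a x <= r) ->
  cinteg mu f /\ sqL mu f.
Proof.
move=> mf M0 fM fr; split.
  apply: (cinteg_le (v := fun x : B => M * \1_(ball r) x)) => //.
  - exact: mfun_prod.
  - move=> x; rewrite indball; have [->|f0] := eqVneq (f x) 0; first by rewrite cabs0 mulr_ge0.
    by rewrite fr// mulr1.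
  - by apply: ge0_intZ_lty.
apply: (sqL_le (v := fun x : B => M ^+ 2 * \1_(ball r) x)) => //.
- exact: mfun_prod.
- move=> x; rewrite indball; have [->|f0] := eqVneq (f x) 0.
    by rewrite cabs0 expr0n mulr_ge0// sqr_ge0.
  by rewrite fr// mulr1 ler_sqr ?nnegrE ?cabs_ge0.
- by apply: ge0_intZ_lty => //; exact: sqr_ge0.
Qed.

Lemma ell_annulus (eps : R) : 0 < eps -> exists2 L : R, 0 <= L &
  forall x, eps <= a x -> a x <= eps^-1 -> `|ell x| <= L.
Proof.
move=> e0; have [t t0 mt] := module_absv lh.
exists (t * `|ln eps|) => [|x x1 x2]; first by rewrite mulr_ge0// ltW.
rewrite /ell mt ln_powR normrM (gtr0_norm t0) ler_pM2l//.
have ax0 : 0 < a x by apply: lt_le_trans x1.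
have h1 : ln eps <= ln (a x) by rewrite ler_ln.
have h2 : ln (a x) <= - ln eps by rewrite -lnV ?posrE// ler_ln ?posrE ?invr_gt0.
rewrite ler_norml; have := ler_norm (- ln eps); rewrite normrN; have := ler_norm (ln eps).
by move=> h3 h4; apply/andP; split; lra.
Qed.

(* The annulus keeps the logarithm bounded and Lipschitz on the support. *)
Record regular f (eps M beta delta : R) : Prop := {
  reg_cmeas : cmeas (f : B -> R[i]) ;
  reg_eps : 0 < eps ;
  reg_M : 0 <= M ;
  reg_beta : 0 < beta <= 1 ;
  reg_delta : 0 < delta <= 1 ;
  reg_supp : forall x, f x != 0 -> eps <= a x <= eps^-1 ;
  reg_bound : forall x, cabs (f x) <= M ;
  reg_hoelder : forall x h, a h <= delta -> cabs (f (x + h) - f x) <= M * a h `^ beta }.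

(** [ell (x + h)] is [ell x + ell (1 + h / x)], and the second term is Lipschitz in [h] for [x] in
    the annulus. Since [beta <= 1] and [a h <= 1], a Lipschitz bound is also one of order [beta]. *)
Lemma regular_ell f eps M beta delta : regular f eps M beta delta ->
  exists M' delta', regular (fun x => (ell x)%:C%C * f x) eps M' beta delta'.
Proof.
move=> [mf e0 M0 /andP[b0 b1] /andP[d0 d1] sf bf hf].
have [L L0 HL] := ell_annulus e0; have [D D0 HD] := ell_near1 lh.
(* For [x] in the annulus, [a h <= eps / 2] gives [a (h / x) <= 2^-1], the range of [ell_near1]. *)
pose d' := Num.min delta (Num.min 2^-1 (eps / 2)).
have d'0 : 0 < d' by rewrite !lt_min d0 invr_gt0 ltr0Sn divr_gt0.
exists ((L + D) * M + D / eps * M + L * M), d'.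
have De : 0 <= D / eps by rewrite divr_ge0// ltW.
have t1 : 0 <= (L + D) * M by rewrite mulr_ge0// addr_ge0.
have t2 : 0 <= D / eps * M by rewrite mulr_ge0.
have t3 : 0 <= L * M by rewrite mulr_ge0.
split=> //.
- by apply: cmeasM => //; apply: cmeasR; exact: mfun_ell.
- by rewrite !addr_ge0.
- by rewrite b0.
- by rewrite d'0 ge_min d1.
- by move=> x fx; apply: sf; apply: contraNneq fx => ->; rewrite mulr0.
- move=> x; have [->|fx] := eqVneq (f x) 0; first by rewrite mulr0 cabs0 !addr_ge0.
  have /andP[x1 x2] := sf _ fx; rewrite cabsM cabsR.
  by apply: le_trans (_ : L * M <= _); [apply: ler_pM; rewrite ?cabs_ge0 ?HL|lra].
move=> x h; rewrite !le_min => /and3P[hd h2 he].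
have hb := hf x h hd; set hp := a h `^ beta in hb *.
have hp0 : 0 <= hp by exact: powR_ge0.
have [fx|fx] := eqVneq (f x) 0.
  rewrite fx subr0 in hb; rewrite fx mulr0 subr0.
  have [->|fxh] := eqVneq (f (x + h)) 0; first by rewrite mulr0 cabs0 mulr_ge0// !addr_ge0.
  have /andP[x1 x2] := sf _ fxh; rewrite cabsM cabsR.
  apply: (@le_trans _ _ (L * (M * hp))).
    by apply: ler_pM; rewrite ?cabs_ge0 ?HL.
  rewrite mulrA ler_wpM2r//; lra.
have /andP[x1 x2] := sf _ fx.
have ax0 : 0 < a x by apply: lt_le_trans x1.
have x0 : x != 0 by rewrite -absv_gt0.
have hx : a (h / x) <= a h / eps.
  by rewrite absvM absvV ler_wpM2l ?absv_ge0// lef_pV2.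
have hx2 : a (h / x) <= 2^-1.
  by apply: le_trans hx _; rewrite ler_pdivrMr// mulrC.
have n1 : 1 + h / x != 0.
  apply/eqP => n1; have := absv_dist_ge (1 : K) (- (h / x)); rewrite opprK n1 absv0 absvN absv1.
  by have := ler_norm (1 - a (h / x)); lra.
have hl : ell (x + h) = ell x + ell (1 + h / x).
  by rewrite -(ellM lh)// mulrDr mulr1 mulrCA mulfV// mulr1.
have l1 : `|ell (1 + h / x)| <= D / eps * a h.
  by apply: le_trans (HD _ hx2) _; rewrite -mulrA (mulrC eps^-1); apply: ler_wpM2l.
have l2 : `|ell (1 + h / x)| <= D.
  by apply: le_trans (HD _ hx2) _; rewrite -[leRHS]mulr1; apply: ler_wpM2l => //; lra.
have ah : a h <= hp.
  have a1 : a h <= 1 by lra.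
  have [ah0|/negPf ah0] := eqVneq (a h) 0; first by rewrite ah0.
  rewrite -[leLHS]powRr1 ?absv_ge0//; apply: ger_powR => //.
  by rewrite lt_neqAle eq_sym ah0 absv_ge0 a1.
have -> : (ell (x + h))%:C%C * f (x + h) - (ell x)%:C%C * f x =
    (ell (x + h))%:C%C * (f (x + h) - f x) + (ell (1 + h / x))%:C%C * f x.
  by rewrite hl RCD; move: (f _) (f _) (ell x)%:C%C (ell _)%:C%C => A1 A2 A3 A4; ring.
apply: le_trans (cabsD _ _) _; rewrite !cabsM !cabsR.
have b1' : `|ell (x + h)| * cabs (f (x + h) - f x) <= (L + D) * (M * hp).
  apply: ler_pM; rewrite ?cabs_ge0// hl; apply: le_trans (ler_normD _ _) _.
  by apply: lerD => //; exact: HL.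
have b2' : `|ell (1 + h / x)| * cabs (f x) <= D / eps * hp * M.
  by apply: ler_pM; rewrite ?cabs_ge0//; apply: le_trans l1 _; apply: ler_wpM2l.
have -> : ((L + D) * M + D / eps * M + L * M) * hp =
  (L + D) * (M * hp) + D / eps * hp * M + L * M * hp by ring.
have : 0 <= L * M * hp by rewrite mulr_ge0.
lra.
Qed.

Lemma regular_integrable f eps M beta delta : regular f eps M beta delta ->
  cinteg mu f /\ sqL mu f.
Proof.
move=> [mf e0 M0 _ _ sf bf _]; apply: (@bounded_ball_integrable _ M eps^-1) => //.
by move=> x /sf/andP[].
Qed.

Lemma regular_log_fourier f eps M beta delta : regular f eps M beta delta ->
  sqL mu (fun y => (ell y)%:C%C * F f y).
Proof.
move=> rf; have [fi f2] := regular_integrable rf.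
have [mf e0 M0 /andP[b0 b1] /andP[d0 d1] sf bf hf] := rf.
have [t t0 mt] := module_absv lh.
(* As [delta <= 1], the ball of radius [rho] contains the supports of [f] and of its translates by
   [h]. *)
pose rho := eps^-1 + 1; pose m := fine (mu (ball rho)).
have mE : mu (ball rho) = m%:E.
  by rewrite fineK// ge0_fin_numE//; exact: haar_ball_lty.
have m0 : 0 <= m by exact: fine_ge0.
(* The module is the power [t] of [absv], so the exponent [beta] for [absv] is [beta / t] for the
   module. *)
apply: (@log_fourier_sqL f (M ^+ 2 * m) (beta / t) delta) => //.
- by rewrite divr_gt0.
- by rewrite mulr_ge0// sqr_ge0.
move=> h hd.
have d2 : sqL mu (fun x => f (x + h) - f x) by apply: sqLB => //; exact: (sqL_shift lp).
have -> : md h `^ (2 * (beta / t)) = (a h `^ beta) ^+ 2.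
  rewrite mt -powRrM (_ : t * (2 * (beta / t)) = beta * 2%:R); last by field; exact: lt0r_neq0.
  by rewrite powRrM powR_mulrn// powR_ge0.
set hp := a h `^ beta.
rewrite -lee_fin -(sqnE d2) /sqn.
apply: (@le_trans _ _ (\int[mu]_x (((M * hp) ^+ 2) * \1_(ball rho) x)%:E)%E).
  apply: ge0_int_le.
  - by apply: meas_sq; have [] := d2.
  - exact: mfun_prod.
  - by move=> x; exact: sqr_ge0.
  move=> x; rewrite indball; have [xr|xr] := lerP (a x) rho.
    by rewrite mulr1 ler_sqr ?nnegrE ?cabs_ge0 ?mulr_ge0 ?powR_ge0// hf.
  have -> : f x = 0.
    apply/eqP; apply: contraTT xr => /sf/andP[_ h1]; rewrite -leNgt /rho; lra.
  have -> : f (x + h) = 0.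
    apply/eqP; apply: contraTT xr => /sf/andP[_ h1]; rewrite -leNgt /rho.
    by have := absvD (x + h) (- h); rewrite addrK absvN; lra.
  by rewrite subr0 cabs0 expr0n /= mulr0.
rewrite ge0_intZ ?sqr_ge0//.
have -> : (\int[mu]_x (\1_(ball rho) x)%:E = m%:E)%E.
  by rewrite integral_indic// setIT; exact: mE.
rewrite -EFinM lee_fin.
by rewrite le_eqVlt; apply/orP; left; apply/eqP; ring.
Qed.

Lemma S0_regular f : S0 f -> exists eps M beta delta, regular f eps M beta delta.
Proof.
move=> Sf; have [sb cs nz] := Sf; have [mf [M1 M10 HM1]] := SB_bound lp sb.
have fM1 x : cabs (f x) <= M1.
  by apply: le_trans (HM1 x) _; rewrite ler_piMr// (decay_le1 lp).
have [M2 M20 HM2] := continuous_bounded_compact cs (@continuous_absv R K).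
have [eps0 e00 He] : exists2 eps0 : R, 0 < eps0 & forall x, a x < eps0 -> f x = 0.
  move: nz; rewrite /nbhs /= => nz; have : nbhs (0 : K) [set x | f x = 0] by [].
  rewrite nbhs_absv => -[d d0 Hd]; exists d => // x xd; apply: Hd => /=.
  by rewrite sub0r absvN.
(* One parameter confines the support on both sides: [eps <= eps0] from inside and
   [M2 + 1 <= eps^-1] from outside. *)
pose eps := Num.min eps0 (M2 + 1)^-1.
have M21 : 0 < M2 + 1 by lra.
have e0 : 0 < eps by rewrite lt_min e00 invr_gt0.
have sf x : f x != 0 -> eps <= a x <= eps^-1.
  move=> fx; apply/andP; split.
    rewrite leNgt; apply: contra fx => xe; apply/eqP/He.
    by apply: lt_le_trans xe _; rewrite ge_min lexx.
  apply: (@le_trans _ _ (M2 + 1)).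
    have := HM2 x (@subset_closure _ [set y | f y != 0] x fx); rewrite ger0_norm ?absv_ge0//; lra.
  by rewrite -[leLHS]invrK lef_pV2 ?posrE ?invr_gt0// ge_min lexx orbT.
have [fin|fin] := pselect (finite_place K).
  have [lc _] : (forall x : K, \forall y \near x, f y = f x) /\ compactly_supported f.
    by move: sb; rewrite /schwartz_bruhat; case: asboolP.
  have [d d0 Hd] := uniformly_locally_constant fin lc cs.
  exists eps, M1, 1, (Num.min 1 (d / 2)); split=> //.
  - by rewrite ltr01 lexx.
  - by rewrite lt_min ltr01 divr_gt0//= ge_min lexx.
  - move=> x h; rewrite le_min => /andP[_ h2]; rewrite Hd; last lra.
    by rewrite subrr cabs0 mulr_ge0// powR_ge0.
have [s1 s2] : schwartz (fun x => Re (f x)) /\ schwartz (fun x => Im (f x)).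
  by move: sb; rewrite /schwartz_bruhat; case: asboolP.
have acr := lp_coords lp fin; have s0 := ac_s acr.
have [N1 N10 H1] := schwartz_hoelder lp fin s1; have [N2 N20 H2] := schwartz_hoelder lp fin s2.
(* The Schwartz bound has exponent [s^-1]; for [a h <= 1] it may be lowered to an exponent at most
   1, as [regular] requires. *)
pose beta := Num.min 1 s^-1.
have b0 : 0 < beta by rewrite lt_min ltr01 invr_gt0.
exists eps, (M1 + (N1 + N2)), beta, 1; split=> //.
- by rewrite !addr_ge0.
- by rewrite b0 ge_min lexx.
- by rewrite ltr01 lexx.
- by move=> x; apply: le_trans (fM1 x) _; rewrite lerDl addr_ge0.
move=> x h h1.
have hb : a h `^ s^-1 <= a h `^ beta.
  have [h0|h0] := eqVneq (a h) 0.
    by rewrite h0 !powR0// gt_eqF// invr_gt0.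
  apply: ger_powR; last by rewrite ge_min lexx orbT.
  by rewrite lt_neqAle eq_sym h0 absv_ge0 h1.
apply: le_trans (cabs_le_ReIm _) _.
have e1 : Re (f (x + h) - f x) = Re (f (x + h)) - Re (f x).
  by case: (f (x + h)) => ? ?; case: (f x).
have e2 : Im (f (x + h) - f x) = Im (f (x + h)) - Im (f x).
  by case: (f (x + h)) => ? ?; case: (f x).
rewrite e1 e2; apply: (@le_trans _ _ ((N1 + N2) * a h `^ s^-1)).
  by rewrite mulrDl; apply: lerD; [exact: H1|exact: H2].
apply: ler_pM; rewrite ?addr_ge0 ?powR_ge0//; lra.
Qed.

(** * The commutator on S0 *)

Definition BL f g : Prop := exists h,
  [/\ FL h f, sqL mu (fun y => (ell y)%:C%C * h y) & FL (fun y => (ell y)%:C%C * h y) g].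

Lemma FL_reflect f g : FL f g -> FL (fun x => g (- x)) f.
Proof.
move=> fg; have h1 := FL_inv lp (FL_inv lp (FL_inv lp fg)).
by have := h1; congr (FL _ _); apply/funext => x; rewrite opprK.
Qed.

(** The graph of B starts from the inverse transform, the matrix coefficients from the direct one.
    The two differ by the reflection of the argument, under which [ell] is invariant. *)
Lemma BL_fourier f : cinteg mu f -> sqL mu f -> sqL mu (fun y => (ell y)%:C%C * F f y) ->
  exists2 g, BL f g & forall v, cinteg mu v -> sqL mu v ->
    ip mu g v = ip mu (fun y => (ell y)%:C%C * F f y) (F v).
Proof.
move=> fi f2 lF.
have h1 := FL_reflect (FL_L1 lp fi f2).
have lFr := sqL_reflection lp lF.
have E : (fun y => (ell (- y))%:C%C * F f (- y)) = (fun y => (ell y)%:C%C * F f (- y)).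
  by apply/funext => y; rewrite (ellN lh).
have lFr2 : sqL mu (fun y => (ell y)%:C%C * F f (- y)) by rewrite -E.
have [g Hg] := FL_total lp lFr2; exists g.
  by exists (fun x => F f (- x)).
move=> v vi v2; rewrite (FL_ip lp Hg (FL_reflect (FL_L1 lp vi v2))).
have Fv2 : sqL mu (F v) by have [] := FL_L1 lp vi v2.
have [_ rE] := reflection_cov lp (cinteg_ip lF Fv2).
rewrite [RHS](esym rE).
by apply: cint_ext => y; rewrite (ellN lh).
Qed.

(* Multiplying the difference by a truncation of itself turns the weak identity
   of log_commutator_form into an almost everywhere one. *)
Lemma log_commutator (kappa : R) f : 0 < kappa ->
  (forall y, y != 0 -> hk mu y = kappa * ell y) -> S0 f -> exists u g, [/\
  sqL mu f /\ sqL mu (fun x => (ell x)%:C%C * f x),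
  BL (fun x => (ell x)%:C%C * f x) u, BL f g &
  {ae mu, forall x : B, u x - (ell x)%:C%C * g x = - ((kappa^-1)%:C%C * kop f x)}].
Proof.
move=> k0 hE Sf; have [eps [M [be [de rf]]]] := S0_regular Sf.
have [M' [de' rl]] := regular_ell rf.
have [fi f2] := regular_integrable rf; have [lfi lf2] := regular_integrable rl.
have lF1 := regular_log_fourier rf; have lF2 := regular_log_fourier rl.
have [u Bu Hu] := BL_fourier lfi lf2 lF2; have [g Bg Hg] := BL_fourier fi f2 lF1.
exists u, g; split=> //.
have [_ [_ _ [_ u2 _]]] := Bu; have [_ [_ _ [_ g2 _]]] := Bg.
have [k2 _] := kop_bound lh f2.
have [mu1 _] := u2; have [mg1 _] := g2; have [mk1 _] := k2.
have mell : cmeas (fun x : B => (ell x)%:C%C : R[i]) by apply: cmeasR; exact: mfun_ell.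
pose d x := u x - (ell x)%:C%C * g x + (kappa^-1)%:C%C * kop f x.
have md1 : cmeas (d : B -> R[i]).
  apply: cmeasD; last by apply: cmeasM => //; exact: cmeas_cst.
  by apply: cmeasB => //; exact: cmeasM.
pose w x : R := Num.min (md x `^ 1) (md x `^ (-1)).
have w0 x : 0 <= w x by rewrite le_min !powR_ge0.
have w1 x : w x <= 1.
  rewrite ge_min; have [x1|x1] := lerP (md x) 1; first by rewrite powRr1 ?module_ge0// x1.
  by rewrite powRN powRr1 ?module_ge0// invf_le1 ?(ltW x1) ?orbT//; exact: lt_trans x1.
have mw : mfun (w : B -> R).
  by apply: measurable_minr; apply: (mfun_comp (measurable_powR _)); exact: mfun_module.
(* The denominator controls the unknown size of [d], [decay] makes the test function integrable, and
   [w] keeps it so after multiplication by [ell]. Off 0 the truncation is positive, so nothing is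
   lost. *)
pose r x : R := w x * decay mu x / (1 + cabs (d x)).
have c0 x : 0 < 1 + cabs (d x) by rewrite ltr_wpDr// cabs_ge0.
have r0 x : 0 <= r x.
  by apply: mulr_ge0; [apply: mulr_ge0 => //; exact: ltW (decay_gt0 lh _)|rewrite invr_ge0 ltW].
have mr : mfun (r : B -> R).
  apply: mfun_prod; first by apply: mfun_prod => //; exact: mfun_decay.
  apply: meas_invr; last by move=> x; exact: ltW.
  by apply: measurable_funD => //; exact: cmeas_cabs.
have rd x : r x * cabs (d x) <= w x * decay mu x.
  rewrite /r -mulrA ler_piMr ?mulr_ge0 ?(ltW (decay_gt0 lh _))//.
  by rewrite mulrC ler_pdivrMr// mul1r lerDr.
have r1 x : r x <= 1.
  rewrite /r ler_pdivrMr// mul1r; apply: (@le_trans _ _ 1); last by rewrite lerDl cabs_ge0.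
  by apply: mulr_ile1; rewrite ?(ltW (decay_gt0 lh _)) ?(decay_le1 lp).
pose psi x : R[i] := (r x)%:C%C * d x; pose v x : R[i] := (r x)%:C%C * psi x.
have mpsi : cmeas (psi : B -> R[i]) by apply: cmeasM => //; exact: cmeasR.
have mv : cmeas (v : B -> R[i]) by apply: cmeasM => //; exact: cmeasR.
have bpsi x : cabs (psi x) <= w x * decay mu x.
  by rewrite /psi cabsM cabs_real.
have bv x : cabs (v x) <= w x * decay mu x.
  rewrite /v cabsM cabs_real//; apply: le_trans (bpsi x).
  by rewrite ler_piMl ?cabs_ge0.
have wd x : w x * decay mu x <= decay mu x by rewrite ler_piMl// ltW// decay_gt0.
have [L L0 HL] := ell_wt lh (ltr01 : (0 : R) < 1).
have blv x : cabs ((ell x)%:C%C * v x) <= L * decay mu x.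
  rewrite cabsM cabsR; apply: (@le_trans _ _ (`|ell x| * (w x * decay mu x))).
    exact: ler_wpM2l.
  by rewrite mulrA; apply: ler_wpM2r; [rewrite ltW// decay_gt0|exact: HL].
have mlv : cmeas (fun x : B => (ell x)%:C%C * v x) by exact: cmeasM.
have ci (h : K -> R[i]) (N : R) : 0 <= N -> cmeas (h : B -> R[i]) ->
    (forall x, cabs (h x) <= N * decay mu x) -> cinteg mu h /\ sqL mu h.
  move=> N0 mh hN; split; last exact: (decay_sqL lp mh N0 hN).
  apply: (cinteg_le (v := fun x : B => N * decay mu x)) => //.
    by apply: mfun_prod => //; exact: mfun_decay.
  apply: ge0_intZ_lty => //; [exact: mfun_decay|by move=> x; rewrite ltW// decay_gt0|exact: decay_int].
have [lvi lv2] := ci _ _ L0 mlv blv.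
have [vi v2] : cinteg mu v /\ sqL mu v.
  by apply: (ci _ 1) => // x; rewrite mul1r; exact: le_trans (bv x) (wd x).
have [_ psi2] : cinteg mu psi /\ sqL mu psi.
  by apply: (ci _ 1) => // x; rewrite mul1r; exact: le_trans (bpsi x) (wd x).
have := log_commutator_form lp k0 hE fi f2 lfi lf2 vi v2 lvi lv2 lF1 lF2.
rewrite -(Hu _ vi v2) -(Hg _ lvi lv2) => key.
have i1 := cinteg_ip u2 v2; have i2 := cinteg_ip g2 lv2; have i3 := cinteg_ip k2 v2.
have i4 := cintegZ (kappa^-1)%:C%C i3.
have kk : (kappa^-1)%:C%C * kappa%:C%C = 1 :> R[i] by rewrite -RCM mulVf ?gt_eqF.
have zero : ip mu psi psi = 0.
  transitivity (cint mu (fun x => (u x * (v x)^*%C - g x * ((ell x)%:C%C * v x)^*%C) +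
      (kappa^-1)%:C%C * (kop f x * (v x)^*%C))).
    apply: cint_ext => x; rewrite /v /psi !conjcM !conjc_real.
    move: ((d x)^*%C) => V; rewrite /d.
    by move: (u x) (g x) (kop f x) ((ell x)%:C%C) ((r x)%:C%C) ((kappa^-1)%:C%C) => A1 A2 A3 A5 A6 A7; ring.
  apply: (etrans (cintD (cintegB i1 i2) i4)).
  apply: (etrans (congr2 +%R (cintB i1 i2) (cintZ _ i3))).
  rewrite -/(ip mu u v) -/(ip mu g (fun x => (ell x)%:C%C * v x)) -/(ip mu (kop f) v).
  move: key; move: (ip mu u v) (ip mu g _) (ip mu (kop f) v) => A1 A2 A3 key.
  by rewrite -[A1 - A2]mul1r -kk -mulrA key mulrN addNr.
have psi0 : nr mu psi = 0.
  by have := ip_self psi2; rewrite zero => -[].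
have ae1 := nr_eq0_ae psi2 psi0.
have ae2 : {ae mu, forall x : B, (x : K) != 0} by exact: (ae_neq0 lh).
apply: filterS2 ae1 ae2 => x px x0.
have rx : 0 < r x.
  have wx : 0 < w x by rewrite /w lt_min !powR_gt0//; exact: (module_gt0 lh).
  by rewrite /r divr_gt0// mulr_gt0// decay_gt0.
have : d x = 0.
  by move: px => /eqP; rewrite /psi mulf_eq0 (negbTE (gt0_RC rx)) /= => /eqP.
by rewrite /d => /eqP; rewrite addr_eq0 => /eqP.
Qed.

(** * Dilations and inversion of the kernel operator *)

Lemma ae_scale (P : K -> Prop) (t : K) : t != 0 ->
  {ae mu, forall x : B, P x} -> {ae mu, forall x : B, P (t * x)}.
Proof.
move=> t0 [A [mA A0 sA]]; exists ((fun x : K => t * x) @^-1` A); split.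
- rewrite -[X in measurable X]setTI; exact: (mfun_mul lh (measurable_cst (t : B)) (@measurable_id _ B setT)).
- by rewrite (module_preimage lh t0 mA) A0 mule0.
- by move=> x nP; apply: sA => /= Px; apply: nP.
Qed.

(** By [int_inv] the inverse image of a null set has integral 0 against the density |x|^-2, which is
    positive off 0. *)
Lemma ae_inv (P : K -> Prop) :
  {ae mu, forall x : B, P x} -> {ae mu, forall x : B, P (x^-1)}.
Proof.
move=> [A [mA A0 sA]].
pose psi (x : K) : R[i] := (\1_A (x^-1 : K) / md x)%:C%C.
have minv : mfun (fun x : B => (x : K)^-1 : B).
  exact: mfun_inv_borel.
have mpsi : cmeas (psi : B -> R[i]).
  apply: cmeasR; apply: mfun_prod.
    by apply: (mfun_comp _ minv); exact: measurable_indic.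
  by apply: meas_invr; [exact: mfun_module|exact: module_ge0].
have s0 : sqn mu psi = 0%E.
  have <- : (\int[mu]_x (\1_A x)%:E = 0)%E by rewrite integral_indic// setIT.
  rewrite /sqn.
  rewrite -(int_inv lh (f := \1_A : B -> R)); last 2 first.
  - exact: measurable_indic.
  - by move=> x; rewrite indicE.
  apply: eq_integral => x _; rewrite cabs_real; last by rewrite divr_ge0 ?module_ge0.
  by rewrite expr_div_n indicE; case: (_ \in _); rewrite ?expr1n ?expr0n.
have psi2 : sqL mu psi by split=> //; rewrite s0.
have psi0 : nr mu psi = 0 by rewrite /nr s0.
have nz : {ae mu, forall x : B, (x : K) != 0} by exact: (ae_neq0 lh).
apply: filterS2 (nr_eq0_ae psi2 psi0) nz => x px x0.
apply: contrapT => nP; have Ax : A (x : K)^-1 by apply: sA.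
move: px => [] /eqP; rewrite indicE mem_set// mul1r invr_eq0.
by rewrite gt_eqF// (module_gt0 lh).
Qed.

Definition dilation (t : K) f : K -> R[i] :=
  fun x => ((Num.sqrt (md t))^-1)%:C%C * f (x / t).

Definition inversion f : K -> R[i] := fun x => ((md x)^-1)%:C%C * f (x^-1).

Lemma dilation_sqL (t : K) f : t != 0 -> sqL mu f -> sqL mu (dilation t f).
Proof.
move=> t0 [mf ff]; apply: sqLZ; split.
  by apply: (cmeas_comp _ mf); exact: (mfun_mul lh).
rewrite /sqn.
have -> : (\int[mu]_x (cabs (f ((x : K) / t)) ^+ 2)%:E = \int[mu]_x (cabs (f (t^-1 * (x : K))) ^+ 2)%:E)%E.
  by apply: eq_integral => x _; rewrite mulrC.
rewrite (int_scale lh (f := fun x => (cabs (f x) ^+ 2)%:E)) ?invr_eq0//; last 2 first.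
- by apply/measurable_EFinP; exact: meas_sq.
- by move=> x; rewrite lee_fin sqr_ge0.
by apply: lte_mul_pinfty => //; rewrite lee_fin invr_ge0 module_ge0.
Qed.

Lemma inversion_sqL f : sqL mu f -> sqL mu (inversion f).
Proof.
move=> [mf ff]; split.
  apply: cmeasM; first by apply: cmeasR; apply: meas_invr; [exact: mfun_module|exact: module_ge0].
  by apply: (cmeas_comp _ mf); exact: mfun_inv_borel.
rewrite /sqn; apply: le_lt_trans ff; rewrite /sqn -(int_inv lh (f := fun x => cabs (f x) ^+ 2)).
- rewrite le_eqVlt; apply/orP; left; apply/eqP; apply: eq_integral => x _.
  by rewrite /inversion cabsM cabs_real ?invr_ge0 ?module_ge0// exprMn exprVn mulrC.
- exact: meas_sq.
- by move=> x; exact: sqr_ge0.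
Qed.

Lemma kop_ae f g : sqL mu f -> sqL mu g -> aeq f g -> aeq (kop f) (kop g).
Proof.
move=> f2 g2 fg; have d2 := sqLB f2 g2.
have [k2 kb] := kop_bound lh d2.
have n0 : nr mu (kop (fun x => f x - g x)) = 0.
  by apply/eqP; rewrite eq_le nr_ge0 andbT; move: kb; rewrite (nr_ae f2 g2 fg) mulr0.
apply: filterS2 (nr_eq0_ae k2 n0) (kopB lh f2 g2) => x -> /esym/eqP.
by rewrite subr_eq0 => /eqP.
Qed.

Lemma q_scale (t x y : K) : t != 0 -> x != 0 -> y != 0 ->
  q (x / t) (y / t) = md t * q x y.
Proof.
move=> t0 x0 y0; rewrite /q !(ellM lh) ?invr_eq0// -mulrBl (moduleM lh) (moduleV lh).
have -> : ell y + ell t^-1 - (ell x + ell t^-1) = ell y - ell x by ring.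
rewrite invfM invrK; move: ((md (y - x))^-1) (md t) (ell y - ell x) => A1 A2 A3; ring.
Qed.

Lemma q_inv (x y : K) : x != 0 -> y != 0 -> q x^-1 y^-1 = - (md x * md y * q x y).
Proof.
move=> x0 y0; rewrite /q !(ellV lh).
have -> : y^-1 - x^-1 = - ((y - x) / (x * y)) by field; rewrite x0 y0.
rewrite (moduleN lh) (moduleM lh) (moduleV lh) (moduleM lh) invfM invrK.
by move: (ell y) (ell x) (md x) (md y) ((md (y - x))^-1) => A1 A2 A3 A4 A5; ring.
Qed.

Lemma kop_dilation (t : K) f : t != 0 -> sqL mu f -> aeq (kop (dilation t f)) (dilation t (kop f)).
Proof.
move=> t0 f2; have u2 := dilation_sqL t0 f2.
have ti : t^-1 != 0 by rewrite invr_eq0.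
have nz : {ae mu, forall x : B, (x : K) != 0} by exact: (ae_neq0 lh).
apply: filterS3 nz (kop_cinteg lh u2) (ae_scale ti (kop_cinteg lh f2)) => x x0 h1 h2.
rewrite /dilation (kopE lh h1) [(x : K) / t]mulrC (kopE lh h2).
have [i1 i2] := cint_scale lp ti h2.
have mt := module_gt0 lh t0.
set c := ((Num.sqrt (md t))^-1)%:C%C.
have i3 := cintegZ (c * ((md t)^-1)%:C%C) i1.
apply: (@etrans _ _ (cint mu (fun y => (c * ((md t)^-1)%:C%C) * ((q (t^-1 * x) (t^-1 * y))%:C%C * f (t^-1 * y))))).
  apply: cint_ae; [by have [] := h1|by have [] := i3|].
  apply: (ae_neq0 lh) => y y0.
  rewrite (mulrC t^-1 x) (mulrC t^-1 y) (q_scale t0 x0 y0) RCM.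
  have mV : ((md t)^-1)%:C%C * (md t)%:C%C = 1 :> R[i] by rewrite -RCM mulVf ?gt_eqF.
  have rl (A1 A2 A3 A4 A5 : R[i]) : A1 * A2 = 1 -> A3 * (A5 * A4) = A5 * A1 * (A2 * A3 * A4).
    by move=> h; rewrite -[LHS]mul1r -h; ring.
  exact: rl.
have mV : ((md t)^-1)%:C%C * (md t)%:C%C = 1 :> R[i] by rewrite -RCM mulVf ?gt_eqF.
have rl (A1 A2 A3 A4 : R[i]) : A1 * A2 = 1 -> A3 * A1 * (A2 * A4) = A3 * A4.
  by move=> h; rewrite -[RHS]mul1r -h; ring.
rewrite (cintZ _ i1) i2 (moduleV lh) invrK; exact: rl.
Qed.

(** The kernel at inverted arguments is -|x| |y| times the kernel. The density |y|^-2 of the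
    substitution and the outer factor |x|^-1 reduce this to -|y|^-1, the weight of the inverted
    function up to sign. *)
Lemma kop_inversion f : sqL mu f ->
  aeq (kop (inversion f)) (fun x => - inversion (kop f) x).
Proof.
move=> f2; have u2 := inversion_sqL f2.
have nz : {ae mu, forall x : B, (x : K) != 0} by exact: (ae_neq0 lh).
apply: filterS3 nz (kop_cinteg lh u2) (ae_inv (kop_cinteg lh f2)) => x x0 h1 h2.
rewrite /inversion (kopE lh h1) (kopE lh h2).
have [i1 i2] : cinteg mu (fun y : K => (q x^-1 y^-1)%:C%C * f y^-1 * (md y ^- 2)%:C%C) /\
    cint mu (fun y : K => (q x^-1 y^-1)%:C%C * f y^-1 * (md y ^- 2)%:C%C) =
    (1 : R)%:C%C * cint mu (fun y => (q x^-1 y)%:C%C * f y).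
  apply: (@cov_cint _ _ _ mu (fun y : K => y^-1) (fun y => md y ^- 2) 1 _ _ _ _ _ _ h2).
  - exact: mfun_inv_borel.
  - apply: meas_invr; last by move=> y; exact: sqr_ge0.
    by apply: measurable_funX; exact: mfun_module.
  - by move=> y; rewrite invr_ge0 sqr_ge0.
  - by [].
  - by move=> g mg g0; rewrite mul1e -(int_inv lh mg g0).
have mx := module_gt0 lh x0.
have i3 := cintegZ (- ((md x)^-1)%:C%C) i1.
apply: (@etrans _ _ (cint mu (fun y => - ((md x)^-1)%:C%C * ((q x^-1 y^-1)%:C%C * f y^-1 * (md y ^- 2)%:C%C)))).
  apply: cint_ae; [by have [] := h1|by have [] := i3|].
  apply: (ae_neq0 lh) => y y0; have my := module_gt0 lh y0.
  have qE : (q x^-1 y^-1)%:C%C = - ((md x)%:C%C * (md y)%:C%C * (q x y)%:C%C) :> R[i].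
    by rewrite (q_inv x0 y0); move: (q x y) => Q; rewrite RCN !RCM.
  have mV : ((md x)^-1)%:C%C * (md x)%:C%C = 1 :> R[i] by rewrite -RCM mulVf ?gt_eqF.
  have mW : (md y ^- 2)%:C%C * (md y)%:C%C = ((md y)^-1)%:C%C :> R[i].
    by rewrite -RCM; congr (_%:C%C); field; exact: lt0r_neq0.
  have rl (A1 A2 A3 A4 A5 A6 A7 : R[i]) : A1 * A2 = 1 -> A5 * A6 = A7 ->
      A3 * (A7 * A4) = - A1 * (- (A2 * A6 * A3) * A4 * A5).
    by move=> h <-; rewrite -[LHS]mul1r -h; ring.
  by rewrite qE; exact: rl.
by rewrite (cintZ _ i1) i2 mul1r mulNr.
Qed.

(** * The hermitian kernel operator and the closure of K *)

Variable kappa : R.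
Hypothesis kappa0 : 0 < kappa.
Hypothesis hkE' : forall y, y != 0 -> hk mu y = kappa * ell y.

(** The number -i/kappa; being purely imaginary, it turns the skew operator [kop] into a hermitian
    one. *)
Definition c0 : R[i] := (0 +i* (- kappa^-1))%C.
Definition T0 f : K -> R[i] := fun x => c0 * kop f x.

Lemma conj_c0 : c0^*%C = - c0.
Proof. by apply/eqP; rewrite eq_complex /= oppr0 !eqxx. Qed.

Lemma c0E : c0 = - ('i%C * (kappa^-1)%:C%C).
Proof. by apply/eqP; rewrite eq_complex /= !mul0r !mul1r subr0 add0r oppr0 !eqxx. Qed.

Lemma T0_sqL f : sqL mu f -> sqL mu (T0 f).
Proof. by move=> f2; apply: sqLZ; have [] := kop_bound lh f2. Qed.

Lemma T0_bound : exists2 D : R, 0 <= D & forall f, sqL mu f -> nr mu (T0 f) <= D * nr mu f.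
Proof.
exists (cabs c0 ^+ 2 * (4 * kerC1 mu ^+ 2)) => [|f f2].
  by apply: mulr_ge0; [exact: sqr_ge0|apply: mulr_ge0 => //; exact: sqr_ge0].
have [k2 kb] := kop_bound lh f2; rewrite /T0 nrZ; last by have [] := k2.
by rewrite -mulrA; apply: ler_wpM2l => //; exact: sqr_ge0.
Qed.

Lemma T0_ae f g : sqL mu f -> sqL mu g -> aeq f g -> aeq (T0 f) (T0 g).
Proof. by move=> f2 g2 fg; apply: filterS (kop_ae f2 g2 fg) => x h; rewrite /T0 h. Qed.

Lemma T0_sub f g : sqL mu f -> sqL mu g ->
  nr mu (fun x => T0 f x - T0 g x) = nr mu (T0 (fun x => f x - g x)).
Proof.
move=> f2 g2; rewrite /nr; congr fine; apply: sqn_ae.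
- by have [] := sqLB (T0_sqL f2) (T0_sqL g2).
- by have [] := T0_sqL (sqLB f2 g2).
- by apply: filterS (kopB lh f2 g2) => x h; rewrite /T0 h mulrBr.
Qed.

Lemma T0_ip f g : sqL mu f -> sqL mu g -> ip mu (T0 f) g = ip mu f (T0 g).
Proof.
move=> f2 g2; have [kf _] := kop_bound lh f2; have [kg _] := kop_bound lh g2.
by rewrite /T0 (ipZl _ kf g2) (ipZr _ kg f2) (kop_anti lh f2 g2) conj_c0 mulNr mulrN.
Qed.

Lemma T0_dilation (t : K) f : t != 0 -> sqL mu f -> aeq (dilation t (T0 f)) (T0 (dilation t f)).
Proof.
move=> t0 f2; apply: filterS (kop_dilation t0 f2) => x h; rewrite /T0 h /dilation; exact: mulrCA.
Qed.

Lemma T0_inversion f : sqL mu f -> aeq (inversion (T0 f)) (fun x => - T0 (inversion f) x).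
Proof.
move=> f2; apply: filterS (kop_inversion f2) => x h; rewrite /T0 h /inversion.
by rewrite mulrN opprK; exact: mulrCA.
Qed.

Lemma T0_S0 f : S0 f -> exists u g, [/\
  [/\ sqL mu f, sqL mu (fun x => (ell x)%:C%C * f x), sqL mu u
    & sqL mu (fun x => (ell x)%:C%C * g x)],
  BL (fun x => (ell x)%:C%C * f x) u, BL f g &
  aeq (T0 f) (fun x => 'i%C * (u x - (ell x)%:C%C * g x))].
Proof.
move=> Sf; have [u [g [[f2 lf2] Bu Bg ug]]] := log_commutator kappa0 hkE' Sf.
have [_ [_ _ [_ u2 _]]] := Bu; have [_ [_ _ [_ g2 _]]] := Bg.
have [k2 _] := kop_bound lh f2; exists u, g; split=> //.
  split=> //; have h := sqLD u2 (sqLZ (kappa^-1)%:C%C k2); apply: (sqL_ae h).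
    by apply: cmeasM; [apply: cmeasR; exact: mfun_ell|have [] := g2].
  by apply: filterS ug => x /eqP; rewrite subr_eq addrC => /eqP ->; ring.
apply: filterS ug => x h.
apply: (etrans _ (esym (congr1 (fun z => 'i%C * z) h))).
by rewrite /T0 c0E mulNr mulrN; congr (- _); rewrite -mulrA.
Qed.

(** Test functions approximate [w] itself, so the squared norm of [w] is a limit of vanishing
    pairings. *)
Lemma dense_ip0 w : sqL mu w -> (forall g, ctest g -> ip mu w g = 0) -> aeq w (fun=> 0).
Proof.
move=> w2 H; have [u [tu uw]] := ctest_seq lp w2.
have u2 k : sqL mu (u k) by apply: (SB_sqL lp); exact: (ctest_SB lp).
have w0 : ip mu w w = 0.
  apply: (cvg2_ip_lim u2 w2 w2 uw) => ep ep0; exists 0%N => k _.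
  by rewrite (ipJ w2 (u2 k)) H// conjc0 subr0 cabs0 ltW.
apply: (nr_eq0_ae w2); have := ip_self w2; rewrite w0 => -[] //.
Qed.

Lemma ip_ell f g : ip mu (fun x => (ell x)%:C%C * f x) g = ip mu f (fun x => (ell x)%:C%C * g x).
Proof. by apply: cint_ext => x; rewrite conjcM conjc_real mulrA (mulrC (f x)). Qed.

(** The transform [ff] lies outside the domain S0 in general, so the commutator formula is applied
    to [f] and to [g] only; hermiticity of [T0] and Plancherel bring both pairings into that
    form. *)
Lemma T0_fourier_test f g ff Phi : S0 f -> S0 g -> FL f ff -> FL (T0 f) Phi ->
  ip mu (T0 ff) g = - ip mu Phi g.
Proof.
move=> Sf Sg Hff HPhi.
have [u [v [[f2 lf2 u2 lv2] [p [Hp lp2 Hu]] [r [Hr lr2 Hv]] Tf]]] := T0_S0 Sf.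
have [u' [v' [[g2 lg2 u'2 lv'2] [p' [Hp' lp'2 Hu']] [k [Hk lk2 Hv']] Tg]]] := T0_S0 Sg.
have [k2 _ _] := Hk; have [_ v2 _] := Hv; have [_ v'2 _] := Hv'; have [r2 _ _] := Hr.
have [p2 _ _] := Hp; have [p'2 _ _] := Hp'.
pose rr x := r (- x).
have Hrr : FL f rr := FL_inv lp Hr.
have rr2 : sqL mu rr by exact: (sqL_reflection lp).
have [_ ff2 _] := Hff.
(* In symbols, <BA f, F^-1 g> = <F f, BA g>; [E2] is the same identity for AB. The opposite signs
   then come from the conjugate of the factor i. *)
have E1 : ip mu u k = ip mu rr u'.
  rewrite (FL_ip lp Hu (FL_reflect Hk)) ip_ell (FL_ip lp Hrr Hu') -[RHS]ip_ell.
  rewrite (FL_ip lp Hp (FL_reflect Hp')).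
  by apply: cint_ext => x; rewrite (ellN lh).
have E2 : ip mu (fun x => (ell x)%:C%C * v x) k = ip mu rr (fun x => (ell x)%:C%C * v' x).
  rewrite ip_ell (FL_ip lp Hv (FL_reflect Hv')) -[RHS]ip_ell.
  have [_ rE] := reflection_cov lp (cinteg_ip lr2 (sqL_reflection lp v'2)).
  rewrite [LHS](esym rE); apply: cint_ext => x.
  by rewrite (ellN lh) opprK.
have Tf2 := T0_sqL f2; have Tg2 := T0_sqL g2; have [_ Phi2 _] := HPhi.
have d2 := sqLB u2 lv2; have d'2 := sqLB u'2 lv'2.
have L1 : ip mu (T0 ff) g = 'i%C^*%C * (ip mu rr u' - ip mu rr (fun x => (ell x)%:C%C * v' x)).
  rewrite (T0_ip ff2 g2) -(ipBr u'2 lv'2 rr2) -(ipZr _ d'2 rr2).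
  apply: ip_ae; [by have [] := ff2|by have [] := rr2|by have [] := Tg2|by have [] := sqLZ 'i%C d'2|exact: (FL_uniq lp Hff Hrr)|exact: Tg].
have L2 : ip mu Phi g = 'i%C * (ip mu u k - ip mu (fun x => (ell x)%:C%C * v x) k).
  rewrite (FL_ip lp HPhi Hk) -(ipBl u2 lv2 k2) -(ipZl _ d2 k2).
  apply: ip_ae; [by have [] := Tf2|by have [] := sqLZ 'i%C d2|by have [] := k2|by have [] := k2|exact: Tf|exact: aeW].
rewrite L1 L2 E1 E2 -mulNr; congr (_ * _).
by apply/eqP; rewrite eq_complex /= !oppr0 !eqxx.
Qed.

(** Density in each variable in turn: [dual] rewrites the pairing with [g] as the pairing of [f]
    with a function depending on [g] alone. That function is orthogonal to all test functions by
    [T0_fourier_test], hence null, so the pairing vanishes for every [f]. *)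
Lemma T0_fourier f ff Phi : FL f ff -> FL (T0 f) Phi -> aeq Phi (fun x => - T0 ff x).
Proof.
move=> Hff HPhi; have [f2 ff2 _] := Hff; have [Tf2 Phi2 _] := HPhi.
have Tff2 := T0_sqL ff2.
suff H : aeq (fun x => T0 ff x + Phi x) (fun=> 0).
  by apply: filterS H => x /eqP; rewrite addrC addr_eq0 => /eqP.
apply: dense_ip0; first exact: sqLD.
move=> g tg; have Sg := ctest_S0 lp tg.
have g2 : sqL mu g by apply: (SB_sqL lp); exact: (ctest_SB lp).
have Tg2 := T0_sqL g2.
have [g' Hg'] := FL_total lp g2; have Hk := FL_reflect Hg'.
set k := (fun x => g' (- x)) in Hk.
have [w' Hw'] := FL_total lp Tg2; have Hw := FL_reflect Hw'.
set w := (fun x => w' (- x)) in Hw.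
have [k2 _ _] := Hk; have [w2 _ _] := Hw; have Tk2 := T0_sqL k2.
have dual h hh Psi : FL h hh -> FL (T0 h) Psi ->
    ip mu (fun x => T0 hh x + Psi x) g = ip mu h (fun x => w x + T0 k x).
  move=> Hh HPsi; have [h2 hh2 _] := Hh; have [Th2 Psi2 _] := HPsi.
  rewrite (ipDl (T0_sqL hh2) Psi2 g2) (T0_ip hh2 g2) (FL_ip lp Hh Hw) (FL_ip lp HPsi Hk).
  by rewrite (T0_ip h2 k2) (ipDr w2 Tk2 h2).
have wk2 := sqLD w2 Tk2.
have wk0 : aeq (fun x => w x + T0 k x) (fun=> 0).
  apply: dense_ip0 => // h th; have Sh := ctest_S0 lp th.
  have h2 : sqL mu h by apply: (SB_sqL lp); exact: (ctest_SB lp).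
  have [hh Hh] := FL_total lp h2; have [Psi HPsi] := FL_total lp (T0_sqL h2).
  have [_ hh2 _] := Hh; have [_ Psi2 _] := HPsi.
  rewrite (ipJ h2 wk2) -(dual h hh Psi Hh HPsi) (ipDl (T0_sqL hh2) Psi2 g2).
  by rewrite (T0_fourier_test Sh Sg Hh HPsi) addNr conjc0.
rewrite (dual f ff Phi Hff HPhi).
rewrite (@ip_ae _ _ _ mu f f (fun x => w x + T0 k x) (fun=> 0)); first last.
- exact: wk0.
- exact: aeW.
- exact: cmeas_cst.
- by have [] := wk2.
- by have [] := f2.
- by have [] := f2.
rewrite /ip (@cint_ext _ _ _ _ _ (fun=> 0)) ?cint0// => x.
by rewrite conjc0 mulr0.
Qed.

Lemma FL_congr f g f' g' : FL f g -> FL f' g' -> aeq f f' -> aeq g g'.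
Proof.
move=> h h' ff; have [f2 g2 _] := h; have [f'2 g'2 _] := h'.
by apply: nr0_ae => //; rewrite (FL_nr lp h h') nr_ae.
Qed.

Lemma FL_inj f g f' g' : FL f g -> FL f' g' -> aeq g g' -> aeq f f'.
Proof.
move=> h h' gg; have [f2 g2 _] := h; have [f'2 g'2 _] := h'.
by apply: nr0_ae => //; rewrite -(FL_nr lp h h') nr_ae.
Qed.

Lemma opFP f g : opF mu f g <-> FL f g.
Proof.
have HT (h k : K -> R[i]) : op_of mu SB F h k -> sqL mu h /\ sqL mu k.
  by move=> [/L2P ? /L2P ? _].
split=> [/(op_closureP _ _ HT)[f2 g2 [u [v [Tuv uf vg]]]]|[f2 g2 [u [su uf vg]]]].
  have /choice[u' Hu'] : forall k, exists f0, [/\ SB f0, aeq (u k) f0 & aeq (v k) (F f0)].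
    by move=> k; have [_ _ [f0 H]] := Tuv k; exists f0.
  split=> //; exists u'; split.
  - by move=> k; have [] := Hu' k.
  - apply: (@cvg2_congr _ _ mu u) => // k; first by have [] := HT _ _ (Tuv k).
    + by have [h _ _] := Hu' k; exact: (SB_sqL lp).
    + by have [] := Hu' k.
  - apply: (@cvg2_congr _ _ mu v) => // k; first by have [] := HT _ _ (Tuv k).
    + by have [h _ _] := Hu' k; have [] := SB_fourier lp h.
    + by have [] := Hu' k.
apply/(op_closureP _ _ HT); split=> //; exists u, (fun k => F (u k)); split=> // k.
split.
- by apply/L2P; exact: (SB_sqL lp).
- by apply/L2P; have [] := SB_fourier lp (su k).
- by exists (u k); split=> //; exact: aeW.
Qed.

Lemma opAP f g : opA mu f g <->
  [/\ sqL mu f, sqL mu g & aeq g (fun x => (ell x)%:C%C * f x)].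
Proof.
split=> [[/L2P f2 /L2P g2 [f0 [_ ff gf]]]|[f2 g2 gf]].
  have ff' : aeq f f0 := ff; have gf' : aeq g (fun x => (ell x)%:C%C * f0 x) := gf.
  by split=> //; apply: filterS2 ff' gf' => x -> ->.
by split; [exact/L2P|exact/L2P|exists f; split=> //; exact: aeW].
Qed.

Lemma opBP f g : opB mu f g <-> BL f g.
Proof.
split=> [[h [h0 /opFP H0 /opAP[h02 h2 hh] /opFP H]]|[h [H0 h2 H]]].
  have lh2 : sqL mu (fun x => (ell x)%:C%C * h0 x).
    apply: (sqL_ae h2 _ hh); apply: cmeasM; last by have [] := h02.
    by apply: cmeasR; exact: mfun_ell.
  have [_ g2 _] := H; exists h0; split=> //.
  by apply: (FL_ae lp H) => //; exact: aeW.
have [hh2 _ _] := H0.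
exists (fun x => (ell x)%:C%C * h x); last exact/opFP.
by exists h; [exact/opFP|apply/opAP; split=> //; exact: aeW].
Qed.

Lemma BL_congr f g f' g' : BL f g -> BL f' g' -> aeq f f' -> aeq g g'.
Proof.
move=> [p [Hp _ Hg]] [p' [Hp' _ Hg']] ff; apply: (FL_congr Hg Hg').
by apply: filterS (FL_inj Hp Hp' ff) => x ->.
Qed.

Lemma opK_T0 f g : opK mu f g -> [/\ sqL mu f, sqL mu g & aeq g (T0 f)].
Proof.
move=> [/L2P f2 /L2P g2 [f0 [u [v [[Sf ff] [h /opAP[f02 h2 hf] /opBP Bh] [k /opBP Bk /opAP[k2 v2 vk]] gE]]]]].
split=> //; have [u0 [g0 [_ Bu Bg Tf]]] := T0_S0 Sf.
have uu := BL_congr Bh Bu hf.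
have kk := BL_congr Bk Bg (aeW mu (fun x => erefl (f0 x))).
have TT := T0_ae f2 f02 ff.
have gE' : aeq g (fun x => 'i%C * (u x - v x)) := gE.
apply: filterS3 (filterI gE' (filterI uu (filterI kk vk))) Tf TT => x [h6 [h1 [h2' h3]]] h4 h5.
by rewrite h6 h1 h3 h2' h5 h4.
Qed.

Lemma S0_opK f : S0 f -> opK mu f (T0 f).
Proof.
move=> Sf; have [u0 [g0 [[f2 lf2 u2 lg2] Bu Bg Tf]]] := T0_S0 Sf.
have [_ [_ _ [_ g02 _]]] := Bg.
split; [exact/L2P|by apply/L2P; exact: T0_sqL|].
exists f, u0, (fun x => (ell x)%:C%C * g0 x); split=> //.
- by split=> //; exact: aeW.
- exists (fun x => (ell x)%:C%C * f x); last exact/opBP.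
  by apply/opAP; split=> //; exact: aeW.
- by exists g0; [exact/opBP|apply/opAP; split=> //; exact: aeW].
Qed.

Lemma T0_cvg (u : nat -> K -> R[i]) f : (forall k, sqL mu (u k)) -> sqL mu f ->
  cvg2 mu u f -> cvg2 mu (fun k => T0 (u k)) (T0 f).
Proof.
move=> u2 f2 uf ep ep0; have [D D0 HD] := T0_bound.
have D1 : 0 < D + 1 by rewrite ltr_wpDl.
have [N HN] := uf _ (divr_gt0 ep0 D1); exists N => k Nk.
have d2 := sqLB (u2 k) f2.
rewrite T0_sub//; apply: le_trans (HD _ d2) _.
apply: le_trans (ler_wpM2l D0 (HN k Nk)) _.
rewrite mulrCA ler_piMr ?(ltW ep0)// ler_pdivrMr// mul1r lerDl; exact: ler01.
Qed.

(** [T0] is bounded and agrees with K on S0, which is dense; the closure is therefore [T0] on all of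
    L2, and the remaining claims concern a bounded operator. *)
Lemma closure_rep : represents mu (op_closure mu (opK mu)) T0.
Proof.
split; [exact: T0_sqL|exact: T0_ae|] => f g.
have HT (h k : K -> R[i]) : opK mu h k -> sqL mu h /\ sqL mu k.
  by move=> /opK_T0[].
split=> [/(op_closureP _ _ HT)[f2 g2 [u [v [Tuv uf vg]]]]|[f2 g2 gf]].
  split=> //; have u2 k : sqL mu (u k) by have [] := HT _ _ (Tuv k).
  have v2 k : sqL mu (v k) by have [] := HT _ _ (Tuv k).
  have Tu2 k : sqL mu (T0 (u k)) by exact: T0_sqL.
  have Tf2 := T0_sqL f2.
  apply: (@cvg2_unique _ _ _ mu (fun k => T0 (u k))) => //; last exact: T0_cvg.
  by apply: (@cvg2_congr _ _ mu v) => // k; have [] := opK_T0 (Tuv k).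
have [u [tu uf]] := ctest_seq lp f2.
have Su k : S0 (u k) by exact: (ctest_S0 lp).
have u2 k : sqL mu (u k) by apply: (SB_sqL lp); exact: (ctest_SB lp).
apply/(op_closureP _ _ HT); split=> //; exists u, (fun k => T0 (u k)); split=> //.
  by move=> k; exact: S0_opK.
have Tu2 k : sqL mu (T0 (u k)) by exact: T0_sqL.
apply: (cvg2_ae Tu2 (T0_sqL f2) g2 _ (T0_cvg u2 f2 uf)).
by apply: filterS gf => x ->.
Qed.

Lemma closure_self_adjoint : essentially_self_adjoint mu (opK mu).
Proof.
have rT := closure_rep; split.
  move=> f /L2P f2; exists (fun=> f); split.
    move=> _; exists (T0 f); apply/(repP rT); split=> //; first exact: T0_sqL.
    exact: aeW.
  apply/L2cvgP => // ep ep0; exists 0%N => k _.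
  by rewrite nr_ae ?ltW//; exact: aeW.
move=> g h; split=> [/(repP rT)[g2 h2 hg]|[/L2P g2 /L2P h2 H]].
  split; [exact/L2P|exact/L2P|] => f k /(repP rT)[f2 k2 kf].
  have Tf2 := T0_sqL f2; have Tg2 := T0_sqL g2.
  transitivity (ip mu (T0 f) g).
    apply: ip_ae; [by have [] := k2|by have [] := Tf2|by have [] := g2|by have [] := g2|exact: kf|exact: aeW].
  rewrite T0_ip//.
  apply: ip_ae; [by have [] := f2|by have [] := f2|by have [] := Tg2|by have [] := h2|exact: aeW|].
  by apply: filterS hg => x ->.
have Tg2 := T0_sqL g2.
apply/(repP rT); split=> //.
(* The domain of [T0] is everything, so the adjoint relation may be tested on test functions, which
   determine [h]. *)
suff : aeq (fun x => h x - T0 g x) (fun=> 0).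
  by apply: filterS => x /eqP; rewrite subr_eq0 => /eqP.
have d2 := sqLB h2 Tg2; apply: (dense_ip0 d2) => f tf.
have f2 : sqL mu f by apply: (SB_sqL lp); exact: (ctest_SB lp).
have Tf2 := T0_sqL f2.
have fT : op_closure mu (opK mu) f (T0 f) by apply/(repP rT); split=> //; exact: aeW.
have key : ip mu (T0 f) g = ip mu f h := H _ _ fT.
by rewrite (ipJ f2 d2) (ipBr h2 Tg2 f2) -key T0_ip// subrr conjc0.
Qed.

Lemma closure_bounded : bounded_op mu (op_closure mu (opK mu)).
Proof.
have rT := closure_rep; split.
  move=> f /L2P f2; exists (T0 f); apply/(repP rT); split=> //; first exact: T0_sqL.
  exact: aeW.
have [D D0 HD] := T0_bound; exists (Num.sqrt D) => f g /(repP rT)[f2 g2 gf].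
have Tf2 := T0_sqL f2.
rewrite !L2norm_nr// -EFinM lee_fin -sqrtrM//; apply: ler_wsqrtr.
apply: le_trans (HD _ f2); rewrite le_eqVlt; apply/orP; left; apply/eqP.
by rewrite /nr; congr fine; apply: sqn_ae => //; [have [] := g2|have [] := Tf2].
Qed.

Lemma dilation_rep (t : K) : t != 0 -> represents mu (opU mu t) (dilation t).
Proof.
move=> t0; apply: op_of_rep => [f f2|f g fg]; first exact: dilation_sqL.
have ti : t^-1 != 0 by rewrite invr_eq0.
by apply: filterS (ae_scale ti fg) => x h; rewrite /dilation [(x : K) / t]mulrC h.
Qed.

Lemma inversion_rep : represents mu (opI mu) inversion.
Proof.
apply: op_of_rep => [f f2|f g fg]; first exact: inversion_sqL.
by apply: filterS (ae_inv fg) => x h; rewrite /inversion h.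
Qed.

Lemma fourier_rep : exists2 phi, represents mu (opF mu) phi &
  forall f, sqL mu f -> FL f (phi f).
Proof.
have /choice[phi Hphi] : forall f, exists g, sqL mu f -> FL f g.
  move=> f; have [f2|f2] := pselect (sqL mu f); last by exists f.
  by have [g Hg] := FL_total lp f2; exists g.
exists phi => //; split.
- by move=> f f2; have [] := Hphi f f2.
- by move=> f g f2 g2; exact: FL_congr (Hphi f f2) (Hphi g g2).
move=> f g; split=> [/opFP H|[f2 g2 gf]].
  have [f2 g2 _] := H; split=> //; exact: (FL_uniq lp H (Hphi f f2)).
apply/opFP; apply: (FL_ae lp (Hphi f f2)) => //; first exact: aeW.
by apply: filterS gf => x ->.
Qed.

Lemma main_properties :
  (forall f, S0 f -> exists g, opK mu f g) /\
  essentially_self_adjoint mu (opK mu) /\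
  bounded_op mu (op_closure mu (opK mu)) /\
  (forall t : K, t != 0 -> commutes mu (opU mu t) (opK mu)) /\
  anti_commutes mu (opF mu) (opK mu) /\
  anti_commutes mu (opI mu) (opK mu).
Proof.
split; first by move=> f Sf; exists (T0 f); exact: S0_opK.
split; first exact: closure_self_adjoint.
split; first exact: closure_bounded.
split.
  move=> t t0; apply: (rep_commutes (dilation_rep t0) closure_rep) => f f2.
  exact: T0_dilation.
split; last first.
  apply: (rep_anti_commutes inversion_rep closure_rep) => f f2.
  exact: T0_inversion.
have [phi rphi Hphi] := fourier_rep.
apply: (rep_anti_commutes rphi closure_rep) => f f2.
exact: (T0_fourier (Hphi f f2) (Hphi _ (T0_sqL f2))).
Qed.
End LogRegularity.

(** * The theorem at a completion of a number field *)

Lemma haar_sigma_finite {R : realType} {K : valuedFieldType R}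
    (mu : {measure set (borel K) -> \bar R}) : is_haar mu ->
  (forall r : R, compact [set x : K | absv x <= r]) -> sigma_finite setT mu.
Proof.
move=> haar cb; exists (fun k => [set x : K | absv x <= k%:R] : set (borel K)).
  apply/seteqP; split=> // x _; exists (`|Num.ceil (absv x)|)%N => //=.
  by rewrite natr_absz; apply: le_trans (ceil_ge _) _; rewrite ler_int; exact: ler_norm.
move=> k; split; first exact: ball_measurable.
exact: (haar_compact haar (cb _)).
Qed.

Theorem theoremE3 (R : realType) (F : fieldExtType rat)
    (K : valuedFieldType R) (iota : {rmorphism F -> K})
    (mu : {measure set (borel K) -> \bar R}) :
  is_completion iota -> is_haar mu -> self_dual mu ->
  (forall f : K -> R[i], S0 f -> exists g, opK mu f g) /\
  essentially_self_adjoint mu (opK mu) /\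
  bounded_op mu (op_closure mu (opK mu)) /\
  (forall t : K, t != 0 -> commutes mu (opU mu t) (opK mu)) /\
  anti_commutes mu (opF mu) (opK mu) /\
  anti_commutes mu (opI mu) (opK mu).
Proof.
move=> iotaC haar sd.
have cb := completion_compact_ball iotaC.
have sf := haar_sigma_finite haar cb.
(* Sigma-finiteness is proved for [mu] from the compact balls, whereas the integration theorems read
   it from the type; the same measure is repackaged with it. *)
have [mu' muE] : exists mu' : {sigma_finite_measure set (borel K) -> \bar R},
    (mu' : {measure set (borel K) -> \bar R}) = mu.
  case: mu sf {haar sd} => m0 cl sf.
  pose m1 : {measure set (borel K) -> \bar R} := Measure.Pack cl.
  pose H := Measure_isSigmaFinite.Build _ _ _ m1 sf.
  by exists (HB.pack_for {sigma_finite_measure set (borel K) -> \bar R} m0 m1 H).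
move: haar sd {sf}; rewrite -muE => haar sd {muE mu}.
have lh : local_haar mu'.
  split; [exact: haar|exact: (completion_separable iotaC)|exact: cb|exact: (completion_gt1 iotaC)].
have [n [e [co [s [C ac]]]]] : exists n e co s C, ~ finite_place K -> @arch_coords R K n e co s C.
  (* At a finite place the premise is false, and the coordinate data are arbitrary. *)
  have [fin|arch] := pselect (finite_place K); first by exists 0%N, (fun=> 0), (fun _ _ => 0), 0, 0.
  by have [n [e [co [s [C ac]]]]] := completion_coords iotaC arch; exists n, e, co, s, C.
have lp : local_place mu' n e co s C.
  split=> //.
  - exact: (lambdaD iotaC).
  - exact: (cabs_lambda).
  - exact: (lambda0 iotaC).
  - exact: (lambdaN iotaC).
  - exact: (lambda_hoelder iotaC).
have [kappa k0 hE] := log_constant lp.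
exact: (main_properties lp k0 hE).
Qed.
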